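(* Let $H$ be a real separable Hilbert space of dimension $d\in\mathbb N\cup\{\infty\}$, let $G$ be a group of Möbius transformations of $\hat H$, and let $\mathbf K$ and $\mathbf L$ denote the limit set and the radial limit set of $G$. If $d=\infty$, assume additionally that $\mathbf K$ is compact. Let $\delta=\mathrm{HD}(\mathbf L)$ and $k=\mathrm{TD}(\mathbf K)$, assume $k\ge 1$, and assume $$\mathcal H^\delta(\mathbf K\setminus\mathbf L)=0$$ (which holds, e.g., if $\mathrm{HD}(\mathbf L)<\mathrm{HD}(\mathbf K)$). Then either $\delta>k$, or $\mathbf K$ is a generalized $k$-sphere.
   Context: All sets and measures are Borel. $\mathcal H^s$ denotes $s$-dimensional Hausdorff measure, $\mathrm{HD}$ Hausdorff dimension, $\mathrm{TD}$ topological (covering) dimension. $\hat H=H\cup\{\infty\}$. A Möbius transformation of $\hat H$ is a composition of (extended) similarities of $H$ and inversions $x\mapsto a+r^2(x-a)/\|x-a\|^2$. Every Möbius transformation $g$ has a unique Poincaré extension $\hat g$, a Möbius transformation of $\widehat{\mathbb R\oplus H}$ restricting to $g$ on $\hat H$ and preserving the upper half-space $\mathbb H=(0,\infty)\times H$ (a model of hyperbolic space). Let $\mathbf 0=(1,0)\in\mathbb H$ and let $\mathrm{ht}:\mathbb H\to(0,\infty)$ be projection to the first coordinate. The limit set is $\mathbf K=\{x\in\hat H:\exists g_n\in G,\ \hat g_n(\mathbf 0)\to x\}$. The radial limit set $\mathbf L\subset\mathbf K$ is the set of $p\in\mathbf K$ for which there exist $g_n\in G$ and a constant $C$ with $\hat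 g_n(\mathbf 0)\to p$ and $\|\hat g_n(\mathbf 0)-p\|\le C\,\mathrm{ht}(\hat g_n(\mathbf 0))$ for all $n$. A subset of $\hat H$ is a generalized $k$-sphere if it is either a $k$-dimensional affine subspace of $H$ (together with $\infty$) or a round $k$-dimensional sphere contained in a $(k+1)$-dimensional affine subspace of $H$.
   Formalization: The parenthetical ''which holds, e.g., if HD(L)<HD(K)'' is dropped because it is false: then HD(K\L)=HD(K)>δ, so H^δ(K\L)=∞. H is taken to be R^d or ℓ², to which every real separable Hilbert space of dimension d is isometric. *)

(* Defs.v *)
(* The real separable Hilbert space of
   dimension d (d : option nat, None = infinity) is modelled concretely as
   the space of square-summable real sequences supported in the first d
   coordinates (ell^2 if d = None, R^d otherwise); every real separable
   Hilbert space of dimension d is isometric to this model. *)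
From HB Require Import structures.
From mathcomp Require Import all_boot all_order all_algebra.
From mathcomp Require Import all_classical all_reals all_analysis.
Set Implicit Arguments. Unset Strict Implicit. Unset Printing Implicit Defensive.
Import Order.TTheory GRing.Theory Num.Theory.
Local Open Scope classical_set_scope.
Local Open Scope ring_scope.

Section Mobius.
Context {R : realType}.

Definition sqn (x : nat -> R) : \bar R := (\sum_(0 <= i <oo) ((x i) ^+ 2)%:E)%E.

Definition in_H (d : option nat) (x : nat -> R) : Prop :=
  (sqn x < +oo)%E /\ (forall n, d = Some n -> forall i, (n <= i)%N -> x i = 0).

Definition Hpt (d : option nat) := {x : nat -> R | in_H d x}.

(** \hat H = H u {oo}, with None = oo *)
Definition hat (d : option nat) := option (Hpt d).

Definition nrm (x : nat -> R) : R := Num.sqrt (fine (sqn x)).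

Definition vsub (x y : nat -> R) : nat -> R := fun i => x i - y i.

Definition chordal (d : option nat) (p q : hat d) : R :=
  match p, q with
  | Some x, Some y => 2 * nrm (vsub (sval x) (sval y)) /
      (Num.sqrt (1 + nrm (sval x) ^+ 2) * Num.sqrt (1 + nrm (sval y) ^+ 2))
  | Some x, None | None, Some x => 2 / Num.sqrt (1 + nrm (sval x) ^+ 2)
  | None, None => 0
  end.

Definition is_ext_sim (d : option nat) (f : hat d -> hat d) : Prop :=
  f None = None /\
  (forall x, exists y, f (Some x) = Some y) /\
  (forall y, exists x, f (Some x) = Some y) /\
  exists lam : R, 0 < lam /\
    forall x y x' y', f (Some x) = Some x' -> f (Some y) = Some y' ->
      nrm (vsub (sval x') (sval y')) = lam * nrm (vsub (sval x) (sval y)).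

Definition is_inversion (d : option nat) (f : hat d -> hat d) : Prop :=
  exists (a : Hpt d) (r : R), 0 < r /\
    f None = Some a /\ f (Some a) = None /\
    forall x : Hpt d, sval x <> sval a -> exists y : Hpt d, f (Some x) = Some y /\
      forall i, sval y i = sval a i + r ^+ 2 * (sval x i - sval a i)
                                / nrm (vsub (sval x) (sval a)) ^+ 2.

Inductive mobius (d : option nat) : (hat d -> hat d) -> Prop :=
| mob_sim f : is_ext_sim f -> mobius f
| mob_inv f : is_inversion f -> mobius f
| mob_comp f g : mobius f -> mobius g -> mobius (f \o g).

Definition mobius_group (d : option nat) (G : set (hat d -> hat d)) : Prop :=
  (forall g, G g -> mobius g) /\ G id /\
  (forall g h, G g -> G h -> G (g \o h)) /\
  (forall g, G g -> exists h, G h /\ h \o g = id /\ g \o h = id).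

(** R (+) H_d is identified with H_(d+1), coordinate 0 being the R-factor *)
Definition dsucc (d : option nat) : option nat := omap S d.

Definition embeds (d : option nat) (p : hat d) (q : hat (dsucc d)) : Prop :=
  match p, q with
  | None, None => True
  | Some x, Some y => sval y 0%N = 0 /\ forall i, sval y i.+1 = sval x i
  | _, _ => False
  end.

Definition upper (d : option nat) (q : hat (dsucc d)) : Prop :=
  match q with Some y => 0 < sval y 0%N | None => False end.

Definition ht (d : option nat) (q : hat (dsucc d)) : R :=
  match q with Some y => sval y 0%N | None => 0 end.

Definition origin (d : option nat) (q : hat (dsucc d)) : Prop :=
  exists y, q = Some y /\ sval y 0%N = 1 /\ forall i, sval y i.+1 = 0.

Definition poincare_ext (d : option nat) (g : hat d -> hat d)
    (gh : hat (dsucc d) -> hat (dsucc d)) : Prop :=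
  mobius gh /\ (forall q, upper q <-> upper (gh q)) /\
  (forall p q, embeds p q -> embeds (g p) (gh q)).

Definition hconv (d : option nat) (u : nat -> hat d) (p : hat d) : Prop :=
  forall eps : R, 0 < eps -> exists N, forall n, (N <= n)%N -> chordal (u n) p < eps.

Definition limit_set (d : option nat) (G : set (hat d -> hat d)) : set (hat d) :=
  [set p | exists (gs : nat -> hat d -> hat d)
                  (ghs : nat -> hat (dsucc d) -> hat (dsucc d))
                  (o q : hat (dsucc d)),
     origin o /\ embeds p q /\
     (forall n, G (gs n) /\ poincare_ext (gs n) (ghs n)) /\
     hconv (fun n => ghs n o) q].

Definition radial_set (d : option nat) (G : set (hat d -> hat d)) : set (hat d) :=
  [set p | limit_set G p /\ exists x : Hpt d, p = Some x /\
     exists (gs : nat -> hat d -> hat d)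
            (ghs : nat -> hat (dsucc d) -> hat (dsucc d))
            (o q : hat (dsucc d)) (C : R),
     origin o /\ embeds p q /\
     (forall n, G (gs n) /\ poincare_ext (gs n) (ghs n)) /\
     hconv (fun n => ghs n o) q /\
     forall n, exists y z, ghs n o = Some y /\ q = Some z /\
        nrm (vsub (sval y) (sval z)) <= C * ht (ghs n o)].

Definition diam (d : option nat) (U : set (hat d)) : \bar R :=
  ereal_sup [set r | exists x y, U x /\ U y /\ r = (chordal x y)%:E].

Definition hterm (d : option nat) (s : R) (U : set (hat d)) : \bar R :=
  if `[< U = set0 >] then 0%E else ((fine (diam U)) `^ s)%:E.

Definition hcontent (d : option nat) (s eps : R) (A : set (hat d)) : \bar R :=
  ereal_inf [set S | exists U : nat -> set (hat d),
     A `<=` \bigcup_i U i /\ (forall i, (diam (U i) <= eps%:E)%E) /\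
     S = (\sum_(0 <= i <oo) hterm s (U i))%E].

Definition hmeasure (d : option nat) (s : R) (A : set (hat d)) : \bar R :=
  ereal_sup [set hcontent s eps A | eps in [set e : R | 0 < e]].

Definition HD (d : option nat) (A : set (hat d)) : \bar R :=
  ereal_inf [set s%:E | s in [set s : R | 0 <= s /\ hmeasure s A = 0%E]].

Definition hopen (d : option nat) (O : set (hat d)) : Prop :=
  forall x, O x -> exists e : R, 0 < e /\ forall y, chordal x y < e -> O y.

Definition hcompact (d : option nat) (K : set (hat d)) : Prop :=
  forall (I : Type) (W : I -> set (hat d)), (forall i, hopen (W i)) ->
    K `<=` \bigcup_i W i ->
    exists (m : nat) (f : 'I_m -> I), forall x, K x -> exists j, W (f j) x.

Definition relopen (d : option nat) (A V : set (hat d)) : Prop :=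
  V `<=` A /\ forall x, V x -> exists e : R, 0 < e /\
    forall y, A y -> chordal x y < e -> V y.

Definition covdim_le (d : option nat) (A : set (hat d)) (n : nat) : Prop :=
  forall (m : nat) (W : 'I_m -> set (hat d)),
    (forall i, relopen A (W i)) -> A `<=` \bigcup_i W i ->
    exists (m' : nat) (V : 'I_m' -> set (hat d)),
      (forall j, relopen A (V j)) /\ A `<=` \bigcup_j V j /\
      (forall j, exists i, V j `<=` W i) /\
      forall f : 'I_n.+2 -> 'I_m', injective f ->
        ~ (exists x, A x /\ forall t, V (f t) x).

Definition top_dim_eq (d : option nat) (A : set (hat d)) (k : nat) : Prop :=
  covdim_le A k /\ forall n, (n < k)%N -> ~ covdim_le A n.

Definition lin_indep (d : option nat) (n : nat) (v : 'I_n -> Hpt d) : Prop :=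
  forall t : 'I_n -> R, (forall i, \sum_(j < n) t j * sval (v j) i = 0) ->
    forall j, t j = 0.

Definition in_affine (d : option nat) (n : nat) (b : Hpt d) (v : 'I_n -> Hpt d)
    (x : Hpt d) : Prop :=
  exists t : 'I_n -> R, forall i, sval x i = sval b i + \sum_(j < n) t j * sval (v j) i.

Definition gen_sphere (d : option nat) (K : set (hat d)) (k : nat) : Prop :=
  (exists (b : Hpt d) (v : 'I_k -> Hpt d), lin_indep v /\
     K = [set p | p = None \/ exists x, p = Some x /\ in_affine b v x]) \/
  (exists (c : Hpt d) (v : 'I_k.+1 -> Hpt d) (r : R), lin_indep v /\ 0 < r /\
     K = [set p | exists x, p = Some x /\ in_affine c v x /\
                            nrm (vsub (sval x) (sval c)) = r]).

End Mobius.

(* Main.v *)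
Require Import Defs.
From HB Require Import structures.
From mathcomp Require Import all_boot all_order all_algebra.
From mathcomp Require Import all_classical all_reals all_analysis.
From mathcomp Require Import measurable_realfun.
From mathcomp Require Import ring lra.
Set Implicit Arguments. Unset Strict Implicit. Unset Printing Implicit Defensive.
Import Order.TTheory GRing.Theory Num.Theory.
Import numFieldNormedType.Exports.
Local Open Scope classical_set_scope.
Local Open Scope ring_scope.

(** Suppose HD(L) <= k. An element [g] of the group whose orbit point [g o]
    approaches a radial point [p] acts near [p] as a zoom: in the chordal metric it
    is, up to an explicit conformal factor, a similarity that blows a small
    neighbourhood of [p] up to definite size.

    Measure. If the set of points that can be zoomed with a fixed constant had
    infinite H^k-measure near two points, finitely many zooms would form an
    iterated function system whose limit set is radial of dimension > k.
    Hence K has finite H^k-measure away from one point, and a density argument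
    applies at almost every point of K.

    Segments. Inverting K at a point [xi] of K gives a closed set P(xi) on which
    zooms act as exact similarities. As K has topological dimension k, slicing
    P(xi) by k-1 generic functionals leaves, by Eilenberg's inequality, continua
    of finite length; almost everywhere on these P(xi) contains almost straight
    pieces, even transversally to any j < k directions in which P(xi) is already
    translation invariant.

    Flatness. Zooming along an ultrafilter turns these pieces into exact segments,
    then into rays in a common direction, then into lines, so that some P(xi)
    becomes invariant under one more direction. After k steps a last zoom makes
    some P(xi) an affine k-plane, and undoing the inversion shows that K is a
    generalized k-sphere. *)

(** * Hausdorff measures by covers *)

Section SumLemmas.
Context {R : realType}.

Lemma sum_half_expn_le (e : R) n : 0 <= e -> \sum_(j < n) e / 2 ^+ j.+1 <= e.
Proof.
move=> e0; suff -> : \sum_(j < n) e / 2 ^+ j.+1 = e - e / 2 ^+ n.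
  by rewrite lerBlDr lerDl divr_ge0 // exprn_ge0.
elim: n => [|n IH]; first by rewrite big_ord0 expr0 divr1 subrr.
rewrite big_ord_recr /= IH exprS.
have : (2 : R) ^+ n != 0 by rewrite expf_neq0 // pnatr_eq0.
by move=> h; field.
Qed.

Lemma ler_sum_ord (f : nat -> R) m n : (forall i, 0 <= f i) -> (m <= n)%N ->
  \sum_(i < m) f i <= \sum_(i < n) f i.
Proof.
move=> f0 mn; rewrite -(subnKC mn) big_split_ord /= lerDl; exact: sumr_ge0.
Qed.

Lemma bounded_sum_tail (f : nat -> R) (M e : R) : (forall i, 0 <= f i) ->
  (forall n, \sum_(i < n) f i <= M) -> 0 < e ->
  exists m, forall n, \sum_(i < n) (if (i < m)%N then 0 else f i) <= e.
Proof.
move=> f0 fM e0; pose S n := \sum_(i < n) f i.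
have S0 : range S !=set0 by exists (S 0%N), 0%N.
have Sb : has_ubound (range S) by exists M => _ [n _ <-]; exact: fM.
have : sup (range S) - e < sup (range S) by rewrite ltrBlDr ltrDl.
move=> /(sup_gt S0)[_ [m _ <-] hm]; exists m => n.
have tailE p : \sum_(i < p) (if (i < m)%N then 0 else f i) = S p - S (minn p m).
  elim: p => [|p IH]; first by rewrite min0n big_ord0 subrr.
  rewrite big_ord_recr /= IH /S; case: ltnP => h.
    by rewrite (minn_idPl h) !subrr addr0.
  by rewrite (minn_idPr (leqW h)) [in RHS]big_ord_recr /=; lra.
rewrite tailE; case: (leqP m n) => mn; last by rewrite subrr ltW.
have : S n <= sup (range S) by apply: ub_le_sup => //; exists n.
lra.
Qed.

Lemma ler_sum_term (I : finType) (P : pred I) (f : I -> R) i :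
  (forall j, 0 <= f j) -> P i -> f i <= \sum_(j | P j) f j.
Proof. by move=> f0 Pi; rewrite (bigD1 i) //= lerDl sumr_ge0. Qed.

Lemma sum_bool_pigeonhole (I : finType) (side : I -> bool) (f : I -> R) (M : R) :
  2 * M <= \sum_i f i -> exists b, M <= \sum_(i | side i == b) f i.
Proof.
rewrite (bigID (fun i => side i == true)) /= => hM.
have [|lt_M] := leP M (\sum_(i | side i == true) f i); first by exists true.
exists false; rewrite (eq_bigl (fun i => side i != true)); first lra.
by move=> i; case: (side i).
Qed.

Lemma ler_sum_uniq_sub (I : eqType) (s t : seq I) (f : I -> R) :
  (forall i, 0 <= f i) -> uniq s -> uniq t -> {subset s <= t} ->
  \sum_(i <- s) f i <= \sum_(i <- t) f i.
Proof.
move=> f0 us ut st; have Es : perm_eq [seq i <- t | i \in s] s.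
  apply: uniq_perm => [||i]; rewrite ?filter_uniq // mem_filter /=.
  by apply: andb_idr => /st.
rewrite [leRHS](bigID (mem s)) /= -[X in _ <= X + _]big_filter (perm_big _ Es).
by rewrite lerDl sumr_ge0.
Qed.

Lemma sum_pickle_inv_le (g : nat -> nat -> R) (N : nat) :
  (forall i j, 0 <= g i j) -> exists m,
  \sum_(n < N) (if pickle_inv n is Some p then g (p : nat * nat).1 p.2 else 0)
   <= \sum_(i < m) \sum_(j < m) g i j.
Proof.
move=> g0; pose s := pmap (pickle_inv : nat -> option (nat * nat)%type) (iota 0 N).
pose f (p : nat * nat) := g p.1 p.2.
have [m sm] : exists m, forall p, p \in s -> (p.1 < m)%N /\ (p.2 < m)%N.
  exists (\max_(p <- s) maxn p.1 p.2).+1 => p ps.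
  have : (maxn p.1 p.2 <= \max_(p <- s) maxn p.1 p.2)%N.
    by rewrite (big_rem p ps) /= leq_maxl.
  by rewrite geq_max => /andP[? ?]; rewrite !ltnS.
exists m; pose t := [seq (i, j) | i <- iota 0 m, j <- iota 0 m].
have -> : \sum_(i < m) \sum_(j < m) g i j = \sum_(p <- t) f p.
  rewrite big_allpairs -(big_mkord xpredT (fun i => \sum_(j < m) g i j)) /index_iota subn0.
  by apply: eq_bigr => i _; rewrite -(big_mkord xpredT (g i)) /index_iota subn0.
have -> : \sum_(n < N) (if pickle_inv n is Some p then f p else 0) = \sum_(p <- s) f p.
  rewrite -(big_mkord xpredT (fun n => if pickle_inv n is Some p then f p else 0)).
  rewrite /index_iota subn0 /s.
  elim: (iota 0 N) => [|n l IH]; first by rewrite !big_nil.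
  by rewrite big_cons IH /=; case: pickle_inv => [p|]; rewrite ?big_cons ?add0r.
apply: ler_sum_uniq_sub => [p|||[i j] /sm[im jm]]; first exact: g0.
- by apply: (pmap_uniq (@pickle_invK _)); exact: iota_uniq.
- by rewrite allpairs_uniq ?iota_uniq // => -[? ?] [? ?] _ _ [-> ->].
by apply/allpairsPdep; exists i, j; rewrite !mem_iota.
Qed.

End SumLemmas.

Section Covers.
Context {R : realType}.

Definition pseudometric (T : Type) (d : T -> T -> R) :=
  [/\ forall x, d x x = 0, forall x y, d x y = d y x
    & forall x y z, d x z <= d x y + d y z].

Lemma pseudometric_ge0 T (d : T -> T -> R) : pseudometric d -> forall x y, 0 <= d x y.
Proof.
by case=> d0 dC dT x y; have := dT x y x; rewrite d0 (dC y x); lra.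
Qed.

Definition cover_sum_le (T : Type) (d : T -> T -> R) (k : nat) (A : set T) (dl M : R) :=
  exists (U : nat -> set T) (r : nat -> R),
  [/\ A `<=` \bigcup_i U i, forall i, 0 <= r i <= dl,
      forall i x y, U i x -> U i y -> d x y <= r i
    & forall n, \sum_(i < n) r i ^+ k <= M].

(* The k-dimensional Hausdorff measure of [A] is at most [M]; bounding the
   partial sums avoids infinite series. *)
Definition hausdorff_le (T : Type) (d : T -> T -> R) (k : nat) (A : set T) (M : R) :=
  forall dl e : R, 0 < dl -> 0 < e -> cover_sum_le d k A dl (M + e).

Definition hausdorff_finite (T : Type) (d : T -> T -> R) (k : nat) (A : set T) :=
  exists M, hausdorff_le d k A M.

Definition hausdorff_null (T : Type) (d : T -> T -> R) (k : nat) (A : set T) :=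
  hausdorff_le d k A 0.

Section Basic.
Context (T : Type) (d : T -> T -> R) (k : nat) (k0 : (0 < k)%N).
Implicit Types A B : set T.

Let exprk0 : (0 : R) ^+ k = 0.
Proof. by rewrite expr0n; case: k k0. Qed.

Lemma cover_sum_leS A B (dl M N : R) : A `<=` B -> M <= N ->
  cover_sum_le d k B dl M -> cover_sum_le d k A dl N.
Proof.
move=> AB MN [U [r [cov rb Ud rM]]]; exists U, r; split => //.
  exact: subset_trans cov.
by move=> n; apply: le_trans MN.
Qed.

Lemma hausdorff_leS A B (M N : R) : A `<=` B -> M <= N ->
  hausdorff_le d k B M -> hausdorff_le d k A N.
Proof.
move=> AB MN h dl e dl0 e0; apply: cover_sum_leS (h _ _ dl0 e0) => //.
by rewrite lerD2r.
Qed.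

Lemma hausdorff_finiteS A B :
  A `<=` B -> hausdorff_finite d k B -> hausdorff_finite d k A.
Proof. by move=> AB [M h]; exists M; apply: hausdorff_leS h. Qed.

Lemma hausdorff_nullS A B : A `<=` B -> hausdorff_null d k B -> hausdorff_null d k A.
Proof. by move=> AB; apply: hausdorff_leS. Qed.

Lemma hausdorff_null_finite A : hausdorff_null d k A -> hausdorff_finite d k A.
Proof. by move=> h; exists 0. Qed.

Lemma cover_sum_le_ge0 A dl M : cover_sum_le d k A dl M -> 0 <= M.
Proof. by case=> U [r [_ _ _ /(_ 0%N)]]; rewrite big_ord0. Qed.

Lemma hausdorff_le_ge0 A M : hausdorff_le d k A M -> 0 <= M.
Proof.
move=> h; rewrite leNgt; apply/negP => M0; have e0 : 0 < - M / 2 by lra.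
by have := cover_sum_le_ge0 (h _ _ ltr01 e0); lra.
Qed.

Lemma hausdorff_le_lim A M :
  (forall N, M < N -> hausdorff_le d k A N) -> hausdorff_le d k A M.
Proof.
move=> h dl e dl0 e0; have e2 : 0 < e / 2 by lra.
have := h (M + e / 2) _ dl (e / 2) dl0 e2; rewrite -addrA -splitr; apply; lra.
Qed.

Lemma hausdorff_finite_least A : hausdorff_finite d k A ->
  exists2 a, hausdorff_le d k A a & forall b, b < a -> ~ hausdorff_le d k A b.
Proof.
move=> [M hM]; pose S : set R := [set a | hausdorff_le d k A a].
have S0 : lbound S 0 by move=> x; exact: hausdorff_le_ge0.
have Si : has_inf S by split; [exists M | exists 0].
exists (inf S).
  apply: hausdorff_le_lim => N /(inf_lt Si.1) [b Sb bN].
  by apply: hausdorff_leS Sb => //; exact: ltW.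
move=> b bS hb; have : inf S <= b by apply: ge_inf => //; case: Si.
by rewrite leNgt bS.
Qed.

Lemma cover_sum_le_bigcup (A : nat -> set T) (M : nat -> R) (dl N : R) :
  0 <= dl -> (forall j, cover_sum_le d k (A j) dl (M j)) ->
  (forall n, \sum_(j < n) M j <= N) -> cover_sum_le d k (\bigcup_j A j) dl N.
Proof.
move=> dl0 h hM; have /choice[U /choice[r Hr]] := h.
exists (fun n => if pickle_inv n is Some p then U (p : nat * nat).1 p.2 else set0).
exists (fun n => if pickle_inv n is Some p then r (p : nat * nat).1 p.2 else 0).
split.
- move=> x [j _ Ajx]; have [cov _ _ _] := Hr j; have [i _ Ui] := cov _ Ajx.
  by exists (pickle (j, i)) => //; rewrite pickleK_inv.
- move=> n; case: (pickle_inv n) => [[i j]|] /=; last by rewrite lexx.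
  by have [_ + _ _] := Hr i; apply.
- move=> n x y; case: (pickle_inv n) => [[i j]|] //=.
  by have [_ _ + _] := Hr i; apply.
move=> n; have := @sum_pickle_inv_le R (fun i j => r i j ^+ k) n.
case=> [i j|m hm].
  by have [_ /(_ j)/andP[? _] _ _] := Hr i; exact: exprn_ge0.
apply: le_trans (hM m); apply: le_trans (le_trans hm _); last first.
  by apply: ler_sum => i _; have [_ _ _ +] := Hr i; apply.
by apply: ler_sum => i _; case: (pickle_inv i) => [p|] //=; rewrite exprk0.
Qed.

Lemma hausdorff_le_bigcup (A : nat -> set T) (M : nat -> R) (N : R) :
  (forall j, hausdorff_le d k (A j) (M j)) ->
  (forall n, \sum_(j < n) M j <= N) -> hausdorff_le d k (\bigcup_j A j) N.
Proof.
move=> h hM dl e dl0 e0.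
apply: (@cover_sum_le_bigcup A (fun j => M j + e / 2 ^+ j.+1)); first exact: ltW.
  by move=> j; apply: h => //; rewrite divr_gt0 // exprn_gt0.
move=> n; rewrite big_split /=.
by apply: lerD; [exact: hM|apply: sum_half_expn_le; exact: ltW].
Qed.

Lemma hausdorff_null_bigcup (A : nat -> set T) :
  (forall j, hausdorff_null d k (A j)) -> hausdorff_null d k (\bigcup_j A j).
Proof. by move=> h; apply: (hausdorff_le_bigcup h) => n; rewrite big1. Qed.

Lemma cover_sum_le0 dl : 0 <= dl -> cover_sum_le d k set0 dl 0.
Proof.
move=> dl0; exists (fun=> set0), (fun=> 0); split => //.
  by move=> i; rewrite lexx.
by move=> n; rewrite big1.
Qed.

Lemma hausdorff_null0 : hausdorff_null d k set0.
Proof.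
move=> dl e dl0 e0; rewrite add0r.
by apply: cover_sum_leS (cover_sum_le0 (ltW dl0)) => //; exact: ltW.
Qed.

Lemma cover_sum_leU A B dl M N : 0 <= dl -> cover_sum_le d k A dl M ->
  cover_sum_le d k B dl N -> cover_sum_le d k (A `|` B) dl (M + N).
Proof.
move=> dl0 hA hB; have M0 := cover_sum_le_ge0 hA; have N0 := cover_sum_le_ge0 hB.
pose AB (j : nat) := if j is 0 then A else if j is 1 then B else set0.
pose MN (j : nat) := if j is 0 then M else if j is 1 then N else 0.
apply: (@cover_sum_leS _ (\bigcup_j AB j) dl (M + N)) => //.
  by move=> x [Ax|Bx]; [exists 0%N|exists 1%N].
apply: (@cover_sum_le_bigcup _ MN) => //.
  by move=> [|[|j]] //; exact: cover_sum_le0.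
move=> [|[|n]]; first by rewrite big_ord0 addr_ge0.
  by rewrite big_ord_recr big_ord0 /= add0r lerDl.
by rewrite !big_ord_recl /= big1 ?addr0.
Qed.

Lemma hausdorff_leU A B M N : hausdorff_le d k A M -> hausdorff_le d k B N ->
  hausdorff_le d k (A `|` B) (M + N).
Proof.
move=> hA hB dl e dl0 e0; have e2 : 0 < e / 2 by lra.
rewrite [M + N + e](_ : _ = M + e / 2 + (N + e / 2)); last by field.
by apply: (cover_sum_leU (ltW dl0)); [exact: hA|exact: hB].
Qed.

Lemma hausdorff_finiteU A B : hausdorff_finite d k A -> hausdorff_finite d k B ->
  hausdorff_finite d k (A `|` B).
Proof. by move=> [M hM] [N hN]; exists (M + N); exact: hausdorff_leU. Qed.

Lemma hausdorff_nullU A B : hausdorff_null d k A -> hausdorff_null d k B ->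
  hausdorff_null d k (A `|` B).
Proof. by move=> hA hB; rewrite /hausdorff_null -(addr0 0); exact: hausdorff_leU. Qed.

Lemma hausdorff_nonnullD A B : ~ hausdorff_null d k A -> hausdorff_null d k B ->
  ~ hausdorff_null d k (A `\` B).
Proof.
move=> nA hB hAB; apply: nA; apply: hausdorff_nullS (hausdorff_nullU hAB hB) => x Ax.
by have [Bx|Bx] := pselect (B x); [right|left].
Qed.

Lemma hausdorff_nonnull_nonempty A : ~ hausdorff_null d k A -> A !=set0.
Proof.
move=> nA; apply: contrapT => /set0P/negP/negPn/eqP A0; apply: nA.
by rewrite A0; exact: hausdorff_null0.
Qed.

Lemma hausdorff_null1 x : d x x = 0 -> hausdorff_null d k [set x].
Proof.
move=> dx dl e dl0 e0; exists (fun=> [set x]), (fun=> 0); split.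
- by move=> y ->; exists 0%N.
- by move=> i; rewrite lexx ltW.
- by move=> i y z -> ->; rewrite dx.
by move=> n; rewrite big1 ?add0r ?ltW.
Qed.

(* Since [k > 0], a cover of small total cost consists of small sets. *)
Lemma hausdorff_nullP A : hausdorff_null d k A <->
  forall e : R, 0 < e -> exists dl, cover_sum_le d k A dl e.
Proof.
split=> [h e e0|h dl e dl0 e0].
  by exists 1; have := h 1 e ltr01 e0; rewrite add0r.
have m0 : 0 < Num.min e (dl ^+ k) by rewrite lt_min e0 exprn_gt0.
have [dl' [U [r [cov rb Ud rM]]]] := h _ m0; exists U, r; split => //.
  move=> i; have /andP[r0 _] := rb i; rewrite r0 /=.
  rewrite -(@ler_pXn2r _ k) ?nnegrE ?(ltW dl0) //.
  apply: (@le_trans _ _ (Num.min e (dl ^+ k))); last by rewrite ge_min lexx orbT.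
  apply: le_trans (rM i.+1); rewrite big_ord_recr /= lerDr sumr_ge0 // => j _.
  by have /andP[? _] := rb j; exact: exprn_ge0.
by move=> n; rewrite add0r; apply: le_trans (rM n) _; rewrite ge_min lexx.
Qed.

Lemma hausdorff_nonnull_cover A : ~ hausdorff_null d k A ->
  exists2 e : R, 0 < e & forall dl, ~ cover_sum_le d k A dl e.
Proof.
move=> /hausdorff_nullP/existsNP[e /not_implyP[e0 he]]; exists e => // dl hc.
by apply: he; exists dl.
Qed.

Lemma hausdorff_nonnull_gt A : ~ hausdorff_null d k A ->
  exists2 e : R, 0 < e & ~ hausdorff_le d k A e.
Proof.
move=> /hausdorff_nonnull_cover[e e0 he]; exists (e / 2); first lra.
move=> /(_ 1 (e / 2) ltr01); rewrite -splitr => hc.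
by apply: (he 1); apply: hc; lra.
Qed.

Section Superadditivity.
Variables (U : nat -> set T) (r : nat -> R).

Definition touching_cost A i : R := if `[< U i `&` A !=set0 >] then r i else 0.

Lemma cover_sum_le_touching A dl M : A `<=` \bigcup_i U i ->
  (forall i, 0 <= r i <= dl) -> (forall i x y, U i x -> U i y -> d x y <= r i) ->
  (forall n, \sum_(i < n) touching_cost A i ^+ k <= M) -> cover_sum_le d k A dl M.
Proof.
move=> cov rb Ud rM; exists (fun i => U i `&` A), (touching_cost A); split=> //.
- by move=> x Ax; have [i _ Ui] := cov x Ax; exists i.
- move=> i; rewrite /touching_cost; case: asboolP => // _.
  by have /andP[/le_trans r0 /r0 ->] := rb i; rewrite lexx.
- move=> i x y Ux Uy; rewrite /touching_cost asboolT; last by exists x.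
  exact: Ud Ux.1 Uy.1.
Qed.

Lemma touching_cost_separated A B dl i : (forall i, 0 <= r i <= dl) ->
  (forall i x y, U i x -> U i y -> d x y <= r i) ->
  (forall x y, A x -> B y -> dl < d x y) ->
  touching_cost A i ^+ k + touching_cost B i ^+ k <= r i ^+ k.
Proof.
move=> rb Ud sep; have /andP[r0 rdl] := rb i; rewrite /touching_cost.
case: asboolP => [[x [Ux Ax]]|_]; case: asboolP => [[y [Uy By]]|_];
  rewrite ?exprk0 ?addr0 ?add0r ?exprn_ge0 //.
by have := sep _ _ Ax By; have := Ud _ _ _ Ux Uy; lra.
Qed.

End Superadditivity.

Lemma hausdorff_le_superadditive A B (a b s : R) : 0 < s ->
  (forall x y, A x -> B y -> s <= d x y) ->
  ~ hausdorff_le d k A a -> ~ hausdorff_le d k B b ->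
  ~ hausdorff_le d k (A `|` B) (a + b).
Proof.
move=> s0 sep /existsNP[d1 /existsNP[e1 /not_implyP[d10 /not_implyP[e10 nA]]]].
move=> /existsNP[d2 /existsNP[e2 /not_implyP[d20 /not_implyP[e20 nB]]]] h.
pose dl := Num.min (Num.min d1 d2) (s / 2).
have dl0 : 0 < dl by rewrite !lt_min d10 d20 divr_gt0.
have [dld1 dld2 dls] : [/\ dl <= d1, dl <= d2 & dl <= s / 2].
  by rewrite !ge_min !lexx !orbT.
have [U [r [cov rb Ud rM]]] := h _ _ dl0 (addr_gt0 e10 e20).
have rb1 i : 0 <= r i <= d1 by have /andP[-> /le_trans] := rb i; apply.
have rb2 i : 0 <= r i <= d2 by have /andP[-> /le_trans] := rb i; apply.
have [n /negP] : exists n, ~ (\sum_(i < n) touching_cost U r A i ^+ k <= a + e1).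
  apply/existsNP => hA; apply: nA; apply: cover_sum_le_touching hA => //.
  by apply: subset_trans cov => x; left.
have [m /negP] : exists n, ~ (\sum_(i < n) touching_cost U r B i ^+ k <= b + e2).
  apply/existsNP => hB; apply: nB; apply: cover_sum_le_touching hB => //.
  by apply: subset_trans cov => x; right.
rewrite -!ltNge => hm hn.
have cost0 C i : 0 <= touching_cost U r C i ^+ k.
  by rewrite /touching_cost exprn_ge0 //; case: ifP => // _; have /andP[] := rb i.
have dlsep x y : A x -> B y -> dl < d x y by move=> Ax /(sep _ _ Ax); lra.
have := ler_sum (index_enum 'I_(maxn n m))
  (fun (i : 'I_(maxn n m)) (_ : true) => touching_cost_separated i rb Ud dlsep).
rewrite big_split /=; have := rM (maxn n m).
have := ler_sum_ord (cost0 A) (leq_maxl n m); have := ler_sum_ord (cost0 B) (leq_maxr n m).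
lra.
Qed.

End Basic.

Section Images.
Context (T T' : Type) (d : T -> T -> R) (d' : T' -> T' -> R) (k : nat).
Context (f : T -> T') (A : set T) (L : R) (L0 : 0 < L).
Hypothesis f_lip : forall x y, A x -> A y -> d' (f x) (f y) <= L * d x y.

Lemma cover_sum_le_image (dl M : R) :
  cover_sum_le d k A dl M -> cover_sum_le d' k (f @` A) (L * dl) (L ^+ k * M).
Proof.
move=> [U [r [cov rb Ud rM]]]; have L0' := ltW L0.
exists (fun i => f @` (U i `&` A)), (fun i => L * r i); split.
- by move=> _ [x Ax <-]; have [i _ Ui] := cov x Ax; exists i => //; exists x.
- by move=> i; have /andP[r0 rdl] := rb i; rewrite mulr_ge0 //= ler_wpM2l.
- move=> i _ _ [x [Ux Ax] <-] [y [Uy Ay] <-]; apply: le_trans (f_lip Ax Ay) _.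
  by apply: ler_wpM2l => //; exact: Ud Ux Uy.
move=> n; under eq_bigr do rewrite exprMn.
by rewrite -mulr_sumr ler_wpM2l // exprn_ge0.
Qed.

Lemma hausdorff_le_image (M : R) :
  hausdorff_le d k A M -> hausdorff_le d' k (f @` A) (L ^+ k * M).
Proof.
move=> h dl e dl0 e0; have Lk : 0 < L ^+ k by rewrite exprn_gt0.
have := h (dl / L) (e / L ^+ k) (divr_gt0 dl0 L0) (divr_gt0 e0 Lk).
move=> /cover_sum_le_image.
by rewrite mulrDr !mulrA ![_ * _ / _]mulrAC !mulfV ?mul1r ?lt0r_neq0.
Qed.

Lemma hausdorff_null_image : hausdorff_null d k A -> hausdorff_null d' k (f @` A).
Proof. by move=> /hausdorff_le_image; rewrite mulr0. Qed.

Lemma hausdorff_finite_image :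
  hausdorff_finite d k A -> hausdorff_finite d' k (f @` A).
Proof. by move=> [M /hausdorff_le_image h]; exists (L ^+ k * M). Qed.

End Images.

End Covers.

Lemma In_mkseq (X : Type) (u : nat -> X) n a :
  List.In a (mkseq u n) <-> exists2 m, (m < n)%N & u m = a.
Proof.
elim: n => [|n IH]; first by split=> // -[].
rewrite mkseqS -cats1 List.in_app_iff IH /=; split=> [[[m mn ua]|[ua|//]]|[m]].
- by exists m => //; exact: ltnW.
- by exists n.
rewrite ltnS leq_eqVlt => /orP[/eqP->|mn] ua; first by right; left.
by left; exists m.
Qed.

Lemma choice2 (X Y : Type) (P Q : X -> Y -> Prop) :
  (forall x, exists2 y, P x y & Q x y) ->
  exists2 f : X -> Y, forall x, P x (f x) & forall x, Q x (f x).
Proof.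
move=> h; have /choice[f hf] x : exists y, P x y /\ Q x y.
  by have [y Py Qy] := h x; exists y.
by exists f => x; case: (hf x).
Qed.

Lemma choice_history (X : Type) (P : seq X -> X -> Prop) :
  (forall l, exists x, P l x) -> exists u : nat -> X, forall n, P (mkseq u n) (u n).
Proof.
move=> /choice[f hf].
pose fix l n : seq X := if n is m.+1 then rcons (l m) (f (l m)) else [::].
exists (f \o l) => n; suff -> : mkseq (f \o l) n = l n by exact: hf.
by elim: n => //= n IH; rewrite mkseqS IH.
Qed.

Section Vitali.
Context {R : realType} (I : Type) (size : I -> R).

Lemma exists_half_maximal (F : set I) (B : R) : F !=set0 ->
  (forall i, F i -> 0 < size i <= B) ->
  exists2 i, F i & forall j, F j -> size j <= 2 * size i.
Proof.
move=> [j0 Fj0] sizeB; pose S := size @` F.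
have S0 : S !=set0 by exists (size j0), j0.
have Sb : has_ubound S by exists B => _ [i /sizeB/andP[_ ?] <-].
have le_supS j : F j -> size j <= sup S by move=> Fj; apply: ub_le_sup => //; exists j.
have sup0 : 0 < sup S.
  by have /andP[p _] := sizeB _ Fj0; exact: lt_le_trans p (le_supS _ Fj0).
have : sup S / 2 < sup S by lra.
move=> /(sup_gt S0)[_ [i Fi <-] hi]; exists i => // j Fj.
by have := le_supS _ Fj; lra.
Qed.

(* [meet] is the conflict relation, typically "the two sets meet". *)
Lemma vitali_selection (F : set I) (meet : I -> I -> Prop) (B : R) :
  (forall i, F i -> 0 < size i <= B) ->
  (forall u : nat -> I, (forall n, F (u n)) ->
     (forall m n, (m < n)%N -> ~ meet (u m) (u n)) ->
     forall e : R, 0 < e -> exists n, size (u n) < e) ->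
  exists s : nat -> option I,
  [/\ forall n i, s n = Some i -> F i,
      forall m n i j, (m < n)%N -> s m = Some i -> s n = Some j -> ~ meet i j
    & forall j, F j -> exists n i, [/\ s n = Some i, meet i j & size j <= 2 * size i]].
Proof.
move=> sizeB sizes_to0.
pose avail (l : seq (option I)) :=
  [set i | F i /\ forall a, List.In (Some a) l -> ~ meet a i].
pose select l o := if o is Some i
  then avail l i /\ forall j, avail l j -> size j <= 2 * size i
  else forall j, ~ avail l j.
have /choice_history[s hs] : forall l, exists o, select l o.
  move=> l; have [ne|/set0P/negP/negPn/eqP e0] := pselect (avail l !=set0).
    have [|i Ai hi] := @exists_half_maximal _ B ne; last by exists (Some i).
    by move=> i [/sizeB].
  by exists None => j; rewrite e0.
have selP n i : s n = Some i ->
    avail (mkseq s n) i /\ forall j, avail (mkseq s n) j -> size j <= 2 * size i.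
  by move=> sn; have := hs n; rewrite sn.
have s_meet m n i j : (m < n)%N -> s m = Some i -> s n = Some j -> ~ meet i j.
  by move=> mn sm /selP[[_ +] _]; apply; apply/In_mkseq; exists m.
exists s; split=> // [n i /selP[[]] //|j Fj]; apply: contrapT => hn.
have avail_j n : avail (mkseq s n) j.
  split=> // a /In_mkseq[m _]; elim/ltn_ind: m a => m IH a sm aj; apply: hn.
  exists m, a; split=> //; have [_] := selP _ _ sm; apply; split=> // b.
  by move=> /In_mkseq[m' mm' sm']; exact: IH mm' _ sm'.
have /choice[u hu] : forall n, exists i, s n = Some i.
  by move=> n; have := hs n; case: (s n) => [i|/(_ j (avail_j n))//]; exists i.
have /andP[j0 _] := sizeB _ Fj.
have [n|m n mn|n] := sizes_to0 u _ _ _ (divr_gt0 j0 (ltr0n R 2)).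
- by have [[]] := selP _ _ (hu n).
- exact: s_meet mn (hu m) (hu n).
by have [_ /(_ j (avail_j n))] := selP _ _ (hu n); lra.
Qed.

End Vitali.

(** * Limits along an ultrafilter *)

Class FreeUltraFilter (U : set_system nat) := {
  free_ultra_filter :: UltraFilter U;
  free_ultra_ge : forall N, U [set n | (N <= n)%N]
}.

Lemma free_ultra_exists : exists U, FreeUltraFilter U.
Proof.
have [U [UU ooU]] := ultraFilterLemma (eventually_filter); exists U; split=> // N.
exact/ooU/nbhs_infty_ge.
Qed.

Lemma exists_invS_lt (R : realType) (e : R) : 0 < e -> exists n, n.+1%:R^-1 < e.
Proof. by move=> /ltr_add_invr[n]; rewrite add0r; exists n. Qed.

Lemma half_expn_small (R : realType) (e : R) : 0 < e ->
  exists N, forall n, (N <= n)%N -> (1 / 2) ^+ n < e.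
Proof.
move=> /exists_invS_lt[N hN]; exists N => n Nn; apply: le_lt_trans hN.
rewrite div1r exprVn lef_pV2 ?posrE ?exprn_gt0 // -natrX ler_nat.
exact: leq_ltn_trans Nn (ltn_expl n _).
Qed.

Section Ultra.
Context {R : realType} (U : set_system nat) {uU : FreeUltraFilter U}.

Lemma ultra_setC A : ~ U A -> U (~` A).
Proof. by have [] := in_ultra_setVsetC A free_ultra_filter. Qed.

Lemma ultra_exists (W : finType) (P : W -> nat -> Prop) :
  U [set n | exists w, P w n] -> exists w, U [set n | P w n].
Proof.
move=> h; apply: contrapT => hn.
have nP : U [set n | forall w, ~ P w n].
  by apply: filter_forall => w; apply: ultra_setC => hw; apply: hn; exists w.
by have [n [[w Pw] /(_ w)]] := filter_ex (filterI h nP).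
Qed.

Lemma free_ultra_ex_ge A N : U A -> exists2 n, (N <= n)%N & A n.
Proof. by move=> UA; have [n [? ?]] := filter_ex (filterI UA (free_ultra_ge N)); exists n. Qed.

Lemma free_ultra_invS_lt (e : R) : 0 < e -> U [set n | n.+1%:R^-1 < e].
Proof.
move=> /exists_invS_lt[N hN]; apply: filterS (free_ultra_ge N) => n /= Nn.
by apply: le_lt_trans hN; rewrite lef_pV2 ?posrE // ler_nat.
Qed.

Definition ultra_cvg (T : Type) (d : T -> T -> R) (u : nat -> T) (x : T) :=
  forall e : R, 0 < e -> U [set n | d (u n) x < e].

Definition ultra_compact (T : Type) (d : T -> T -> R) (K : set T) :=
  forall u : nat -> T, (forall n, K (u n)) -> exists2 x, K x & ultra_cvg d u x.

Section Metric.
Context (T : Type) (d : T -> T -> R) (pd : pseudometric d).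
Let d0 x : d x x = 0. Proof. by case: pd. Qed.
Let dC x y : d x y = d y x. Proof. by case: pd. Qed.
Let dT x y z : d x z <= d x y + d y z. Proof. by case: pd. Qed.
Let dge0 := pseudometric_ge0 pd.

Lemma ultra_cvg_cst x : ultra_cvg d (fun=> x) x.
Proof. by move=> e e0; apply: filterE => n /=; rewrite d0. Qed.

Lemma ultra_cvg_dist u v x y : ultra_cvg d u x -> ultra_cvg d v y ->
  forall e : R, 0 < e -> U [set n | `|d (u n) (v n) - d x y| < e].
Proof.
move=> hu hv e e0; have e2 : 0 < e / 2 by lra.
apply: filterS (filterI (hu _ e2) (hv _ e2)) => n [/= h1 h2].
have := dT (u n) x (v n); have := dT x y (v n); have := dT x (u n) y.
have := dT (u n) (v n) y; rewrite (dC x (u n)) (dC y (v n)) ltr_norml => *.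
by apply/andP; split; lra.
Qed.

Lemma ultra_cvg_exists A y : (forall e : R, 0 < e -> exists z, A z /\ d y z < e) ->
  exists z : nat -> T, (forall n, A (z n)) /\ ultra_cvg d z y.
Proof.
move=> close; have /choice[z hz] n : exists z, A z /\ d y z < n.+1%:R^-1.
  by apply: close; rewrite invr_gt0.
exists z; split=> [n|e e0]; first by case: (hz n).
apply: filterS (free_ultra_invS_lt e0) => n /=; rewrite dC.
by case: (hz n) => _; exact: lt_trans.
Qed.

Lemma ultra_cvg_dist_le z y x (t : R) : ultra_cvg d z y -> U [set n | d (z n) x <= t] -> d y x <= t.
Proof.
move=> zy zx; rewrite leNgt; apply/negP; rewrite -subr_gt0 => /zy/(filterI zx).
by move=> /filter_ex[n [/=]]; have := dT y (z n) x; rewrite (dC y (z n)); lra.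
Qed.

Lemma ultra_cvg_dist_ge z y x (t : R) : ultra_cvg d z y -> U [set n | t <= d (z n) x] -> t <= d y x.
Proof.
move=> zy zx; rewrite leNgt; apply/negP; rewrite -subr_gt0 => /zy/(filterI zx).
by move=> /filter_ex[n [/=]]; have := dT (z n) y x; lra.
Qed.

Definition positively_separated (A B : set T) :=
  exists2 s : R, 0 < s & forall x y, A x -> B y -> s <= d x y.

Lemma positively_separatedC A B : positively_separated A B -> positively_separated B A.
Proof. by move=> [s s0 h]; exists s => // x y Bx Ay; rewrite dC; exact: h. Qed.

Lemma positively_separatedS A A' B B' : A `<=` A' -> B `<=` B' ->
  positively_separated A' B' -> positively_separated A B.
Proof. by move=> AA' BB' [s s0 h]; exists s => // x y /AA' ? /BB'; exact: h. Qed.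

Lemma positively_separated_bigcup (I : finType) (A : I -> set T) (B : set T) :
  (forall i, positively_separated (A i) B) -> positively_separated (\bigcup_i A i) B.
Proof.
move=> /choice2[s s0 sep]; exists (\big[Num.min/1]_i s i).
  by apply: lt_bigmin => // i _; exact: s0.
by move=> x y [i _ Ax] By; apply: le_trans (sep i x y Ax By); exact: bigmin_le_cond.
Qed.

Lemma positively_separated_ord n (A : 'I_n -> set T) :
  (forall i j : 'I_n, (i < j)%N -> positively_separated (A i) (A j)) ->
  forall i j, i != j -> positively_separated (A i) (A j).
Proof.
move=> sep i j; rewrite -val_eqE neq_ltn => /orP[/sep //|/sep].
exact: positively_separatedC.
Qed.

Lemma hausdorff_le_superadditive_sum k (I : finType) (A : I -> set T) (a : I -> R) :
  (0 < k)%N -> (forall i j, i != j -> positively_separated (A i) (A j)) ->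
  (forall i b, b < a i -> ~ hausdorff_le d k (A i) b) ->
  forall b, b < \sum_i a i -> ~ hausdorff_le d k (\bigcup_i A i) b.
Proof.
move=> k0 sep nA; suff H (l : seq I) : uniq l -> forall b, b < \sum_(i <- l) a i ->
    ~ hausdorff_le d k (\bigcup_(i in [set` l]) A i) b.
  move=> b hb; apply: contra_not (H _ (index_enum_uniq I) b hb).
  by apply: hausdorff_leS => // x [i _ Ai]; exists i.
elim: l => [_ b|i l IH /= /andP[il ul] b]; first by rewrite big_nil => b0 /hausdorff_le_ge0; lra.
rewrite big_cons; set S := \sum_(j <- l) a j => hb hle.
pose g := (a i + S - b) / 2.
have [s s0 hs] : positively_separated (A i) (\bigcup_(j in [set` l]) A j).
  apply: positively_separatedC.
  apply: (@positively_separatedS _ (\bigcup_(j : {j | j != i}) A (sval j)) _ (A i)) => //.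
    move=> x [j /= jl Aj]; have ji : j != i by apply: contra il => /eqP <-.
    by exists (exist _ j ji).
  by apply: positively_separated_bigcup => -[j ji]; exact: sep.
apply: (hausdorff_le_superadditive k0 s0 hs (nA i (a i - g) _) (IH ul (S - g) _)).
- by rewrite /g; lra.
- by rewrite -/S /g; lra.
apply: hausdorff_leS hle => [x [Ax|[j jl Aj]]|]; last by rewrite /g; lra.
- by exists i => //=; rewrite mem_head.
- by exists j => //=; rewrite in_cons jl orbT.
Qed.

Lemma ultra_compact_restrict A (P : set T) : ultra_compact d A ->
  (forall u x, (forall n, A (u n) /\ P (u n)) -> A x -> ultra_cvg d u x -> P x) ->
  ultra_compact d (A `&` P).
Proof.
move=> cA closed u hu; have [|x Ax ux] := cA u; first by move=> n; case: (hu n).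
by exists x => //; split=> //; apply: closed ux.
Qed.

Lemma ultra_compact_ball A p (t : R) : ultra_compact d A ->
  ultra_compact d (A `&` [set u | d p u <= t]).
Proof.
move=> cA; apply: ultra_compact_restrict => // u x hu Ax ux /=.
rewrite leNgt; apply/negP => hlt; have e0 : 0 < d p x - t by rewrite subr_gt0.
have [n /= xn] := filter_ex (ux _ e0); have [_ /= pn] := hu n.
by have := dT p (u n) x; lra.
Qed.

Lemma ultra_compact0 : ultra_compact d set0.
Proof. by move=> u /(_ 0%N). Qed.

Lemma ultra_compact1 x : ultra_compact d [set x].
Proof. by move=> u ux; exists x => // e e0; apply: filterE => n /=; rewrite ux d0. Qed.

Lemma ultra_compact_separated A B : ultra_compact d A -> ultra_compact d B ->
  (forall x y, A x -> B y -> d x y <> 0) -> positively_separated A B.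
Proof.
move=> cA cB AB0; apply: contrapT => hn.
have /choice[w hw] n : exists w, [/\ A w.1, B w.2 & d w.1 w.2 < n.+1%:R^-1].
  apply: contrapT => h; apply: hn; exists n.+1%:R^-1; first by rewrite invr_gt0.
  by move=> x y Ax By; rewrite leNgt; apply/negP => hxy; apply: h; exists (x, y).
have [|a Aa ca] := cA (fun n => (w n).1); first by move=> n; case: (hw n).
have [|b Bb cb] := cB (fun n => (w n).2); first by move=> n; case: (hw n).
have dab : 0 < d a b by rewrite lt_neqAle dge0 andbT eq_sym; apply/eqP; exact: AB0.
have e0 : 0 < d a b / 2 by rewrite divr_gt0.
have [n [/= h1 h2]] := filter_ex (filterI (ultra_cvg_dist ca cb e0) (free_ultra_invS_lt e0)).
have [_ _ h3] := hw n; move: h1; rewrite ltr_norml => /andP[h1 _].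
by move: h2 h3 h1; move: (n.+1%:R^-1 : R) => q; lra.
Qed.

Lemma ultra_compact_image (f : T -> T) A (L : R) : 0 < L ->
  (forall x y, A x -> A y -> d (f x) (f y) <= L * d x y) ->
  ultra_compact d A -> ultra_compact d (f @` A).
Proof.
move=> L0 f_lip cA _ /choice2[v Av /funext <-].
have [x Ax vx] := cA v Av; exists (f x); first by exists x.
move=> e e0; apply: filterS (vx _ (divr_gt0 e0 L0)) => n /= hn.
by apply: le_lt_trans (f_lip _ _ (Av n) Ax) _; rewrite mulrC -ltr_pdivlMr.
Qed.

Section Uniqueness.
Hypothesis d_sep : forall x y, d x y = 0 -> x = y.

Lemma dist_gt0 x y : x <> y -> 0 < d x y.
Proof. by move=> xy; rewrite lt_neqAle dge0 andbT eq_sym; apply/eqP => /d_sep. Qed.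

Lemma ultra_cvg_unique u x y : ultra_cvg d u x -> ultra_cvg d u y -> x = y.
Proof.
move=> hx hy; apply: contrapT => /dist_gt0 xy; have e0 : 0 < d x y / 2 by lra.
have [n [/= ux uy]] := filter_ex (filterI (hx _ e0) (hy _ e0)).
by have := dT x (u n) y; rewrite (dC x (u n)); lra.
Qed.

End Uniqueness.

Context (K : set T) (cK : ultra_compact d K).

Lemma ultra_compact_close_pair (u : nat -> T) (e : R) : 0 < e -> (forall n, K (u n)) ->
  exists m n, (m < n)%N /\ d (u m) (u n) < e.
Proof.
move=> e0 Ku; have [x _ hx] := cK Ku; have e2 : 0 < e / 2 by lra.
have [m /= hm] := filter_ex (hx _ e2).
have [n mn /= hn] := free_ultra_ex_ge m.+1 (hx _ e2).
by exists m, n; split=> //; have := dT (u m) x (u n); rewrite (dC x); lra.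
Qed.

Lemma ultra_compact_radii_to0 (u : nat -> T) (r : nat -> R) : (forall n, K (u n)) ->
  (forall m n, (m < n)%N -> r m + r n <= d (u m) (u n)) ->
  forall e : R, 0 < e -> exists n, r n < e.
Proof.
move=> Ku h e e0; have [m [n [mn dmn]]] := ultra_compact_close_pair (addr_gt0 e0 e0) Ku.
have := h m n mn; have [|re] := ltP (r m) e; first by exists m.
by exists n; lra.
Qed.

Lemma finite_net (e : R) : 0 < e -> exists l : seq T,
  (forall x, List.In x l -> K x) /\ forall x, K x -> exists2 y, List.In y l & d x y < e.
Proof.
move=> e0; apply: contrapT => no_net.
pose far l x := (forall y, List.In y l -> K y) -> K x /\ forall y, List.In y l -> e <= d x y.
have /choice_history[u far_u] : forall l, exists x, far l x.
  move=> l; have [lK|nlK] := pselect (forall y, List.In y l -> K y); last first.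
    have [x0 _] : K !=set0; last by exists x0.
    apply: contrapT => K0; apply: no_net; exists [::]; split=> // x Kx.
    by case: K0; exists x.
  apply: contrapT => hl; apply: no_net; exists l; split=> // x Kx.
  apply: contrapT => hx; apply: hl; exists x => _; split=> // y ly.
  by rewrite leNgt; apply/negP => dxy; apply: hx; exists y.
have Ku n : K (u n).
  elim/ltn_ind: n => n IH; have [|//] := far_u n.
  by move=> y /In_mkseq[m mn <-]; exact: IH.
have [m [n [mn]]] := ultra_compact_close_pair e0 Ku; rewrite ltNge => /negP; apply.
have [|_] := far_u n; first by move=> y /In_mkseq[i _ <-].
by rewrite dC; apply; apply/In_mkseq; exists m.
Qed.

Lemma dense_seq x0 : K x0 -> exists D : nat -> T, (forall n, K (D n)) /\
  forall x (e : R), K x -> 0 < e -> exists n, d x (D n) < e.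
Proof.
move=> Kx0; have /choice[l hl] n : exists l : seq T, (forall x, List.In x l -> K x) /\
    forall x, K x -> exists2 y, List.In y l & d x y < n.+1%:R^-1.
  by apply: finite_net; rewrite invr_gt0.
exists (fun m => if pickle_inv m is Some p then List.nth (p : nat * nat).2 (l p.1) x0 else x0).
split=> [m|x e Kx e0].
  case: (pickle_inv m) => // p; have [hp|hp] := List.nth_in_or_default p.2 (l p.1) x0.
    exact: (hl _).1 hp.
  by rewrite hp.
have [n hn] := exists_invS_lt e0; have [y ly dy] := (hl n).2 x Kx.
have [i [_ hi]] := List.In_nth _ _ x0 ly.
by exists (pickle (n, i)); rewrite pickleK_inv /= hi; exact: lt_trans hn.
Qed.

Section Ideal.
Variable J : set (set T).
Hypotheses (J0 : J set0) (JS : forall A B, A `<=` B -> J B -> J A).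
Hypothesis JU : forall A B, J A -> J B -> J (A `|` B).

Definition locally_in_ideal A x := exists2 r : R, 0 < r & J (A `&` [set y | d y x <= r]).

Lemma ideal_of_locally A : A `<=` K ->
  (forall x, K x -> (forall e : R, 0 < e -> exists2 y, A y & d y x < e) ->
     locally_in_ideal A x) -> J A.
Proof.
move=> AK loc.
have [e e0 he] : exists2 e : R, 0 < e & forall x, A x -> J (A `&` [set y | d y x <= e]).
  apply: contrapT => hn.
  have /choice[u hu] n : exists x, A x /\ ~ J (A `&` [set y | d y x <= n.+1%:R^-1]).
    apply: contrapT => h; apply: hn; exists n.+1%:R^-1; first by rewrite invr_gt0.
    by move=> x Ax; apply: contrapT => hJ; apply: h; exists x.
  have [|x Kx ux] := cK (u := u); first by move=> n; apply/AK/(hu n).1.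
  have [e e0|r r0 Jr] := loc x Kx.
    by have [n ?] := filter_ex (ux _ e0); exists (u n) => //; case: (hu n).
  have r2 : 0 < r / 2 by lra.
  have [n [/= uxn inv_n]] := filter_ex (filterI (ux _ r2) (free_ultra_invS_lt r2)).
  have [_] := hu n; apply; apply: JS Jr => y [Ay /= yu]; split => //=.
  apply: le_trans (dT y (u n) x) _; rewrite (splitr r); apply: lerD; last exact: ltW.
  exact: le_trans yu (ltW inv_n).
have e2 : 0 < e / 2 by lra.
have [l [_ lnet]] := finite_net e2.
suff : J (A `&` [set x | exists2 y, List.In y l & d x y < e / 2]).
  by apply: JS => x Ax; split=> //=; apply: lnet; exact: AK.
elim: l {lnet} => [|y l IH]; first by apply: JS J0 => x [_ []].
apply: JS (JU IH (_ : J (A `&` [set x | d x y < e / 2]))) => [x|].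
  by move=> [Ax [z [<-|lz] dz]]; [right|left; split=> //; exists z].
have [[x [Ax dx]]|nx] := pselect (A `&` [set x | d x y < e / 2] !=set0).
  apply: JS (he x Ax) => z [Az /= dz]; split=> //=.
  by have := dT z y x; rewrite (dC y); move: dx => /=; lra.
by apply: JS J0 => x Ax; apply: nx; exists x.
Qed.

Lemma ideal_dichotomy (A : set T) x0 : K x0 -> A `<=` K ->
  (exists2 x, K x & forall e : R, 0 < e -> J (A `&` [set y | e <= d y x])) \/
  exists x1 x2, [/\ K x1, K x2, 0 < d x1 x2,
    ~ locally_in_ideal A x1 & ~ locally_in_ideal A x2].
Proof.
move=> Kx0 AK.
have [?|one_bad] := pselect (exists x1 x2, [/\ K x1, K x2, 0 < d x1 x2,
    ~ locally_in_ideal A x1 & ~ locally_in_ideal A x2]); [by right|left].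
have [x Kx loc] : exists2 x, K x & forall y, K y -> 0 < d y x -> locally_in_ideal A y.
  have [[x [Kx nx]]|no_bad] := pselect (exists x, K x /\ ~ locally_in_ideal A x).
    exists x => // y Ky yx; apply: contrapT => ny.
    by apply: one_bad; exists y, x.
  by exists x0 => // y Ky _; apply: contrapT => ny; apply: no_bad; exists y.
exists x => // e e0; apply: ideal_of_locally => [y [/AK] //|y Ky near].
have [|r r0 Jr] := loc y Ky; last first.
  by exists r => //; apply: JS Jr => z [[Az _] zy]; split.
have [z [_ /= zx] zy] := near _ (divr_gt0 e0 (ltr0n R 2)).
by have := dT z y x; lra.
Qed.

End Ideal.

Context (k : nat) (k0 : (0 < k)%N).

Lemma hausdorff_nonnull_two_points (A : set T) x : ~ hausdorff_null d k A ->
  exists a b, [/\ A a, A b, a <> b, a <> x & b <> x].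
Proof.
move=> nA; have nAx := hausdorff_nonnullD k0 nA (hausdorff_null1 k0 (d0 x)).
have [a [Aa ax]] := hausdorff_nonnull_nonempty k0 nAx.
have [b [[Ab bx] ba]] := hausdorff_nonnull_nonempty k0
  (hausdorff_nonnullD k0 nAx (hausdorff_null1 k0 (d0 a))).
by exists a, b; split=> // ab; apply: ba.
Qed.

Lemma hausdorff_nonnull_away (A : set T) x : (forall y, y <> x -> 0 < d y x) ->
  ~ hausdorff_null d k A ->
  exists2 t : R, 0 < t & ~ hausdorff_null d k (A `&` [set y | t <= d y x]).
Proof.
move=> d_sep nA; apply: contrapT => hn; apply: nA.
apply: (@hausdorff_nullS _ _ _ _ _ ([set x] `|` \bigcup_n (A `&` [set y | n.+1%:R^-1 <= d y x]))).
  move=> y Ay; have [->|/d_sep yx] := pselect (y = x); [by left|right].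
  by have [n hn'] := exists_invS_lt yx; exists n => //; split=> //=; exact: ltW.
apply: hausdorff_nullU => //; first exact: hausdorff_null1.
apply: hausdorff_null_bigcup => // n; apply: contrapT => hA; apply: hn.
by exists n.+1%:R^-1; rewrite ?invr_gt0.
Qed.

Lemma vitali_packing (I : Type) (F : set I) (center : I -> T) (radius : I -> R)
    (A : set T) (B M : R) :
  (forall i, F i -> K (center i)) -> (forall i, F i -> 0 < radius i <= B) ->
  (forall x, A x -> exists2 i, F i & center i = x) -> 0 <= B ->
  ~ cover_sum_le d k A (12 * B) M ->
  exists n (u : 'I_n -> I), [/\ forall i, F (u i),
    forall i j, i != j -> 2 * (radius (u i) + radius (u j)) < d (center (u i)) (center (u j))
    & M < \sum_i (12 * radius (u i)) ^+ k].
Proof.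
move=> FK Frad FA B0 ncov.
pose meet i j := d (center i) (center j) <= 2 * (radius i + radius j).
have [|s [sF s_meet s_max]] := @vitali_selection R I radius F meet B Frad.
  move=> u uF u_meet; apply: (@ultra_compact_radii_to0 (center \o u)) => [n|m n mn].
    exact: FK.
  have /negP := u_meet m n mn; rewrite -ltNge /=.
  by have /andP[? _] := Frad _ (uF m); have /andP[? _] := Frad _ (uF n); lra.
pose r n := oapp radius 0 (s n).
have rB n : 0 <= r n <= B.
  rewrite /r; case E : (s n) => [i|] /=; last by rewrite lexx.
  by have /andP[/ltW -> ->] := Frad _ (sF _ _ E).
have [n hn] : exists n, M < \sum_(i < n) (12 * r i) ^+ k.
  apply: contrapT => hno; apply: ncov.
  exists (fun n => if s n is Some i then [set x | d (center i) x <= 6 * radius i] else set0).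
  exists (fun n => 12 * r n); split.
  - move=> x Ax; have [j Fj <-] := FA x Ax; have [n [i [sn ij ji]]] := s_max j Fj.
    by exists n => //; rewrite sn /=; move: ij; rewrite /meet; lra.
  - by move=> n; have /andP[? ?] := rB n; rewrite mulr_ge0 //= ler_wpM2l.
  - move=> n x y; rewrite /r; case: (s n) => //= i hx hy.
    by have := dT x (center i) y; rewrite (dC x (center i)); lra.
  - by move=> n; rewrite leNgt; apply/negP => h; apply: hno; exists n.
pose D := [pred i : 'I_n | s i].
have /choice[u su] (i : 'I_#|D|) : exists j, s (enum_val i) = Some j.
  by have := enum_valP i; rewrite inE; case: (s _) => // j _; exists j.
exists #|D|, u; split=> [i|i j ij|]; first exact: sF (su i).
- have meetC a b : meet a b -> meet b a by rewrite /meet dC [radius a + _]addrC.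
  have : (enum_val i : nat) != enum_val j.
    by apply: contra ij => /eqP/val_inj/enum_val_inj ->.
  rewrite ltNge neq_ltn => /orP[lt_ij|lt_ji]; apply/negP.
    exact: s_meet lt_ij (su i) (su j).
  by move=> /meetC; exact: s_meet lt_ji (su j) (su i).
apply: lt_le_trans hn _; rewrite (bigID (mem D)) /= [X in _ + X]big1 ?addr0 => [|i].
  rewrite big_enum_val /=; apply: ler_sum => i _.
  by rewrite /r su.
by rewrite inE /r; case: (s i) => //= _; rewrite mulr0 expr0n (gtn_eqF k0).
Qed.

Section Density.
Variables (B Q : set T) (c : R).
Hypotheses (c0 : 0 < c) (fB : hausdorff_finite d k B) (QK : Q `<=` K).
Hypothesis B_off_Q : forall x, B x -> exists2 t : R, 0 < t & forall q, Q q -> t <= d x q.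

Definition thick_points := [set p | Q p /\ forall r0 : R, 0 < r0 -> exists r : R,
  [/\ 0 < r, r < r0 & ~ hausdorff_le d k (B `&` [set x | d x p <= r]) (c * r ^+ k)]].

Definition collar (t : R) := [set x | B x /\ exists2 q, Q q & d x q < t].

Lemma collarS s t : s <= t -> collar s `<=` collar t.
Proof. by move=> st x [Bx [q Qq qs]]; split => //; exists q => //; exact: lt_le_trans st. Qed.

Lemma collar_off (t : R) x : B x -> ~ collar t x -> forall q, Q q -> t <= d x q.
Proof. by move=> Bx nx q Qq; rewrite leNgt; apply/negP => h; apply: nx; split=> //; exists q. Qed.

Lemma collar_separated s t r : s < t ->
  positively_separated (collar r `\` collar t) (collar s).
Proof.
move=> st; exists (t - s); first by rewrite subr_gt0.
move=> x y [[Bx _] nx] [_ [q Qq yq]]; have := collar_off Bx nx Qq.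
by have := dT x y q; lra.
Qed.

Lemma collar_mass : ~ hausdorff_null d k thick_points ->
  exists2 m : R, 0 < m & forall t, 0 < t -> ~ hausdorff_le d k (collar t) m.
Proof.
move=> /(hausdorff_nonnull_cover k0)[e e0 ncov].
have c12 : 0 < c / 12 ^+ k by rewrite divr_gt0 ?exprn_gt0.
exists (c / 12 ^+ k * e / 2); first by rewrite divr_gt0 ?mulr_gt0.
move=> t t0.
pose F := [set i : T * R | [/\ thick_points i.1, 0 < i.2, i.2 < t
  & ~ hausdorff_le d k (B `&` [set x | d x i.1 <= i.2]) (c * i.2 ^+ k)]].
have [|||||n [u [uF u_sep u_sum]]] := @vitali_packing _ F fst snd thick_points t e.
- by move=> i [[/QK]].
- by move=> i [_ -> /ltW ->].
- move=> p p_thick; have [r [r0 rt hr]] := p_thick.2 t t0.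
  by exists (p, r).
- exact: ltW.
- exact: ncov.
have sep i j : i != j -> positively_separated
    (B `&` [set x | d x (u i).1 <= (u i).2]) (B `&` [set x | d x (u j).1 <= (u j).2]).
  move=> /u_sep uij; have [_ ? _ _] := uF i; have [_ ? _ _] := uF j.
  exists ((u i).2 + (u j).2); first exact: addr_gt0.
  move=> x y [_ /= xi] [_ /= yj]; have := dT (u i).1 x (u j).1; have := dT x y (u j).1.
  by rewrite (dC (u i).1 x); lra.
have mass i b : b < c * (u i).2 ^+ k ->
    ~ hausdorff_le d k (B `&` [set x | d x (u i).1 <= (u i).2]) b.
  move=> hb; have [_ _ _] := uF i; apply: contra_not; apply: hausdorff_leS => //.
  exact: ltW.
apply: contra_not (hausdorff_le_superadditive_sum k0 sep mass (b := c / 12 ^+ k * e / 2) _).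
  apply: hausdorff_leS => // x [i _ [Bx /= xi]]; split=> //.
  by have [[Qi _] _ it _] := uF i; exists (u i).1 => //; exact: le_lt_trans it.
have -> : \sum_i c * (u i).2 ^+ k = c / 12 ^+ k * \sum_i (12 * (u i).2) ^+ k.
  rewrite mulr_sumr; apply: eq_bigr => i _; rewrite exprMn mulrA divfK //.
have := ltr_pM2l c12 e (\sum_i (12 * (u i).2) ^+ k); rewrite u_sum.
by have := mulr_gt0 c12 e0; lra.
Qed.

Definition shell (t : R) n := collar (t / 2 ^+ n) `\` collar (t / 2 ^+ n.+1).

Lemma shell_union (t : R) : 0 < t -> collar t `<=` \bigcup_n shell t n.
Proof.
move=> t0 x xt; have [s s0 hs] := B_off_Q xt.1.
have [N hN] : exists N, ~ collar (t / 2 ^+ N) x.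
  have [N hN] := exists_invS_lt (divr_gt0 s0 t0); exists N => -[_ [q /hs sq qN]].
  suff : t / 2 ^+ N < s by lra.
  rewrite -ltr_pdivlMl // mulrC; apply: le_lt_trans hN.
  by rewrite lef_pV2 ?posrE ?exprn_gt0 // -natrX ler_nat; exact: ltn_expl.
elim: N hN => [|N IH hN]; first by rewrite expr0 divr1.
by have [xN|/IH] := pselect (collar (t / 2 ^+ N) x); [exists N|].
Qed.

Lemma half_expn_ler (t : R) m n : 0 < t -> (m <= n)%N -> t / 2 ^+ n <= t / 2 ^+ m.
Proof.
move=> t0 mn; rewrite ler_pM2l // lef_pV2 ?posrE ?exprn_gt0 //.
by rewrite ler_eXn2l // ltr1n.
Qed.

(* Shells whose indices have the same parity are positively separated. *)
Lemma shell_parity_mass (t M : R) (p : nat) : 0 < t ->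
  (forall s : R, 0 < s -> s < t -> hausdorff_le d k (collar t `\` collar s) M) ->
  hausdorff_le d k (\bigcup_n shell t (n.*2 + p)) M.
Proof.
move=> t0 hM.
have /choice2[a ha a_min] n : exists2 a, hausdorff_le d k (shell t (n.*2 + p)) a
    & forall b, b < a -> ~ hausdorff_le d k (shell t (n.*2 + p)) b.
  apply: hausdorff_finite_least; apply: hausdorff_finiteS fB.
  by move=> x [[]].
apply: (hausdorff_le_bigcup k0 ha) => n; rewrite leNgt; apply/negP => hlt.
have sep : forall i j : 'I_n, i != j ->
    positively_separated (shell t (i.*2 + p)) (shell t (j.*2 + p)).
  apply: (positively_separated_ord (A := fun i : 'I_n => shell t (i.*2 + p))) => i j ij.
  apply: (@positively_separatedS _ (shell t (i.*2 + p)) _ (collar (t / 2 ^+ (j.*2 + p)))) => //.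
    by move=> x [].
  apply: collar_separated; apply: (@le_lt_trans _ _ (t / 2 ^+ (i.*2 + p).+2)).
    by apply: half_expn_ler => //; rewrite -!addSn -doubleS leq_add2r leq_double.
  have : 0 < t / 2 ^+ (i.*2 + p).+1 by rewrite divr_gt0 ?exprn_gt0.
  by rewrite [2 ^+ _.+2]exprS invfM mulrA mulrAC; lra.
apply: (hausdorff_le_superadditive_sum k0 sep (fun i => a_min i) hlt).
have lt1 : t / 2 ^+ (n.*2 + p).+1 < t.
  by rewrite ltr_pdivrMr ?exprn_gt0 // ltr_pMr // exprn_egt1 ?ltr1n.
apply: hausdorff_leS (hM _ _ lt1) => //; last by rewrite divr_gt0 ?exprn_gt0.
move=> x [i _ [xi nxi]]; split.
  by apply: collarS xi; rewrite -{2}[t]divr1 -(expr0 2); exact: half_expn_ler.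
apply: contra_not nxi; apply/collarS/half_expn_ler => //.
by rewrite ltnS leq_add2r leq_double; exact/ltnW.
Qed.

Lemma annulus_mass (m : R) : (forall t, 0 < t -> ~ hausdorff_le d k (collar t) m) ->
  forall t, 0 < t -> exists s : R,
    [/\ 0 < s, s < t & ~ hausdorff_le d k (collar t `\` collar s) (m / 2)].
Proof.
move=> hm t t0; apply: contrapT => hn; apply: (hm t t0).
have half p : hausdorff_le d k (\bigcup_n shell t (n.*2 + p)) (m / 2).
  apply: shell_parity_mass => // s s0 st; apply: contrapT => h.
  by apply: hn; exists s.
rewrite [m]splitr; apply: hausdorff_leS (hausdorff_leU k0 (half 0%N) (half 1%N)) => //.
move=> x /(shell_union t0)[n _ xn].
have [on|en] := boolP (odd n); [right|left]; exists n./2 => //.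
  by rewrite addn1 halfK on subn1 prednK ?odd_gt0.
by rewrite addn0 even_halfK.
Qed.

(* Lebesgue density: were the thick points not null, infinitely many separated
   annuli around [Q] would each carry a definite part of the mass of [B]. *)
Lemma hausdorff_density : hausdorff_null d k thick_points.
Proof.
apply: contrapT => /collar_mass[m m0 /annulus_mass annulus].
have /choice[next hnext] (t : R) : exists s : R, 0 < t ->
    [/\ 0 < s, s < t & ~ hausdorff_le d k (collar t `\` collar s) (m / 2)].
  by have [/annulus[s h]|h] := pselect (0 < t); [exists s|exists 0 => /h].
pose t n := iter n (fun s : R => next s / 2) 1.
have t0 n : 0 < t n.
  by elim: n => [|n IH] //=; rewrite divr_gt0 //; case: (hnext _ IH).
have tS i n : (i < n)%N -> t n <= next (t i) / 2.
  elim: n => // n IH; rewrite ltnS leq_eqVlt => /orP[/eqP -> //|/IH h].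
  by apply: le_trans h; have [] := hnext _ (t0 n); have := t0 n; rewrite [t n.+1]/=; lra.
have [M hM] := fB; have m2 : 0 < m / 2 by lra.
pose n := (Num.truncn (M / (m / 2))).+1.
have lt_M : M < \sum_(i < n) m / 2.
  by rewrite sumr_const card_ord -[_ *+ n]mulr_natl -ltr_pdivrMr //; exact: truncnS_gt.
have sep : forall i j : 'I_n, i != j -> positively_separated
    (collar (t i) `\` collar (next (t i))) (collar (t j) `\` collar (next (t j))).
  apply: (positively_separated_ord
    (A := fun i : 'I_n => collar (t i) `\` collar (next (t i)))) => i j ij.
  apply: (@positively_separatedS _ (collar (t i) `\` collar (next (t i))) _ (collar (t j))) => //.
  by apply: collar_separated; have := tS _ _ ij; have [? _ _] := hnext _ (t0 i); lra.
apply: (hausdorff_le_superadditive_sum k0 sep _ lt_M) => [i b hb|].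
  have [_ _] := hnext _ (t0 i); apply: contra_not.
  by apply: hausdorff_leS => //; exact: ltW.
by apply: hausdorff_leS hM => // x [i _ [[]]].
Qed.

End Density.

End Metric.
End Ultra.

(** * Self-similar trees and iterated function systems *)

Definition hausdorff_dim_le (R : realType) (T : Type) (d : T -> T -> R) (A : set T) (k : nat) :=
  forall s : R, k%:R < s -> forall e : R, 0 < e ->
  exists (V : nat -> set T) (r : nat -> R), [/\ A `<=` \bigcup_i V i,
    forall i, 0 <= r i, forall i x y, V i x -> V i y -> d x y <= r i
    & forall n, \sum_(i < n) r i `^ s <= e].

Lemma hausdorff_dim_leS (R : realType) (T : Type) (d : T -> T -> R) (A B : set T) k :
  A `<=` B -> hausdorff_dim_le d B k -> hausdorff_dim_le d A k.
Proof.
move=> AB dimB s ks e e0; have [V [r [cov r0 Vd rs]]] := dimB s ks e e0.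
by exists V, r; split=> //; exact: subset_trans cov.
Qed.

Definition word_map (T I : Type) (f : I -> T -> T) (w : seq I) (x : T) := foldr f x w.

Section TreeSum.
Context {R : realType} (T : Type) (d : T -> T -> R) (I : finType).
Context (f : I -> T -> T) (r : I -> R) (B : set T) (x0 : T) (sep s rho : R).
Hypotheses (Bx0 : B x0) (fB : forall i x, B x -> B (f i x)).
Hypothesis f_expand : forall i x y, B x -> B y -> r i * d x y <= d (f i x) (f i y).
Hypothesis sep0 : 0 < sep.
Hypothesis f_sep : forall i j x y, i != j -> B x -> B y -> sep <= d (f i x) (f j y).
Hypotheses (r_bounds : forall i, 0 < r i <= rho) (s0 : 0 < s).
Hypothesis sum_r : 1 <= \sum_i r i `^ s.

Let point w := word_map f w x0.

Lemma word_map_base w : B (point w).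
Proof. by elim: w => //= i w; exact: fB. Qed.

Definition tree_cost n (a : R) := (Num.max (a / sep) (rho ^+ n)) `^ s.

Lemma tree_cost_ge0 n a : 0 <= tree_cost n a.
Proof. exact: powR_ge0. Qed.

Lemma tree_cost_ge1 n a : 1 <= Num.max (a / sep) (rho ^+ n) -> 1 <= tree_cost n a.
Proof.
have p1 : (1 : R) `^ s = 1 by rewrite powR1.
move=> h; rewrite -[leLHS]p1; apply: ge0_ler_powR; rewrite ?nnegrE ?(ltW s0) //.
exact: le_trans h.
Qed.

Lemma tree_costS i n a : 0 <= a -> r i `^ s * tree_cost n (a / r i) <= tree_cost n.+1 a.
Proof.
move=> a0; have /andP[ri0 ri_rho] := r_bounds i.
have h0 : 0 <= Num.max (a / r i / sep) (rho ^+ n) by rewrite le_max !divr_ge0 // ltW.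
rewrite -powRM //; last exact: ltW.
apply: ge0_ler_powR; rewrite ?nnegrE ?(ltW s0) //.
- by rewrite mulr_ge0 // ltW.
- by rewrite le_max divr_ge0 // ltW.
rewrite maxr_pMr ?(ltW ri0) // ge_max !le_max; apply/andP; split; apply/orP.
  by left; rewrite mulrAC mulrCA mulfV ?mulr1 ?lt0r_neq0.
right; rewrite exprS ler_wpM2r // exprn_ge0 //; apply: le_trans ri_rho; exact: ltW.
Qed.

(* Each covering set either separates two first-level branches, and is then
   large, or touches a single branch. *)
Lemma tree_sum_ge1 n J (V : 'I_J -> set T) (a : 'I_J -> R) (P : pred 'I_J) :
  (forall j, 0 <= a j) -> (forall j x y, V j x -> V j y -> d x y <= a j) ->
  (forall w : seq I, size w = n -> exists2 j, P j & V j (point w)) ->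
  1 <= \sum_(j | P j) tree_cost n (a j).
Proof.
elim: n J V a P => [|n IH] J V a P a0 Va cov.
  have [j Pj _] := cov [::] erefl; apply: le_trans (ler_sum_term _ Pj) => [|i].
    by apply: tree_cost_ge1; rewrite le_max expr0 lexx orbT.
  exact: tree_cost_ge0.
pose touch i j := `[< exists2 w, size w = n & V j (f i (point w)) >].
have [[j [i [i' [Pj ii' /asboolP[w _ hw] /asboolP[w' _ hw']]]]]|no_straddle] :=
  pselect (exists j i i', [/\ P j, i != i', touch i j & touch i' j]).
  apply: le_trans (ler_sum_term _ Pj) => [|i0]; last exact: tree_cost_ge0.
  apply: tree_cost_ge1; rewrite le_max ler_pdivlMr // mul1r; apply/orP; left.
  exact: le_trans (f_sep ii' (word_map_base w) (word_map_base w')) (Va _ _ _ hw hw').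
have branch i : r i `^ s <= \sum_(j | P j && touch i j) tree_cost n.+1 (a j).
  have /andP[ri0 _] := r_bounds i.
  pose V' j := [set x | B x /\ V j (f i x)].
  have h : 1 <= \sum_(j | P j && touch i j) tree_cost n (a j / r i).
    apply: (IH J V') => [j|j x y [Bx Vx] [By Vy]|w sw].
    - by rewrite divr_ge0 // ltW.
    - by rewrite ler_pdivlMr // mulrC; apply: le_trans (f_expand _ Bx By) (Va _ _ _ Vx Vy).
    - have [|j Pj Vj] := cov (i :: w); first by rewrite /= sw.
      exists j; last by split=> //; exact: word_map_base.
      by rewrite Pj; apply/asboolP; exists w.
  apply: le_trans (ler_peMr (powR_ge0 _ _) h) _; rewrite mulr_sumr.
  by apply: ler_sum => j _; exact: tree_costS.
apply: le_trans sum_r (le_trans (ler_sum _ (fun i _ => branch i)) _).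
rewrite (exchange_big_dep P) /=; last by move=> i j _ /andP[].
apply: ler_sum => j Pj; rewrite Pj /=.
have [[i ti]|ni] := pselect (exists i, touch i j); last first.
  by rewrite big1 ?tree_cost_ge0 // => i ti; case: ni; exists i; exact: ti.
rewrite (bigD1 i) //= big1 ?addr0 // => i' /andP[ti' ii'].
by case: no_straddle; exists j, i', i.
Qed.

Lemma tree_cost_le n a : 1 <= s -> 0 < rho <= 1 -> 0 <= a ->
  tree_cost n a <= a `^ s / sep `^ s + rho ^+ n.
Proof.
move=> s1 /andP[rho0 rho1] a0; have sep_s : 0 < sep `^ s by rewrite powR_gt0.
rewrite /tree_cost maxEle; case: ifP => _.
  rewrite -[leLHS]add0r lerD ?divr_ge0 ?powR_ge0 // ge1r_powR //.
  by rewrite exprn_gt0 // exprn_ile1 // ltW.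
rewrite [X in X <= _](_ : _ = a `^ s / sep `^ s) ?lerDl ?exprn_ge0 ?(ltW rho0) //.
apply: (mulIf (lt0r_neq0 sep_s)); rewrite divfK ?lt0r_neq0 //.
by rewrite -powRM ?divr_ge0 ?(ltW sep0) // divfK ?lt0r_neq0.
Qed.

End TreeSum.

Lemma exists_gt_sum_powR_ge1 (R : realType) (I : finType) (r : I -> R) (k : nat) :
  (forall i, 0 < r i) -> 2 <= \sum_i r i ^+ k ->
  exists2 s : R, k%:R < s & 1 <= \sum_i r i `^ s.
Proof.
move=> r0 sum_r; pose rmin := \big[Num.min/1]_i r i.
have rmin0 : 0 < rmin by apply: lt_bigmin => // i _; exact: r0.
have [p hp] := half_expn_small rmin0.
have half_r i : (1 / 2) ^+ p.+1 <= r i.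
  by apply: le_trans (ltW (hp p.+1 (leqnSn p))) _; exact: bigmin_le_cond.
exists (k%:R + p.+1%:R^-1); first by rewrite ltrDl invr_gt0.
apply: (@le_trans _ _ (\sum_i r i ^+ k / 2)); first by rewrite -mulr_suml; lra.
apply: ler_sum => i _; rewrite powRD; last by apply/implyP => _; rewrite lt0r_neq0.
rewrite powR_mulrn ?(ltW (r0 i)) //; apply: ler_wpM2l; first by rewrite exprn_ge0 // ltW.
have -> : 2^-1 = ((1 / 2) ^+ p.+1) `^ p.+1%:R^-1 :> R.
  rewrite -powR_mulrn; last lra.
  by rewrite -powRrM mulfV ?pnatr_eq0 // powRr1 ?div1r ?invr_ge0.
by apply: ge0_ler_powR; rewrite ?nnegrE ?invr_ge0 ?(ltW (r0 i)) ?exprn_ge0 //; lra.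
Qed.

Lemma cover_sum_enlarge (R : realType) (r : nat -> R) (s e : R) : 0 < s -> 0 < e ->
  (forall j, 0 <= r j) -> (forall n, \sum_(j < n) r j `^ s <= e) ->
  exists2 a : nat -> R, forall j, r j < a j & forall n, \sum_(j < n) a j `^ s <= 2 * e.
Proof.
move=> s0 e0 r0 rs; pose a j := (r j `^ s + e / 2 ^+ j.+1) `^ s^-1.
have ej j : 0 < e / 2 ^+ j.+1 by rewrite divr_gt0 // exprn_gt0.
exists a => [j|n].
  rewrite -(powRr1 (r0 j)) -(mulfV (lt0r_neq0 s0)) powRrM /a.
  by apply: gt0_ltr_powR; rewrite ?nnegrE ?invr_gt0 ?addr_ge0 ?powR_ge0 ?ltrDl // ltW.
have as_ j : a j `^ s = r j `^ s + e / 2 ^+ j.+1.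
  by rewrite /a -powRrM mulVf ?lt0r_neq0 // powRr1 // addr_ge0 ?powR_ge0 // ltW.
under eq_bigr do rewrite as_; rewrite big_split /= (_ : 2 * e = e + e); last by lra.
by apply: lerD; [exact: rs|apply: sum_half_expn_le; exact: ltW].
Qed.

Section IteratedFunctionSystem.
Context {R : realType} (U : set_system nat) {uU : FreeUltraFilter U}.
Context (T : Type) (d : T -> T -> R) (pd : pseudometric d).
Hypothesis d_sep : forall x y, d x y = 0 -> x = y.
Let dC x y : d x y = d y x. Proof. by case: pd. Qed.
Let dT x y z : d x z <= d x y + d y z. Proof. by case: pd. Qed.
Let dge0 := pseudometric_ge0 pd.

Context (I : finType) (f : I -> T -> T) (B : set T).
Hypotheses (cB : ultra_compact U d B) (fB : forall i x, B x -> B (f i x)).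
Hypothesis f_contract : forall i x y, B x -> B y -> d (f i x) (f i y) <= d x y / 2.

Definition cylinders n := [set x | exists w b, [/\ size w = n, B b & x = word_map f w b]].

Definition attractor := \bigcap_n cylinders n.

Lemma word_map_stable w x : B x -> B (word_map f w x).
Proof. by move=> Bx; elim: w => //= i w; exact: fB. Qed.

Lemma word_map_contract w x y : B x -> B y ->
  d (word_map f w x) (word_map f w y) <= (1 / 2) ^+ size w * d x y.
Proof.
move=> Bx By; elim: w => [|i w IH] /=; first by rewrite expr0 mul1r.
apply: le_trans (f_contract i (word_map_stable w Bx) (word_map_stable w By)) _.
by rewrite exprS; move: IH; rewrite /word_map; lra.
Qed.

Lemma cylinders_mono m n : (m <= n)%N -> cylinders n `<=` cylinders m.
Proof.
have cylS n' : cylinders n'.+1 `<=` cylinders n'.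
  move=> x [w [b [sw Bb ->]]]; case/lastP: w sw => // w i; rewrite size_rcons => -[sw].
  by exists w, (f i b); split; rewrite ?/word_map ?foldr_rcons //; exact: fB.
elim: n => [|n IH]; first by rewrite leqn0 => /eqP ->.
by rewrite leq_eqVlt => /orP[/eqP -> //|mn]; apply: subset_trans (IH mn).
Qed.

Lemma cylinders_sub n : cylinders n `<=` B.
Proof. by move=> x [w [b [_ Bb ->]]]; exact: word_map_stable. Qed.

Lemma attractor_limit u x : (forall n, cylinders n (u n)) -> ultra_cvg U d u x -> attractor x.
Proof.
move=> cyl_u ux n _; pose P (w : n.-tuple I) m := exists2 b, B b & u m = word_map f w b.
have [w Pw] : exists w, U [set m | P w m].
  apply: ultra_exists; apply: filterS (free_ultra_ge n) => m /= nm.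
  have [w [b [sw Bb E]]] := cylinders_mono nm (cyl_u m).
  by move/eqP in sw; exists (Tuple sw), b.
have [b0 Bb0] : B !=set0 by have [m [b Bb _]] := filter_ex Pw; exists b.
have /choice2[b Bb ub] m : exists2 b, B b & P w m -> u m = word_map f w b.
  by have [[b Bb E]|nP] := pselect (P w m); [exists b|exists b0].
have [y By yb] := cB Bb.
exists w, y; split; rewrite ?size_tuple //; apply: (ultra_cvg_unique pd d_sep ux) => e e0.
apply: filterS (filterI Pw (yb _ e0)) => m [/= Pm hm]; rewrite (ub m Pm).
apply: le_lt_trans (word_map_contract _ (Bb m) By) _; apply: le_lt_trans hm.
by rewrite ler_piMl // exprn_ile1 //; lra.
Qed.

Lemma attractor_finite_cover (V : nat -> set T) (e : nat -> R) : (forall j, 0 < e j) ->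
  attractor `<=` \bigcup_j V j -> exists n, cylinders n `<=`
    [set x | exists2 j, (j < n)%N & exists2 y, V j y & d x y < e j].
Proof.
move=> e0 cov; apply: contrapT => hn.
have /choice2[u cyl_u out_u] n : exists2 x, cylinders n x &
    ~ exists2 j, (j < n)%N & exists2 y, V j y & d x y < e j.
  apply: contrapT => h; apply: hn; exists n => x cyl_x.
  by apply: contrapT => hx; apply: h; exists x.
have [x Bx ux] := cB (fun n => cylinders_sub (cyl_u n)).
have [j _ Vj] := cov x (attractor_limit cyl_u ux).
have [n jn /= hn1] := free_ultra_ex_ge j.+1 (ux _ (e0 j)).
by apply: (out_u n); exists j => //; exists x.
Qed.

Hypothesis f_disjoint : forall i j x y, i != j -> B x -> B y -> f i x <> f j y.

Lemma ifs_separated : exists2 sep : R, 0 < sep &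
  forall i j x y, i != j -> B x -> B y -> sep <= d (f i x) (f j y).
Proof.
have cfB i : ultra_compact U d (f i @` B).
  by apply: (ultra_compact_image (L := 1 / 2)) => // x y Bx By; have := f_contract i Bx By; lra.
have /choice2[s s0 hs] (ij : I * I) : exists2 s : R, 0 < s & ij.1 != ij.2 ->
    forall x y, B x -> B y -> s <= d (f ij.1 x) (f ij.2 y).
  case: ij => i j /=; have [_|ij] := eqVneq i j; first by exists 1.
  have [|s s0 hs] := ultra_compact_separated pd (cfB i) (cfB j); last first.
    by exists s => // _ x y Bx By; apply: hs; [exists x|exists y].
  by move=> _ _ [x Bx <-] [y By <-] /d_sep; exact: f_disjoint.
exists (\big[Num.min/1]_ij s ij); first by apply: lt_bigmin.
move=> i j x y ij Bx By; apply: le_trans (hs (i, j) ij x y Bx By).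
exact: bigmin_le_cond.
Qed.

Context (r : I -> R).
Hypothesis r0 : forall i, 0 < r i.
Hypothesis f_expand : forall i x y, B x -> B y -> r i * d x y <= d (f i x) (f i y).
Hypothesis B_two_points : exists x y, [/\ B x, B y & x <> y].

Lemma attractor_dim_gt k : (0 < k)%N -> 2 <= \sum_i r i ^+ k ->
  ~ hausdorff_dim_le d attractor k.
Proof.
move=> k0 sum_r dimA; have [b0 [b1 [Bb0 Bb1 b01]]] := B_two_points.
have r_half i : 0 < r i <= 1 / 2.
  rewrite r0 /= -(ler_pM2r (dist_gt0 pd d_sep b01)) mul1r [leRHS]mulrC.
  exact: le_trans (f_expand i Bb0 Bb1) (f_contract i Bb0 Bb1).
have [s ks sum_rs] := exists_gt_sum_powR_ge1 r0 sum_r.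
have s1 : 1 <= s by apply: ltW; apply: le_lt_trans ks; rewrite ler1n.
have s0 : 0 < s by exact: lt_le_trans ltr01 s1.
have [sep sep0 f_sep] := ifs_separated.
have sep_s : 0 < sep `^ s by rewrite powR_gt0.
pose e := sep `^ s / 8; have e0 : 0 < e by rewrite divr_gt0.
have [V [a [Vcov a0 Va as_]]] := dimA s ks e e0.
have [b ab bs] := cover_sum_enlarge s0 e0 a0 as_.
have b0' j : 0 <= b j by exact: le_trans (ltW (ab j)).
have [|N hN] := attractor_finite_cover (e := fun j => (b j - a j) / 2) _ Vcov.
  by move=> j; rewrite divr_gt0 // subr_gt0.
have [n0 hn0] := half_expn_small (divr_gt0 ltr01 (ltr0Sn R N.*2)).
pose n := maxn N n0.
have small_n : N%:R * (1 / 2) ^+ n <= 1 / 2 :> R.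
  apply: (@le_trans _ _ (N%:R * (1 / N.*2.+1%:R))).
    by rewrite ler_wpM2l // ltW // hn0 // leq_maxr.
  rewrite mulrA mulr1 ler_pdivrMr ?ltr0Sn // mulrC mulrA ler_pdivlMr // mulr1.
  by rewrite -natrM ler_nat muln2 leqnSn.
pose W (j : 'I_N) := [set x | exists2 y, V j y & d x y < (b j - a j) / 2].
have : 1 <= \sum_(j < N) tree_cost sep s (1 / 2) n (b j).
  apply: (@tree_sum_ge1 R T d I f r B b0 sep s (1 / 2) Bb0 fB f_expand sep0 f_sep
    r_half s0 sum_rs n N W (fun j => b j) xpredT) => // [j x y|w sw].
    move=> [x' Vx' hx] [y' Vy' hy]; have := Va _ _ _ Vx' Vy'; have := dT x x' y.
    by have := dT x' y' y; rewrite (dC y' y); lra.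
  have [|j jn Wj] := hN (word_map f w b0); last by exists (Ordinal jn).
  by apply: (cylinders_mono (leq_maxl N n0)); exists w, b0.
rewrite leNgt => /negP; apply.
apply: (@le_lt_trans _ _ (\sum_(j < N) (b j `^ s / sep `^ s + (1 / 2) ^+ n))).
  by apply: ler_sum => j _; apply: tree_cost_le => //; apply/andP; split; lra.
rewrite big_split /= -mulr_suml sumr_const card_ord -[_ *+ N]mulr_natl.
have : (\sum_(j < N) b j `^ s) / sep `^ s <= 2 * e / sep `^ s.
  by rewrite ler_wpM2r ?invr_ge0 ?(ltW sep_s).
have -> : 2 * e / sep `^ s = 1 / 4 by rewrite /e; field; rewrite lt0r_neq0.
by move=> h; lra.
Qed.

End IteratedFunctionSystem.

(** * Zooms *)

(* [g] and [h] are inverse bijections of [K]; in the application [m u] is the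
   chordal distance from [u] to the image of the origin under the Poincaré
   extension of [g], and [kap] is comparable to the height of that image. *)
Record zoom_map (R : realType) (T : Type) (d : T -> T -> R) (K : set T) (c0 : R)
    (g h : T -> T) (kap : R) (m : T -> R) : Prop := ZoomMap {
  zoom_fwd : forall u, K u -> K (g u);
  zoom_bwd : forall u, K u -> K (h u);
  zoom_bwdK : forall u, K u -> g (h u) = u;
  zoom_fwdK : forall u, K u -> h (g u) = u;
  zoom_scale_gt0 : 0 < kap;
  zoom_pole_le2 : forall u, K u -> m u <= 2;
  zoom_scale_le_pole : forall u, K u -> kap <= c0 * m u;
  zoom_dist_le_poles : forall u v, K u -> K v -> d u v <= m u + m v;
  zoom_pole_lip : forall u v, K u -> K v -> m u <= m v + d u v;
  zoom_conformal_bwd : forall u v, K u -> K v ->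
    d (h u) (h v) * (m u * m v) = kap * d u v }.

Record zoom_system (R : realType) (T : Type) (d : T -> T -> R) (K : set T) (c0 : R)
    (Z : (T -> T) -> (T -> T) -> R -> (T -> R) -> Prop) : Prop := ZoomSystem {
  zoom_system_map : forall g h kap m, Z g h kap m -> zoom_map d K c0 g h kap m;
  zoom_system_comp : forall g h kap m g' h' kap' m',
    Z g h kap m -> Z g' h' kap' m' -> exists kap'' m'', Z (g \o g') (h' \o h) kap'' m'';
  zoom_system_near : forall x (e : R), K x -> 0 < e ->
    exists g h kap m, [/\ Z g h kap m, kap < e & m x < e] }.

Section ZoomMap.
Context {R : realType} (T : Type) (d : T -> T -> R) (pd : pseudometric d).
Hypothesis d_le2 : forall x y, d x y <= 2.
Context (K : set T) (c0 : R) (c00 : 0 < c0) (g h : T -> T) (kap : R) (m : T -> R).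
Hypothesis z : zoom_map d K c0 g h kap m.
Let dge0 := pseudometric_ge0 pd.
Let kap0 := zoom_scale_gt0 z.

Lemma zoom_pole_gt0 u : K u -> 0 < m u.
Proof.
by move=> Ku; rewrite -(pmulr_rgt0 _ c00); exact: lt_le_trans (zoom_scale_le_pole z Ku).
Qed.

Lemma zoom_conformal_fwd u v : K u -> K v ->
  d u v * (m (g u) * m (g v)) = kap * d (g u) (g v).
Proof.
move=> Ku Kv; have := zoom_conformal_bwd z (zoom_fwd z Ku) (zoom_fwd z Kv).
by rewrite !(zoom_fwdK z).
Qed.

Lemma zoom_expand u v : K u -> K v -> kap / c0 ^+ 2 * d u v <= d (g u) (g v).
Proof.
move=> Ku Kv; have pole_ge w : K w -> kap / c0 <= m w.
  by move=> Kw; rewrite ler_pdivrMr // mulrC; exact: zoom_scale_le_pole z _ Kw.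
rewrite -(ler_pM2l kap0) -(zoom_conformal_fwd Ku Kv).
have -> : kap * (kap / c0 ^+ 2 * d u v) = d u v * ((kap / c0) * (kap / c0)).
  by rewrite expr2 invfM; ring.
apply: ler_wpM2l => //; have kc : 0 <= kap / c0 by rewrite divr_ge0 ?ltW.
by apply: ler_pM => //; apply/pole_ge/(zoom_fwd z).
Qed.

Lemma zoom_bwd_lip u v : K u -> K v -> d (h u) (h v) <= c0 ^+ 2 / kap * d u v.
Proof.
move=> Ku Kv; have := zoom_expand (zoom_bwd z Ku) (zoom_bwd z Kv).
rewrite !(zoom_bwdK z) // => huv; rewrite mulrAC ler_pdivlMr // mulrC.
rewrite -ler_pdivrMl ?exprn_gt0 //; apply: le_trans huv.
by rewrite mulrA [_ * kap]mulrC.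
Qed.

Lemma zoom_lip u v : K u -> K v -> d (g u) (g v) <= 4 / kap * d u v.
Proof.
move=> Ku Kv; rewrite -(ler_pM2l kap0) -(zoom_conformal_fwd Ku Kv).
have -> : kap * (4 / kap * d u v) = d u v * (2 * 2) by field; rewrite lt0r_neq0.
apply: ler_wpM2l => //; have Kg := zoom_fwd z.
by apply: ler_pM; rewrite ?(zoom_pole_le2 z) ?ltW ?zoom_pole_gt0 //; exact: Kg.
Qed.

Lemma zoom_pole_product_le (et : R) u v : K u -> K v -> et <= d (h u) (h v) ->
  et * (m u * m v) <= 2 * kap.
Proof.
move=> Ku Kv huv; apply: (@le_trans _ _ (d (h u) (h v) * (m u * m v))).
  by rewrite ler_wpM2r // mulr_ge0 ?ltW ?zoom_pole_gt0.
by rewrite (zoom_conformal_bwd z Ku Kv) mulrC ler_wpM2r // ltW.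
Qed.

Lemma zoom_pole_le (et D : R) u v : K u -> K v -> 0 < et -> et <= d (h u) (h v) ->
  0 < D -> D / 2 <= m v -> m u <= 4 * kap / (et * D).
Proof.
move=> Ku Kv et0 huv D0 mv; rewrite ler_pdivlMr ?mulr_gt0 //.
have := zoom_pole_product_le Ku Kv huv.
have : et * (m u * (D / 2)) <= et * (m u * m v).
  by rewrite !ler_wpM2l // ltW // zoom_pole_gt0.
lra.
Qed.

Lemma zoom_pole_fwd_le (et : R) p q u : K p -> K q -> K u -> 2 * m p <= d q p ->
  0 < d q p -> 0 < et -> et <= d u (h q) -> m (g u) <= 4 * kap / (et * d q p).
Proof.
move=> Kp Kq Ku mp qp et0 hu; apply: (zoom_pole_le (zoom_fwd z Ku) Kq et0 _ qp).
  by rewrite (zoom_fwdK z Ku).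
by have := zoom_dist_le_poles z Kq Kp; lra.
Qed.

Lemma zoom_near (C et : R) p q u : K p -> K q -> K u -> m p < C * kap ->
  2 * m p <= d q p -> 0 < d q p -> 0 < et -> et <= d u (h q) ->
  d (g u) p <= (C + 4 / (et * d q p)) * kap.
Proof.
move=> Kp Kq Ku hm small qp et0 far.
have := zoom_pole_fwd_le Kp Kq Ku small qp et0 far.
have := zoom_dist_le_poles z (zoom_fwd z Ku) Kp.
have -> : 4 * kap / (et * d q p) = 4 / (et * d q p) * kap by ring.
lra.
Qed.

Lemma zoom_conformal_factor : exists2 om : T -> R, forall x, K x -> 0 < om x &
  forall x y, K x -> K y -> d (g x) (g y) = om x * om y * d x y.
Proof.
have sq : Num.sqrt kap^-1 ^+ 2 = kap^-1 by rewrite sqr_sqrtr // invr_ge0 ltW.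
have sq0 : 0 < Num.sqrt kap^-1 by rewrite sqrtr_gt0 invr_gt0.
exists (fun x => Num.sqrt kap^-1 * m (g x)) => [x Kx|x y Kx Ky].
  exact: mulr_gt0 sq0 (zoom_pole_gt0 (zoom_fwd z Kx)).
rewrite [RHS](_ : _ = Num.sqrt kap^-1 ^+ 2 * (d x y * (m (g x) * m (g y)))); last by ring.
by rewrite sq zoom_conformal_fwd // mulKf // lt0r_neq0.
Qed.

Lemma zoom_ball (C : R) p v : K p -> K v -> 0 < C -> m p < C * kap ->
  d v (h p) <= 1 / (2 * C) -> d (g v) p <= C * kap /\ m (g v) <= 2 * C * kap.
Proof.
move=> Kp Kv C0 hm hv; have Kg := zoom_fwd z Kv.
have := zoom_conformal_bwd z Kg Kp; rewrite (zoom_fwdK z Kv) => E.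
have mg := zoom_pole_gt0 Kg; have mp := zoom_pole_gt0 Kp.
have mg_le := zoom_pole_lip z Kg Kp.
have : kap * d (g v) p <= kap * (m (g v) / 2).
  rewrite -E; apply: (@le_trans _ _ (1 / (2 * C) * (m (g v) * (C * kap)))).
    by apply: ler_pM; rewrite ?mulr_ge0 ?(ltW mg) ?(ltW mp) // ler_wpM2l ?(ltW mg) ?(ltW hm).
  by rewrite le_eqVlt; apply/orP; left; apply/eqP; field; rewrite lt0r_neq0.
rewrite ler_pM2l // => d_le; split; lra.
Qed.

Lemma zoom_ball_contract (C a : R) p x y u v : K p -> K x -> K y -> K u -> K v ->
  0 < C -> m p < C * kap -> d x (h p) <= 1 / (2 * C) -> d y (h p) <= 1 / (2 * C) ->
  0 < a -> d x y <= 4 / a * d u v -> 32 * C ^+ 2 * kap <= a -> d (g x) (g y) <= d u v / 2.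
Proof.
move=> Kp Kx Ky Ku Kv C0 hm hx hy a0 xy kap_a.
have [_ mx] := zoom_ball Kp Kx C0 hm hx; have [_ my] := zoom_ball Kp Ky C0 hm hy.
have mx0 := zoom_pole_gt0 (zoom_fwd z Kx); have my0 := zoom_pole_gt0 (zoom_fwd z Ky).
rewrite -(ler_pM2l kap0) -(zoom_conformal_fwd Kx Ky).
apply: (@le_trans _ _ (4 / a * d u v * (2 * C * kap * (2 * C * kap)))).
  by apply: ler_pM => //; [rewrite mulr_ge0 // ltW|apply: ler_pM => //; exact: ltW].
rewrite [leLHS](_ : _ = kap * d u v * (16 * C ^+ 2 * kap / a)); last by field; rewrite lt0r_neq0.
rewrite [leRHS]mulrA; apply: ler_wpM2l; first by rewrite mulr_ge0 // ltW.
by rewrite ler_pdivrMr //; lra.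
Qed.

End ZoomMap.

Section ZoomSystem.
Context {R : realType} (U : set_system nat) {uU : FreeUltraFilter U}.
Context (T : Type) (d : T -> T -> R) (pd : pseudometric d).
Hypothesis d_sep : forall x y, d x y = 0 -> x = y.
Hypothesis d_le2 : forall x y, d x y <= 2.
Context (K : set T) (cK : ultra_compact U d K) (c0 : R) (c00 : 0 < c0).
Context (Z : (T -> T) -> (T -> T) -> R -> (T -> R) -> Prop).
Hypothesis ZS : zoom_system d K c0 Z.
Let d0 x : d x x = 0. Proof. by case: pd. Qed.
Let dC x y : d x y = d y x. Proof. by case: pd. Qed.
Let dT x y z : d x z <= d x y + d y z. Proof. by case: pd. Qed.
Let dge0 := pseudometric_ge0 pd.
Let dgt0 := dist_gt0 pd d_sep.
Let Zmap := zoom_system_map ZS.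
Let Zcomp := zoom_system_comp ZS.

Definition radial_with (C : R) := [set p | K p /\ forall e : R, 0 < e ->
  exists g h kap m, [/\ Z g h kap m, kap < e & m p < C * kap]].

(* In the application this is the radial limit set. *)
Definition radial_points := [set p | exists C, radial_with C p].

Lemma radial_with_mono (C C' : R) : C <= C' -> radial_with C `<=` radial_with C'.
Proof.
move=> CC' p [Kp h]; split=> // e e0; have [g [h' [kap [m [z h1 h2]]]]] := h e e0.
exists g, h', kap, m; split=> //; apply: lt_le_trans h2 _.
by rewrite ler_wpM2r // ltW // (zoom_scale_gt0 (Zmap z)).
Qed.

Lemma radial_points_bigcup : radial_points `<=` \bigcup_n radial_with n.+1%:R.
Proof.
move=> p [C hC]; exists (Num.truncn C) => //; apply: radial_with_mono hC.
by apply: ltW; exact: truncnS_gt.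
Qed.

Context (k : nat) (k0 : (0 < k)%N).
Hypothesis dim_radial : hausdorff_dim_le d radial_points k.

Section WordZoom.
Variables (J : finType) (f h : J -> T -> T).
Hypothesis fZ : forall i, exists kap m, Z (f i) (h i) kap m.

Let unword (w : seq J) (x : T) := foldl (fun x i => h i x) x w.

Lemma word_map_zoom i w : exists kap m, Z (word_map f (i :: w)) (unword (i :: w)) kap m.
Proof.
elim: w i => [|j w IH] i; first exact: fZ.
by have [kap [m z]] := fZ i; have [kap' [m' z']] := IH j; exact: Zcomp z z'.
Qed.

Variables B Bp : set T.
Hypotheses (BBp : B `<=` Bp) (BpK : Bp `<=` K) (fB : forall i x, Bp x -> B (f i x)).

Lemma unword_out i w y : K y -> ~ B y ->
  K (unword (i :: w) y) /\ ~ Bp (unword (i :: w) y).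
Proof.
elim: w i y => [|j w IH] i y Ky nBy; last first.
  have [Kh nBh] := IH i y Ky nBy; apply: (IH j (h i y)).
    by have [kap [m /Zmap z]] := fZ i; exact: (zoom_bwd z Ky).
  move=> /BBp; have [kap [m /Zmap z]] := fZ i.
  by move=> /(fB i); rewrite (zoom_bwdK z Ky).
have [kap [m /Zmap z]] := fZ i; split; first exact: (zoom_bwd z Ky).
by move=> /(fB i); rewrite (zoom_bwdK z Ky).
Qed.

Variables (et : R) (q q' : T).
Hypothesis et0 : 0 < et.
Hypothesis gap : forall x y, B x -> K y -> ~ Bp y -> et <= d x y.
Hypotheses (Kq : K q) (Kq' : K q') (qq' : q <> q') (nBq : ~ B q) (nBq' : ~ B q').
Hypothesis f_contract : forall i x y, B x -> B y -> d (f i x) (f i y) <= d x y / 2.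
Hypothesis B_two_points : exists x y, [/\ B x, B y & x <> y].

Let fBB i x : B x -> B (f i x). Proof. by move=> /BBp; exact: fB. Qed.

(* The poles of the zooms spelled by long words stay away from [q] or [q'],
   hence close to the points of the cylinder of the word. *)
Lemma attractor_radial : attractor f B `<=` radial_points.
Proof.
have BK : B `<=` K by apply: subset_trans BpK.
have dq : 0 < d q q' by exact: dgt0.
have [b0 [b1 [Bb0 Bb1 b01]]] := B_two_points; have db : 0 < d b0 b1 by exact: dgt0.
move=> x Ax; exists (4 / (et * d q q') + 1).
have Bx : B x by have := Ax 0%N I; exact: cylinders_sub.
have Kx := BK _ Bx; split=> // e e0.
have [N hN] := half_expn_small (divr_gt0 e0 (exprn_gt0 2 c00)).
have [w [b [sw Bb xw]]] := Ax N.+1 I; case: w sw xw => // i w sw xw.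
have [kap [m z]] := word_map_zoom i w; have z' := Zmap z; have kap0 := zoom_scale_gt0 z'.
exists (word_map f (i :: w)), (unword (i :: w)), kap, m; split => //.
  have := le_trans (zoom_expand pd c00 z' (BK _ Bb0) (BK _ Bb1))
    (word_map_contract fBB f_contract (i :: w) Bb0 Bb1).
  rewrite ler_pM2r // sw ler_pdivrMr ?exprn_gt0 // => /le_lt_trans; apply.
  by rewrite -ltr_pdivlMr ?exprn_gt0 // hN.
have wx : unword (i :: w) x = b by rewrite xw; apply: zoom_fwdK z' _ _; exact: BK.
have [y [Ky nBy hy]] : exists y, [/\ K y, ~ B y & d q q' / 2 <= m y].
  have := zoom_dist_le_poles z' Kq Kq'; have [h1 _|h1 h2] := leP (d q q' / 2) (m q).
    by exists q.
  by exists q'; split => //; lra.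
have [Ky' nBy'] := unword_out i w Ky nBy.
have sep : et <= d (unword (i :: w) x) (unword (i :: w) y) by rewrite wx; exact: gap.
have mx := zoom_pole_le d_le2 c00 z' Kx Ky et0 sep dq hy.
apply: (le_lt_trans mx).
by rewrite [4 * kap]mulrC -mulrA mulrC ltr_pM2r //; lra.
Qed.

End WordZoom.

(* Finitely many zooms mapping [P] into pairwise disjoint subsets of [Q]. *)
Definition zoom_branches (P Q : set T) (M : R) :=
  exists (I : finType) (f h : I -> T -> T) (r : I -> R),
  [/\ forall i, exists kap m, Z (f i) (h i) kap m,
      (forall i x, P x -> Q (f i x)) /\
      (forall i j x y, i != j -> P x -> P y -> f i x <> f j y),
      (forall i, 0 < r i) /\ (forall i x y, K x -> K y -> r i * d x y <= d (f i x) (f i y)),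
      forall i x y, P x -> P y -> d (f i x) (f i y) <= d x y / 2
    & M <= \sum_i r i ^+ k].

Lemma zoom_branches_mono P Q (M N : R) : N <= M -> zoom_branches P Q M -> zoom_branches P Q N.
Proof.
move=> NM [I [f [h [r [fZ fQ fr f_contract sum_r]]]]]; exists I, f, h, r; split=> //.
exact: le_trans sum_r.
Qed.

Lemma zoom_branches_comp P Q P' Q' (M : R) : P `<=` K -> P' `<=` K -> Q' `<=` P -> 0 <= M ->
  zoom_branches P Q M -> zoom_branches P' Q' 1 -> zoom_branches P' Q M.
Proof.
move=> PK PK' QP M0 [I [f [h [r [fZ [fQ f_disj] [r0 f_expand] f_contract sum_r]]]]].
move=> [I' [f' [h' [r' [fZ' [fQ' f_disj'] [r0' f_expand'] f_contract' sum_r']]]]].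
have fP j x : P' x -> P (f' j x) by move=> /(fQ' j); exact: QP.
exists (I * I')%type, (fun w => f w.1 \o f' w.2), (fun w => h' w.2 \o h w.1),
  (fun w => r w.1 * r' w.2); split.
- by move=> [i j]; have [? [? z]] := fZ i; have [? [? z']] := fZ' j; exact: Zcomp z z'.
- split=> [[i j] x Px|[i j] [i' j'] x y ne Px Py] /=; first by apply: fQ; exact: fP.
  have [ii|ii] := eqVneq i i'; last by apply: f_disj => //; exact: fP.
  move: ne; rewrite -ii xpair_eqE eqxx /= => jj E; apply: (f_disj' j j' x y jj Px Py).
  have [kap [m /Zmap z]] := fZ i.
  by rewrite -(zoom_fwdK z (PK _ (fP j x Px))) E (zoom_fwdK z (PK _ (fP j' y Py))).
- split=> [[i j]|[i j] x y Kx Ky] /=; first exact: mulr_gt0.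
  have [kap [m /Zmap z]] := fZ' j.
  apply: le_trans (f_expand i _ _ (zoom_fwd z Kx) (zoom_fwd z Ky)).
  by rewrite -mulrA ler_wpM2l ?(ltW (r0 i)) // f_expand'.
- move=> [i j] x y Px Py /=; apply: le_trans (f_contract i _ _ (fP _ _ Px) (fP _ _ Py)) _.
  by have := f_contract' j x y Px Py; have := dge0 x y; lra.
apply: le_trans sum_r _; rewrite -[leLHS]mulr1.
apply: (@le_trans _ _ ((\sum_i r i ^+ k) * (\sum_j r' j ^+ k))).
  by apply: ler_wpM2l sum_r'; apply: sumr_ge0 => i _; rewrite exprn_ge0 // ltW.
by rewrite big_distrlr pair_bigA /=; apply: ler_sum => w _; rewrite exprMn.
Qed.

Lemma zoom_branches_lt2 (B Bp : set T) (et : R) q q' : B `<=` Bp -> Bp `<=` K ->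
  ultra_compact U d B -> 0 < et -> (forall x y, B x -> K y -> ~ Bp y -> et <= d x y) ->
  K q -> K q' -> q <> q' -> ~ B q -> ~ B q' -> (exists x y, [/\ B x, B y & x <> y]) ->
  ~ zoom_branches Bp B 2.
Proof.
move=> BBp BpK cB et0 gap Kq Kq' qq' nBq nBq' B2.
move=> [I [f [h [r [fZ [fB f_disj] [r0 f_expand] f_contract sum_r]]]]].
have BK : B `<=` K by exact: subset_trans BpK.
have fBB i x : B x -> B (f i x) by move=> /BBp; exact: fB.
have f_contractB i x y : B x -> B y -> d (f i x) (f i y) <= d x y / 2.
  by move=> /BBp Bx /BBp By; exact: f_contract.
have f_disjB i j x y : i != j -> B x -> B y -> f i x <> f j y.
  by move=> ij /BBp Bx /BBp By; exact: f_disj.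
have f_expandB i x y : B x -> B y -> r i * d x y <= d (f i x) (f i y).
  by move=> /BK Kx /BK Ky; exact: f_expand.
apply: (attractor_dim_gt pd d_sep cB fBB f_contractB f_disjB r0 f_expandB B2 k0 sum_r).
apply: hausdorff_dim_leS dim_radial.
exact: (attractor_radial fZ BBp BpK fB et0 gap Kq Kq' qq' nBq nBq' f_contractB B2).
Qed.

(** * Finiteness of the measure of the limit set *)

Lemma zoom_absorb x q (th et : R) (B : bool -> set T) : K x -> K q -> x <> q -> 0 < th ->
  0 < et -> (forall b, B b `<=` K) -> (forall u v, B true u -> B false v -> 2 * et <= d u v) ->
  exists b g h kap m, Z g h kap m /\ forall u, B b u -> d (g u) x < th.
Proof.
move=> Kx Kq xq th0 et0 BK gap; have qx : 0 < d q x by rewrite dC; exact: dgt0.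
pose A : R := 4 / (et * d q x) + 1.
have A0 : 0 < A by rewrite addr_gt0 // divr_gt0 // mulr_gt0.
have e0 : 0 < Num.min (d q x / 2) (th / A) by rewrite lt_min !divr_gt0.
have [g [h [kap [m [z hk hm]]]]] := zoom_system_near ZS Kx e0; have z' := Zmap z.
move: hk hm; rewrite !lt_min => /andP[_ hk] /andP[hm1 hm2].
have close u : K u -> et <= d u (h q) -> d (g u) x < th.
  move=> Ku hu; apply: le_lt_trans (zoom_dist_le_poles z' (zoom_fwd z' Ku) Kx) _.
  have mx : 2 * m x <= d q x by lra.
  have := zoom_pole_fwd_le d_le2 c00 z' Kx Kq Ku mx qx et0 hu.
  have : 4 * kap / (et * d q x) + m x < 4 * (th / A) / (et * d q x) + th / A.
    by rewrite ltrD // ltr_pM2r ?invr_gt0 ?mulr_gt0 // ltr_pM2l.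
  have E t : 4 * t / (et * d q x) + t = t * A by rewrite /A; ring.
  by rewrite E divfK ?lt0r_neq0 //; lra.
have [far|/existsNP[u1 /not_implyP[Bu1 hu1]]] := pselect (forall u, B true u -> et <= d u (h q)).
  by exists true, g, h, kap, m; split=> // u Bu; apply: close (far _ Bu); exact: BK Bu.
exists false, g, h, kap, m; split=> // v Bv; apply: close; first exact: BK Bv.
have := gap _ _ Bu1 Bv; have := dT u1 (h q) v; move/negP: hu1; rewrite -ltNge (dC v); lra.
Qed.

Section TwoPoints.
Context (x1 x2 : T) (K1 : K x1) (K2 : K x2) (et : R) (et0 : 0 < et) (x12 : 8 * et <= d x1 x2).
Let center (b : bool) := if b then x1 else x2.
Let disk b := K `&` [set x | d (center b) x <= et].
Let disk2 b := K `&` [set x | d (center b) x <= 2 * et].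

Let Kcenter b : K (center b). Proof. by case: b. Qed.

Let disk_sub b : disk b `<=` disk2 b.
Proof. by move=> x [Kx /= h]; split=> //=; have := et0; lra. Qed.

Lemma disk2_gap u v : disk2 true u -> disk2 false v -> 2 * et <= d u v.
Proof.
move=> [_ /= h1] [_ /= h2]; have := dT x1 u x2; have := dT u v x2.
by rewrite (dC v x2); have := x12; have := et0; lra.
Qed.

Lemma disk_neq b x y : disk b x -> disk (~~ b) y -> x <> y.
Proof.
move=> /disk_sub Bx /disk_sub By xy; have et_le u v : 2 * et <= d u v -> u <> v.
  by move=> h uv; move: h; rewrite uv d0; have := et0; lra.
case: b Bx By => Bx By; first exact: et_le (disk2_gap Bx By) xy.
exact: et_le (disk2_gap By Bx) (esym xy).
Qed.

Lemma uniform_absorb (th : R) : 0 < th -> exists2 c : R, 0 < c & forall z, K z ->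
  exists b g h kap m, [/\ Z g h kap m, c <= kap & forall u, disk2 b u -> d (g u) z < th].
Proof.
move=> th0; have th2 : 0 < th / 2 by lra.
have [l [lK lnet]] := finite_net pd cK th2.
suff [c c0' hc] : exists2 c : R, 0 < c & forall z, List.In z l -> exists b g h kap m,
    [/\ Z g h kap m, c <= kap & forall u, disk2 b u -> d (g u) z < th / 2].
  exists c => // z Kz; have [y /hc[b [g [h [kap [m [zm hk close]]]]]] zy] := lnet z Kz.
  exists b, g, h, kap, m; split=> // u /close.
  by have := dT (g u) y z; rewrite (dC y); lra.
elim: l lK {lnet} => [|z l IH] lK; first by exists 1.
have [|c c0' hc] := IH; first by move=> x lx; apply: lK; right.
have Kz : K z by apply: lK; left.
have [q [Kq zq]] : exists q, K q /\ z <> q.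
  have [E|?] := pselect (z = x1); [exists x2; split=> // E2|by exists x1].
  by have := x12; rewrite -E -E2 d0; have := et0; lra.
have [b [g [h [kap [m [zm close]]]]]] :=
  zoom_absorb Kz Kq zq th2 et0 (fun b x (h : disk2 b x) => h.1) disk2_gap.
exists (Num.min c kap); first by rewrite lt_min c0' (zoom_scale_gt0 (Zmap zm)).
move=> w [<-|/hc[b' [g' [h' [kap' [m' [zm' hk' close']]]]]]].
  by exists b, g, h, kap, m; split=> //; rewrite ge_min lexx orbT.
by exists b', g', h', kap', m'; split=> //; rewrite ge_min hk'.
Qed.

Record zoom_item := ZoomItem {
  item_point : T; item_scale : R; item_side : bool; item_map : T -> T; item_inv : T -> T }.

Definition good_item (C Q : R) (i : zoom_item) :=
  [/\ exists kap m, Z (item_map i) (item_inv i) kap m,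
    forall x, disk2 (item_side i) x -> d (item_map i x) (item_point i) <= C * item_scale i,
    forall x y, K x -> K y -> item_scale i * Q * d x y <= d (item_map i x) (item_map i y)
  & forall x y, disk2 (item_side i) x -> disk2 (item_side i) y ->
    d (item_map i x) (item_map i y) <= d x y / 2].

(* Compose a zoom at [p] with one absorbing a disk near the image of [p]. *)
Lemma exists_good_item (C : R) : 0 < C -> exists2 Q : R, 0 < Q &
  forall p (e : R), radial_with C p -> 0 < e -> exists i,
    [/\ good_item C Q i, item_point i = p & 0 < item_scale i < e].
Proof.
move=> C0; have th0 : 0 < 1 / (2 * C) by rewrite divr_gt0 // mulr_gt0.
have [a a0 absorb] := uniform_absorb th0.
exists (a / c0 ^+ 4); first by rewrite divr_gt0 // exprn_gt0.
move=> p e [Kp rad] e0.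
have [|g [h [kap [m [z hk hm]]]]] := rad (Num.min e (a / (32 * C ^+ 2))).
  by rewrite lt_min e0 divr_gt0 // mulr_gt0 // exprn_gt0.
move: hk; rewrite lt_min ltr_pdivlMr ?mulr_gt0 ?exprn_gt0 // => /andP[kap_e kap_a].
have z' := Zmap z; have kap0 := zoom_scale_gt0 z'.
have [b [g1 [h1 [kap1 [m1 [z1 a_kap1 close]]]]]] := absorb _ (zoom_bwd z' Kp).
have z1' := Zmap z1; have kap10 := zoom_scale_gt0 z1'.
have near x : disk2 b x -> d (g1 x) (h p) <= 1 / (2 * C) by move=> /close/ltW.
exists (ZoomItem p kap b (g \o g1) (h1 \o h)); split; rewrite /= ?kap0 //; split=> /=.
- exact: Zcomp z z1.
- move=> x Bx; have Kx := zoom_fwd z1' Bx.1.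
  by have [] := zoom_ball pd c00 z' Kp Kx C0 hm (near x Bx).
- move=> x y Kx Ky; apply: le_trans (zoom_expand pd c00 z' (zoom_fwd z1' Kx) (zoom_fwd z1' Ky)).
  apply: (@le_trans _ _ (kap / c0 ^+ 2 * (kap1 / c0 ^+ 2 * d x y))); last first.
    by rewrite ler_wpM2l ?divr_ge0 ?exprn_ge0 ?(ltW kap0) ?(ltW c00) //;
      exact: (zoom_expand pd c00 z1' Kx Ky).
  rewrite [leRHS](_ : _ = kap * (kap1 / c0 ^+ 4) * d x y); last by field; rewrite lt0r_neq0.
  by rewrite ler_wpM2r // !ler_wpM2l ?(ltW kap0) // ler_wpM2r // invr_ge0 exprn_ge0 // ltW.
move=> x y Bx By.
have Kx := zoom_fwd z1' Bx.1; have Ky := zoom_fwd z1' By.1.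
apply: (zoom_ball_contract pd c00 z' Kp Kx Ky Bx.1 By.1 C0 hm (near x Bx) (near y By) kap10).
  exact: (zoom_lip pd c00 z1' Bx.1 By.1).
by apply: le_trans a_kap1; lra.
Qed.

Lemma exists_item_packing a (C Q N : R) : 0 < C ->
  (forall p (e : R), radial_with C p -> 0 < e -> exists i,
    [/\ good_item C Q i, item_point i = p & 0 < item_scale i < e]) ->
  ~ locally_in_ideal d (hausdorff_finite d k) (radial_with C) (center a) ->
  exists n (u : 'I_n -> zoom_item),
  [/\ forall i, good_item C Q (u i) /\ 0 < item_scale (u i),
      forall i x, disk2 (item_side (u i)) x -> disk a (item_map (u i) x),
      forall i j, i != j -> 2 * (C * item_scale (u i) + C * item_scale (u j))
        < d (item_point (u i)) (item_point (u j))
    & N < \sum_i (12 * (C * item_scale (u i))) ^+ k].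
Proof.
move=> C0 items inf; have et2 : 0 < et / 2 by have := et0; lra.
pose A := radial_with C `&` [set x | d x (center a) <= et / 2].
have : ~ hausdorff_le d k A N by move=> h; apply: inf; exists (et / 2) => //; exists N.
move=> /existsNP[dl /existsNP[e /not_implyP[dl0 /not_implyP[e0 ncov]]]].
pose kmax := Num.min (dl / 12 / C) (et / 2 / C).
have kmax0 : 0 < kmax by rewrite lt_min !divr_gt0 // et2.
pose F := [set i | [/\ good_item C Q i, A (item_point i) & 0 < item_scale i < kmax]].
have [|||||n [u [uF u_sep u_sum]]] :=
  @vitali_packing R U uU T d pd K cK k k0 _ F item_point (fun i => C * item_scale i)
    A (dl / 12) (N + e).
- by move=> i [_ [[]]].
- move=> i [_ _ /andP[i0]]; rewrite lt_min => /andP[ik _].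
  by rewrite mulr_gt0 //= mulrC -ler_pdivlMr // ltW.
- move=> p Ap; have [i [gi ip ik]] := items p kmax Ap.1 kmax0.
  by exists i => //; split; rewrite ?ip.
- by rewrite divr_ge0 // ltW.
- by rewrite mulrC divfK // pnatr_eq0.
exists n, u; split=> // [i|i x Bx|].
- by have [gi _ /andP[]] := uF i.
- have [[[kap [m /Zmap z]] near _ _] [_ /= ia] /andP[_]] := uF i.
  rewrite lt_min => /andP[_]; rewrite ltr_pdivlMr // => ik; split; first exact: (zoom_fwd z Bx.1).
  move: (near x Bx) ia; set p := item_point _; set y := item_map _ x => yp pa.
  rewrite /=; have := dT (center a) p y; rewrite (dC p y) (dC (center a) p). lra.
by apply: le_lt_trans u_sum; rewrite lerDl ltW.
Qed.

Lemma branches_of_infinite a (C M : R) : 0 < C -> 0 <= M ->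
  ~ locally_in_ideal d (hausdorff_finite d k) (radial_with C) (center a) ->
  exists b, zoom_branches (disk2 b) (disk a) M.
Proof.
move=> C0 M0 inf; have [Q Q0 items] := exists_good_item C0.
have CQ0 : 0 < (12 * C / Q) ^+ k by rewrite exprn_gt0 // divr_gt0 // mulr_gt0.
have [n [u [ug u_disk u_sep u_sum]]] :=
  exists_item_packing ((12 * C / Q) ^+ k * (2 * M)) C0 items inf.
have sumE : \sum_i (12 * (C * item_scale (u i))) ^+ k =
    (12 * C / Q) ^+ k * \sum_i (item_scale (u i) * Q) ^+ k.
  rewrite mulr_sumr; apply: eq_bigr => i _; rewrite -exprMn; congr (_ ^+ _).
  by field; rewrite lt0r_neq0.
move: u_sum; rewrite sumE ltr_pM2l // => /ltW.
move=> /(sum_bool_pigeonhole (item_side \o u))[b /= hb].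
pose A := [pred i | item_side (u i) == b].
have side (i : 'I_#|A|) : item_side (u (enum_val i)) = b.
  by have := enum_valP i; rewrite inE => /eqP.
exists b; exists 'I_#|A|, (fun i => item_map (u (enum_val i))),
  (fun i => item_inv (u (enum_val i))), (fun i => item_scale (u (enum_val i)) * Q).
split.
- by move=> i; have [[]] := ug (enum_val i).
- split=> [i x Bx|i j x y ij Bx By fxy]; first by apply: u_disk; rewrite side.
  have [[_ neari _ _] _] := ug (enum_val i); have [[_ nearj _ _] _] := ug (enum_val j).
  have := neari x; have := nearj y; rewrite !side => /(_ By) hj /(_ Bx) hi.
  have := u_sep (enum_val i) (enum_val j); rewrite (inj_eq enum_val_inj) => /(_ ij).
  have [_ i0] := ug (enum_val i); have [_ j0] := ug (enum_val j).
  have := mulr_gt0 C0 i0; have := mulr_gt0 C0 j0; rewrite -fxy in hj.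
  move: hi hj; set p := item_point _; set q := item_point _; set v := item_map _ x => hi hj.
  by have := dT p v q; rewrite (dC p v); lra.
- split=> [i|i x y Kx Ky]; first by have [_ i0] := ug (enum_val i); exact: mulr_gt0.
  by have [[_ _ expand _] _] := ug (enum_val i); exact: expand.
- by move=> i x y Bx By; have [[_ _ _ ctr] _] := ug (enum_val i); apply: ctr; rewrite side.
by rewrite (le_trans hb) // -(big_enum_val (fun i => (item_scale (u i) * Q) ^+ k)).
Qed.

Lemma no_two_infinite_points (C : R) : 0 < C ->
  ~ (forall a, ~ locally_in_ideal d (hausdorff_finite d k) (radial_with C) (center a)).
Proof.
move=> C0 inf.
have two_points a : exists x y, [/\ disk a x, disk a y & x <> y].
  apply: contrapT => hn; apply: (inf a); exists et => //; apply: hausdorff_null_finite.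
  apply: (@hausdorff_nullS R T d k _ [set center a]); last exact: hausdorff_null1.
  move=> x [[Kx _] /= dx] /=; apply: contrapT => xc; apply: hn; exists x, (center a).
  by have Kc := Kcenter a; split=> //; split=> //=; rewrite ?d0 ?(dC _ x) // ltW.
have self_branch a : ~ zoom_branches (disk2 a) (disk a) 2.
  have [x [y [Bx By xy]]] := two_points (~~ a).
  apply: (zoom_branches_lt2 (q := x) (q' := y) (et := et)) => //.
  - by move=> u [].
  - exact: ultra_compact_ball.
  - move=> u v [Ku /= hu] Kv nBv; rewrite leNgt; apply/negP => uv; apply: nBv; split=> //=.
    by have := dT (center a) u v; lra.
  - by case: Bx.
  - by case: By.
  - by move=> /disk_neq/(_ Bx).
  - by move=> /disk_neq/(_ By).
have cross a : zoom_branches (disk2 (~~ a)) (disk a) 2.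
  have [b hb] := branches_of_infinite C0 (ler0n R 2) (inf a).
  have [ba|ba] := eqVneq b a; first by rewrite ba in hb; case: (self_branch _ hb).
  by have <- : b = ~~ a by case: (a) (b) ba => -[].
apply: (self_branch true); apply: (zoom_branches_comp _ _ (@disk_sub false) _ (cross true)) => //.
- by move=> x [].
- by move=> x [].
by apply: zoom_branches_mono (cross false); rewrite ler1n.
Qed.

End TwoPoints.

Lemma radial_with_finite_away (C : R) x0 : K x0 -> exists2 x, K x & forall e : R, 0 < e ->
  hausdorff_finite d k (radial_with C `&` [set y | e <= d y x]).
Proof.
move=> Kx0; pose C' := Num.max C 1; have C'0 : 0 < C' by rewrite lt_max ltr01 orbT.
have [||||[x Kx h]|[x1 [x2 [K1 K2 x12 inf1 inf2]]]] :=
  ideal_dichotomy pd cK (J := hausdorff_finite d k) (A := radial_with C') _ _ _ Kx0.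
- by apply: hausdorff_null_finite; exact: hausdorff_null0.
- by move=> A B AB; exact: hausdorff_finiteS.
- by move=> A B; exact: hausdorff_finiteU.
- by move=> p [].
- exists x => // e e0; apply: hausdorff_finiteS (h e e0) => y [Ly hy]; split=> //.
  by apply: radial_with_mono Ly; rewrite le_max lexx.
exfalso; apply: (@no_two_infinite_points x1 x2 K1 K2 (d x1 x2 / 8) _ _ C' C'0) => [||[]//].
  by rewrite divr_gt0.
by rewrite mulrC divfK // pnatr_eq0.
Qed.

(* The cocycle relating the poles of a composition is constant: its values at
   any two of three points have the same product. *)
Lemma zoom_comp_cocycle g1 h1 kap1 m1 g h kap m kap2 m2 (om : T -> R) u v p :
  zoom_map d K c0 g1 h1 kap1 m1 -> zoom_map d K c0 g h kap m ->
  zoom_map d K c0 (g1 \o g) (h \o h1) kap2 m2 -> (forall x, K x -> 0 < om x) ->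
  (forall x y, K x -> K y -> d (g1 x) (g1 y) = om x * om y * d x y) ->
  K u -> K v -> K p -> u <> v -> u <> p -> v <> p ->
  exists2 f : R, 0 < f & [/\ m2 (g1 u) = f * (m u * om u), m2 (g1 p) = f * (m p * om p)
    & kap2 = f ^+ 2 * kap].
Proof.
move=> z1 z z2 om0 omE Ku Kv Kp uv up vp.
have kap0 := zoom_scale_gt0 z; have m0 x : K x -> 0 < m x by exact: (zoom_pole_gt0 c00 z).
have m20 x : K x -> 0 < m2 (g1 x) by move=> Kx; apply/(zoom_pole_gt0 c00 z2)/(zoom_fwd z1).
pose F x := m2 (g1 x) / (m x * om x).
have F0 x : K x -> 0 < F x by move=> Kx; rewrite divr_gt0 ?mulr_gt0 ?m0 ?om0 ?m20.
have mF x : K x -> m2 (g1 x) = F x * (m x * om x).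
  by move=> Kx; rewrite divfK // mulf_neq0 ?lt0r_neq0 ?m0 ?om0.
have FF x y : K x -> K y -> x <> y -> F x * F y * kap = kap2.
  move=> Kx Ky /dgt0 xy.
  have E2 := zoom_conformal_bwd z2 (zoom_fwd z1 Kx) (zoom_fwd z1 Ky).
  rewrite /= (zoom_fwdK z1 Kx) (zoom_fwdK z1 Ky) (omE _ _ Kx Ky) (mF x Kx) (mF y Ky) in E2.
  have E1 := zoom_conformal_bwd z Kx Ky.
  have nz : om x * om y * d x y != 0 by rewrite lt0r_neq0 // !mulr_gt0 ?om0.
  apply: (mulIf nz); rewrite -E2.
  transitivity (F x * F y * (om x * om y) * (kap * d x y)); first by ring.
  by rewrite -E1; ring.
have FuFp : F u = F p.
  have : F u * F v * kap = F v * F p * kap by rewrite (FF u v) // (FF v p).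
  move/(mulIf (lt0r_neq0 kap0)); rewrite [F u * _]mulrC; apply: mulfI.
  by rewrite lt0r_neq0 ?F0.
exists (F p); first exact: F0.
by rewrite mF // mF // FuFp; split=> //; rewrite -(FF u p) // FuFp expr2.
Qed.

Lemma cocycle_bounds (ou op D mu mp f : R) :
  0 < ou -> 0 < op -> 0 < D -> 0 < f -> D <= mu + mp -> mu <= mp + D ->
  ou * op * D <= f * (mu * ou) + f * (mp * op) ->
  f * (mu * ou) <= f * (mp * op) + ou * op * D ->
  mp * (ou + op) <= ou * D / 2 -> op / 2 <= f <= 2 * op.
Proof.
move=> ou0 op0 D0 f0 sum_ge lip tri_ge tri_le small.
have X0 : 0 < ou * D by exact: mulr_gt0.
apply/andP; split; rewrite -(ler_pM2r X0).
  have : f * (mu * ou) <= f * ((D + mp) * ou).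
    by rewrite ler_wpM2l ?(ltW f0) // ler_wpM2r ?(ltW ou0) //; lra.
  have : f * (ou * (D + mp) + mp * op) <= f * (2 * (ou * D)).
    by rewrite ler_wpM2l ?(ltW f0) //; lra.
  lra.
have : f * (ou * D / 2) <= f * (ou * (D - mp) - mp * op).
  by rewrite ler_wpM2l ?(ltW f0) //; lra.
have : f * ((D - mp) * ou) <= f * (mu * ou).
  by rewrite ler_wpM2l ?(ltW f0) // ler_wpM2r ?(ltW ou0) //; lra.
lra.
Qed.

Lemma radial_with_image g1 h1 kap1 m1 p (C : R) : Z g1 h1 kap1 m1 -> 0 < C ->
  radial_with C p -> (exists u v, [/\ K u, K v, u <> v, u <> p & v <> p]) ->
  radial_with (2 * C) (g1 p).
Proof.
move=> z1 C0 [Kp rad] [u [v [Ku Kv uv up vp]]]; have z1' := Zmap z1.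
have [om om0 omE] := zoom_conformal_factor c00 z1'.
split=> [|e e0]; first exact: (zoom_fwd z1' Kp).
have ou := om0 _ Ku; have op := om0 _ Kp; have dup := dgt0 up.
have [|g [h [kap [m [z + hm]]]]] :=
    rad (Num.min (om u * d u p / (2 * C * (om u + om p))) (e / (4 * om p ^+ 2))).
  by rewrite lt_min !divr_gt0 // ?mulr_gt0 ?addr_gt0 ?exprn_gt0.
rewrite lt_min !ltr_pdivlMr ?mulr_gt0 ?addr_gt0 ?exprn_gt0 // => /andP[hk1 hk2].
have z' := Zmap z; have kap0 := zoom_scale_gt0 z'.
have [kap2 [m2 z2]] := Zcomp z1 z; have z2' := Zmap z2.
have [f f0 [m2u m2p kap2E]] := zoom_comp_cocycle z1' z' z2' om0 omE Ku Kv Kp uv up vp.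
have K1u := zoom_fwd z1' Ku; have K1p := zoom_fwd z1' Kp.
have /andP[f_ge f_le] : om p / 2 <= f <= 2 * om p.
  apply: (cocycle_bounds ou op dup f0 (zoom_dist_le_poles z' Ku Kp) (zoom_pole_lip z' Ku Kp)).
  - by rewrite -m2u -m2p -omE //; exact: zoom_dist_le_poles z2' _ _ K1u K1p.
  - by rewrite -m2u -m2p -omE //; exact: zoom_pole_lip z2' _ _ K1u K1p.
  have : m p * (om u + om p) <= C * kap * (om u + om p).
    by rewrite ler_wpM2r ?addr_ge0 ?ltW.
  lra.
exists (g1 \o g), (h \o h1), kap2, m2; split=> //; rewrite kap2E.
  apply: le_lt_trans hk2; rewrite mulrC ler_wpM2l ?(ltW kap0) //.
  have : f * f <= 2 * om p * (2 * om p) by apply: ler_pM; rewrite ?(ltW f0).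
  by rewrite !expr2; lra.
rewrite m2p; apply: (@lt_le_trans _ _ (f * (C * kap * om p))).
  by rewrite ltr_pM2l // ltr_pM2r.
rewrite [leRHS](_ : _ = f * (C * kap * (2 * f))); last by ring.
by rewrite ler_wpM2l ?(ltW f0) // ler_wpM2l ?mulr_ge0 ?(ltW C0) ?(ltW kap0) //; lra.
Qed.

Lemma zoom_image_mass g h kap m (A : set T) (a : R) : zoom_map d K c0 g h kap m ->
  A `<=` K -> ~ hausdorff_le d k A a ->
  ~ hausdorff_le d k (g @` A) (a * (kap / c0 ^+ 2) ^+ k).
Proof.
move=> z AK; have kap0 := zoom_scale_gt0 z; apply: contra_not => hle.
have L0 : 0 < c0 ^+ 2 / kap by rewrite divr_gt0 // exprn_gt0.
have -> : a = (c0 ^+ 2 / kap) ^+ k * (a * (kap / c0 ^+ 2) ^+ k).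
  rewrite mulrCA -exprMn [_ / _ * _](_ : _ = 1) ?expr1n ?mulr1 //.
  by field; rewrite !lt0r_neq0.
apply: (@hausdorff_leS R T d k _ (h @` (g @` A))) (lexx _) (hausdorff_le_image L0 _ hle).
  by move=> x Ax; exists (g x); [exists x|exact: (zoom_fwdK z (AK _ Ax))].
move=> _ _ [x /AK Kx <-] [y /AK Ky <-].
exact: (zoom_bwd_lip pd c00 z (zoom_fwd z Kx) (zoom_fwd z Ky)).
Qed.

(* Zooming a set of positive measure into small balls around a radial point. *)
Lemma radial_point_mass p (C : R) (A B : set T) q : radial_with C p -> 0 < C -> K q ->
  q <> p -> A `<=` K -> ~ hausdorff_null d k A ->
  (forall g h kap m x, Z g h kap m -> A x -> B (g x)) ->
  exists2 c : R, 0 < c & forall r0 : R, 0 < r0 -> exists r : R, [/\ 0 < r, r < r0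
    & ~ hausdorff_le d k (B `&` [set x | d x p <= r]) (c * r ^+ k)].
Proof.
move=> [Kp rad] C0 Kq qp AK nA gA; have dqp := dgt0 qp.
have e0 n : 0 < Num.min (d q p / (4 * C)) n.+1%:R^-1.
  by rewrite lt_min invr_gt0 divr_gt0 ?mulr_gt0 //=.
have /choice[g /choice[h /choice[kap /choice[m zooms]]]] n := rad _ (e0 n).
have [|xi Kxi xi_lim] := cK (u := fun n => h n q).
  by move=> n; have [/Zmap z _ _] := zooms n; exact: (zoom_bwd z Kq).
have [th th0 nA'] := hausdorff_nonnull_away pd k0 (fun x (xx : x <> xi) => dgt0 xx) nA.
have [a a0 mass] := hausdorff_nonnull_gt k0 nA'.
have th2 : 0 < th / 2 by lra.
pose S : R := C + 4 / (th / 2 * d q p).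
have S0 : 0 < S by rewrite addr_gt0 // divr_gt0 // mulr_gt0.
exists (a / (c0 ^+ 2 * S) ^+ k); first by rewrite divr_gt0 ?exprn_gt0 ?mulr_gt0 ?exprn_gt0.
move=> r0 r00; have [n [/= xi_n inv_n]] :=
  filter_ex (filterI (xi_lim _ th2) (free_ultra_invS_lt (divr_gt0 r00 S0))).
have [z + hm] := zooms n; rewrite lt_min ltr_pdivlMr ?mulr_gt0 // => /andP[hk1 hk2].
have z' := Zmap z; have kap0 := zoom_scale_gt0 z'.
exists (S * kap n); split; first exact: mulr_gt0.
  by rewrite mulrC -ltr_pdivlMr //; exact: lt_trans hk2 inv_n.
have -> : a / (c0 ^+ 2 * S) ^+ k * (S * kap n) ^+ k = a * (kap n / c0 ^+ 2) ^+ k.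
  rewrite -mulrA -exprVn -exprMn; congr (_ * _ ^+ _).
  by field; rewrite !lt0r_neq0.
apply: contra_not (zoom_image_mass z' _ mass) => [|x [/AK]//].
apply: hausdorff_leS => // _ [x [Ax /= xxi] <-]; split; first exact: gA z Ax.
have Kx := AK _ Ax; have far : th / 2 <= d x (h n q).
  by have := dT x (h n q) xi; lra.
have small : 2 * m n p <= d q p by lra.
exact: (zoom_near d_le2 c00 z' Kp Kq Kx hm small dqp th2 far).
Qed.

Section FiniteAway.
Variables (C : R) (xo : T).
Hypotheses (C0 : 0 < C) (nonnull_C : ~ hausdorff_null d k (radial_with C)).
Hypothesis finite_away : forall e : R, 0 < e ->
  hausdorff_finite d k (radial_with (2 * C) `&` [set x | e <= d x xo]).
Hypothesis nonradial_null : hausdorff_null d k (K `\` radial_points).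

Let nonradial_at (j i : nat) := [set p | [/\ K p, i.+1%:R^-1 <= d p xo
  & forall g h kap m, Z g h kap m -> kap < j.+1%:R^-1 -> 2 * C * kap <= m p]].

Let nonradial_cover :
  K `\` radial_with (2 * C) `<=` [set xo] `|` \bigcup_j \bigcup_i nonradial_at j i.
Proof.
move=> p [Kp nL]; have [->|/dgt0 po] := pselect (p = xo); [by left|right].
have /existsNP[e /not_implyP[e0 he]] : ~ forall e : R, 0 < e ->
    exists g h kap m, [/\ Z g h kap m, kap < e & m p < 2 * C * kap].
  by move=> h; apply: nL.
have [j hj] := exists_invS_lt e0; have [i hi] := exists_invS_lt po.
exists j => //; exists i => //; split=> //; first exact: ltW.
move=> g h kap m z hk; rewrite leNgt; apply/negP => hm; apply: he.
by exists g, h, kap, m; split=> //; exact: lt_trans hj.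
Qed.

(* A closed set of positive measure would meet the quasi-invariant set of
   radial points with positive density, contradicting [hausdorff_density]. *)
Let nonradial_at_null j i : hausdorff_null d k (nonradial_at j i).
Proof.
pose t : R := i.+1%:R^-1 / 2; have t0 : 0 < t by rewrite divr_gt0.
pose B := radial_with (2 * C) `&` [set x | t <= d x xo].
have B_off x : B x -> exists2 s : R, 0 < s & forall q, nonradial_at j i q -> s <= d x q.
  move=> [[Kx rad] _]; have [|g [h [kap [m [z hk hm]]]]] := rad j.+1%:R^-1.
    by rewrite invr_gt0.
  exists (2 * C * kap - m x); first by rewrite subr_gt0.
  move=> q [Kq _ /(_ _ _ _ _ z hk)]; have := zoom_pole_lip (Zmap z) Kq Kx.
  by rewrite (dC q); lra.
have dens n : hausdorff_null d k (thick_points d k B (nonradial_at j i) n.+1%:R^-1).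
  by apply: (hausdorff_density pd cK k0 _ (finite_away t0)) => // x [].
apply: contrapT => nQ.
have [p [[Qp nLp] not_thick]] := hausdorff_nonnull_nonempty k0 (hausdorff_nonnullD k0
  (hausdorff_nonnullD k0 nQ nonradial_null) (hausdorff_null_bigcup k0 dens)).
have [Kp po _] := Qp.
have radC : radial_with C `<=` K by move=> x [].
have /radial_points_bigcup[c _ rad_p] : radial_points p by apply: contrapT => h; apply: nLp.
have image g h kap m x : Z g h kap m -> radial_with C x -> radial_with (2 * C) (g x).
  move=> z Lx; apply: (radial_with_image z C0 Lx).
  have [u [v [Lu Lv uv ux vx]]] := hausdorff_nonnull_two_points pd k0 x nonnull_C.
  by exists u, v; split=> //; exact: radC.
have [q [_ [Lq _ _ qp _]]] := hausdorff_nonnull_two_points pd k0 p nonnull_C.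
have [c2 c20 mass] := radial_point_mass rad_p (ltr0Sn R c) (radC _ Lq) qp radC nonnull_C image.
have [n hn] := exists_invS_lt c20; apply: not_thick; exists n => //; split=> // r0 r00.
have [|r [r_gt0 + mass_r]] := mass (Num.min r0 t); first by rewrite lt_min r00.
rewrite lt_min => /andP[r_lt r_t]; exists r; split=> //.
apply: contra_not mass_r; apply: hausdorff_leS.
  move=> x [Lx /= xp]; split=> //; split=> //=.
  have := dT p x xo; rewrite (dC p x); move: po r_t; rewrite /t.
  by move: (i.+1%:R^-1 : R) => a; lra.
by rewrite ler_wpM2r ?exprn_ge0 ?(ltW r_gt0) ?(ltW hn).
Qed.

Lemma radial_with_conull : hausdorff_null d k (K `\` radial_with (2 * C)).
Proof.
apply: hausdorff_nullS nonradial_cover _; apply: hausdorff_nullU => //.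
  exact: hausdorff_null1.
by apply: hausdorff_null_bigcup => // j; apply: hausdorff_null_bigcup => // i; exact: nonradial_at_null.
Qed.

End FiniteAway.

Lemma limit_finite_away : hausdorff_null d k (K `\` radial_points) -> K !=set0 ->
  exists2 xo, K xo &
    forall e : R, 0 < e -> hausdorff_finite d k (K `&` [set x | e <= d x xo]).
Proof.
move=> nul [x0 Kx0].
have [null_rad|/existsNP[n0]] := pselect (forall n, hausdorff_null d k (radial_with n.+1%:R)).
  exists x0 => // e e0; apply: hausdorff_null_finite.
  apply: hausdorff_nullS (hausdorff_nullU k0 nul (hausdorff_null_bigcup k0 null_rad)).
  move=> x [Kx _]; have [/radial_points_bigcup Lx|nLx] := pselect (radial_points x).
    by right.
  by left.
set C : R := n0.+1%:R => nonnull_C; have C0 : 0 < C by rewrite ltr0Sn.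
have [xo Kxo fin] := radial_with_finite_away (2 * C) Kx0; exists xo => // e e0.
have null_rest := radial_with_conull C0 nonnull_C fin nul.
apply: hausdorff_finiteS (hausdorff_finiteU k0 (fin e e0) (hausdorff_null_finite null_rest)).
by move=> x [Kx hx]; have [Lx|nLx] := pselect (radial_with (2 * C) x); [left|right].
Qed.

End ZoomSystem.

(** * Continua of finite length *)

Lemma interval_cover_length (R : realType) (D M : R) (a r : nat -> R) :
  (forall i, 0 <= r i) -> (forall s : R, 0 <= s <= D -> exists i, a i <= s <= a i + r i) ->
  (forall n, \sum_(i < n) r i <= M) -> 0 <= D -> D <= M.
Proof.
move=> r0 hc hM D0.
pose I0 : set R := `[0, D]%classic.
pose J i : set R := `[a i, (a i + r i)]%classic.
have : (lebesgue_measure I0 <= \sum_(0 <= i <oo) lebesgue_measure (J i))%E.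
{ apply: measure_sigma_subadditive; [by move=> i; exact: measurable_itv|exact: measurable_itv|].
  move=> s; rewrite /I0 /= in_itv /= => hs; have [i hi] := hc s hs.
  by exists i => //; rewrite /J /= in_itv.
}
have E (x y : R) : x <= y -> lebesgue_measure (`[x, y]%classic : set R) = (y - x)%:E.
{ move=> xy; rewrite lebesgue_measure_itv /= lte_fin; case: ltP => // h.
  have -> : y = x by apply/eqP; rewrite eq_le xy h.
  by rewrite subrr.
}
rewrite /I0 E // subr0 => h.
rewrite -lee_fin; apply: (le_trans h).
apply: lime_le; first by apply: is_cvg_nneseries => i _ _; exact: measure_ge0.
apply: nearW => n; rewrite big_mkord.
rewrite (eq_bigr (fun i : 'I_n => (r i)%:E)); last first.
  by move=> i _; rewrite /J E ?lerDl // addrC addKr.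
rewrite sumEFin lee_fin; exact: hM.
Qed.

Section Chains.
Context {R : realType} (U : set_system nat) {uU : FreeUltraFilter U}.
Context (T : Type) (d : T -> T -> R) (pd : pseudometric d).
Let d0 x : d x x = 0. Proof. by case: pd. Qed.
Let dC x y : d x y = d y x. Proof. by case: pd. Qed.
Let dT x y z : d x z <= d x y + d y z. Proof. by case: pd. Qed.
Let dge0 := pseudometric_ge0 pd.

Inductive chain (A : set T) (e : R) (x : T) : T -> Prop :=
| chain0 : A x -> chain A e x x
| chainS y z : chain A e x y -> A z -> d y z <= e -> chain A e x z.

Definition chain_linked (A : set T) x y := forall e : R, 0 < e -> chain A e x y.
Definition chain_connected (A : set T) := forall x y, A x -> A y -> chain_linked A x y.

Lemma chain_left (A : set T) e x y : chain A e x y -> A x.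
Proof. by elim. Qed.

Lemma chain_right (A : set T) e x y : chain A e x y -> A y.
Proof. by elim. Qed.

Lemma chain_mono A B (e e' : R) x y : A `<=` B -> e <= e' -> chain A e x y -> chain B e' x y.
Proof.
move=> AB ee'; elim=> [/AB Bx|y' z _ IH /AB Bz h]; first exact: chain0.
by apply: chainS IH Bz _; exact: le_trans ee'.
Qed.

Lemma chain_trans A e x y z : chain A e x y -> chain A e y z -> chain A e x z.
Proof. by move=> h; elim=> // y' z' _ IH Az dz; apply: chainS IH Az dz. Qed.

Lemma chain_sym A e x y : chain A e x y -> chain A e y x.
Proof.
elim=> [|y' z h IH Az dz]; first exact: chain0.
have Ay' := chain_right h.
by apply: chain_trans (chainS (chain0 _ Az) Ay' _) IH; rewrite dC.
Qed.

Lemma chain_linked_trans A x y z : chain_linked A x y -> chain_linked A y z -> chain_linked A x z.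
Proof. by move=> h1 h2 e e0; apply: chain_trans (h1 _ e0) (h2 _ e0). Qed.

Lemma chain_linked_sym A x y : chain_linked A x y -> chain_linked A y x.
Proof. by move=> h e e0; apply: chain_sym; exact: h. Qed.

Lemma chain_exit A (e t : R) p z : 0 <= t -> chain A e p z ->
  (exists x, chain (A `&` [set u | d p u <= t]) e p x /\ t - e <= d p x) \/
  chain (A `&` [set u | d p u <= t]) e p z.
Proof.
move=> t0; elim=> [Ap|y' z' h IH Az dz]; first by right; apply: chain0; split; rewrite //= d0.
case: IH => [|IH]; first by left.
have [h1|h1] := leP (d p z') t; first by right; apply: chainS IH _ dz.
by left; exists y'; split=> //; have := dT p y' z'; lra.
Qed.

(* Boundary bumping: a chain-connected set leaving a ball contains a
   chain-connected part of the ball that reaches its boundary. *)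
Lemma chain_linked_cut A p z (t : R) : ultra_compact U d A -> chain_linked A p z ->
  0 <= t -> t <= d p z ->
  exists x, [/\ A x, d p x = t & chain_linked (A `&` [set u | d p u <= t]) p x].
Proof.
move=> cA hc t0 tz.
have H n : exists x, chain (A `&` [set u | d p u <= t]) n.+1%:R^-1 p x /\ t - n.+1%:R^-1 <= d p x.
{ have n0 : (0 : R) < n.+1%:R^-1 by rewrite invr_gt0.
  have [//|h] := chain_exit t0 (hc _ n0); exists z; split=> //.
  by apply: le_trans tz; rewrite gerBl ltW.
}
have /choice[x hx] := H.
have hin n : (A `&` [set u | d p u <= t]) (x n) by have [h _] := hx n; exact: chain_right h.
have [y [Ay /= py] cy] := ultra_compact_ball pd (p := p) (t := t) cA hin.
exists y; split=> //.
{ apply/eqP; rewrite eq_le py /= leNgt; apply/negP => hlt.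
  have e0 : 0 < (t - d p y) / 2 by rewrite divr_gt0 // subr_gt0.
  have [n [/= h1 h2]] := filter_ex (filterI (cy _ e0) (free_ultra_invS_lt e0)).
  have [_ h3] := hx n; have := dT p y (x n); rewrite (dC y).
  move: h2 h3; move: (n.+1%:R^-1 : R) => q; lra.
}
move=> e e0; have [n [/= h1 h2]] := filter_ex (filterI (cy _ e0) (free_ultra_invS_lt e0)).
have [h3 _] := hx n; apply: (@chainS _ _ _ (x n)); [|by split|exact: ltW].
by apply: chain_mono h3 => //; exact: ltW.
Qed.

Definition quasicomponent (A : set T) p := [set x | chain_linked A p x].

Lemma quasicomponent_sub A p : quasicomponent A p `<=` A.
Proof. by move=> x /(_ 1 ltr01); exact: chain_right. Qed.

Lemma ultra_compact_quasicomponent A p : ultra_compact U d A -> ultra_compact U d (quasicomponent A p).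
Proof.
move=> cA u hu; have [|x Ax cx] := cA u; first by move=> n; exact: (@quasicomponent_sub A p).
exists x => // e e0; have [n /= hn] := filter_ex (cx _ e0).
by apply: chainS (hu n e e0) Ax _; exact: ltW.
Qed.

Lemma chain_connected_quasicomponent A p : ultra_compact U d A -> A p ->
  chain_connected (quasicomponent A p).
Proof.
move=> cA Ap.
have Qp : quasicomponent A p p by move=> e e0; exact: chain0.
suff h x : quasicomponent A p x -> chain_linked (quasicomponent A p) p x.
  by move=> x y /h hx /h hy; apply: chain_linked_trans hy; exact: chain_linked_sym.
move=> Qx e e0; have e3 : 0 < e / 3 by rewrite divr_gt0.
have [dl [dl0 hdl]] : exists dl : R, 0 < dl /\ forall y, chain A dl p y ->
    exists2 q, quasicomponent A p q & d y q < e / 3.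
{ apply: contrapT => hn.
  have nx n : exists y, chain A n.+1%:R^-1 p y /\ forall q, quasicomponent A p q -> e / 3 <= d y q.
    apply: contrapT => h; apply: hn; exists n.+1%:R^-1; split; first by rewrite invr_gt0.
    move=> y hy; apply: contrapT => h2; apply: h; exists y; split=> // q Qq.
    by rewrite leNgt; apply/negP => h3; apply: h2; exists q.
  have /choice[y hy] := nx.
  have [|z Az cz] := cA y; first by move=> n; have [h _] := hy n; exact: chain_right h.
  have Qz : quasicomponent A p z.
    move=> e' e'0; have [n [/= h1 h2]] := filter_ex (filterI (cz _ e'0) (free_ultra_invS_lt e'0)).
    apply: (@chainS _ _ _ (y n)) => //; last exact: ltW.
    by have [h3 _] := hy n; apply: chain_mono h3 => //; exact: ltW.
  have [n /= h1] := filter_ex (cz _ e3).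
  by have [_ /(_ z Qz)] := hy n; lra.
}
pose e1 := Num.min dl (e / 3).
have e10 : 0 < e1 by rewrite lt_min dl0.
have shadow y : chain A e1 p y -> exists q, chain (quasicomponent A p) e p q /\ d y q <= e / 3.
{ elim=> [_|y' z h [q [hq dq]] Az dz].
    by exists p; split; [exact: chain0|rewrite d0 ltW].
  have [|q' Qq' dq'] := hdl z.
    apply: (@chain_mono A A e1 dl) => //; first by rewrite ge_min lexx.
    exact: chainS h Az dz.
  exists q'; split; last exact: ltW.
  apply: chainS hq Qq' _; have : e1 <= e / 3 by rewrite ge_min lexx orbT.
  by have := dT q y' q'; have := dT y' z q'; rewrite (dC q y'); lra.
}
have [q [hq dq]] := shadow x (Qx _ e10).
by apply: chainS hq Qx _; rewrite dC; lra.
Qed.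

Lemma length_ge_dist A x y (c : R) : ultra_compact U d A -> chain_linked A x y -> c < d x y ->
  ~ hausdorff_le d 1 A c.
Proof.
move=> cA hc cxy hle.
pose e := (d x y - c) / 2.
have e0 : 0 < e by rewrite /e divr_gt0 // subr_gt0.
have [V [r [h1 h2 h3 h4]]] := hle 1 e ltr01 e0.
pose S i := [set d x z | z in V i `&` A].
have : d x y <= c + e.
{ apply: (@interval_cover_length R _ _ (fun i => inf (S i)) r) => //.
  - by move=> i; have /andP[] := h2 i.
  - move=> s /andP[s0 sD]; have [z [Az dz _]] := chain_linked_cut cA hc s0 sD.
    have [i _ Vz] := h1 z Az; exists i.
    have Si : has_lbound (S i) by exists 0 => _ [w _ <-]; exact: dge0.
    apply/andP; split; first by apply: ge_inf => //; exists z.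
    rewrite -lerBlDr; apply: lb_le_inf; first by exists s; exists z.
    move=> _ [w [Vw Aw] <-]; have := h3 i _ _ Vz Vw; have := dT x w z; rewrite (dC w z).
    by rewrite -dz; lra.
}
by rewrite /e; lra.
Qed.

Lemma length_ball_ge A a z (t c : R) : ultra_compact U d A -> chain_connected A -> A a -> A z ->
  0 <= t -> t <= d a z ->
  c < t -> ~ hausdorff_le d 1 (A `&` [set u | d a u <= t]) c.
Proof.
move=> cA hA Aa Az t0 taz ct.
have [x [Ax dx hc]] := chain_linked_cut cA (hA _ _ Aa Az) t0 taz.
by apply: (length_ge_dist (ultra_compact_ball pd cA) hc); rewrite dx.
Qed.

Lemma length_disjoint_balls (I : finType) (A : set T) (p : I -> T) (t : I -> R) (c : R) :
  ultra_compact U d A -> chain_connected A -> (forall i, A (p i)) -> (forall i, 0 <= t i) ->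
  (forall i, exists2 q, A q & t i <= d (p i) q) ->
  (forall i j, i != j -> t i + t j < d (p i) (p j)) ->
  c < \sum_i t i -> ~ hausdorff_le d 1 A c.
Proof.
move=> cA hA Ap t0 At disj ct.
pose ball i := A `&` [set u | d (p i) u <= t i].
have sep i j : i != j -> positively_separated d (ball i) (ball j).
  move=> /disj ij; exists (d (p i) (p j) - (t i + t j)); first by rewrite subr_gt0.
  move=> x y [_ /= xi] [_ /= yj]; have := dT (p i) x (p j); have := dT x y (p j).
  by rewrite (dC y (p j)); lra.
have len i b : b < t i -> ~ hausdorff_le d 1 (ball i) b.
  have [q Aq tq] := At i; exact: (length_ball_ge cA hA (Ap i) Aq (t0 i) tq).
apply: contra_not (hausdorff_le_superadditive_sum pd (ltn0Sn 0) sep len ct).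
by apply: hausdorff_leS => // x [i _ []].
Qed.

(* The balls around a, b, z with radii the Gromov products are disjoint. *)
Lemma length_gt_excess A a b z (c : R) : ultra_compact U d A -> chain_connected A ->
  A a -> A b -> A z -> d a b < d a z + d z b -> 0 < d a b ->
  c < d a b + (d a z + d z b - d a b) / 2 -> ~ hausdorff_le d 1 A c.
Proof.
move=> cA hA Aa Ab Az ex D0 hc.
have t1 := dT a b z; have t2 := dT z a b; rewrite (dC b z) in t1; rewrite (dC z a) in t2.
set D := d a b in ex D0 hc t1 t2 *; set x := d a z in ex hc t1 t2 *.
set y := d z b in ex hc t1 t2 *; pose S := (x + y + D) / 2.
have S0 : 0 < S by rewrite /S; lra.
have [nu /andP[nu0 nu1] cS] : exists2 nu : R, 0 < nu < 1 & c < (1 - nu) * S.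
  have [c0|c0] := ltP c 0.
    by exists (1 / 2); [apply/andP; split; lra|apply: (lt_trans c0); rewrite mulr_gt0 //; lra].
  exists ((S - c) / (2 * S)); last first.
    by rewrite [X in _ < X](_ : _ = (S + c) / 2); [rewrite /S; lra|field; rewrite lt0r_neq0].
  by rewrite divr_gt0 ?mulr_gt0 // ?ltr_pdivrMr ?mulr_gt0 //; rewrite /S; lra.
pose p (i : 'I_3) := nth a [:: a; b; z] i.
pose r := [:: (x + D - y) / 2; (y + D - x) / 2; (x + y - D) / 2].
pose t (i : 'I_3) := (1 - nu) * r`_i.
have r_shrink u v w : 0 <= u -> 0 <= v -> 0 < w -> u + v = w ->
    (1 - nu) * u + (1 - nu) * v < w.
  by move=> u0 v0 w0 uvw; rewrite -mulrDr uvw gtr_pMl //; lra.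
have shrink u : 0 <= u -> (1 - nu) * u <= u by move=> u0; rewrite ler_piMl //; lra.
apply: (@length_disjoint_balls _ A p t) => // [i|i|i|i j ij|].
- by case: i => -[|[|[|//]]].
- by rewrite mulr_ge0 //; [lra|case: i => -[|[|[|//]]] /= _; lra].
- case: i => -[|[|[|//]]] /= ?; rewrite /p /t /=; [exists b|exists a|exists a] => //;
    rewrite ?(dC b a) ?(dC z a) -/D -/x; apply: le_trans (shrink _ _) _; lra.
- case: i j ij => -[|[|[|//]]] ? [[|[|[|//]]] ?] //= _; rewrite /p /t /=;
    rewrite ?(dC b a) ?(dC z a) ?(dC b z) -/D -/x -/y; apply: r_shrink; lra.
by rewrite !big_ord_recl big_ord0 /t /=; move: cS; rewrite /S; lra.
Qed.

Lemma ultra_compact_diameter A p : ultra_compact U d A -> A p -> exists a b, [/\ A a, A b &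
  forall u v, A u -> A v -> d u v <= d a b].
Proof.
move=> cA Ap.
pose S : set R := [set r | exists u v, [/\ A u, A v & r = d u v]].
have S0 : S !=set0 by exists (d p p), p, p.
have Sb : has_ubound S.
{ apply: contrapT => hn.
  have nx n : exists u, A u /\ n%:R < d p u.
    apply: contrapT => h; apply: hn; exists (2 * n%:R) => _ [u [v [Au Av ->]]].
    have hle w : A w -> d p w <= n%:R by move=> Aw; rewrite leNgt; apply/negP => hw; apply: h; exists w.
    by have := dT u p v; rewrite (dC u p); have := hle u Au; have := hle v Av; lra.
  have /choice[u hu] := nx.
  have [|x Ax cx] := cA u; first by move=> n; case: (hu n).
  have [n hn1 /= hn2] := free_ultra_ex_ge (Num.truncn (d p x + 1)).+1 (cx _ ltr01).
  have [_ h1] := hu n; have h2 := truncnS_gt (d p x + 1).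
  have h3 : ((Num.truncn (d p x + 1)).+1%:R : R) <= n%:R by rewrite ler_nat.
  by have := dT p x (u n); rewrite (dC x); lra.
}
have nx n : exists uv, [/\ A uv.1, A uv.2 & sup S - n.+1%:R^-1 < d uv.1 uv.2].
{ have n0 : (0 : R) < n.+1%:R^-1 by rewrite invr_gt0.
  have : sup S - n.+1%:R^-1 < sup S by rewrite ltrBlDr ltrDl.
  by move=> /(sup_gt S0)[_ [u [v [Au Av ->]]] h]; exists (u, v).
}
have /choice[w hw] := nx.
have [|a Aa ca] := cA (fun n => (w n).1); first by move=> n; case: (hw n).
have [|b Ab cb] := cA (fun n => (w n).2); first by move=> n; case: (hw n).
exists a, b; split=> // u v Au Av.
have : d u v <= sup S by apply: ub_le_sup => //; exists u, v.
move=> h; apply: (le_trans h); rewrite leNgt; apply/negP => hlt.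
have e0 : 0 < (sup S - d a b) / 2 by rewrite divr_gt0 // subr_gt0.
have [n [/= h1 h2]] := filter_ex (filterI (ultra_cvg_dist pd ca cb e0) (free_ultra_invS_lt e0)).
have [_ _ h3] := hw n; move: h1; rewrite ltr_norml => /andP[_ h1].
by move: h2 h3 h1; move: (n.+1%:R^-1 : R) => q; lra.
Qed.

Definition near_straight (W : set T) p a b (e : R) :=
  [/\ ultra_compact U d W, chain_connected W, W p /\ (W a /\ W b),
    forall u v, W u -> W v -> d u v <= d a b
    & forall z, W z -> d a z + d z b <= (1 + e) * d a b].

Section VitaliLength.
Variables (ga : set T) (a q : R).
Hypotheses (ga_len : hausdorff_le d 1 ga a) (q0 : 0 < q).

Definition long_piece (W : set T) (D : R) := [/\ W `<=` ga, ultra_compact U d W, 0 <= D,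
  forall u v, W u -> W v -> d u v <= D & forall c, c < q * D -> ~ hausdorff_le d 1 W c].

Lemma long_piece0 : long_piece set0 0.
Proof.
split=> //; first exact: ultra_compact0.
by move=> c; rewrite mulr0 => c0 /hausdorff_le_ge0; lra.
Qed.

Lemma disjoint_long_pieces (I : finType) (W : I -> set T) (D : I -> R) :
  (forall i, long_piece (W i) (D i)) ->
  (forall i j x y, i != j -> W i x -> W j y -> d x y <> 0) -> \sum_i D i <= a / q.
Proof.
move=> long disj; rewrite ler_pdivlMr // mulrC mulr_sumr leNgt; apply/negP => lt_a.
have sep i j : i != j -> positively_separated d (W i) (W j).
  have [_ cWi _ _ _] := long i; have [_ cWj _ _ _] := long j => ij.
  by apply: (ultra_compact_separated pd cWi cWj) => x y; exact: disj.
have mass i : forall b, b < q * D i -> ~ hausdorff_le d 1 (W i) b by have [] := long i.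
apply: (hausdorff_le_superadditive_sum pd (ltn0Sn 0) sep mass lt_a).
by apply: hausdorff_leS ga_len => // x [i _]; have [+ _ _ _ _] := long i; apply.
Qed.

Variable N : set T.
Hypothesis fine_cover : forall p (t : R), ga p -> ~ N p -> 0 < t ->
  exists W D, [/\ W p, 0 < D, long_piece W D & D < t].

Lemma vitali_long_pieces (dl : R) : 0 < dl -> exists (W : nat -> set T) (D : nat -> R),
  [/\ forall n, long_piece (W n) (D n), forall n, 5 * D n <= dl,
    forall m n x y, m != n -> W m x -> W n y -> d x y <> 0
  & forall p t, ga p -> ~ N p -> 0 < t ->
    exists n, exists2 x, W n x & d p x < t /\ d p x <= 2 * D n].
Proof.
move=> dl0.
pose F := [set i : set T * R | [/\ long_piece i.1 i.2, 0 < i.2 & 5 * i.2 <= dl]].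
pose meet (i j : set T * R) := exists x y, [/\ i.1 x, j.1 y & d x y = 0].
have meetC i j : meet i j -> meet j i.
  by move=> [x [y [? ? xy]]]; exists y, x; split=> //; rewrite dC.
have [i [_ i0 hi]|u uF u_meet e e0|s [sF s_meet s_max]] := @vitali_selection R _ snd F meet dl.
- by rewrite i0; lra.
- apply: contrapT => hn.
  have ge_e n : e <= (u n).2 by rewrite leNgt; apply/negP => h; apply: hn; exists n.
  pose n := (Num.truncn (a / q / e)).+1.
  have : \sum_(i < n) (u i).2 <= a / q.
    apply: (@disjoint_long_pieces _ (fun i : 'I_n => (u i).1)) => [i|i j x y].
      by have [] := uF i.
    rewrite -val_eqE neq_ltn => /orP[ij|ji] xi yj xy; first by apply: (u_meet _ _ ij); exists x, y.
    by apply: (u_meet _ _ ji); apply: meetC; exists x, y.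
  rewrite leNgt => /negP; apply; apply: (@lt_le_trans _ _ (\sum_(i < n) e)).
    by rewrite sumr_const card_ord -[_ *+ n]mulr_natl -ltr_pdivrMr //; exact: truncnS_gt.
  by apply: ler_sum.
exists (fun n => oapp fst set0 (s n)), (fun n => oapp snd 0 (s n)); split.
- by move=> n; case E : (s n) => [i|] /=; [have [] := sF _ _ E|exact: long_piece0].
- by move=> n; case E : (s n) => [i|] /=; [have [] := sF _ _ E|rewrite mulr0 ltW].
- move=> m n x y; case Em : (s m) => [i|] //; case En : (s n) => [j|] //=.
  rewrite neq_ltn => /orP[mn|nm] xi yj xy; first by apply: (s_meet _ _ _ _ mn Em En); exists x, y.
  by apply: (s_meet _ _ _ _ nm En Em); apply: meetC; exists x, y.
move=> p t gp nNp t0; have [|W [D [Wp D0 longW]]] := fine_cover gp nNp (_ : 0 < Num.min t (dl / 5)).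
  by rewrite lt_min t0 divr_gt0.
rewrite lt_min => /andP[Dt Ddl].
have [|n [i [sn [x [y [xi Wy xy]]] Di]]] := s_max (W, D); first by split=> //=; lra.
exists n; rewrite sn; exists x => //=; have [_ _ _ WD _] := longW.
by have := WD _ _ Wp Wy; have := dT p y x; rewrite (dC y x) xy /= in Di *; lra.
Qed.

Lemma vitali_length_le : hausdorff_null d 1 N -> hausdorff_le d 1 ga (a / q).
Proof.
move=> nN dl e dl0 e0; have [W [D [long D5 disj cov]]] := vitali_long_pieces dl0.
have D0 n : 0 <= D n by have [] := long n.
have D_sum n : \sum_(i < n) D i <= a / q.
  by apply: (@disjoint_long_pieces _ (fun i : 'I_n => W i)) => // i j x y; exact: disj.
have [m tail_m] := bounded_sum_tail D0 D_sum (divr_gt0 e0 (ltr0n R 8)).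
pose tail i := if (i < m)%N then 0 else D i.
have tail_bounds i : 0 <= tail i <= D i by rewrite /tail; case: ifP; rewrite ?lexx ?D0.
have cov_tail n : \sum_(i < n) (D i + 4 * tail i) <= a / q + e / 2.
  by rewrite big_split /= -mulr_sumr; have := D_sum n; have := tail_m n; rewrite -/(tail _); lra.
have -> : a / q + e = a / q + e / 2 + e / 2 by lra.
apply: (@cover_sum_leS R T d 1 _ ((ga `\` N) `|` N) dl (a / q + e / 2 + e / 2)) => //.
  by move=> x gx; have [Nx|Nx] := pselect (N x); [right|left].
apply: (cover_sum_leU (ltn0Sn 0) (ltW dl0)); last first.
  by have := nN dl (e / 2) dl0 (divr_gt0 e0 (ltr0n R 2)); rewrite add0r.
exists (fun n => [set x | exists2 u, W n u & d x u <= 2 * tail n]).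
exists (fun n => D n + 4 * tail n); split=> [p [gp nNp]|n|n x y [u Wu xu] [v Wv yv]|n].
- have [[n nm [u Wu pu]]|off] :=
    pselect (exists2 n, (n < m)%N & exists2 u, W n u & d p u = 0).
    by exists n => //; exists u; rewrite // pu /tail nm mulr0.
  have [i|t t0 ht] := @positively_separated_bigcup R T d _ (fun i : 'I_m => W i) [set p].
    have [_ cW _ _ _] := long i.
    have c1 : ultra_compact U d [set p] by exact: ultra_compact1.
    apply: (ultra_compact_separated pd cW c1) => u _ Wu -> up.
    by apply: off; exists i => //; exists u; rewrite // dC.
  have [n [x Wx [px px2]]] := cov p t gp nNp t0.
  exists n => //; exists x => //; rewrite /tail; case: ltnP => // nm.
  have : t <= d x p by apply: ht => //; exists (Ordinal nm).
  by rewrite dC; lra.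
- by have := D5 n; have := tail_bounds n; lra.
- have [_ _ _ WD _] := long n; have := WD _ _ Wu Wv.
  by have := dT x u y; have := dT u v y; rewrite (dC v y); lra.
by under eq_bigr do rewrite expr1; exact: cov_tail.
Qed.

End VitaliLength.

(* At scale [r] around [p], a continuum is either almost straight or contains a
   piece whose length exceeds its diameter by a definite factor. *)
Lemma near_straight_or_long (ga : set T) p z (e r : R) : ultra_compact U d ga ->
  chain_connected ga -> ga p -> ga z -> 0 < e -> 0 < r -> r <= d p z ->
  (exists W a b, [/\ W `<=` ga, near_straight W p a b e, r <= d a b
    & forall u, W u -> d p u <= r]) \/
  exists W D, [/\ W p, 0 < D, long_piece ga (1 + e / 2) W D & D <= 2 * r].
Proof.
move=> cg hg gp gz e0 r0 pz.
have [x [gx px link]] := chain_linked_cut cg (hg _ _ gp gz) (ltW r0) pz.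
pose A := ga `&` [set u | d p u <= r].
have cA : ultra_compact U d A by exact: ultra_compact_ball.
have Ap : A p by split=> //=; rewrite d0 ltW.
pose W := quasicomponent A p.
have cW : ultra_compact U d W by exact: ultra_compact_quasicomponent.
have hW : chain_connected W by exact: chain_connected_quasicomponent.
have Wp : W p by move=> e' _; exact: chain0.
have [a [b [Wa Wb diam_ab]]] := ultra_compact_diameter cW Wp.
have Wsub u : W u -> ga u /\ d p u <= r by move=> /quasicomponent_sub.
have rab : r <= d a b by rewrite -px; exact: diam_ab.
have [[z' Wz' hz']|short] := pselect (exists2 z', W z' & (1 + e) * d a b < d a z' + d z' b).
  right; exists W, (d a b); split=> //; first exact: lt_le_trans rab.
    split=> // [u /Wsub[]//|c hc]; apply: (length_gt_excess cW hW Wa Wb Wz').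
    - by apply: lt_trans hz'; rewrite ltr_pMl ?(lt_le_trans r0 rab) // ltrDl.
    - exact: lt_le_trans rab.
    by apply: (lt_le_trans hc); lra.
  by have [_ h1] := Wsub _ Wa; have [_ h2] := Wsub _ Wb; have := dT a p b; rewrite (dC a p); lra.
left; exists W, a, b; split=> // [u /Wsub[]//||u /Wsub[]//].
split=> // w Ww; rewrite leNgt; apply/negP => h; apply: short; by exists w.
Qed.

Lemma near_straight_exists (ga N : set T) (e : R) p0 p1 : ultra_compact U d ga ->
  chain_connected ga -> hausdorff_finite d 1 ga -> ga p0 -> ga p1 -> 0 < d p0 p1 ->
  hausdorff_null d 1 N -> 0 < e ->
  exists p, [/\ ga p, ~ N p & exists2 r0 : R, 0 < r0 & forall r : R, 0 < r -> r < r0 ->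
    exists W a b, [/\ W `<=` ga, near_straight W p a b e, r <= d a b
      & forall u, W u -> d p u <= r]].
Proof.
move=> cg hg fg g0 g1 d01 nN e0; apply: contrapT => none.
have [a a_le a_min] := hausdorff_finite_least fg.
have a0 : 0 < a.
  rewrite ltNge; apply/negP => h; apply: (length_ge_dist (c := a) cg (hg _ _ g0 g1)) => //.
  exact: le_lt_trans d01.
have q1 : 1 < 1 + e / 2 by lra.
have q0 : 0 < 1 + e / 2 by lra.
apply: (a_min (a / (1 + e / 2))); first by rewrite ltr_pdivrMr // ltr_pMr.
apply: (vitali_length_le a_le q0 _ nN) => p t gp nNp t0.
pose r1 := Num.min (t / 4) (d p0 p1 / 2).
have r10 : 0 < r1 by rewrite lt_min !divr_gt0.
have [r [r0 + no_straight]] : exists r : R, [/\ 0 < r, r < r1 & ~ exists W a b,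
    [/\ W `<=` ga, near_straight W p a b e, r <= d a b & forall u, W u -> d p u <= r]].
  apply: contrapT => h; apply: none; exists p; split=> //; exists r1 => // r r0 rr1.
  by apply: contrapT => h2; apply: h; exists r.
rewrite lt_min => /andP[rt r01].
have [z gz pz] : exists2 z, ga z & r <= d p z.
  have [h|h] := leP r (d p p0); first by exists p0.
  by exists p1 => //; have := dT p0 p p1; rewrite (dC p0 p); lra.
have [//|[W [D [Wp D0 longW Dr]]]] := near_straight_or_long cg hg gp gz e0 r0 pz.
by exists W, D; split=> //; lra.
Qed.

End Chains.

(** * Covering dimension by slicing *)

Section CovDim.
Context {R : realType} (U : set_system nat) {uU : FreeUltraFilter U}.
Context (T : Type) (d : T -> T -> R) (pd : pseudometric d).
Hypothesis d_sep : forall x y, d x y = 0 -> x = y.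
Let d0 x : d x x = 0. Proof. by case: pd. Qed.
Let dC x y : d x y = d y x. Proof. by case: pd. Qed.
Let dT x y z : d x z <= d x y + d y z. Proof. by case: pd. Qed.
Let dge0 := pseudometric_ge0 pd.

Definition zero_dimensional (A : set T) := forall e : R, 0 < e -> exists2 dl : R, 0 < dl &
  forall x y, chain d A dl x y -> d x y <= e.

(* A fine chain in the union is shadowed by a chain in [A], up to its last
   excursion in [B]. *)
Lemma chain_setU_shadow A B (a b dl : R) x y :
  (forall u v, chain d B b u v -> d u v <= a / 4) -> 0 < a -> dl <= a / 4 -> dl <= b ->
  A x -> chain d (A `|` B) dl x y ->
  exists z, chain d A a x z /\ (y = z \/ exists w, chain d B b w y /\ d z w <= a / 4).
Proof.
move=> smallB a0 dla dlb Ax.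
elim=> [_|y' z' _ [z [xz [->|[w [wy zw]]]]] [Az|Bz] yz].
- by exists x; split; [exact: chain0|left].
- by exists z'; split; [apply: chainS xz Az _; lra|left].
- by exists z; split=> //; right; exists z'; split; [exact: chain0|lra].
- exists z'; split; last by left.
  by apply: chainS xz Az _; have := smallB _ _ wy; have := dT z w z'; have := dT w y' z'; lra.
- by exists z; split=> //; right; exists w; split=> //; apply: chainS wy Bz _; lra.
Qed.

Lemma chain_setU_enter A B (b dl : R) x y : dl <= b -> B x -> chain d (A `|` B) dl x y ->
  chain d B b x y \/
  exists v z, [/\ chain d B b x v, A z, d v z <= dl & chain d (A `|` B) dl z y].
Proof.
move=> dlb Bx; elim=> [_|y' z' _ [xy|[v [z [xv Az vz zy]]]] ABz yz].
- by left; exact: chain0.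
- case: ABz => [Az|Bz]; last by left; apply: chainS xy Bz _; lra.
  by right; exists y', z'; split=> //; apply: chain0; left.
by right; exists v, z; split=> //; apply: chainS zy ABz yz.
Qed.

Lemma zero_dimensionalU A B : zero_dimensional A -> zero_dimensional B ->
  zero_dimensional (A `|` B).
Proof.
move=> hA hB e e0; have e3 : 0 < e / 3 by rewrite divr_gt0.
have [a' a'0 smallA'] := hA _ e3.
pose a := Num.min a' (e / 3); have a0 : 0 < a by rewrite lt_min a'0.
have ae : a <= e / 3 by rewrite ge_min lexx orbT.
have smallA x y : chain d A a x y -> d x y <= e / 3.
  by move=> xy; apply: smallA'; apply: chain_mono xy => //; rewrite ge_min lexx.
have [b b0 smallB] := hB _ (divr_gt0 a0 (ltr0n R 4)).
pose dl := Num.min b (a / 4); have dl0 : 0 < dl by rewrite lt_min b0 divr_gt0.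
have dlb : dl <= b by rewrite ge_min lexx.
have dla : dl <= a / 4 by rewrite ge_min lexx orbT.
have from_A x y : A x -> chain d (A `|` B) dl x y -> d x y <= e / 3 + a / 2.
  move=> Ax /(chain_setU_shadow smallB a0 dla dlb Ax)[z [/smallA xz [->|[w [/smallB wy zw]]]]].
    lra.
  by have := dT x z y; have := dT z w y; lra.
exists dl => // x y xy; case: (chain_left xy) => [Ax|Bx]; first by have := from_A _ _ Ax xy; lra.
have [/smallB|[v [z [/smallB xv Az vz /(from_A _ _ Az)]]]] := chain_setU_enter dlb Bx xy.
  lra.
by have := dT x v y; have := dT v z y; lra.
Qed.

Lemma not_zero_dimensional A : ultra_compact U d A -> ~ zero_dimensional A ->
  exists x y, [/\ A x, A y, 0 < d x y & chain_linked d A x y].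
Proof.
move=> cA /existsNP[e /not_implyP[e0 hn]].
have nx n : exists w, chain d A n.+1%:R^-1 w.1 w.2 /\ e < d w.1 w.2.
{ apply: contrapT => h; apply: hn; exists n.+1%:R^-1; first by rewrite invr_gt0.
  by move=> x y hc; rewrite leNgt; apply/negP => hxy; apply: h; exists (x, y).
}
have /choice[w hw] := nx.
have [|x Ax cx] := cA (fun n => (w n).1); first by move=> n; have [h _] := hw n; exact: (chain_left h).
have [|y Ay cy] := cA (fun n => (w n).2); first by move=> n; have [h _] := hw n; exact: (chain_right h).
exists x, y; split=> //.
{ have e2 : 0 < e / 2 by rewrite divr_gt0.
  have [n /= h1] := filter_ex (ultra_cvg_dist pd cx cy e2).
  by have [_ h2] := hw n; move: h1; rewrite ltr_norml => /andP[? ?]; lra.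
}
move=> e' e'0; have [n [[/= h1 h2] h3]] :=
  filter_ex (filterI (filterI (cx _ e'0) (cy _ e'0)) (free_ultra_invS_lt e'0)).
have [h4 _] := hw n; apply: (@chainS _ _ _ _ _ _ (w n).2) => //; last exact: ltW.
apply: (@chain_trans _ _ _ _ _ _ (w n).1); last by apply: (chain_mono _ _ h4) => //; exact: ltW.
apply: (@chainS _ _ _ _ _ _ x); [exact: chain0|exact: (chain_left h4)|].
by rewrite dC ltW.
Qed.

Definition colouring (n : nat) (A : set T) (e : R) (I : finType) (F : I -> set T)
    (col : I -> nat) :=
  [/\ forall i, F i `<=` A /\ ultra_compact U d (F i),
      forall i x y, F i x -> F i y -> d x y <= e,
      forall x, A x -> exists i, F i x
    & (forall i, (col i <= n)%N) /\
      forall i j x, i != j -> col i = col j -> F i x -> F j x -> False].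

Definition colourable (n : nat) (A : set T) := forall e : R, 0 < e ->
  exists (I : finType) (F : I -> set T) (col : I -> nat), colouring n A e F col.

Lemma colouring0 n e (F : 'I_0 -> set T) (col : 'I_0 -> nat) : colouring n set0 e F col.
Proof. by split=> [[]|[]|x []|] //; split=> -[]. Qed.

Lemma zero_dimensional_colourable A : ultra_compact U d A -> zero_dimensional A -> colourable 0 A.
Proof.
move=> cA hA e e0; have [dl dl0 hdl] := hA e e0.
have [l [lA hl]] := finite_net pd cA dl0.
have [->|/set0P[x0 Ax0]] := eqVneq A set0.
  by exists 'I_0, (fun=> set0), (fun=> 0%N); exact: colouring0.
pose z (i : 'I_(length l)) := List.nth i l x0.
pose F i := [set x | chain d A dl (z i) x /\
  forall j : 'I_(length l), (j < i)%N -> ~ chain d A dl (z j) x].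
exists 'I_(length l), F, (fun=> 0%N); split=> //.
{ move=> i; split; first by move=> x [h _]; exact: (chain_right h).
  move=> u hu; have [|x Ax cx] := cA u; first by move=> n; have [h _] := hu n; exact: (chain_right h).
  have [n /= hn] := filter_ex (cx _ dl0); have [h1 h2] := hu n.
  exists x => //; split; first by apply: chainS h1 Ax _; exact: ltW.
  move=> j ji hj; apply: (h2 j ji); apply: chainS hj (chain_right h1) _; by rewrite dC ltW.
}
{ move=> i x y [hx _] [hy _]; apply: hdl; apply: chain_trans hy; exact: (chain_sym pd hx).
}
{ move=> x Ax; have [y ly dy] := hl x Ax.
  have [i [il hi]] := List.In_nth _ _ x0 ly.
  have [i' hi'] : exists i : 'I_(length l), chain d A dl (z i) x.
    have il' : (i < length l)%N by apply/ssrnat.ltP.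
    exists (Ordinal il'); rewrite /z /= hi; apply: chainS (chain0 _ _ (lA _ ly)) Ax _.
    by rewrite dC ltW.
  have [i'' h1 h2] := @arg_minnP _ i' (fun i => `[< chain d A dl (z i) x >])
    (fun i : 'I_(length l) => i : nat) (asboolT hi').
  exists i''; split; first exact/asboolP.
  by move=> j ji hj; have := h2 j (asboolT hj); rewrite leqNgt ji.
}
split=> // i j x ij _ [h1 h2] [h3 h4].
have : (i : nat) != j by [].
by rewrite neq_ltn => /orP[/h4|/h2]; apply.
Qed.

Lemma ultra_compactU A B : ultra_compact U d A -> ultra_compact U d B -> ultra_compact U d (A `|` B).
Proof.
move=> cA cB u hu.
have cluster (C : set T) : ultra_compact U d C -> U [set n | C (u n)] ->
  exists2 x, C x & ultra_cvg U d u x.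
{ move=> cC hC; have [n0 Cn0] := filter_ex hC.
  pose v n := if `[< C (u n) >] then u n else u n0.
  have [|x Cx cx] := cC v; first by move=> n; rewrite /v; case: asboolP.
  exists x => // e e0; apply: filterS (filterI hC (cx _ e0)) => n [/= h1].
  by rewrite /v asboolT.
}
have [h|/ultra_setC h] := pselect (U [set n | A (u n)]).
  by have [x Ax cx] := cluster A cA h; exists x => //; left.
have [|x Bx cx] := cluster B cB; last by exists x => //; right.
by apply: filterS h => n /= nA; case: (hu n).
Qed.

Lemma lebesgue_number A (O : T -> set T) : ultra_compact U d A ->
  (forall x, A x -> exists2 e : R, 0 < e & forall y, A y -> d x y < e -> O x y) ->
  exists2 e : R, 0 < e & forall x, A x -> exists2 z, A z & forall y, A y -> d x y < e -> O z y.
Proof.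
move=> cA hO; apply: contrapT => hn.
have nx n : exists x, A x /\ forall z, A z -> exists y, [/\ A y, d x y < n.+1%:R^-1 & ~ O z y].
{ apply: contrapT => h; apply: hn; exists n.+1%:R^-1; first by rewrite invr_gt0.
  move=> x Ax; apply: contrapT => h2; apply: h; exists x; split=> // z Az.
  apply: contrapT => h3; apply: h2; exists z => // y Ay dxy; apply: contrapT => h4.
  by apply: h3; exists y.
}
have /choice[x hx] := nx.
have [|z Az cz] := cA x; first by move=> n; case: (hx n).
have [e e0 he] := hO z Az; have e2 : 0 < e / 2 by rewrite divr_gt0.
have [n [/= h1 h2]] := filter_ex (filterI (cz _ e2) (free_ultra_invS_lt e2)).
have [_ /(_ z Az)[y [Ay dy]]] := hx n; apply; apply: he => //.
by move: h2 dy; have := dT z (x n) y; rewrite (dC z (x n)); move: (n.+1%:R^-1 : R) => q; lra.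
Qed.

Lemma colouring_separated n A e (I : finType) (F : I -> set T) (col : I -> nat) :
  colouring n A e F col -> exists2 s : R, 0 < s &
  forall i j x y, i != j -> col i = col j -> F i x -> F j y -> s <= d x y.
Proof.
move=> [hF _ _ [_ disj]].
have /choice2[s s0 hs] (ij : I * I) : exists2 s : R, 0 < s & ij.1 != ij.2 ->
    col ij.1 = col ij.2 -> forall x y, F ij.1 x -> F ij.2 y -> s <= d x y.
  case: ij => i j /=; have [_|ij] := eqVneq i j; first by exists 1.
  have [cij|ncij] := pselect (col i = col j); last by exists 1 => // _ /ncij.
  have [|s s0 hs] := ultra_compact_separated pd (hF i).2 (hF j).2; last by exists s.
  by move=> x y Fx Fy /d_sep xy; apply: (disj i j x ij cij Fx); rewrite xy.
exists (\big[Num.min/1]_ij s ij); first by apply: lt_bigmin.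
move=> i j x y ij cij Fx Fy; apply: le_trans (hs (i, j) ij cij x y Fx Fy).
exact: bigmin_le_cond.
Qed.

Definition thicken (A F : set T) (t : R) := [set x | A x /\ exists2 u, F u & d x u <= t].

Lemma ultra_compact_thicken A F t : ultra_compact U d A -> ultra_compact U d F ->
  ultra_compact U d (thicken A F t).
Proof.
move=> cA cF; apply: ultra_compact_restrict => // u x hu Ax ux.
have /choice2[v Fv uv] m : exists2 v, F v & d (u m) v <= t by case: (hu m).
have [y Fy vy] := cF v Fv; exists y => //; rewrite leNgt; apply/negP => hlt.
have e0 : 0 < d x y - t by rewrite subr_gt0.
have [m /= hm] := filter_ex (ultra_cvg_dist pd ux vy e0).
by have := uv m; move: hm; rewrite ltr_norml => /andP[? ?]; lra.
Qed.

Lemma ultra_compact_far A B t : ultra_compact U d A ->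
  ultra_compact U d (A `&` [set x | forall u, B u -> t <= d x u]).
Proof.
move=> cA; apply: ultra_compact_restrict => // u x hu _ ux w Bw.
rewrite leNgt; apply/negP => hlt; have e0 : 0 < t - d x w by rewrite subr_gt0.
have [m /= hm] := filter_ex (ux _ e0); have [_ /(_ w Bw)] := hu m.
by have := dT (u m) x w; lra.
Qed.

Definition open_in (K O : set T) := forall y, K y -> O y ->
  exists2 e : R, 0 < e & forall z, K z -> d y z < e -> O z.

Definition boundary_in (K O : set T) := [set y | [/\ K y, ~ O y
  & forall e : R, 0 < e -> exists z, [/\ K z, O z & d y z < e]]].

Lemma boundary_in_setU (K O O' : set T) :
  boundary_in K (O `|` O') `<=` boundary_in K O `|` boundary_in K O'.
Proof.
move=> y [Ky nO yO]; have [no|yes] := pselect (boundary_in K O y); first by left.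
right; split=> // [h|e e0]; first by apply: nO; right.
apply: contrapT => nO'; apply: yes; split=> // [h|e' e'0]; first by apply: nO; left.
have [|z [Kz]] := yO (Num.min e e'); first by rewrite lt_min e0.
rewrite lt_min => -[Oz|O'z] /andP[ze ze']; first by exists z.
by case: nO'; exists z.
Qed.

Lemma boundary_in_bigcup (K : set T) M (O : 'I_M -> set T) :
  boundary_in K (\bigcup_a O a) `<=` \bigcup_a boundary_in K (O a).
Proof.
move=> y [Ky nO yO]; have [e e0|z [hz zy]] := @ultra_cvg_exists _ _ _ _ _ pd (K `&` \bigcup_a O a) y.
  by have [z [Kz Oz yz]] := yO e e0; exists z.
have /ultra_exists[a Oz] : U [set n | exists a, O a (z n)].
  by apply: filterE => n; have [_ [a _ Oa]] := hz n; exists a.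
exists a => //; split=> // [Oy|e e0]; first by apply: nO; exists a.
have [n [/= On zn]] := filter_ex (filterI Oz (zy _ e0)).
by exists (z n); split=> //; [case: (hz n)|rewrite dC].
Qed.

Section Slices.
Context (nullR : set R -> Prop) (S : nat -> R -> set T) (K : set T).
Hypothesis nullR_sub : forall A B, A `<=` B -> nullR B -> nullR A.
Hypothesis nullR0 : nullR set0.
Hypothesis nullRU : forall A B, nullR A -> nullR B -> nullR (A `|` B).
Hypothesis S_closed : forall i t A, A `<=` K -> ultra_compact U d A ->
  ultra_compact U d (A `&` S i t).

Definition slices (l : seq (nat * R)) := [set y | exists2 p, List.In p l & S p.1 p.2 y].

Lemma finite_slice_cover (P : nat * R -> Prop) A (e : R) : A `<=` K -> ultra_compact U d A ->
  (forall x, A x -> exists (O : set T) (l : seq (nat * R)),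
    [/\ O x, open_in K O, forall y z, K y -> K z -> O y -> O z -> d y z <= e,
        forall p, List.In p l -> P p & boundary_in K O `<=` slices l]) ->
  exists M (O : 'I_M -> set T) (l : seq (nat * R)),
  [/\ forall x, A x -> exists a, O a x,
      forall a, [/\ exists2 x, A x & O a x, open_in K (O a)
        & forall y z, K y -> K z -> O a y -> O a z -> d y z <= e],
      forall p, List.In p l -> P p & forall a, boundary_in K (O a) `<=` slices l].
Proof.
move=> AK cA hA.
pose nbhd x (Ol : set T * seq (nat * R)) := [/\ Ol.1 x, open_in K Ol.1,
  forall y z, K y -> K z -> Ol.1 y -> Ol.1 z -> d y z <= e,
  forall p, List.In p Ol.2 -> P p & boundary_in K Ol.1 `<=` slices Ol.2].
have /choice[Ol hOl] x : exists Ol, A x -> nbhd x Ol.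
  have [/hA[V [l h]]|nA] := pselect (A x); last by exists (set0, [::]).
  by exists (V, l).
have [|lam lam0 hlam] := @lebesgue_number A (fun x => (Ol x).1) cA.
  move=> x Ax; have [Ox Oo _ _ _] := hOl x Ax; have [r r0 hr] := Oo x (AK _ Ax) Ox.
  by exists r => // y Ay; apply: hr; exact: AK.
have [net [netA hnet]] := finite_net pd cA lam0.
have /choice[z hz] y : exists z, A y -> A z /\ forall w, A w -> d y w < lam -> (Ol z).1 w.
  have [Ay|nA] := pselect (A y); last by exists y.
  by have [z Az hz] := hlam y Ay; exists z.
have [A0|/set0P[x0 Ax0]] := eqVneq A set0.
  by exists 0%N, (fun=> set0), [::]; split=> [x|[]|p []|[]] //; rewrite A0.
pose pt (a : 'I_(length net)) := List.nth a net x0.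
have net_pt a : List.In (pt a) net by apply: List.nth_In; apply/ssrnat.ltP.
have Az a : A (z (pt a)) by have [] := hz _ (netA _ (net_pt a)).
exists (length net), (fun a => (Ol (z (pt a))).1), (List.flat_map (fun y => (Ol (z y)).2) net).
split.
- move=> x Ax; have [y ly xy] := hnet x Ax.
  have [i [/ssrnat.ltP il yi]] := List.In_nth _ _ x0 ly.
  exists (Ordinal il); rewrite /pt /= yi; have [_] := hz _ (netA _ ly).
  by apply=> //; rewrite dC.
- by move=> a; have [] := hOl _ (Az a); split=> //; exists (z (pt a)).
- move=> p /List.in_flat_map[y [ly lp]]; have [Azy _] := hz _ (netA _ ly).
  by have [_ _ _ h _] := hOl _ Azy; exact: h.
move=> a y yb; have [_ _ _ _ /(_ y yb)[p lp Sp]] := hOl _ (Az a); exists p => //.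
by apply/List.in_flat_map; exists (pt a).
Qed.

(* Small neighbourhoods with boundary in finitely many slices, whose levels
   avoid prescribed null sets. *)
Hypothesis slice_nbhd : forall N : nat -> set R, (forall i, nullR (N i)) ->
  forall x (e : R), K x -> 0 < e -> exists (O : set T) (l : seq (nat * R)),
  [/\ O x, open_in K O, forall y z, K y -> K z -> O y -> O z -> d y z <= e,
      forall p, List.In p l -> ~ N p.1 p.2 & boundary_in K O `<=` slices l].

Fixpoint slice_dim_le (j : nat) (A : set T) : Prop := match j with
  | 0 => zero_dimensional A
  | j'.+1 => forall i, nullR [set t | ~ slice_dim_le j' (A `&` S i t)]
  end.

Lemma slice_dim_leU j A B : slice_dim_le j A -> slice_dim_le j B -> slice_dim_le j (A `|` B).
Proof.
elim: j A B => [|j IH] A B /=; first exact: zero_dimensionalU.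
move=> hA hB i; apply: nullR_sub (nullRU (hA i) (hB i)) => t /= h.
apply: contrapT => /not_orP[/contrapT h1 /contrapT h2]; apply: h.
by rewrite setIUl; exact: IH.
Qed.

Lemma slice_dim_le0 j : slice_dim_le j set0.
Proof.
elim: j => [|j IH] /=; first by move=> e e0; exists 1 => // x y xy; have := chain_left xy.
by move=> i; apply: nullR_sub nullR0 => t /=; rewrite set0I.
Qed.

Section ColouringStep.
Variables (n : nat) (A B : set T) (e : R) (M : nat) (O : 'I_M -> set T).
Hypotheses (AK : A `<=` K) (cA : ultra_compact U d A) (BA : B `<=` A).
Hypotheses (colB : colourable n B) (e0 : 0 < e).
Hypothesis O_cover : forall x, A x -> exists a, O a x.
Hypothesis O_open : forall a, open_in K (O a).
Hypothesis O_small : forall a y z, K y -> K z -> O a y -> O a z -> d y z <= e.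
Hypothesis O_boundary : forall a, A `&` boundary_in K (O a) `<=` B.

Let core (t : R) := A `&` [set x | forall u, B u -> t <= d x u].

Let cell (t : R) (P : {set 'I_M}) := core t `&` [set x | forall a, O a x <-> a \in P].

Let ultra_compact_cell t P : 0 < t -> ultra_compact U d (cell t P).
Proof.
move=> t0; apply: ultra_compact_restrict; first exact: ultra_compact_far.
move=> u x hu [Ax far] ux a; split=> [Oax|aP].
  have [r r0 hr] := O_open (AK Ax) Oax; have [m /= hm] := filter_ex (ux _ r0).
  by have [[Am _] /(_ a) <-] := hu m; apply: hr; [exact: AK|rewrite dC].
apply: contrapT => nO; suff Bx : B x by have := far x Bx; rewrite d0 leNgt t0.
apply: (@O_boundary a); split=> //; split=> // [|r r0]; first exact: AK.
have [m /= hm] := filter_ex (ux _ r0); have [[Am _] hP] := hu m.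
by exists (u m); split; [exact: AK|exact/hP|rewrite dC].
Qed.

(* The thickened colouring of the boundaries keeps its colours; the remaining
   cells are pairwise disjoint and share one new colour. *)
Lemma colouring_step : exists (I : finType) (F : I -> set T) (col : I -> nat),
  colouring n.+1 A e F col.
Proof.
have [I [F [col colF]]] := colB (divr_gt0 e0 (ltr0n R 3)).
have [s s0 hs] := colouring_separated colF; have [hF Fsmall Fcov [col_le _]] := colF.
pose t := Num.min (s / 4) (e / 3); have t0 : 0 < t by rewrite lt_min !divr_gt0.
have ts : t <= s / 4 by rewrite ge_min lexx.
have te : t <= e / 3 by rewrite ge_min lexx orbT.
pose G (w : I + {set 'I_M}) :=
  match w with inl i => thicken A (F i) t | inr P => cell t P end.
exists (I + {set 'I_M})%type, G, (fun w => if w is inl i then col i else n.+1); split.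
- move=> [i|P]; first by split=> [x []//|]; apply: ultra_compact_thicken (hF i).2.
  by split=> [x [[]]|] //; exact: ultra_compact_cell.
- move=> [i|P] x y.
    move=> [_ [u Fu xu]] [_ [v Fv yv]]; have := Fsmall _ _ _ Fu Fv.
    by have := dT x u y; have := dT u v y; rewrite (dC v y); lra.
  move=> [[Ax _] xP] [[Ay _] yP]; have [a Oa] := O_cover Ax.
  by apply: (O_small (a := a)); [exact: AK|exact: AK|by []|exact/yP/xP].
- move=> x Ax; have [far|near] := pselect (core t x).
    exists (inr [set a | `[< O a x >]]%SET); split=> // a; rewrite inE.
    by split=> [h|/asboolP]; [exact/asboolP|].
  have [u [Bu xu]] : exists u, B u /\ d x u < t.
    apply: contrapT => h; apply: near; split=> // u Bu; rewrite leNgt; apply/negP => xu.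
    by apply: h; exists u.
  by have [i Fi] := Fcov u Bu; exists (inl i); split=> //; exists u => //; exact: ltW.
split; first by move=> [i|P] //; exact: leqW.
move=> [i|P] [j|P'] x /=.
- move=> ij cij [_ [u Fu xu]] [_ [v Fv xv]].
  by have := hs i j u v ij cij Fu Fv; have := dT u x v; rewrite (dC u x); lra.
- by move=> _ E; have := col_le i; rewrite E ltnn.
- by move=> _ E; have := col_le j; rewrite -E ltnn.
move=> PP' _ [_ xP] [_ xP']; move/eqP: PP'; apply; congr inr.
by apply/setP => a; apply/idP/idP => [/xP/xP'|/xP'/xP].
Qed.

End ColouringStep.

Lemma slices_dim_le j A l : A `<=` K -> ultra_compact U d A ->
  (forall p, List.In p l -> slice_dim_le j (A `&` S p.1 p.2)) ->
  ultra_compact U d (A `&` slices l) /\ slice_dim_le j (A `&` slices l).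
Proof.
move=> AK cA; elim: l => [|p l IH] hl.
  have -> : A `&` slices [::] = set0 by apply/seteqP; split=> // y [_ []].
  by split; [exact: ultra_compact0|exact: slice_dim_le0].
have -> : A `&` slices (p :: l) = (A `&` S p.1 p.2) `|` (A `&` slices l).
  apply/seteqP; split=> y.
    by move=> [Ay [q [<-|lq] Sq]]; [left|right; split=> //; exists q].
  by move=> [[Ay Sy]|[Ay [q lq Sq]]]; split=> //; [exists p => //; left|exists q => //; right].
have [|cl Dl] := IH; first by move=> q lq; apply: hl; right.
split; last by apply: slice_dim_leU => //; apply: hl; left.
by apply: ultra_compactU => //; exact: S_closed.
Qed.

Lemma slice_dim_le_cover j A (e : R) : A `<=` K -> ultra_compact U d A -> 0 < e ->
  slice_dim_le j.+1 A -> exists M (O : 'I_M -> set T) (l : seq (nat * R)),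
  [/\ forall x, A x -> exists a, O a x,
      forall a, [/\ exists2 x, A x & O a x, open_in K (O a)
        & forall y z, K y -> K z -> O a y -> O a z -> d y z <= e],
      forall p, List.In p l -> slice_dim_le j (A `&` S p.1 p.2)
    & forall a, boundary_in K (O a) `<=` slices l].
Proof.
move=> AK cA e0 hA.
apply: (finite_slice_cover (P := fun p => slice_dim_le j (A `&` S p.1 p.2))) => // x Ax.
have [V [l [Vx Vo Ve lN bd]]] := slice_nbhd hA (AK _ Ax) e0.
by exists V, l; split=> // p lp; apply: contrapT => /(lN _ lp).
Qed.

Lemma slice_dim_le_colourable j A : A `<=` K -> ultra_compact U d A -> slice_dim_le j A ->
  colourable j A.
Proof.
elim: j A => [|j IH] A AK cA; first exact: zero_dimensional_colourable.
move=> hA e e0; have [M [V [l [Vcov hV lD bd]]]] := slice_dim_le_cover AK cA e0 hA.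
have [cB DB] := slices_dim_le AK cA lD.
apply: (@colouring_step j A (A `&` slices l) e M V) => // [|a|a|a x [Ax /bd] //].
- by apply: IH => // x [/AK].
- by have [] := hV a.
by have [] := hV a.
Qed.

End Slices.

Definition rel_open (A V : set T) := V `<=` A /\ forall x, V x -> exists e : R, 0 < e /\
  forall y, A y -> d x y < e -> V y.

Definition covering_dim_le (A : set T) (n : nat) :=
  forall (m : nat) (W : 'I_m -> set T), (forall i, rel_open A (W i)) -> A `<=` \bigcup_i W i ->
  exists (m' : nat) (V : 'I_m' -> set T),
    (forall j, rel_open A (V j)) /\ A `<=` \bigcup_j V j /\
    (forall j, exists i, V j `<=` W i) /\
    forall f : 'I_n.+2 -> 'I_m', injective f -> ~ (exists x, A x /\ forall t, V (f t) x).

Lemma colouring_multiplicity n A e (I : finType) (F : I -> set T) (col : I -> nat) (s : R) :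
  colouring n A e F col ->
  (forall i j x y, i != j -> col i = col j -> F i x -> F j y -> s <= d x y) ->
  forall (f : 'I_n.+2 -> I) x, injective f -> ~ forall t, exists2 u, F (f t) u & d x u < s / 2.
Proof.
move=> [_ _ _ [col_le _]] sep f x f_inj hx.
pose c (t : 'I_n.+2) : 'I_n.+1 := inord (col (f t)).
have : ~~ injectiveb c.
  by apply/negP => /injectiveP/leq_card; rewrite !card_ord ltnn.
move=> /injectivePn[t [t' tt' /(congr1 val)]]; rewrite /c /= !inordK ?ltnS ?col_le // => ctt'.
have [u Fu xu] := hx t; have [v Fv xv] := hx t'.
have ftt' : f t != f t' by rewrite (inj_eq f_inj).
by have := sep _ _ _ _ ftt' ctt' Fu Fv; have := dT u x v; rewrite (dC u x); lra.
Qed.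

Lemma colourable_covering_dim_le n A : ultra_compact U d A -> colourable n A ->
  covering_dim_le A n.
Proof.
move=> cA colA m W Wo Wc.
have [A0|/set0P[x0 Ax0]] := eqVneq A set0.
  exists 0%N, (fun=> set0); split; first by case.
  split; first by rewrite A0.
  by split=> [[] //|f _ [x []]]; rewrite A0.
have /choice[w hw] x : exists i : 'I_m, A x -> W i x.
  have [Ax|nAx] := pselect (A x); first by have [i _ Wi] := Wc x Ax; exists i.
  by have [i _ _] := Wc x0 Ax0; exists i.
have [|lam lam0 hlam] := @lebesgue_number A (fun x => W (w x)) cA.
  by move=> x Ax; have [_ /(_ x (hw x Ax))[e [e0 he]]] := Wo (w x); exists e.
have [I [F [col colF]]] := colA _ (divr_gt0 lam0 (ltr0n R 4)).
have [s s0 sep] := colouring_separated colF; have [hF Fsmall Fcov _] := colF.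
pose t := Num.min (s / 2) (lam / 4); have t0 : 0 < t by rewrite lt_min !divr_gt0.
pose V (j : 'I_#|I|) := [set x | A x /\ exists2 u, F (enum_val j) u & d x u < t].
exists #|I|, V; split=> [j|].
  split=> [x []//|x [Ax [u Fu xu]]].
  exists (t - d x u); rewrite subr_gt0; split=> // y Ay xy.
  by split=> //; exists u => //; have := dT y x u; rewrite (dC y x); lra.
split=> [x Ax|].
  have [i Fi] := Fcov x Ax; exists (enum_rank i) => //; split=> //.
  by exists x; rewrite ?enum_rankK ?d0.
split=> [j|f f_inj [x [Ax hx]]].
  have [[u0 Fu0]|nF] := pselect (exists u, F (enum_val j) u); last first.
    by exists (w x0) => x [_ [u Fu _]]; case: nF; exists u.
  have [z Az hz] := hlam u0 ((hF _).1 _ Fu0); exists (w z) => x [Ax [u Fu xu]]; apply: hz => //.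
  have := Fsmall _ _ _ Fu0 Fu; have := dT u0 u x; rewrite (dC u x).
  by move: xu; rewrite lt_min => /andP[_]; lra.
apply: (@colouring_multiplicity _ _ _ _ _ _ _ colF sep (enum_val \o f) x) => [|a /=].
  exact: inj_comp enum_val_inj f_inj.
have [_ [u Fu xu]] := hx a; exists u => //.
by move: xu; rewrite lt_min => /andP[].
Qed.

End CovDim.

(** * Eilenberg's inequality *)

Ltac positivity := repeat first [assumption | apply: mulr_gt0 | apply: divr_gt0
  | apply: addr_gt0 | apply: exprn_gt0 | rewrite invr_gt0 | apply: ltr0Sn | done].

Notation lebesgue_null := (negligible (@lebesgue_measure _)).

Section Eilenberg.
Context {R : realType}.
Notation mu := (@lebesgue_measure R).

Lemma lebesgue_null_itv (a b : R) (A : set R) : a < b -> lebesgue_null A ->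
  exists2 t, a < t < b & ~ A t.
Proof.
move=> ab nA; apply: contrapT => h.
have sA : `]a, b[%classic `<=` A.
  by move=> t /=; rewrite in_itv /= => tab; apply: contrapT => nAt; apply: h; exists t.
have nab : lebesgue_null `]a, b[ by exact: negligibleS nA.
have := (negligibleP mu (measurable_itv `]a, b[)).1 nab.
have := lebesgue_measure_itv `]a, b[; rewrite /= lte_fin ab -EFinB => -> [] h0; lra.
Qed.

Lemma integral_cst_ball (w c l : R) : 0 <= w -> 0 <= l ->
  (\int[mu]_t (w%:E * (\1_(`[(c - l)%R, (c + l)%R]%classic : set R) t)%:E) = (w * (2 * l))%:E)%E.
Proof.
move=> w0 l0; set J : set R := `[c - l, c + l]%classic.
have mJ : measurable J by exact: measurable_itv.
have m1 : measurable_fun setT (fun t : R => (\1_J t : R)%:E).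
  by apply/measurable_EFinP; exact: measurable_indic.
rewrite (ge0_integralZl_EFin mu (@measurableT _ _) _ m1 w0); last first.
  by move=> t _; rewrite lee_fin.
have -> : (\int[mu]_t (\1_J t)%:E = mu J)%E.
  by rewrite (integral_indic mu (@measurableT _ _) mJ) setIT.
have -> := lebesgue_measure_itv `[c - l, c + l]; rewrite /= lte_fin -EFinB.
case: ifPn => h; first by rewrite -EFinM; congr (_%:E); ring.
have -> : l = 0 by move: h; rewrite -leNgt; lra.
by rewrite !mulr0 mule0.
Qed.

Lemma weighted_balls_integral (w c l : nat -> R) (B : R) :
  (forall i, 0 <= w i) -> (forall i, 0 <= l i) ->
  (forall n, \sum_(i < n) w i * (2 * l i) <= B) ->
  exists phi : R -> \bar R,
  [/\ measurable_fun setT phi, forall t, (0 <= phi t)%E, (\int[mu]_t phi t <= B%:E)%E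
   & forall (t : R) n,
     ((\sum_(i < n) (if c i - l i <= t <= c i + l i then w i else 0))%:E <= phi t)%E].
Proof.
move=> w0 l0 hB; pose J i : set R := `[c i - l i, c i + l i]%classic.
pose f i (t : R) : \bar R := ((w i)%:E * (\1_(J i) t)%:E)%E.
have f0 i t : (0 <= f i t)%E by apply: mule_ge0; rewrite lee_fin.
have mf i : measurable_fun setT (f i).
  have mJ : measurable (J i) by exact: measurable_itv.
  have m1 : measurable_fun setT (fun t : R => (\1_(J i) t : R)%:E).
    by apply/measurable_EFinP; exact: measurable_indic.
  exact: measurable_funeM.
exists (fun t => (\sum_(0 <= i <oo) f i t)%E); split.
- exact: (@ge0_emeasurable_sum _ _ _ setT f xpredT).
- by move=> t; apply: nneseries_ge0 => i _ _.
- rewrite (integral_nneseries mu (@measurableT _ _)) //.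
  apply: lime_le; first by apply: is_cvg_nneseries => i _ _; apply: integral_ge0.
  apply: nearW => n; rewrite big_mkord.
  under eq_bigr do rewrite integral_cst_ball //.
  by rewrite sumEFin lee_fin.
move=> t n; apply: le_trans (nneseries_lim_ge n (fun i _ _ => f0 i t)).
rewrite big_mkord -sumEFin; apply: lee_sum => i _.
rewrite /f indicE /J; case: ifPn => h; last exact: f0.
by rewrite mem_set ?mule1 //= in_itv.
Qed.

Lemma limn_einf_lt (u : nat -> \bar R) (x : \bar R) n :
  (limn_einf u < x)%E -> exists2 m, (n <= m)%N & (u m < x)%E.
Proof.
rewrite limn_einf_lim (cvg_lim _ (@cvg_einfs_sup R u)) // => h.
have : (einfs u n < x)%E by apply: le_lt_trans h; apply: ereal_sup_ubound; exists n.
by rewrite /einfs => /ereal_inf_lt [y [m /= nm <-] yx]; exists m.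
Qed.

Lemma limn_einf_le (u : nat -> \bar R) (a : R) :
  (forall e : R, 0 < e -> exists n, forall m, (n <= m)%N -> (u m <= (a + e)%:E)%E) ->
  (limn_einf u <= a%:E)%E.
Proof.
move=> hu; apply/lee_addgt0Pr => e e0; have [n un] := hu e e0.
rewrite leNgt; apply/negP; rewrite limn_einf_lim (cvg_lim _ (@cvg_einfs_sup R _)) //.
rewrite ltNge => /negP; apply; apply: ge_ereal_sup => _ [j _ <-].
apply: (@le_trans _ _ (u (maxn n j))); last exact/un/leq_maxl.
by rewrite /einfs; apply: ereal_inf_lbound; exists (maxn n j) => //=; exact: leq_maxr.
Qed.

Lemma unit_interval_nonnull (a : R) :
  ~ hausdorff_null (fun x y : R => `|x - y|) 1 [set t | a <= t <= a + 1].
Proof.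
have e0 : 0 < 1 / 8 :> R by lra.
move=> /(_ 1 (1 / 8) ltr01 e0)[W [r [cov r_bd W_diam r_sum]]].
have /choice[y hy] i : exists y, forall x, W i x -> `|x - y| <= r i.
  have [[y Wy]|no] := pselect (exists y, W i y); first by exists y => x Wx; exact: W_diam.
  by exists 0 => x Wx; case: no; exists x.
suff : 1 <= 1 / 2 :> R by lra.
apply: (@interval_cover_length R 1 (1 / 2) (fun i => y i - r i - a) (fun i => 2 * r i)) => //.
- by move=> i; have /andP[r0 _] := r_bd i; lra.
- move=> s /andP[s0 s1]; have [|i _ /hy ys] := cov (a + s); first by apply/andP; split; lra.
  by exists i; move: ys; rewrite ler_norml => /andP[? ?]; apply/andP; split; lra.
move=> m; rewrite -mulr_sumr; have := r_sum m.
by under eq_bigr do rewrite expr1; lra.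
Qed.

Section Slice.
Context (T : Type) (d : T -> T -> R) (s : nat) (s0 : (0 < s)%N).
Context (A : set T) (f : T -> R) (L : R) (L0 : 0 < L).
Hypothesis f_lip : forall x y, A x -> A y -> `|f x - f y| <= L * d x y.

Let level t := A `&` [set x | f x = t].

(* A covering set of diameter [r] meets the levels of an interval of length
   [2 L r] only. *)
Lemma eilenberg_cover (dl M : R) : 0 <= dl -> cover_sum_le d s.+1 A dl M ->
  exists phi : R -> \bar R,
  [/\ measurable_fun setT phi, forall t, (0 <= phi t)%E, (\int[mu]_t phi t <= (2 * L * M)%:E)%E
   & forall t (N : R), (phi t <= N%:E)%E -> cover_sum_le d s (level t) dl N].
Proof.
move=> dl0 [V [r [cov rb Vd rM]]]; have r0 i : 0 <= r i by have /andP[] := rb i.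
have /choice[c hc] i : exists c : R, forall x, A x -> V i x -> c - L * r i <= f x <= c + L * r i.
  have [[y [Ay Vy]]|no] := pselect (exists x, A x /\ V i x); last first.
    by exists 0 => x Ax Vx; case: no; exists x.
  exists (f y) => x Ax Vx; have : `|f x - f y| <= L * r i.
    by apply: le_trans (f_lip Ax Ay) _; rewrite ler_pM2l //; exact: Vd Vx Vy.
  by rewrite ler_norml; lra.
have [i|i|m|phi [mphi phi0 int_phi phi_ge]] :=
    @weighted_balls_integral (fun i => r i ^+ s) c (fun i => L * r i) (2 * L * M).
- exact: exprn_ge0.
- exact: mulr_ge0 (ltW L0) (r0 i).
- have -> : \sum_(i < m) r i ^+ s * (2 * (L * r i)) = 2 * L * \sum_(i < m) r i ^+ s.+1.
    by rewrite mulr_sumr; apply: eq_bigr => i _; rewrite exprSr; ring.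
  by rewrite ler_pM2l //; positivity.
exists phi; split=> // t N phiN.
pose hit i := c i - L * r i <= t <= c i + L * r i.
exists (fun i => if hit i then V i else set0), (fun i => if hit i then r i else 0); split.
- move=> x [Ax fx]; have [i _ Vi] := cov _ Ax; exists i => //.
  by have /= := hc i x Ax Vi; rewrite fx /hit => ->.
- by move=> i; case: ifP => _; [exact: rb|rewrite lexx].
- by move=> i x y; case: ifP => // _; exact: Vd.
move=> j; have := le_trans (phi_ge t j) phiN; rewrite lee_fin; apply: le_trans.
apply: ler_sum => i _; rewrite /hit; case: ifP => // _.
by rewrite expr0n eqn0Ngt s0.
Qed.

Lemma eilenberg_inequality (M : R) : hausdorff_le d s.+1 A M -> exists F : R -> \bar R,
  [/\ measurable_fun setT F, forall t, (0 <= F t)%E, (\int[mu]_t F t <= (2 * L * M)%:E)%E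
   & forall t (N : R), (F t < N%:E)%E -> hausdorff_le d s (level t) N].
Proof.
move=> hM; have n0 n : 0 < n.+1%:R^-1 :> R by rewrite invr_gt0.
have /choice[phi hphi] n := eilenberg_cover (ltW (n0 n)) (hM _ _ (n0 n) (n0 n)).
have mphi n : measurable_fun setT (phi n) by case: (hphi n).
have phi0 n t : (0 <= phi n t)%E by case: (hphi n).
exists (fun t => limn_einf (phi^~ t)); split.
- rewrite /limn_einf; apply: measurableT_comp => //.
  by apply: measurable_realfun.measurable_fun_limn_esup => n; exact: measurableT_comp.
- by move=> t; rewrite leNgt; apply/negP => /(@limn_einf_lt _ _ 0)[m _]; rewrite ltNge phi0.
- apply: le_trans (fatou mu (@measurableT _ _) mphi (fun n x _ => phi0 n x)) _.
  apply: limn_einf_le => e e0; have L2 : 0 < 2 * L by positivity.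
  have [n hn] := exists_invS_lt (divr_gt0 e0 L2); exists n => m nm.
  have [_ _ int_phi _] := hphi m; apply: le_trans int_phi _.
  rewrite lee_fin mulrDr lerD2l mulrC -ler_pdivlMr //; apply: le_trans (ltW hn).
  by rewrite lef_pV2 ?posrE // ler_nat.
move=> t N FN dl e dl0 e0; have [n hn] := exists_invS_lt dl0.
have [m nm /ltW hm] := @limn_einf_lt _ _ n FN.
have [_ _ _ /(_ t N hm)[V [r [cov rb Vd rN]]]] := hphi m.
exists V, r; split=> // [i|j]; last by apply: le_trans (rN j) _; rewrite lerDl ltW.
have /andP[-> /le_trans] := rb i; apply; apply: le_trans (ltW hn).
by rewrite lef_pV2 ?posrE // ler_nat.
Qed.

Lemma eilenberg_finite : hausdorff_finite d s.+1 A ->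
  lebesgue_null [set t | ~ hausdorff_finite d s (level t)].
Proof.
move=> [M /eilenberg_inequality [F [mF F0 iF hF]]].
have intF : mu.-integrable setT F.
  apply/integrableP; split => //; under eq_integral do rewrite gee0_abs //.
  by apply: le_lt_trans iF _; exact: ltry.
apply: negligibleS (integrable_ae (@measurableT _ _) intF) => t /= h1 h2; apply: h1.
have := h2 I; have := F0 t; case E : (F t) => [a| |] // _ _.
by exists (a + 1); apply: hF; rewrite E lte_fin; lra.
Qed.

Lemma eilenberg_null : hausdorff_null d s.+1 A ->
  lebesgue_null [set t | ~ hausdorff_null d s (level t)].
Proof.
move=> /eilenberg_inequality [F [mF F0 iF hF]].
have I0 : (\int[mu]_t `|F t| = 0)%E.
  apply/eqP; rewrite eq_le; apply/andP; split; last by apply: integral_ge0.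
  under eq_integral do rewrite gee0_abs //.
  by rewrite mulr0 in iF.
have := (ae_eq_integral_abs mu (@measurableT _ _) mF).1 I0.
apply: negligibleS => t /= h1 h2; apply: h1; apply: hausdorff_le_lim => N N0.
by apply: hF; rewrite (h2 I) lte_fin.
Qed.

End Slice.
End Eilenberg.

(** * Inner product spaces *)

Structure ipspace (R : realType) := IPSpace {
  ipV :> lmodType R;
  ip : ipV -> ipV -> R;
  ipC : forall x y, ip x y = ip y x;
  ipDl : forall x y z, ip (x + y) z = ip x z + ip y z;
  ipZl : forall a x y, ip (a *: x) y = a * ip x y;
  ip_ge0 : forall x, 0 <= ip x x;
  ip_eq0 : forall x, ip x x = 0 -> x = 0 }.

Arguments ip {R V} : rename.

Section InnerProduct.
Context {R : realType} (V : ipspace R).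
Implicit Types x y z : V.

Lemma ipDr x y z : ip x (y + z) = ip x y + ip x z.
Proof. by rewrite ipC ipDl !(ipC _ x). Qed.

Lemma ipZr a x y : ip x (a *: y) = a * ip x y.
Proof. by rewrite ipC ipZl (ipC _ x). Qed.

Lemma ipNl x y : ip (- x) y = - ip x y.
Proof. by rewrite -scaleN1r ipZl mulN1r. Qed.

Lemma ipNr x y : ip x (- y) = - ip x y.
Proof. by rewrite ipC ipNl ipC. Qed.

Lemma ip0l x : ip 0 x = 0.
Proof. by rewrite -(scale0r (0 : V)) ipZl mul0r. Qed.

Lemma ip0r x : ip x 0 = 0.
Proof. by rewrite ipC ip0l. Qed.

Lemma ip_suml (I : Type) (r : seq I) (P : pred I) (F : I -> V) x :
  ip (\sum_(i <- r | P i) F i) x = \sum_(i <- r | P i) ip (F i) x.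
Proof.
by elim/big_rec2: _ => [|i y1 y2 _ IH]; [rewrite ip0l | rewrite ipDl IH].
Qed.

Lemma ip_sumr (I : Type) (r : seq I) (P : pred I) (F : I -> V) x :
  ip x (\sum_(i <- r | P i) F i) = \sum_(i <- r | P i) ip x (F i).
Proof. by rewrite ipC ip_suml; apply: eq_bigr => i _; rewrite ipC. Qed.

Definition ipE := (ipDl, ipDr, ipZl, ipZr, ipNl, ipNr).

Definition ip_norm x := Num.sqrt (ip x x).

Lemma ip_norm_ge0 x : 0 <= ip_norm x. Proof. exact: sqrtr_ge0. Qed.

Lemma ip_norm_sq x : ip_norm x ^+ 2 = ip x x.
Proof. by rewrite sqr_sqrtr // ip_ge0. Qed.

Lemma ip_norm0 : ip_norm 0 = 0. Proof. by rewrite /ip_norm ip0l sqrtr0. Qed.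

Lemma ip_norm_eq0 x : ip_norm x = 0 -> x = 0.
Proof. by move=> h; apply: ip_eq0; rewrite -ip_norm_sq h expr0n. Qed.

Lemma ip_norm_gt0 x : x <> 0 -> 0 < ip_norm x.
Proof.
move=> x0; rewrite lt_neqAle ip_norm_ge0 andbT; apply/eqP => h; apply: x0; exact: ip_norm_eq0.
Qed.

Lemma ip_normZ a x : ip_norm (a *: x) = `|a| * ip_norm x.
Proof. by rewrite /ip_norm ipZl ipZr mulrA -expr2 sqrtrM ?sqr_ge0 // sqrtr_sqr. Qed.

Lemma ip_normN x : ip_norm (- x) = ip_norm x.
Proof. by rewrite /ip_norm ipNl ipNr opprK. Qed.

Lemma ip_distC x y : ip_norm (x - y) = ip_norm (y - x).
Proof. by rewrite -ip_normN opprB. Qed.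

Lemma ip_cauchy_schwarz x y : `|ip x y| <= ip_norm x * ip_norm y.
Proof.
rewrite -(ler_pXn2r (n := 2)) ?nnegrE ?mulr_ge0 ?ip_norm_ge0 // exprMn !ip_norm_sq real_normK
  ?num_real //.
have [y0|y0] := eqVneq (ip y y) 0.
  by rewrite (ip_eq0 y0) !ip0r mulr0 expr0n.
have yp : 0 < ip y y by rewrite lt_def y0 ip_ge0.
have := ip_ge0 (ip y y *: x - ip x y *: y).
rewrite !ipE (ipC y x).
set u := ip y y; set v := ip x x; set w := ip x y => h.
have : 0 <= u * (v * u - w ^+ 2) by apply: le_trans h _; rewrite le_eqVlt; apply/orP; left;
  apply/eqP; ring.
by rewrite pmulr_rge0 // subr_ge0.
Qed.

Lemma ip_normD x y : ip_norm (x + y) <= ip_norm x + ip_norm y.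
Proof.
rewrite -(ler_pXn2r (n := 2)) ?nnegrE ?addr_ge0 ?ip_norm_ge0 // sqrrD !ip_norm_sq.
rewrite ipDl !ipDr (ipC y x).
have := ip_cauchy_schwarz x y; have := ler_norm (ip x y) => h1 h2.
have : ip x y <= ip_norm x * ip_norm y by apply: le_trans h2.
lra.
Qed.

Lemma ip_dist_triangle x y z : ip_norm (x - z) <= ip_norm (x - y) + ip_norm (y - z).
Proof. by have := ip_normD (x - y) (y - z); rewrite addrA subrK. Qed.

Lemma ip_norm_dist x y : `|ip_norm x - ip_norm y| <= ip_norm (x - y).
Proof.
rewrite ler_norml; have := ip_normD (x - y) y; have := ip_normD (y - x) x.
rewrite !subrK (ip_distC y x); lra.
Qed.

Lemma ip_dist_eq0 x y : ip_norm (x - y) = 0 -> x = y.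
Proof. by move/ip_norm_eq0/eqP; rewrite subr_eq0 => /eqP. Qed.

Lemma ip_dist_small_eq x y : (forall e : R, 0 < e -> ip_norm (x - y) <= e) -> x = y.
Proof.
move=> h; apply: ip_dist_eq0; apply/eqP; rewrite eq_le ip_norm_ge0 andbT leNgt; apply/negP => h0.
have := h (ip_norm (x - y) / 2); lra.
Qed.

Lemma ip_polarization x y : ip x y = (ip_norm x ^+ 2 + ip_norm y ^+ 2 - ip_norm (x - y) ^+ 2) / 2.
Proof. by rewrite !ip_norm_sq !ipE (ipC y x); field. Qed.

Definition ip_inv x := (ip x x)^-1 *: x.

Lemma ip_inv_norm x : ip_norm (ip_inv x) = (ip_norm x)^-1.
Proof.
have [->|x0] := eqVneq x 0; first by rewrite /ip_inv scaler0 ip_norm0 invr0.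
have := ip_norm_gt0 (elimN eqP x0) => h; rewrite /ip_inv ip_normZ -ip_norm_sq ger0_norm
  ?invr_ge0 ?exprn_ge0 ?ip_norm_ge0 //.
by field; rewrite gt_eqF.
Qed.

Lemma ip_inv_dist x y : x <> 0 -> y <> 0 ->
  ip_norm (ip_inv x - ip_inv y) = ip_norm (x - y) / (ip_norm x * ip_norm y).
Proof.
move=> x0 y0; have X := ip_norm_gt0 x0; have Y := ip_norm_gt0 y0.
apply: (@pexpIrn _ 2) => //; rewrite ?nnegrE ?ip_norm_ge0 ?divr_ge0 ?mulr_ge0 ?ip_norm_ge0 //.
rewrite expr_div_n exprMn !ip_norm_sq /ip_inv !ipE (ipC y x).
by field; rewrite -!ip_norm_sq !expf_eq0 /= !gt_eqF.
Qed.

End InnerProduct.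

(* [A] is only controlled on the subspace [D]. *)
Record linear_isometry {R : realType} (V V' : ipspace R) (D : V -> Prop) (A : V -> V') : Prop :=
  LinearIsometry {
  isometry_dom0 : D 0;
  isometry_dom_lin : forall a x y, D x -> D y -> D (a *: x + y);
  isometry_lin : forall a x y, D x -> D y -> A (a *: x + y) = a *: A x + A y;
  isometry_norm : forall x, D x -> ip_norm (A x) = ip_norm x }.

Section LinearIsometry.
Context {R : realType} (V V' : ipspace R) (D : V -> Prop) (A : V -> V').
Hypothesis isoA : linear_isometry D A.

Lemma isometry0 : A 0 = 0.
Proof. by apply: ip_norm_eq0; rewrite (isometry_norm isoA) ?ip_norm0 //; case: isoA. Qed.

Lemma isometry_domZ a x : D x -> D (a *: x).
Proof. by move=> Dx; rewrite -[a *: x]addr0; case: isoA => ? lin _ _; exact: lin. Qed.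

Lemma isometryZ a x : D x -> A (a *: x) = a *: A x.
Proof.
by move=> Dx; rewrite -[a *: x]addr0 (isometry_lin isoA) ?isometry0 ?addr0 //; case: isoA.
Qed.

Lemma isometry_domB x y : D x -> D y -> D (x - y).
Proof.
by move=> Dx Dy; rewrite addrC -scaleN1r; exact: (isometry_dom_lin isoA).
Qed.

Lemma isometryB x y : D x -> D y -> A (x - y) = A x - A y.
Proof.
by move=> Dx Dy; rewrite addrC -scaleN1r (isometry_lin isoA) // scaleN1r addrC.
Qed.

Lemma isometry_dom_sum j (t : 'I_j -> R) (w : 'I_j -> V) : (forall i, D (w i)) ->
  D (\sum_i t i *: w i).
Proof.
move=> Dw; elim: (index_enum _) => [|i l IH]; first by rewrite big_nil; case: isoA.
by rewrite big_cons; exact: (isometry_dom_lin isoA).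
Qed.

Lemma isometry_sum j (t : 'I_j -> R) (w : 'I_j -> V) : (forall i, D (w i)) ->
  A (\sum_i t i *: w i) = \sum_i t i *: A (w i).
Proof.
move=> Dw; suff [] : D (\sum_i t i *: w i) /\ A (\sum_i t i *: w i) = \sum_i t i *: A (w i) by [].
elim: (index_enum _) => [|i l [Dl Al]]; first by rewrite !big_nil isometry0; case: isoA.
by rewrite !big_cons (isometry_lin isoA) // Al; split=> //; exact: (isometry_dom_lin isoA).
Qed.

Lemma isometry_ip x y : D x -> D y -> ip (A x) (A y) = ip x y.
Proof.
move=> Dx Dy; rewrite !ip_polarization -isometryB // !(isometry_norm isoA) //.
exact: isometry_domB.
Qed.

End LinearIsometry.

Section SimilarityExtension.
Context {R : realType} (V V' : ipspace R) (I : Type) (P : I -> Prop).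
Context (X : I -> V) (Y : I -> V') (lam : R) (i0 : I).
Hypothesis lam0 : 0 < lam.
Hypothesis P0 : P i0.
Hypothesis XY : forall i j, P i -> P j -> ip_norm (Y i - Y j) = lam * ip_norm (X i - X j).

Let admissible (l : seq (R * I)) := forall p, List.In p l -> P p.2.

Let comb (W : ipspace R) (Z : I -> W) (l : seq (R * I)) :=
  \sum_(p <- l) p.1 *: (Z p.2 - Z i0).

Let scale a (l : seq (R * I)) := [seq (a * p.1, p.2) | p <- l].

Let admissible_scale a l : admissible l -> admissible (scale a l).
Proof.
elim: l => //= q l IH h p [<-|]; first by apply: (h q); left.
by apply: IH => p' hp; apply: h; right.
Qed.

Let admissible_cat l l' : admissible l -> admissible l' -> admissible (l ++ l').
Proof. by move=> h h' p /(List.in_app_or _ _ _) [/h|/h']. Qed.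

Let comb_lin (W : ipspace R) (Z : I -> W) a l l' :
  comb Z (scale a l ++ l') = a *: comb Z l + comb Z l'.
Proof.
rewrite /comb big_cat big_map scaler_sumr; congr (_ + _).
by apply: eq_bigr => p _; rewrite scalerA.
Qed.

Let comb_diff (W : ipspace R) (Z : I -> W) i j : comb Z [:: (1, i); (-1, j)] = Z i - Z j.
Proof. by rewrite /comb !big_cons big_nil addr0 /= scale1r scaleN1r opprB addrA subrK. Qed.

Definition diff_span (x : V) := exists l, admissible l /\ x = comb X l.

Lemma diff_span_lin a x y : diff_span x -> diff_span y -> diff_span (a *: x + y).
Proof.
move=> [l [ok ->]] [l' [ok' ->]]; exists (scale a l ++ l'); rewrite comb_lin; split; last by [].
exact: admissible_cat (admissible_scale ok) ok'.
Qed.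

Lemma diff_span_diff i j : P i -> P j -> diff_span (X i - X j).
Proof.
move=> Pi Pj; exists [:: (1, i); (-1, j)]; rewrite comb_diff.
by split=> // p [<-|[<-|[]]].
Qed.

Lemma diff_span0 : diff_span 0.
Proof. by exists [::]; split=> //; rewrite /comb big_nil. Qed.

Lemma diff_ip i j : P i -> P j ->
  ip (Y i - Y i0) (Y j - Y i0) = lam ^+ 2 * ip (X i - X i0) (X j - X i0).
Proof.
move=> Pi Pj; rewrite !ip_polarization !XY // !opprB !addrA !subrK !XY //; by field.
Qed.

Let comb_ip l l' : admissible l -> admissible l' ->
  ip (comb Y l) (comb Y l') = lam ^+ 2 * ip (comb X l) (comb X l').
Proof.
rewrite /comb => h h'; elim: l h => [|p l IH] h; first by rewrite !big_nil !ip0l mulr0.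
rewrite !big_cons !ipDl IH; last by move=> q hq; apply: h; right.
rewrite mulrDr; congr (_ + _); rewrite !ipZl mulrCA; congr (_ * _).
have Pp : P p.2 by apply: h; left.
move: {IH} h'; elim: l' => [|q l' IH'] h'; first by rewrite !big_nil !ip0r mulr0.
rewrite !big_cons !ipDr IH'; last by move=> r hr; apply: h'; right.
rewrite mulrDr; congr (_ + _); rewrite !ipZr mulrCA; congr (_ * _).
by apply: diff_ip => //; apply: h'; left.
Qed.

Let comb_nv l : admissible l -> ip_norm (comb Y l) = lam * ip_norm (comb X l).
Proof.
move=> ok; apply: (@pexpIrn _ 2) => //; rewrite ?nnegrE ?mulr_ge0 ?ip_norm_ge0 ?(ltW lam0) //.
by rewrite exprMn !ip_norm_sq comb_ip.
Qed.

Let comb_wd l l' : admissible l -> admissible l' -> comb X l = comb X l' ->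
  comb Y l = comb Y l'.
Proof.
move=> ok ok' E; apply: ip_dist_eq0.
have := comb_nv (admissible_cat (@admissible_scale (-1) _ ok') ok).
by rewrite !comb_lin !scaleN1r E addNr ip_norm0 mulr0 addrC.
Qed.

Lemma similarity_linear_ext : exists2 A : V -> V', linear_isometry diff_span A &
  forall i j, P i -> P j -> Y i - Y j = lam *: A (X i - X j).
Proof.
have /choice[L hL] x : exists l, diff_span x -> admissible l /\ x = comb X l.
  by have [[l hl]|no] := pselect (diff_span x); [exists l|exists [::]].
have AE l : admissible l -> comb Y (L (comb X l)) = comb Y l.
  move=> ok; have [okL EL] := hL (comb X l) (ex_intro _ l (conj ok erefl)).
  exact/comb_wd.
exists (fun x => lam^-1 *: comb Y (L x)); last first.
  move=> i j Pi Pj; rewrite scalerA mulfV ?gt_eqF // scale1r -(comb_diff X) AE ?comb_diff //.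
  by move=> p [<-|[<-|]].
split; [exact: diff_span0|exact: diff_span_lin| |].
- move=> a x y hx hy; have [ox Ex] := hL x hx; have [oy Ey] := hL y hy.
  rewrite {1}Ex {1}Ey -comb_lin AE ?comb_lin ?scalerDr ?scalerA 1?mulrC //.
  exact: admissible_cat (admissible_scale ox) oy.
move=> x hx; have [ox Ex] := hL x hx.
by rewrite ip_normZ comb_nv // -Ex gtr0_norm ?invr_gt0 // mulKf ?gt_eqF.
Qed.

End SimilarityExtension.

(** * Limit sets seen from infinity *)

Section Pictures.
Context {R : realType} (U : set_system nat) {uU : FreeUltraFilter U} (V : ipspace R).
Context (T : Type) (d : T -> T -> R) (Phi : T -> V).
Hypothesis d_sep : forall x y, d x y = 0 -> x = y.
Hypothesis dPhi : forall x y, d x y = ip_norm (Phi x - Phi y).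

Definition chart (xi u : T) : V := ip_inv (Phi u - Phi xi).

Lemma Phi_neq u v : u <> v -> Phi u - Phi v <> 0.
Proof. by move=> uv h; apply: uv; apply: d_sep; rewrite dPhi h ip_norm0. Qed.

Lemma Phi_pseudometric : pseudometric d.
Proof.
split=> [x|x y|x y z]; rewrite !dPhi; first by rewrite subrr ip_norm0.
  exact: ip_distC.
exact: ip_dist_triangle.
Qed.

Lemma Phi_gt0 u v : u <> v -> 0 < d u v.
Proof. by move=> uv; rewrite dPhi; apply: ip_norm_gt0; apply: Phi_neq. Qed.

Lemma chart_dist xi u v : u <> xi -> v <> xi ->
  ip_norm (chart xi u - chart xi v) = d u v / (d u xi * d v xi).
Proof.
move=> h1 h2; rewrite ip_inv_dist; [|exact: Phi_neq..].
by rewrite opprB addrA subrK !dPhi.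
Qed.

Lemma chart_norm xi u : ip_norm (chart xi u) = (d u xi)^-1.
Proof. by rewrite ip_inv_norm dPhi. Qed.

Lemma chart_inj xi u v : u <> xi -> v <> xi -> chart xi u = chart xi v -> u = v.
Proof.
move=> h1 h2 h; apply: d_sep; have := chart_dist h1 h2.
rewrite h subrr ip_norm0 => /esym/eqP; rewrite mulf_eq0 invr_eq0 mulf_eq0.
by rewrite (gt_eqF (Phi_gt0 h1)) (gt_eqF (Phi_gt0 h2)) !orbF => /eqP.
Qed.

Definition ip_cvg (x : nat -> V) (y : V) := forall e : R, 0 < e -> U [set n | ip_norm (x n - y) < e].

Lemma ip_cvg_cst y : ip_cvg (fun=> y) y.
Proof. by move=> e e0; apply: filterE => n /=; rewrite subrr ip_norm0. Qed.

Lemma ip_cvg_squeeze (W : set nat) (x : nat -> V) y (f : nat -> R) (C : R) : 0 < C ->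
  (forall e : R, 0 < e -> U [set n | f n < e]) ->
  U W -> (forall n, W n -> ip_norm (x n - y) <= C * f n) -> ip_cvg x y.
Proof.
move=> C0 h UW H e e0; have eC : 0 < e / C by positivity.
apply: filterS (filterI UW (h _ eC)) => n /= [Wn]; rewrite ltr_pdivlMr // => h1.
by apply: le_lt_trans (H _ Wn) _; rewrite mulrC.
Qed.

Lemma ip_cvg_near_eq (x y : nat -> V) z : U [set n | x n = y n] -> ip_cvg x z -> ip_cvg y z.
Proof. by move=> h c e e0; apply: filterS (filterI h (c e e0)) => n /= [<-]. Qed.

Lemma ip_cvgD x x' y y' : ip_cvg x y -> ip_cvg x' y' -> ip_cvg (fun n => x n + x' n) (y + y').
Proof.
move=> h h' e e0; have e2 : 0 < e / 2 by lra.
apply: filterS (filterI (h _ e2) (h' _ e2)) => n /= [h1 h2].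
have := ip_normD (x n - y) (x' n - y'); rewrite addrACA -opprD; lra.
Qed.

Lemma ip_cvgZ a x y : ip_cvg x y -> ip_cvg (fun n => a *: x n) (a *: y).
Proof.
move=> h; have C0 : 0 < `|a| + 1 by have := normr_ge0 a; lra.
apply: (ip_cvg_squeeze C0 h (filterT)) => n _; rewrite -scalerBr ip_normZ.
by apply: ler_wpM2r; [exact: ip_norm_ge0 | lra].
Qed.

Lemma ip_cvgN x y : ip_cvg x y -> ip_cvg (fun n => - x n) (- y).
Proof.
by move=> h e e0; apply: filterS (h _ e0) => n /=; rewrite -opprD ip_normN.
Qed.

Lemma ip_cvgB x x' y y' : ip_cvg x y -> ip_cvg x' y' -> ip_cvg (fun n => x n - x' n) (y - y').
Proof. by move=> h h'; apply: ip_cvgD => //; apply: ip_cvgN. Qed.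

Lemma ip_cvg_sum (J : finType) (x : J -> nat -> V) (y : J -> V) :
  (forall j, ip_cvg (x j) (y j)) -> ip_cvg (fun n => \sum_j x j n) (\sum_j y j).
Proof.
move=> h; elim: (index_enum J) => [|j l IH].
  by apply: (ip_cvg_near_eq _ (ip_cvg_cst _)); apply: filterE => n /=; rewrite !big_nil.
rewrite big_cons; apply: (ip_cvg_near_eq _ (ip_cvgD (h j) IH)).
by apply: filterE => n /=; rewrite big_cons.
Qed.

Lemma ip_cvg_norm_le x y (c : R) : ip_cvg x y ->
  (forall e : R, 0 < e -> U [set n | ip_norm (x n) <= c + e]) -> ip_norm y <= c.
Proof.
move=> h h'; rewrite leNgt; apply/negP => cy.
pose e := (ip_norm y - c) / 3; have e0 : 0 < e by rewrite /e; lra.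
have [n [/= h1 h2]] := filter_ex (filterI (h _ e0) (h' _ e0)).
have := ip_norm_dist (x n) y; rewrite ler_norml /e in h1 h2 *; lra.
Qed.

Lemma ip_cvg_norm_ge x y (c : R) : ip_cvg x y ->
  (forall e : R, 0 < e -> U [set n | c - e <= ip_norm (x n)]) -> c <= ip_norm y.
Proof.
move=> h h'; rewrite leNgt; apply/negP => cy.
pose e := (c - ip_norm y) / 3; have e0 : 0 < e by rewrite /e; lra.
have [n [/= h1 h2]] := filter_ex (filterI (h _ e0) (h' _ e0)).
have := ip_norm_dist (x n) y; rewrite ler_norml /e in h1 h2 *; lra.
Qed.

Lemma ip_cvg_unique x y z : ip_cvg x y -> ip_cvg x z -> y = z.
Proof.
move=> h h'; apply: ip_dist_small_eq => e e0; have e2 : 0 < e / 2 by lra.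
have [n [/= h1 h2]] := filter_ex (filterI (h _ e2) (h' _ e2)).
have := ip_dist_triangle y (x n) z; rewrite (ip_distC y (x n)); lra.
Qed.

Lemma ip_cvg_bounded x y : ip_cvg x y -> U [set n | ip_norm (x n) <= ip_norm y + 1].
Proof.
move=> xy; apply: filterS (xy 1 ltr01) => n /=.
by have := ip_norm_dist (x n) y; rewrite ler_norml; lra.
Qed.

Lemma ip_cvg_ip x x' y y' : ip_cvg x y -> ip_cvg x' y' ->
  forall e : R, 0 < e -> U [set n | `|ip (x n) (x' n) - ip y y'| < e].
Proof.
move=> xy xy' e e0; pose C := ip_norm y + 1 + (ip_norm y' + 1).
have ny := ip_norm_ge0 y; have ny' := ip_norm_ge0 y'.
have C0 : 0 < C by rewrite /C; lra.
have eC : 0 < e / C by positivity.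
apply: filterS (filterI (filterI (xy _ eC) (xy' _ eC)) (ip_cvg_bounded xy)) => n /= [[xn xn'] bn].
have -> : ip (x n) (x' n) - ip y y' = ip (x n - y) y' + ip (x n) (x' n - y').
  by rewrite !ipE; ring.
have : ip_norm (x n - y) * ip_norm y' <= e / C * ip_norm y' by rewrite ler_wpM2r // ltW.
have : ip_norm (x n) * ip_norm (x' n - y') <= (ip_norm y + 1) * (e / C).
  by apply: ler_pM => //; rewrite ?ip_norm_ge0 // ltW.
have := ip_cauchy_schwarz (x n - y) y'; have := ip_cauchy_schwarz (x n) (x' n - y').
have := ler_normD (ip (x n - y) y') (ip (x n) (x' n - y')).
have : e = e / C * (ip_norm y + 1 + (ip_norm y' + 1)) by rewrite -/C divfK // gt_eqF.
by move: eC; move: (e / C) => q q0; lra.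
Qed.

Lemma ip_cvg_ip_cst x x' y y' (c : R) : ip_cvg x y -> ip_cvg x' y' ->
  (forall n, ip (x n) (x' n) = c) -> ip y y' = c.
Proof.
move=> xy xy' xc; apply/eqP; rewrite eq_sym -subr_eq0 -normr_eq0.
apply/negPn/negP; rewrite normr_eq0 -normr_gt0 => /(ip_cvg_ip xy xy')/filter_ex[n /=].
by rewrite xc ltxx.
Qed.

Lemma ip_cvg_coef x x' y y' : ip_cvg x y -> ip_cvg x' y' ->
  ip_cvg (fun n => ip (x n) (x' n) *: x' n) (ip y y' *: y').
Proof.
move=> xy xy' e e0; pose C := ip_norm y' + 1 + (`|ip y y'| + 1).
have ny := ip_norm_ge0 y'; have ni := normr_ge0 (ip y y').
have C0 : 0 < C by rewrite /C; lra.
have eC : 0 < e / C by positivity.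
apply: filterS (filterI (filterI (ip_cvg_ip xy xy' eC) (xy' _ eC)) (ip_cvg_bounded xy')) => n /=.
move=> [[an xn'] bn].
have -> : ip (x n) (x' n) *: x' n - ip y y' *: y' =
    (ip (x n) (x' n) - ip y y') *: x' n + ip y y' *: (x' n - y').
  by rewrite scalerBl scalerBr addrA subrK.
have : `|ip (x n) (x' n) - ip y y'| * ip_norm (x' n) <= e / C * (ip_norm y' + 1).
  by apply: ler_pM => //; rewrite ?ip_norm_ge0 // ltW.
have : `|ip y y'| * ip_norm (x' n - y') <= `|ip y y'| * (e / C) by rewrite ler_wpM2l // ltW.
have := ip_normD ((ip (x n) (x' n) - ip y y') *: x' n) (ip y y' *: (x' n - y')).
rewrite !ip_normZ.
have : e = e / C * (ip_norm y' + 1 + (`|ip y y'| + 1)) by rewrite -/C divfK // gt_eqF.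
by move: eC; move: (e / C) => q q0; lra.
Qed.

Lemma chart_cvg xs xi x v : ultra_cvg U d xs xi -> ultra_cvg U d x v -> v <> xi ->
  U [set n | x n <> xs n] /\ ip_cvg (fun n => chart (xs n) (x n)) (chart xi v).
Proof.
move=> h1 h2 vx; have D0 := Phi_gt0 vx; pose D := d v xi.
have pd := Phi_pseudometric; have [d0 dC dt] := pd.
have e0 : 0 < D / 4 by rewrite /D; lra.
have near : U [set n | D / 2 <= d (x n) (xs n)].
{ apply: filterS (filterI (h1 _ e0) (h2 _ e0)) => n /= [a b].
  have := dt v (x n) xi; have := dt (x n) (xs n) xi; rewrite (dC v (x n)) -/D; lra.
}
split.
  by apply: filterS near => n /= h E; move: h; rewrite E d0 /D; lra.
have C0 : 0 < 2 / D ^+ 2 by positivity.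
apply: (ip_cvg_squeeze C0 (f := fun n => d (x n) v + d (xs n) xi) _ near).
{ move=> e ep; have e2 : 0 < e / 2 by lra.
  by apply: filterS (filterI (h1 _ e2) (h2 _ e2)) => n /= [a b]; lra.
}
move=> n /= hn; have xn : x n <> xs n by move=> E; move: hn; rewrite E d0 /D; lra.
rewrite /chart ip_inv_dist; [|exact: Phi_neq..].
rewrite -(dPhi (x n) (xs n)) -(dPhi v xi) -/D.
have a1 : ip_norm (Phi (x n) - Phi (xs n) - (Phi v - Phi xi)) <= d (x n) v + d (xs n) xi.
{ have -> : Phi (x n) - Phi (xs n) - (Phi v - Phi xi) = (Phi (x n) - Phi v) - (Phi (xs n) - Phi xi).
    by rewrite !opprB [RHS]addrACA [in RHS](addrC (- Phi v)) addrACA (addrC (- Phi (xs n))) -!addrA.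
  by apply: le_trans (ip_normD _ _) _; rewrite ip_normN -!dPhi.
}
apply: (@le_trans _ _ ((d (x n) v + d (xs n) xi) / (D / 2 * D))); last first.
  rewrite le_eqVlt; apply/orP; left; apply/eqP; field; by rewrite gt_eqF.
have D2 : 0 < D / 2 * D by rewrite /D; positivity.
apply: ler_pM => //; first exact: ip_norm_ge0.
  by rewrite invr_ge0 mulr_ge0 // (pseudometric_ge0 pd).
rewrite lef_pV2 ?posrE //; last by apply: mulr_gt0 => //; lra.
by rewrite ler_pM2r.
Qed.

Context (K : set T) (cK : ultra_compact U d K).

Lemma chart_bounded_cvg xs xi y (B : R) : ultra_cvg U d xs xi -> K xi ->
  U [set n | K (y n) /\ y n <> xs n] ->
  U [set n | ip_norm (chart (xs n) (y n)) <= B] ->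
  exists v, [/\ K v, v <> xi, ultra_cvg U d y v & ip_cvg (fun n => chart (xs n) (y n)) (chart xi v)].
Proof.
move=> h Kxi hy hB; have [d0 dC dt] := Phi_pseudometric.
pose y' n := if pselect (K (y n)) then y n else xi.
have Ky' n : K (y' n) by rewrite /y'; case: pselect.
have yy' : U [set n | y' n = y n] by apply: filterS hy => n /= [Kn _]; rewrite /y'; case: pselect.
have [v Kv hv'] := cK Ky'.
have hv : ultra_cvg U d y v.
{ by move=> e e0; apply: filterS (filterI yy' (hv' e e0)) => n /= [->].
}
have vx : v <> xi.
{ move=> E; rewrite {}E in hv; pose C := `|B| + 1.
  have C0 : 0 < C by rewrite /C; have := normr_ge0 B; lra.
  have e0 : 0 < C^-1 / 2 by positivity.
  have [n [[/= a b] [[Kn yn] c]]] := filter_ex (filterI (filterI (hv _ e0) (h _ e0)) (filterI hy hB)).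
  have dn := Phi_gt0 yn.
  have : d (y n) (xs n) < C^-1 by have := dt (y n) xi (xs n); rewrite (dC xi); lra.
  rewrite -ltf_pV2 ?posrE ?invr_gt0 // invrK -chart_norm => h1.
  have := ler_norm B; rewrite /C in h1; move: c => /= c; lra.
}
by have [_ hc] := chart_cvg h hv vx; exists v.
Qed.

Lemma ultra_diagonal (X : Type) (x0 : X) (P : nat -> X -> Prop) (f : nat -> X -> R) :
  (forall n x, 0 <= f n x) ->
  (forall e : R, 0 < e -> U [set n | exists x, P n x /\ f n x <= e]) ->
  exists z : nat -> X, forall e : R, 0 < e -> U [set n | P n (z n) /\ f n (z n) <= e].
Proof.
move=> f0 h.
have ch n : exists z, forall x, P n x -> P n z /\ f n z <= f n x + n.+1%:R^-1.
{ have [[x Px]|no] := pselect (exists x, P n x); last by exists x0 => x Px; exfalso; apply: no; exists x.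
  pose S : set R := [set f n x | x in P n].
  have Si : has_inf S by split; [exists (f n x); exists x | exists 0 => _ [z _ <-]].
  have q0 : 0 < n.+1%:R^-1 :> R by rewrite invr_gt0 ltr0Sn.
  have : inf S < inf S + n.+1%:R^-1 by rewrite ltrDl.
  move=> /(inf_lt Si.1) [_ [z Pz <-] hz]; exists z => w Pw; split => //.
  apply: le_trans (ltW hz) _; rewrite lerD2r; apply: ge_inf; first by case: Si.
  by exists w.
}
have [z hz] := choice ch; exists z => e e0; have e2 : 0 < e / 2 by lra.
apply: filterS (filterI (h _ e2) (free_ultra_invS_lt e2)) => n /= [[x [Px fx]] hn].
have [Pz fz] := hz n x Px; split => //; move: hn fz; move: (n.+1%:R^-1 : R) => q; lra.
Qed.

End Pictures.

Section ZoomSequences.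
Context {R : realType} (U : set_system nat) {uU : FreeUltraFilter U} (V : ipspace R).
Context (T : Type) (d : T -> T -> R) (Phi : T -> V).
Hypothesis d_sep : forall x y, d x y = 0 -> x = y.
Hypothesis dPhi : forall x y, d x y = ip_norm (Phi x - Phi y).
Hypothesis d_le2 : forall x y, d x y <= 2.
Context (K : set T) (cK : ultra_compact U d K) (c0 : R) (c00 : 0 < c0).
Context (Z : (T -> T) -> (T -> T) -> R -> (T -> R) -> Prop).
Hypothesis ZS : zoom_system d K c0 Z.
Context (k : nat) (k0 : (0 < k)%N).
Let pd : pseudometric d := Phi_pseudometric dPhi.
Let d0 x : d x x = 0. Proof. by case: pd. Qed.
Let dC x y : d x y = d y x. Proof. by case: pd. Qed.
Let dT x y z : d x z <= d x y + d y z. Proof. by case: pd. Qed.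
Let dgt0 := dist_gt0 pd d_sep.
Let Zmap := zoom_system_map ZS.

Lemma ball_nonnull v (e : R) : ~ hausdorff_null d k K -> K v -> 0 < e ->
  ~ hausdorff_null d k (K `&` [set x | d x v < e]).
Proof.
move=> nK Kv e0 nB.
have [||||[x0 Kx0 h]|[x1 [x2 [K1 K2 x12 h1 h2]]]] :=
  ideal_dichotomy pd cK (J := hausdorff_null d k) (A := K) _ _ _ Kv.
- exact: hausdorff_null0.
- by move=> A B; exact: hausdorff_nullS.
- by move=> A B; exact: hausdorff_nullU.
- by [].
- have [t t0 nt] := hausdorff_nonnull_away pd k0 (fun y (yx : y <> x0) => dgt0 yx) nK.
  exact: nt (h t t0).
have D4 : 0 < d x1 x2 / 4 by rewrite divr_gt0.
have [q Kq vq] : exists2 q, K q & v <> q.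
  have [vx|vx] := pselect (v = x1); last by exists x1.
  by exists x2 => // E; move: x12; rewrite -vx -E d0 ltxx.
pose B b := K `&` [set x | d x (if b : bool then x1 else x2) <= d x1 x2 / 4].
have [|u w [_ /= du] [_ /= dw]|b [g [h [kap [m [z hg]]]]]] :=
  zoom_absorb pd d_sep d_le2 c00 ZS (B := B) Kv Kq vq e0 D4.
- by move=> b x [].
- by have := dT x1 u x2; have := dT u w x2; rewrite (dC x1 u); lra.
have nb : ~ hausdorff_null d k (B b).
  by move=> hB; case: b {hg} hB => hB; [apply: h1|apply: h2]; exists (d x1 x2 / 4).
have BK : B b `<=` K by move=> x [].
apply: (zoom_image_mass (k := k) pd c00 (Zmap z) BK nb); rewrite mul0r.
apply: hausdorff_leS nB => // _ [x Bx <-]; split; last exact: hg.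
exact: (zoom_fwd (Zmap z) Bx.1).
Qed.

Lemma zoom_chart_neq g h kap m xi u : zoom_map d K c0 g h kap m -> K xi -> K u ->
  u <> xi -> h u <> h xi.
Proof. by move=> z Kxi Ku ux E; apply: ux; rewrite -(zoom_bwdK z Ku) E (zoom_bwdK z). Qed.

Lemma zoom_chart_dist g h kap m xi u v : zoom_map d K c0 g h kap m -> K xi -> K u -> K v ->
  u <> xi -> v <> xi -> ip_norm (chart Phi (h xi) (h u) - chart Phi (h xi) (h v)) =
  m xi ^+ 2 / kap * ip_norm (chart Phi xi u - chart Phi xi v).
Proof.
move=> z Kx Ku Kv ux vx.
rewrite !(chart_dist d_sep dPhi) //; [|exact: (zoom_chart_neq z)..].
have kp := zoom_scale_gt0 z; have mx := zoom_pole_gt0 c00 z Kx.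
have mu := zoom_pole_gt0 c00 z Ku; have mv := zoom_pole_gt0 c00 z Kv.
have E a b : K a -> K b -> d (h a) (h b) = kap * d a b / (m a * m b).
  move=> Ka Kb; rewrite -(zoom_conformal_bwd z Ka Kb) mulfK // mulf_neq0 //.
    by rewrite gt_eqF ?(zoom_pole_gt0 c00 z).
  by rewrite gt_eqF ?(zoom_pole_gt0 c00 z).
by rewrite !E //; have := dgt0 ux; have := dgt0 vx => a1 a2; field; rewrite !gt_eqF.
Qed.

Section ZoomAtPoint.
Variables (p xi xi' xo : T) (C : R).
Variables (g h : nat -> T -> T) (kap : nat -> R) (m : nat -> T -> R).
Hypotheses (Kp : K p) (Kxi : K xi) (pxi : p <> xi) (pxo : p <> xo) (C0 : 0 < C).
Hypothesis zooms : forall n, zoom_map d K c0 (g n) (h n) (kap n) (m n).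
Hypothesis scale_lt : forall n, kap n < n.+1%:R^-1.
Hypothesis pole_lt : forall n, m n p < C * kap n.
Hypothesis xi_lim : ultra_cvg U d (fun n => h n xi) xi'.

Let kap0 n : 0 < kap n. Proof. exact: zoom_scale_gt0 (zooms n). Qed.

Lemma scale_ultra_small (e : R) : 0 < e -> U [set n | kap n < e].
Proof.
by move=> /free_ultra_invS_lt; apply: filterS => n /= hn; exact: lt_trans hn.
Qed.

Lemma pole_ultra_small (e : R) : 0 < e -> U [set n | m n p < e].
Proof.
move=> e0; apply: filterS (scale_ultra_small (divr_gt0 e0 C0)) => n /=.
by rewrite ltr_pdivlMr // mulrC; exact: lt_trans.
Qed.

Lemma zoom_ratio_infinite (M : R) : U [set n | M < m n xi ^+ 2 / kap n].
Proof.
have D2 : 0 < d p xi / 2 by rewrite divr_gt0 ?dgt0.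
have M1 : 0 < `|M| + 1 by have := normr_ge0 M; lra.
have e0 : 0 < (d p xi / 2) ^+ 2 / (`|M| + 1) by rewrite divr_gt0 ?exprn_gt0.
apply: filterS (filterI (pole_ultra_small D2) (scale_ultra_small e0)) => n /= [mp].
rewrite !ltr_pdivlMr // => kap_lt.
have mxi : d p xi / 2 <= m n xi by have := zoom_dist_le_poles (zooms n) Kp Kxi; lra.
have : (d p xi / 2) ^+ 2 <= m n xi ^+ 2 by rewrite ler_pXn2r ?nnegrE //; lra.
have : M * kap n <= kap n * (`|M| + 1).
  by rewrite mulrC ler_pM2l //; have := ler_norm M; lra.
lra.
Qed.

Definition off (Q : set T) := [set x | exists2 t : R, 0 < t & forall q, Q q -> t <= d x q].

Definition porous_points (Q : set T) (s j : nat) :=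
  thick_points d k ((K `&` [set x | s.+1%:R^-1 <= d x xo]) `&` off Q) Q j.+1%:R^-1.

Variable Q : set T.
Hypotheses (QK : Q `<=` K) (Qp : Q p) (not_porous : forall s j, ~ porous_points Q s j p).

Lemma zoom_off n u v (e : R) : K u -> d u v < e / 2 ->
  (forall x, Q x -> e <= d (h n x) v) -> off Q (g n u).
Proof.
move=> Ku uv Qfar; have L0 : 0 < c0 ^+ 2 / kap n by positivity.
have e0 : 0 < e / 2 by exact: le_lt_trans (pseudometric_ge0 pd u v) uv.
exists (e / 2 / (c0 ^+ 2 / kap n)); first exact: divr_gt0.
move=> x Qx; rewrite ler_pdivrMr // [leRHS]mulrC.
have := zoom_bwd_lip pd c00 (zooms n) (zoom_fwd (zooms n) Ku) (QK Qx).
rewrite (zoom_fwdK (zooms n)) //; apply: le_trans.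
by have := Qfar x Qx; have := dT (h n x) u v; rewrite (dC (h n x) u); lra.
Qed.

(* Otherwise the zooms would carry a ball around [v] to a definite part of
   small balls around [p] off [Q], making [p] porous. *)
Lemma zoom_fill v (e : R) : ~ hausdorff_null d k K -> K v -> v <> xi' -> 0 < e ->
  U [set n | exists x, Q x /\ d (h n x) v <= e].
Proof.
move=> nK Kv vxi e0; apply: contrapT => /ultra_setC not_filled.
pose E := d v xi'; have E0 : 0 < E by exact: dgt0.
pose e' := Num.min (e / 2) (E / 4); have e'0 : 0 < e' by rewrite lt_min !divr_gt0.
pose B := K `&` [set x | d x v < e'].
have [a a0 mass] := hausdorff_nonnull_gt k0 (ball_nonnull nK Kv e'0).
have Do : 0 < d p xo by exact: dgt0.
have Dx : 0 < d xi p by rewrite dC; exact: dgt0.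
have E2 : 0 < E / 2 by rewrite divr_gt0.
pose rho := C + 4 / (E / 2 * d xi p); have rho0 : 0 < rho by rewrite addr_gt0 // !divr_gt0 // mulr_gt0.
have b0 : 0 < (c0 ^+ 2 * rho) ^+ k by rewrite exprn_gt0 // mulr_gt0 // exprn_gt0.
have [j hj] := exists_invS_lt (divr_gt0 a0 b0).
have [s hs] := exists_invS_lt (divr_gt0 Do (ltr0n R 2)).
suff : porous_points Q s j p by exact: not_porous.
split=> // r0 r00.
have t0 : 0 < Num.min r0 (d p xo / 2) / rho by rewrite divr_gt0 // lt_min r00 divr_gt0.
have [n [/= [nf xin] [scale_n pole_n]]] := filter_ex (filterI
  (filterI not_filled (xi_lim (divr_gt0 E0 (ltr0n R 4))))
  (filterI (scale_ultra_small t0) (pole_ultra_small (divr_gt0 Dx (ltr0n R 2))))).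
move: scale_n; rewrite ltr_pdivlMr // mulrC lt_min => /andP[scale_r0 scale_xo].
exists (rho * kap n); split=> //; first exact: mulr_gt0.
have BK : B `<=` K by move=> x [].
move=> small; apply: (zoom_image_mass pd c00 (zooms n) BK mass); apply: (hausdorff_leS _ _ small).
  move=> _ [u [Ku /= uv_lt] <-]; move: uv_lt; rewrite lt_min => /andP[uv uvE].
  have near : d (g n u) p <= rho * kap n.
    apply: (zoom_near d_le2 c00 (zooms n) Kp Kxi Ku (pole_lt n) _ Dx E2); first lra.
    by have := dT v u xi'; have := dT u (h n xi) xi'; rewrite (dC v u) -/E; lra.
  split=> //; split; first split=> /=.
  - exact: (zoom_fwd (zooms n) Ku).
  - have := dT p (g n u) xo; rewrite (dC p (g n u)); move: hs.
    by move: (s.+1%:R^-1 : R) => q; lra.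
  apply: zoom_off Ku uv _ => x Qx; rewrite leNgt; apply/negP => xv.
  by apply: nf; exists x; split=> //; exact: ltW.
have -> : a * (kap n / c0 ^+ 2) ^+ k = a / (c0 ^+ 2 * rho) ^+ k * (rho * kap n) ^+ k.
  rewrite -mulrA [X in _ = _ * X]mulrC -expr_div_n; congr (_ * _ ^+ _).
  by field; rewrite !lt0r_neq0.
by rewrite ler_pM2r ?exprn_gt0 ?mulr_gt0 // ltW.
Qed.

End ZoomAtPoint.

Context (xo : T).
Hypothesis Kfin : forall e : R, 0 < e -> hausdorff_finite d k (K `&` [set x | e <= d x xo]).
Hypothesis Lnull : hausdorff_null d k (K `\` radial_points K Z).

Lemma porous_points_null (Q : set T) s j : Q `<=` K -> hausdorff_null d k (porous_points xo Q s j).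
Proof.
move=> QK; apply: (hausdorff_density pd cK k0) => //.
  have s0 : 0 < s.+1%:R^-1 :> R by rewrite invr_gt0.
  by apply: hausdorff_finiteS (Kfin s0) => x [].
by move=> x [].
Qed.

Lemma radial_zooms C p : radial_with K Z C p -> exists g h kap m, forall n,
  [/\ Z (g n) (h n) (kap n) (m n), kap n < n.+1%:R^-1 & m n p < C * kap n].
Proof.
move=> [_ rad]; have n0 n : 0 < n.+1%:R^-1 :> R by rewrite invr_gt0.
by have /choice[g /choice[h /choice[kap /choice[m H]]]] n := rad _ (n0 n); exists g, h, kap, m.
Qed.

(* Almost every point of [X] is the centre of a sequence of zooms along which
   every [Q i] containing it fills up the whole limit set. *)
Lemma exists_filling_zooms xi (X : set T) (Q : nat -> set T) : K xi -> X `<=` K ->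
  ~ hausdorff_null d k X -> (forall i, Q i `<=` K) ->
  exists p g h kap m xi',
  [/\ X p /\ p <> xi, forall n, Z (g n) (h n) (kap n) (m n),
      K xi' /\ ultra_cvg U d (fun n => h n xi) xi',
      forall M : R, U [set n | M < m n xi ^+ 2 / kap n]
    & forall i, Q i p -> forall v, K v -> v <> xi' -> exists x : nat -> T,
      U [set n | Q i (x n)] /\ ultra_cvg U d (fun n => h n (x n)) v].
Proof.
move=> Kxi XK nX QK.
have nK : ~ hausdorff_null d k K by move=> h; apply: nX; apply: hausdorff_nullS h.
pose N := (\bigcup_i \bigcup_s \bigcup_j porous_points xo (Q i) s j)
  `|` ([set xo] `|` ([set xi] `|` (K `\` radial_points K Z))).
have nN : hausdorff_null d k N.
  apply: hausdorff_nullU => //; last first.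
    by do 2!(apply: hausdorff_nullU => //; first exact: hausdorff_null1).
  by do 3!(apply: hausdorff_null_bigcup => // ?); exact: porous_points_null.
have [p [Xp Np]] := hausdorff_nonnull_nonempty k0 (hausdorff_nonnullD k0 nX nN).
have Kp : K p := XK _ Xp.
have pxo : p <> xo by move=> E; apply: Np; right; left.
have pxi : p <> xi by move=> E; apply: Np; right; right; left.
have [C radC] : radial_points K Z p by apply: contrapT => h; apply: Np; right; right; right.
have C0 : 0 < `|C| + 1 by have := normr_ge0 C; lra.
have [|g [h [kap [m H]]]] := @radial_zooms (`|C| + 1) p.
  by apply: (radial_with_mono ZS _ radC); have := ler_norm C; lra.
have zooms n : zoom_map d K c0 (g n) (h n) (kap n) (m n) by have [/Zmap] := H n.
have scale_lt n : kap n < n.+1%:R^-1 by have [] := H n.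
have pole_lt n : m n p < (`|C| + 1) * kap n by have [] := H n.
have [xi' Kxi' xi_lim] := cK (fun n => zoom_bwd (zooms n) Kxi).
exists p, g, h, kap, m, xi'; split=> // [n|M|i Qp v Kv vxi]; first by have [] := H n.
  exact: (zoom_ratio_infinite Kp Kxi pxi C0 zooms scale_lt pole_lt).
have not_porous s j : ~ porous_points xo (Q i) s j p.
  by move=> h'; apply: Np; left; exists i => //; exists s => //; exists j.
have fill (e : R) : 0 < e -> U [set n | exists x, Q i x /\ d (h n x) v <= e].
  exact: (zoom_fill Kp Kxi pxi pxo C0 zooms scale_lt pole_lt xi_lim (QK i) Qp not_porous nK Kv vxi).
have [x hx] := ultra_diagonal v (P := fun n x => Q i x) (f := fun n x => d (h n x) v)
  (fun n x => pseudometric_ge0 pd _ _) fill.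
exists x; split; first by apply: filterS (hx 1 ltr01) => n [].
move=> e e0; have e2 : 0 < e / 2 by lra.
by apply: filterS (hx _ e2) => n /= [_]; lra.
Qed.

End ZoomSequences.

Lemma vandermonde_inverse (R : realType) (j : nat) (e : 'I_j -> nat) : injective e ->
  exists B : 'I_j -> 'I_j -> R, forall t : 'I_j -> R, forall l,
    t l = \sum_i B i l * \sum_(m < j) t m * (e i)%:R ^+ m.
Proof.
move=> einj; pose M : 'M[R]_j := Vandermonde j (\row_i (e i)%:R).
have uM : M \in unitmx.
{ rewrite unitmxE det_Vandermonde unitfE; apply/prodf_neq0 => i _; apply/prodf_neq0 => i' ii'.
  rewrite !mxE subr_eq0 eqr_nat; apply/eqP => /einj E; by rewrite E ltnn in ii'.
}
exists (fun i l => invmx M i l) => t l; pose v : 'rV[R]_j := \row_m t m.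
have : v = v *m M *m invmx M by rewrite mulmxK.
move=> /rowP/(_ l); rewrite !mxE => ->; apply: eq_bigr => i _; rewrite mxE mulrC; congr (_ * _).
by apply: eq_bigr => m _; rewrite !mxE.
Qed.

Section IPAux.
Context {R : realType} (V : ipspace R).

Lemma ip_norm_sum (J : Type) (r : seq J) (F : J -> V) :
  ip_norm (\sum_(i <- r) F i) <= \sum_(i <- r) ip_norm (F i).
Proof.
elim: r => [|i r IH]; first by rewrite !big_nil ip_norm0.
by rewrite !big_cons; apply: le_trans (ip_normD _ _) _; rewrite lerD2l.
Qed.

Lemma near_segment (a b z : V) (e q : R) : 0 <= e -> 0 <= q -> 2 * e <= q ^+ 2 ->
  0 < ip_norm (a - b) -> ip_norm (a - z) <= ip_norm (a - b) ->
  ip_norm (a - z) + ip_norm (z - b) <= (1 + e) * ip_norm (a - b) ->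
  ip_norm (z - a - (ip_norm (a - z) / ip_norm (a - b)) *: (b - a)) <= q * ip_norm (a - b).
Proof.
move=> e0 q0 eq D0 tD ts.
set D := ip_norm (a - b) in D0 tD ts *.
set t := ip_norm (a - z) in tD ts *; set s := ip_norm (z - b) in ts.
have t0 : 0 <= t := ip_norm_ge0 _; have s0 : 0 <= s := ip_norm_ge0 _.
rewrite -(ler_pXn2r (n := 2)) ?nnegrE ?ip_norm_ge0 ?mulr_ge0 ?(ltW D0) // ip_norm_sq.
have E1 : ip (z - a) (z - a) = t ^+ 2 by rewrite -ip_norm_sq ip_distC.
have E2 : ip (b - a) (b - a) = D ^+ 2 by rewrite -ip_norm_sq ip_distC.
have E3 : ip (z - a) (b - a) = (t ^+ 2 + D ^+ 2 - s ^+ 2) / 2.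
{ rewrite ip_polarization (ip_distC z a) (ip_distC b a) -/t -/D; congr ((_ - _ ^+ 2) / _).
  by rewrite opprB addrA subrK.
}
have -> : ip (z - a - (t / D) *: (b - a)) (z - a - (t / D) *: (b - a)) =
  ip (z - a) (z - a) - 2 * (t / D) * ip (z - a) (b - a) + (t / D) ^+ 2 * ip (b - a) (b - a).
{ move: (z - a) (b - a) => x y; rewrite !ipE (ipC y x); ring.
}
rewrite E1 E2 E3.
have -> : t ^+ 2 - 2 * (t / D) * ((t ^+ 2 + D ^+ 2 - s ^+ 2) / 2) + (t / D) ^+ 2 * D ^+ 2 =
  t / D * ((s + t - D) * (s + D - t)) by field; rewrite gt_eqF.
have st : s <= D + t by have := ip_dist_triangle z a b; rewrite (ip_distC z a) -/s -/t -/D; lra.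
have h0 : D <= t + s by have := ip_dist_triangle a z b; rewrite -/s -/t -/D.
have h1 : t / D <= 1 by rewrite ler_pdivrMr // mul1r.
have h2 : (s + t - D) * (s + D - t) <= (e * D) * (2 * D) by apply: ler_pM; lra.
have h3 : t / D * ((s + t - D) * (s + D - t)) <= 1 * ((e * D) * (2 * D)).
{ apply: ler_pM => //; first by apply: divr_ge0 => //; apply: ltW.
  by apply: mulr_ge0; lra.
}
apply: le_trans h3 _; rewrite exprMn mul1r.
have -> : e * D * (2 * D) = 2 * e * D ^+ 2 by ring.
by apply: ler_wpM2r => //; apply: exprn_ge0; apply: ltW.
Qed.

Context (j : nat) (w : 'I_j -> V).
Hypothesis w_orth : forall i i', ip (w i) (w i') = (i == i')%:R.

Lemma ip_orth_sum (t : 'I_j -> R) l : ip (\sum_i t i *: w i) (w l) = t l.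
Proof.
rewrite ip_suml (bigD1 l) //= ipZl w_orth eqxx mulr1 big1 ?addr0 // => i il.
by rewrite ipZl w_orth (negbTE il) mulr0.
Qed.

Lemma ip_norm_w i : ip_norm (w i) = 1.
Proof. by rewrite /ip_norm w_orth eqxx sqrtr1. Qed.

Context (a : nat -> V).

(* On the span of the frame the functionals [ip _ (moment_vector n)] form a Vandermonde
   family, so that any [j] of them are independent there. *)
Definition moment_vector n : V :=
  (if (n < j)%N then 0 else a (n - j) - \sum_(l < j) ip (a (n - j)) (w l) *: w l)
  + \sum_(l < j) (n%:R ^+ l) *: w l.

Lemma ip_moment_vector n l : ip (w l) (moment_vector n) = n%:R ^+ l.
Proof.
rewrite ipC /moment_vector ipDl ip_orth_sum; case: ifP => _; first by rewrite ip0l add0r.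
by rewrite ipDl ipNl ip_orth_sum subrr add0r.
Qed.

Lemma moment_vector_separating x : (forall n, ip x (moment_vector n) = 0) -> forall m, ip x (a m) = 0.
Proof.
move=> h; have w0 l : ip x (w l) = 0.
{ have [B hB] := @vandermonde_inverse R j (fun i => i) (@ord_inj j).
  rewrite (hB (fun l => ip x (w l)) l) big1 // => i _.
  have -> : \sum_(m < j) ip x (w m) * i%:R ^+ m = ip x (moment_vector i).
  { rewrite /moment_vector ltn_ord add0r ip_sumr; apply: eq_bigr => m _; by rewrite ipZr mulrC.
  }
  by rewrite h mulr0.
}
move=> m; have := h (m + j)%N; rewrite /moment_vector ltnNge leq_addl /= addnK ipDr ipDr ipNr !ip_sumr.
rewrite [X in _ - X + _]big1 ?subr0; last by move=> l _; rewrite ipZr w0 mulr0.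
by rewrite big1 ?addr0 // => l _; rewrite ipZr w0 mulr0.
Qed.

Lemma moment_vector_angle (e : 'I_j -> nat) : injective e -> exists2 eta : R, 0 < eta &
  forall x, (forall i, ip x (moment_vector (e i)) = 0) ->
  forall t : 'I_j -> R, eta * ip_norm x <= ip_norm (x - \sum_i t i *: w i).
Proof.
move=> einj; have [B hB] := vandermonde_inverse R einj.
pose F := \sum_i ip_norm (moment_vector (e i)); pose C := \sum_l \sum_i `|B i l| * F.
have F0 : 0 <= F by apply: sumr_ge0 => i _; apply: ip_norm_ge0.
have C0 : 0 <= C.
{ by apply: sumr_ge0 => l _; apply: sumr_ge0 => i _; apply: mulr_ge0.
}
exists (1 + C)^-1; first by rewrite invr_gt0; lra.
move=> x hx t; rewrite mulrC ler_pdivrMr; last lra.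
set z := x - _.
have tE i : \sum_(m < j) t m * (e i)%:R ^+ m = - ip z (moment_vector (e i)).
{ rewrite /z ipDl ipNl hx sub0r opprK ip_suml.
  by apply: eq_bigr => m _; rewrite ipZl ip_moment_vector.
}
have tl l : `|t l| <= (\sum_i `|B i l| * F) * ip_norm z.
{ rewrite (hB t l); apply: le_trans (ler_norm_sum _ _ _) _; rewrite mulr_suml.
  apply: ler_sum => i _; rewrite normrM tE normrN -mulrA; apply: ler_wpM2l => //.
  apply: le_trans (ip_cauchy_schwarz _ _) _; rewrite mulrC; apply: ler_wpM2r; first exact: ip_norm_ge0.
  rewrite /F (bigD1 i) //= lerDl; apply: sumr_ge0 => i' _; exact: ip_norm_ge0.
}
have h1 : ip_norm (\sum_i t i *: w i) <= C * ip_norm z.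
{ apply: le_trans (ip_norm_sum _ _) _; rewrite /C mulr_suml; apply: ler_sum => i _.
  by rewrite ip_normZ ip_norm_w mulr1.
}
have h2 := ip_normD z (\sum_i t i *: w i); rewrite /z subrK -/z in h2; lra.
Qed.

End IPAux.

(** * Generic slices *)

Section Slicing.
Context {R : realType} (U : set_system nat) {uU : FreeUltraFilter U} (V : ipspace R).
Context (T : Type) (d : T -> T -> R) (Phi : T -> V).
Hypothesis d_sep : forall x y, d x y = 0 -> x = y.
Hypothesis dPhi : forall x y, d x y = ip_norm (Phi x - Phi y).
Context (K : set T) (cK : ultra_compact U d K) (xi : T).
Let pd : pseudometric d := Phi_pseudometric dPhi.
Let d0 x : d x x = 0. Proof. by case: pd. Qed.
Let dC x y : d x y = d y x. Proof. by case: pd. Qed.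
Let dT x y z : d x z <= d x y + d y z. Proof. by case: pd. Qed.
Let dgt0 x y : x <> y -> 0 < d x y. Proof. exact: Phi_gt0. Qed.
Notation c := (chart Phi xi).
Context (f : nat -> V).
Hypothesis f_sep : forall u v, K u -> K v -> u <> xi -> v <> xi ->
  (forall n, ip (c u - c v) (f n) = 0) -> u = v.

Definition coord i u := ip (c u) (f i).

(* The point [xi] at infinity belongs to every slice. *)
Definition slice (i : nat) (t : R) : set T := [set u | u = xi \/ (u <> xi /\ coord i u = t)].

Lemma ultra_cvg_neq x v y : ultra_cvg U d x v -> v <> y -> U [set n | x n <> y].
Proof.
by move=> xv /dgt0 vy; apply: filterS (xv _ vy) => n /= + E; rewrite E dC ltxx.
Qed.

Lemma coord_cvg i x v : ultra_cvg U d x v -> v <> xi -> forall e : R, 0 < e ->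
  U [set n | `|coord i (x n) - coord i v| < e].
Proof.
move=> xv vxi e e0; have [_ cv] := chart_cvg d_sep dPhi (ultra_cvg_cst pd xi) xv vxi.
have f0 := ip_norm_ge0 (f i); have f1 : 0 < ip_norm (f i) + 1 by lra.
apply: filterS (cv _ (divr_gt0 e0 f1)) => n /=; rewrite ltr_pdivlMr //; apply: le_lt_trans.
have := ip_cauchy_schwarz (c (x n) - c v) (f i); rewrite ipDl ipNl => /le_trans; apply.
by rewrite ler_wpM2l ?ip_norm_ge0 //; lra.
Qed.

Lemma chart_lip (r : R) u v : 0 < r -> r <= d u xi -> r <= d v xi ->
  ip_norm (c u - c v) <= (r ^+ 2)^-1 * d u v.
Proof.
move=> r0 ur vr; have far w : r <= d w xi -> w <> xi by move=> h E; move: h; rewrite E d0; lra.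
rewrite (chart_dist d_sep dPhi (far _ ur) (far _ vr)) mulrC.
apply: ler_wpM2r; first exact: pseudometric_ge0.
rewrite lef_pV2 ?posrE ?exprn_gt0 //; last by apply: mulr_gt0; lra.
by rewrite expr2; apply: ler_pM; lra.
Qed.

Lemma coord_lip i (r : R) u v : 0 < r -> r <= d u xi -> r <= d v xi ->
  `|coord i u - coord i v| <= (ip_norm (f i) + 1) / r ^+ 2 * d u v.
Proof.
move=> r0 ur vr; have := ip_cauchy_schwarz (c u - c v) (f i); rewrite ipDl ipNl => /le_trans.
apply; rewrite mulrC -mulrA; apply: ler_pM; rewrite ?ip_norm_ge0 ?chart_lip //.
by rewrite lerDl.
Qed.

Lemma coord_cvg_ge i z y t : ultra_cvg U d z y -> y <> xi -> (forall n, t <= coord i (z n)) ->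
  t <= coord i y.
Proof.
move=> zy yxi tz; rewrite leNgt; apply/negP; rewrite -subr_gt0 => /(coord_cvg i zy yxi).
by move=> /filter_ex[n /=]; have := tz n; rewrite ltr_norml; lra.
Qed.

Lemma coord_cvg_le i z y t : ultra_cvg U d z y -> y <> xi -> (forall n, coord i (z n) <= t) ->
  coord i y <= t.
Proof.
move=> zy yxi tz; rewrite leNgt; apply/negP; rewrite -subr_gt0 => /(coord_cvg i zy yxi).
by move=> /filter_ex[n /=]; have := tz n; rewrite ltr_norml; lra.
Qed.

Lemma ultra_compact_slice i t A : A `<=` K -> ultra_compact U d A ->
  ultra_compact U d (A `&` slice i t).
Proof.
move=> AK cA; apply: ultra_compact_restrict => // u x hu Ax ux.
have [->|xxi] := pselect (x = xi); [by left|right; split=> //].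
apply: contrapT => ne; have e0 : 0 < `|coord i x - t| by rewrite normr_gt0 subr_eq0; apply/eqP.
have [n [/= unxi]] := filter_ex (filterI (ultra_cvg_neq ux xxi) (coord_cvg i ux xxi e0)).
by have [_ [//|[_ ->]]] := hu n; rewrite distrC ltxx.
Qed.

Lemma coord_separates x (F : set T) : K x -> x <> xi -> ultra_compact U d F -> F `<=` K ->
  (forall u, F u -> u <> x /\ u <> xi) ->
  exists M, exists2 e : R, 0 < e &
    forall u, F u -> exists i : 'I_M, e < `|coord i u - coord i x|.
Proof.
move=> Kx xxi cF FK hF; apply: contrapT => none.
have /choice[u hu] M : exists u, F u /\ forall i, (i < M)%N -> `|coord i u - coord i x| <= M.+1%:R^-1.
  apply: contrapT => no_u; apply: none; exists M, M.+1%:R^-1; first by rewrite invr_gt0.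
  move=> u Fu; apply: contrapT => no_i; apply: no_u; exists u; split=> // i iM.
  by rewrite leNgt; apply/negP => lt; apply: no_i; exists (Ordinal iM).
have [v Fv uv] := cF u (fun n => (hu n).1); have [vx vxi] := hF v Fv.
apply: vx; apply: f_sep => // [|i]; first exact: FK.
rewrite ipDl ipNl -/(coord i v) -/(coord i x); apply: contrapT => /eqP.
rewrite -normr_gt0 => dist0; have e0 : 0 < `|coord i v - coord i x| / 2 by lra.
have [n [/= uvn [iM nn]]] := filter_ex (filterI (coord_cvg i uv vxi e0)
  (filterI (free_ultra_ge i.+1) (free_ultra_invS_lt e0))).
have := (hu n).2 i iM; have := ler_distD (coord i (u n)) (coord i v) (coord i x).
by rewrite (distrC (coord i v) (coord i (u n))); move: nn; move: (n.+1%:R^-1 : R) => q; lra.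
Qed.

Definition box x (r : R) M (a b : nat -> R) :=
  [set u | d u x < r /\ forall i : 'I_M, a i < coord i u < b i].

Definition edges M (a b : nat -> R) :=
  List.flat_map (fun i => [:: (i, a i); (i, b i)]) (List.seq 0 M).

Lemma in_edges M a b p : List.In p (edges M a b) <->
  exists i : 'I_M, p = (i : nat, a i) \/ p = (i : nat, b i).
Proof.
rewrite /edges List.in_flat_map; split=> [[i [/List.in_seq[_ /ssrnat.ltP iM] ip]]|[i ip]].
  by exists (Ordinal iM); case: ip => [<-|[<-|//]]; [left|right].
exists (i : nat); split; last by case: ip => ->; [left|right; left].
by apply/List.in_seq; split; [exact/ssrnat.leP|exact/ssrnat.ltP].
Qed.

Lemma open_in_box x r M a b : r <= d x xi -> open_in d K (box x r M a b).
Proof.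
move=> rx y Ky [yx yab]; apply: contrapT => not_open.
have yxi : y <> xi by move=> E; move: yx; rewrite E (dC xi); lra.
have [e e0|z [hz zy]] := @ultra_cvg_exists _ _ _ _ _ pd (K `&` ~` box x r M a b) y.
  apply: contrapT => none; apply: not_open; exists e => // z Kz yz.
  by apply: contrapT => nz; apply: none; exists z.
have z_ab : U [set n | forall i : 'I_M, a i < coord i (z n) < b i].
  apply: filter_forall => i; have /andP[ya yb] := yab i.
  have q0 : 0 < Num.min (coord i y - a i) (b i - coord i y) by rewrite lt_min !subr_gt0 ya.
  apply: filterS (coord_cvg i zy yxi q0) => n /=.
  by rewrite lt_min !ltr_norml => /andP[/andP[? ?] /andP[? ?]]; apply/andP; split; lra.
have r0 : 0 < r - d y x by rewrite subr_gt0.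
have [n [/= zn nab]] := filter_ex (filterI (zy _ r0) z_ab).
have [_] := hz n; apply; split=> //=.
by have := dT (z n) y x; lra.
Qed.

Lemma boundary_in_box x r M a b y : boundary_in d K (box x r M a b) y -> y <> xi -> d y x < r ->
  slices slice (edges M a b) y.
Proof.
move=> [Ky ny yO] yxi yx.
have [e e0|z [hz zy]] := @ultra_cvg_exists _ _ _ _ _ pd (box x r M a b) y.
  by have [z [_ Oz yz]] := yO e e0; exists z.
have [i ni] : exists i : 'I_M, ~ (a i < coord i y < b i).
  by apply: contrapT => none; apply: ny; split=> // i; apply: contrapT => ni; apply: none; exists i.
have ya : a i <= coord i y.
  by apply: coord_cvg_ge zy yxi _ => n; have [_ /(_ i)/andP[/ltW]] := hz n.
have yb : coord i y <= b i.
  by apply: coord_cvg_le zy yxi _ => n; have [_ /(_ i)/andP[_ /ltW]] := hz n.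
have [ay|ay] := eqVneq (coord i y) (a i).
  by exists (i : nat, a i); [apply/in_edges; exists i; left|right].
have [by_|by_] := eqVneq (coord i y) (b i).
  by exists (i : nat, b i); [apply/in_edges; exists i; right|right].
by case: ni; rewrite !lt_neqAle ya yb eq_sym ay by_.
Qed.

Lemma ultra_compact_shell x (r s : R) : ultra_compact U d (K `&` [set u | r <= d u x /\ d u x <= s]).
Proof.
apply: ultra_compact_restrict => // u v hu Kv uv; split.
  by apply: (ultra_cvg_dist_ge pd uv); apply: filterE => n /=; have [_ []] := hu n.
by apply: (ultra_cvg_dist_le pd uv); apply: filterE => n /=; have [_ []] := hu n.
Qed.

Section Neighbourhoods.
Variable N : nat -> set R.
Hypothesis N_null : forall i, lebesgue_null (N i).

Lemma exists_generic_bounds (t : nat -> R) (e : R) : 0 < e -> exists a b : nat -> R, forall i,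
  [/\ t i - e < a i < t i, t i < b i < t i + e & ~ N i (a i) /\ ~ N i (b i)].
Proof.
move=> e0; have /choice[ab hab] i : exists ab : R * R,
    [/\ t i - e < ab.1 < t i, t i < ab.2 < t i + e & ~ N i ab.1 /\ ~ N i ab.2].
  have [|a ha Na] := @lebesgue_null_itv R (t i - e) (t i) _ _ (N_null i); first lra.
  have [|b hb Nb] := @lebesgue_null_itv R (t i) (t i + e) _ _ (N_null i); first lra.
  by exists (a, b).
by exists (fun i => (ab i).1), (fun i => (ab i).2).
Qed.

(* Finitely many coordinates separate [x] from a small shell around it, so that
   a thin box around [x] stays inside the shell. *)
Lemma slice_nbhd_away x (e : R) : K x -> x <> xi -> 0 < e ->
  exists (O : set T) (l : seq (nat * R)),
  [/\ O x, open_in d K O, forall y z, K y -> K z -> O y -> O z -> d y z <= e,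
      forall p, List.In p l -> ~ N p.1 p.2 & boundary_in d K O `<=` slices slice l].
Proof.
move=> Kx xxi e0; have D0 := dgt0 xxi.
pose r := Num.min (e / 2) (d x xi / 4); have r0 : 0 < r by rewrite lt_min !divr_gt0.
have re : r <= e / 2 by rewrite ge_min lexx.
have rD : r <= d x xi / 4 by rewrite ge_min lexx orbT.
have far u : d u x <= 2 * r -> u <> xi by move=> ux E; move: ux; rewrite E dC; lra.
have [u []//|u [_ [ru ur]]|M [s s0 hM]] := coord_separates Kx xxi (@ultra_compact_shell x r (2 * r)).
  by split; [move=> E; move: ru; rewrite E d0; lra|exact: far].
have [a [b ab]] := exists_generic_bounds (fun i => coord i x) s0.
pose O := box x (2 * r) M a b.
have O_near u : K u -> O u -> d u x < r.
  move=> Ku [ux uab]; rewrite ltNge; apply/negP => ru.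
  have [|i] := hM u; first by split=> //; split=> //; exact: ltW.
  have [/andP[? ?] /andP[? ?] _] := ab i; have /andP[? ?] := uab i.
  by apply/negP; rewrite -leNgt ler_norml; apply/andP; split; lra.
exists O, (edges M a b); split.
- split=> [|i]; first by rewrite d0; lra.
  by have [/andP[_ ->] /andP[-> _]] := ab i.
- by apply: open_in_box; lra.
- move=> y z Ky Kz /(O_near _ Ky) yx /(O_near _ Kz) zx.
  by have := dT y x z; rewrite (dC x z); lra.
- by move=> p /in_edges[i [->|->]]; have [_ _ []] := ab i.
move=> y yb; have [Ky _ yO] := yb.
have yx : d y x <= r.
  have [e' e'0|z [hz zy]] := @ultra_cvg_exists _ _ _ _ _ pd (K `&` O) y.
    by have [z [Kz Oz yz]] := yO e' e'0; exists z.
  apply: (ultra_cvg_dist_le pd zy); apply: filterE => n /=; apply: ltW.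
  by have [Kz Oz] := hz n; exact: O_near.
by apply: boundary_in_box yb _ _; [apply: far|]; lra.
Qed.

(* A neighbourhood of [xi] is a ball together with small neighbourhoods of the
   points of its boundary sphere. *)
Lemma slice_nbhd_pole (e : R) : K xi -> 0 < e -> exists (O : set T) (l : seq (nat * R)),
  [/\ O xi, open_in d K O, forall y z, K y -> K z -> O y -> O z -> d y z <= e,
      forall p, List.In p l -> ~ N p.1 p.2 & boundary_in d K O `<=` slices slice l].
Proof.
move=> Kxi e0; pose r := e / 4; have r0 : 0 < r by rewrite divr_gt0.
pose F := K `&` [set u | r <= d u xi /\ d u xi <= r].
have [u []//|x [Kx [rx _]]|M [W [l [Wcov hW lN lb]]]] := finite_slice_cover pd (S := slice) (K := K)
    (P := fun p => ~ N p.1 p.2) (A := F) (e := r / 2) _ (@ultra_compact_shell xi r r).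
  by apply: slice_nbhd_away; [|move=> E; move: rx; rewrite E d0; lra|rewrite divr_gt0].
pose O := [set u | d u xi < r] `|` \bigcup_a W a.
have O_near u : K u -> O u -> d u xi <= 3 / 2 * r.
  move=> Ku [/= ?|[a _ Wu]]; first lra.
  have [[z [Kz [_ zr]] Wz] _ /(_ u z Ku Kz Wu Wz) uz] := hW a.
  by have := dT u z xi; lra.
exists O, l; split=> //.
- by left; rewrite /= d0.
- move=> y Ky [/= yr|[a _ Wy]].
    exists (r - d y xi) => [|z Kz yz]; first lra.
    by left; have := dT z y xi; rewrite /= (dC z y); lra.
  by have [_ /(_ y Ky Wy)[s s0 hs] _] := hW a; exists s => // z Kz yz; right; exists a => //; exact: hs.
- move=> y z Ky Kz /(O_near _ Ky) yr /(O_near _ Kz) zr.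
  by have := dT y xi z; rewrite (dC xi z) /r in yr zr *; lra.
move=> y yb; have [Ky nO _] := yb.
have [[_ _ y_near]|/(boundary_in_bigcup pd)[a _ /lb //]] := boundary_in_setU yb.
have yr : r <= d y xi by rewrite leNgt; apply/negP => h; apply: nO; left.
suff /Wcov[a Wa] : F y by case: nO; right; exists a.
split=> //; split=> //; rewrite leNgt; apply/negP => ry.
have [|z [_ /= zr yz]] := y_near (d y xi - r); first lra.
by have := dT y z xi; lra.
Qed.

Lemma slice_nbhd x (e : R) : K x -> 0 < e -> exists (O : set T) (l : seq (nat * R)),
  [/\ O x, open_in d K O, forall y z, K y -> K z -> O y -> O z -> d y z <= e,
      forall p, List.In p l -> ~ N p.1 p.2 & boundary_in d K O `<=` slices slice l].
Proof.
have [->|xxi Kx] := pselect (x = xi); first exact: slice_nbhd_pole.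
exact: slice_nbhd_away.
Qed.

End Neighbourhoods.

Context (xo : T) (E : set T).
Hypothesis Exi : ~ E xi.

Definition finite_away n A := forall e : R, 0 < e ->
  hausdorff_finite d n (A `&` [set u | e <= d u xo /\ e <= d u xi]).

Lemma slice_regular n A i : A `<=` K -> finite_away n.+2 A -> hausdorff_null d n.+2 (E `&` A) ->
  lebesgue_null [set t | ~ (finite_away n.+1 (A `&` slice i t) /\
    hausdorff_null d n.+1 (E `&` (A `&` slice i t)))].
Proof.
move=> AK finA nulA; pose t_ N : R := N.+1%:R^-1; have t0 N : 0 < t_ N by rewrite invr_gt0.
pose L N := (ip_norm (f i) + 1) / t_ N ^+ 2.
have L0 N : 0 < L N by rewrite divr_gt0 ?exprn_gt0 //; have := ip_norm_ge0 (f i); lra.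
pose A_fin N := A `&` [set u | t_ N <= d u xo /\ t_ N <= d u xi].
pose A_nul N := (E `&` A) `&` [set u | t_ N <= d u xi].
have fin_null N : lebesgue_null [set t | ~ hausdorff_finite d n.+1 (A_fin N `&`
  [set x | coord i x = t])].
  apply: (@eilenberg_finite _ _ _ n.+1 _ _ _ (L N)) => //; last exact: finA.
  by move=> x y [_ [_ hx]] [_ [_ hy]]; exact: coord_lip.
have nul_null N : lebesgue_null [set t | ~ hausdorff_null d n.+1 (A_nul N `&` [set x | coord i x = t])].
  apply: (@eilenberg_null _ _ _ n.+1 _ _ _ (L N)) => //.
    by move=> x y [_ hx] [_ hy]; exact: coord_lip.
  by apply: hausdorff_nullS nulA => x [].
apply: negligibleS (negligibleU (negligible_bigcup fin_null) (negligible_bigcup nul_null)) => t /= bad.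
apply: contrapT => /not_orP[fin_t nul_t]; apply: bad; split=> [e e0|].
  have [N hN] := exists_invS_lt e0.
  have : hausdorff_finite d n.+1 (A_fin N `&` [set x | coord i x = t]).
    by apply: contrapT => h; apply: fin_t; exists N.
  apply: hausdorff_finiteS => u [[Au Su] [eo ex]]; split.
    by split=> //; split; apply: le_trans (ltW hN) _.
  by case: Su => [E'|[//]]; move: ex; rewrite E' d0; lra.
apply: (@hausdorff_nullS _ _ _ _ _ (\bigcup_N (A_nul N `&` [set x | coord i x = t]))).
  move=> u [Eu [Au [E'|[uxi ut]]]]; first by case: Exi; rewrite -E'.
  by have [N hN] := exists_invS_lt (dgt0 uxi); exists N => //; split=> //; split=> //; exact: ltW.
by apply: hausdorff_null_bigcup => // N; apply: contrapT => h; apply: nul_t; exists N.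
Qed.

Notation slice_dim_le := (slice_dim_le d lebesgue_null slice).

Lemma slice_dim_le_pole n A : A `<=` [set xi] -> slice_dim_le n A.
Proof.
elim: n A => [|n IH] A Axi /=.
  by move=> e e0; exists 1 => // x y xy; rewrite (Axi _ (chain_left xy)) (Axi _ (chain_right xy)) d0 ltW.
move=> i; apply: negligibleS (negligible_set0 _) => t /=; apply; apply: IH.
exact: subset_trans Axi.
Qed.

Lemma lebesgue_null_set1 (t : R) : lebesgue_null [set t].
Proof. by apply/negligibleP; [exact: measurable_set1|exact: lebesgue_measure_set1]. Qed.

(* Slicing along a coordinate that is already constant on [A] is void, so every
   step uses a new coordinate. *)
Lemma slice_descent n A (l : seq nat) (t : nat -> R) : A `<=` K -> ultra_compact U d A ->
  (forall i u, i \in l -> A u -> u <> xi -> coord i u = t i) -> uniq l ->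
  finite_away n.+1 A -> hausdorff_null d n.+1 (E `&` A) -> ~ slice_dim_le n A ->
  exists A' l' t', [/\ A' `<=` K, ultra_compact U d A' /\ ~ zero_dimensional d A',
    forall i u, i \in l' -> A' u -> u <> xi -> coord i u = t' i,
    uniq l' /\ size l' = (size l + n)%N & finite_away 1 A' /\ hausdorff_null d 1 (E `&` A')].
Proof.
elim: n A l t => [|n IH] A l t AK cA At ul finA nulA nD.
  by exists A, l, t; split=> //; rewrite addn0.
have /existsNP[i ni] := nD.
have il : i \notin l.
  apply/negP => il; apply: ni; apply: negligibleS (lebesgue_null_set1 (t i)) => s /= nd.
  apply: contrapT => st; apply: nd; apply: slice_dim_le_pole => u [Au [//|[uxi us]]].
  by case: st; rewrite -us (At i).
have [s [nDs [finAs nulAs]]] : exists s, ~ slice_dim_le n (A `&` slice i s) /\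
    (finite_away n.+1 (A `&` slice i s) /\ hausdorff_null d n.+1 (E `&` (A `&` slice i s))).
  apply: contrapT => none; apply: ni; apply: negligibleS (slice_regular i AK finA nulA) => s /= ns good.
  by apply: none; exists s.
have [||||A' [l' [t' [A'K cA' A't [ul' sl'] regA']]]] :=
  IH (A `&` slice i s) (i :: l) (fun i' => if i' == i then s else t i') _ _ _ _ finAs nulAs nDs.
- by move=> u [/AK].
- exact: ultra_compact_slice.
- move=> i' u; rewrite inE => /orP[/eqP->|i'l] [Au Su] uxi.
    by rewrite eqxx; case: Su => [//|[]].
  by case: eqP => [E'|_]; [rewrite E' (negbTE il) in i'l|exact: At].
- by rewrite /= il.
by exists A', l', t'; split=> //; rewrite /= addSnnS in sl'.
Qed.

End Slicing.

Lemma ip_ext (R : realType) (V : ipspace R) (x y : V) : (forall v, ip x v = ip y v) -> x = y.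
Proof. by move=> h; apply: ip_dist_eq0; rewrite /ip_norm ipDl ipNl h subrr sqrtr0. Qed.

Ltac vector_ring := apply: ip_ext => ?; rewrite ?(ipDl, ipZl, ipNl, ip0l); ring.

(** * Approximate segments *)

Section ChangeOfMetric.
Context {R : realType} (U : set_system nat) {uU : FreeUltraFilter U}.
Context (T : Type) (d d' : T -> T -> R) (A : set T) (L : R).
Hypotheses (L0 : 0 < L) (d'_le : forall u v, A u -> A v -> d' u v <= L * d u v).

Lemma ultra_compact_metric_le : ultra_compact U d A -> ultra_compact U d' A.
Proof.
move=> cA u Au; have [x Ax ux] := cA u Au; exists x => // e e0.
apply: filterS (ux _ (divr_gt0 e0 L0)) => n /=; rewrite ltr_pdivlMr // mulrC.
exact/le_lt_trans/d'_le.
Qed.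

Lemma chain_metric_le (e : R) x y : chain d A e x y -> chain d' A (L * e) x y.
Proof.
elim=> [Ax|y' z xy' IH Az yz]; first exact: chain0.
apply: (chainS IH Az); apply: le_trans (d'_le (chain_right xy') Az) _.
by rewrite ler_pM2l.
Qed.

Lemma chain_connected_metric_le : chain_connected d A -> chain_connected d' A.
Proof.
move=> coA x y Ax Ay e e0; have := chain_metric_le (coA x y Ax Ay _ (divr_gt0 e0 L0)).
by rewrite mulrC divfK ?gt_eqF.
Qed.

Lemma hausdorff_finite_metric_le k : hausdorff_finite d k A -> hausdorff_finite d' k A.
Proof.
move=> /(hausdorff_finite_image (d' := d') (f := id) L0 d'_le).
by apply: hausdorff_finiteS => u Au; exists u.
Qed.

Lemma hausdorff_null_metric_le k (E : set T) : hausdorff_null d k (E `&` A) ->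
  hausdorff_null d' k (E `&` A).
Proof.
have d'E u v : (E `&` A) u -> (E `&` A) v -> d' u v <= L * d u v.
  by move=> [_ Au] [_ Av]; exact: d'_le.
move=> /(hausdorff_null_image (d' := d') (f := id) L0 d'E).
by apply: hausdorff_nullS => u EAu; exists u.
Qed.

End ChangeOfMetric.

Section Continua.
Context {R : realType} (U : set_system nat) {uU : FreeUltraFilter U}.
Context (T : Type) (d : T -> T -> R) (pd : pseudometric d).
Hypothesis d_sep : forall x y, d x y = 0 -> x = y.
Let d0 x : d x x = 0. Proof. by case: pd. Qed.
Let dC x y : d x y = d y x. Proof. by case: pd. Qed.
Let dT x y z : d x z <= d x y + d y z. Proof. by case: pd. Qed.

Lemma near_straight_sym (W : set T) p a b (e : R) :
  near_straight U d W p a b e -> near_straight U d W p b a e.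
Proof.
case=> cW coW [Wp [Wa Wb]] diam straight; split=> // [u v Wu Wv|z Wz]; rewrite (dC b a).
  exact: diam.
by rewrite addrC (dC z a) (dC b z); exact: straight.
Qed.

Lemma exists_neq2 (a b D : R) : 0 < D -> exists t, [/\ 0 < t, t <= D, t <> a & t <> b].
Proof.
move=> D0; apply: contrapT => none.
have bad n : (0 < n)%N -> n%:R^-1 * D = a \/ n%:R^-1 * D = b.
  move=> n0; apply: contrapT => /not_orP[ta tb]; apply: none; exists (n%:R^-1 * D); split=> //.
    by rewrite mulr_gt0 // invr_gt0 ltr0n.
  by rewrite ler_piMl ?(ltW D0) // invf_le1 ?ltr0n // ler1n.
have := bad 1%N isT; have := bad 2%N isT; have := bad 3%N isT.
by move=> [] h3 [] h2 [] h1; lra.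
Qed.

Lemma exists_continuum_away A x1 x2 : ultra_compact U d A -> ~ zero_dimensional d A ->
  exists2 rho : R, 0 < rho & exists ga p0 p1,
  [/\ ga `<=` A, ultra_compact U d ga /\ chain_connected d ga, ga p0 /\ ga p1, 0 < d p0 p1
    & forall u, ga u -> rho <= d u x1 /\ rho <= d u x2].
Proof.
move=> cA /(not_zero_dimensional pd cA)[x [y [Ax Ay xy link]]].
pose A1 := quasicomponent d A x.
have cA1 : ultra_compact U d A1 by exact: ultra_compact_quasicomponent.
have coA1 : chain_connected d A1 by exact: (chain_connected_quasicomponent pd cA).
have A1x : A1 x by move=> e e0; exact: chain0.
have [s [s0 sy sx1 sx2]] := exists_neq2 (d x x1) (d x x2) xy.
have [p [A1p xp _]] := chain_linked_cut pd cA1 (coA1 x y A1x link) (ltW s0) sy.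
have px1 : p <> x1 by move=> E; apply: sx1; rewrite -xp E.
have px2 : p <> x2 by move=> E; apply: sx2; rewrite -xp E.
have px1_gt0 := dist_gt0 pd d_sep px1; have px2_gt0 := dist_gt0 pd d_sep px2.
pose rho : R := Num.min (d p x1) (d p x2) / 2.
have rho0 : 0 < rho by rewrite divr_gt0 // lt_min px1_gt0.
have [rho1 rho2] : 2 * rho <= d p x1 /\ 2 * rho <= d p x2.
  by rewrite /rho mulrC divfK ?pnatr_eq0 // !ge_min !lexx orbT.
pose t := Num.min rho (d p x).
have t0 : 0 < t by rewrite lt_min rho0 dC xp.
have t_rho : t <= rho by rewrite ge_min lexx.
have tx : t <= d p x by rewrite ge_min lexx orbT.
have [p1 [_ pp1 link1]] := chain_linked_cut pd cA1 (coA1 p x A1p A1x) (ltW t0) tx.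
pose B := A1 `&` [set u | d p u <= t].
have cB : ultra_compact U d B by exact: ultra_compact_ball.
have subB : quasicomponent d B p `<=` B by exact: quasicomponent_sub.
have Bp : B p by split=> //=; rewrite d0 ltW.
exists rho => //; exists (quasicomponent d B p), p, p1; split.
- by move=> u /subB[A1u _]; exact: quasicomponent_sub A1u.
- by split; [exact: ultra_compact_quasicomponent|exact: (chain_connected_quasicomponent pd)].
- by split=> // e e0; exact: chain0.
- by rewrite pp1.
move=> u /subB[_ /= pu].
by have := dT p u x1; have := dT p u x2; lra.
Qed.

End Continua.

Section NearStraight.
Context {R : realType} (U : set_system nat) {uU : FreeUltraFilter U} (V : ipspace R).
Context (T : Type) (c : T -> V).

Let dist u v := ip_norm (c u - c v).

Lemma pseudometric_map : pseudometric dist.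
Proof.
by split=> [x|x y|x y z]; [rewrite /dist subrr ip_norm0|exact: ip_distC|exact: ip_dist_triangle].
Qed.

Definition approx_segment (W : set T) p b (e : R) := forall s : R, 0 <= s <= 1 ->
  exists2 z, W z & ip_norm (c z - c p - s *: (c b - c p)) <= e.

Lemma near_straight_segment_to (W : set T) p a b (e q r : R) : near_straight U dist W p a b e ->
  0 <= e -> 0 <= q -> 2 * e <= q ^+ 2 -> 0 < r -> r <= dist a b ->
  (forall u, W u -> dist p u <= r) -> approx_segment W p b (4 * q * r).
Proof.
move=> [cW coW [Wp [Wa Wb]] diam straight] e0 q0 eq r0; set D := dist a b => rD Wr s s01.
have D0 : 0 < D by lra.
have D2r : D <= 2 * r.
  have := ip_dist_triangle (c a) (c p) (c b); have := Wr a Wa; have := Wr b Wb.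
  by rewrite /D /dist (ip_distC (c p) (c a)); lra.
pose t := dist a p; have t0 : 0 <= t := ip_norm_ge0 _; have tD : t <= D := diam a p Wa Wp.
pose th := (1 - s) * (t / D) + s.
have tD1 : 0 <= t / D <= 1 by rewrite divr_ge0 ?(ltW D0) //= ler_pdivrMr // mul1r.
have th01 : 0 <= th <= 1 by rewrite /th; move: tD1 s01; move: (t / D) => y; nra.
have thD0 : 0 <= th * D by apply: mulr_ge0; lra.
have thD1 : th * D <= D by rewrite -[leRHS]mul1r ler_wpM2r ?(ltW D0) //; lra.
have [z [Wz dz _]] := chain_linked_cut pseudometric_map cW (coW a b Wa Wb) thD0 thD1.
exists z => //.
have near_z := near_segment e0 q0 eq D0 (diam a z Wa Wz) (straight z Wz).
have near_p := near_segment e0 q0 eq D0 tD (straight p Wp).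
rewrite -[ip_norm (c a - c z)]/(dist a z) dz -/(dist a b) -/D mulfK ?gt_eqF // in near_z.
rewrite -[ip_norm (c a - c p)]/t -/(dist a b) -/D in near_p.
have -> : c z - c p - s *: (c b - c p) = (c z - c a - th *: (c b - c a)) -
   (1 - s) *: (c p - c a - (t / D) *: (c b - c a)) by rewrite /th; vector_ring.
apply: le_trans (ip_normD _ _) _; rewrite ip_normN ip_normZ ger0_norm; last lra.
have : (1 - s) * ip_norm (c p - c a - (t / D) *: (c b - c a)) <= 1 * (q * D).
  by apply: ler_pM => //; [lra|exact: ip_norm_ge0|lra].
have : q * D <= q * (2 * r) by exact: ler_wpM2l.
lra.
Qed.

Lemma near_straight_segment (W : set T) p a b (e q r : R) : near_straight U dist W p a b e ->
  0 <= e -> 0 <= q -> 2 * e <= q ^+ 2 -> 0 < r -> r <= dist a b ->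
  (forall u, W u -> dist p u <= r) ->
  exists b', [/\ W b', r / 2 <= dist b' p <= r & approx_segment W p b' (4 * q * r)].
Proof.
have dC u v : dist u v = dist v u by exact: ip_distC.
move=> st e0 q0 eq r0 rD Wr; have [_ _ [_ [Wa Wb]] _ _] := st.
have [rb|rb] := leP (r / 2) (dist p b).
  by exists b; split; [|rewrite dC rb Wr|exact: (near_straight_segment_to st)].
exists a; split=> //.
  rewrite dC Wr // andbT.
  by have := ip_dist_triangle (c a) (c p) (c b); move: rD rb; rewrite (dC p a) /dist; lra.
by apply: (near_straight_segment_to (near_straight_sym pseudometric_map st)) => //; rewrite dC.
Qed.

End NearStraight.

Section Tangent.
Context {R : realType} (U : set_system nat) {uU : FreeUltraFilter U} (V : ipspace R).
Context (T : Type) (d : T -> T -> R) (Phi : T -> V).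
Hypothesis d_sep : forall x y, d x y = 0 -> x = y.
Hypothesis dPhi : forall x y, d x y = ip_norm (Phi x - Phi y).
Context (K : set T) (cK : ultra_compact U d K).
Let pd : pseudometric d := Phi_pseudometric dPhi.

(* An orthonormal family of directions along which the chart image of [K] is
   translation invariant. *)
Definition invariant_frame (xi : T) (j : nat) (w : 'I_j -> V) :=
  (forall i i', ip (w i) (w i') = (i == i')%:R) /\
  forall u (t : 'I_j -> R), K u -> u <> xi -> exists v,
    [/\ K v, v <> xi & chart Phi xi v = chart Phi xi u + \sum_i t i *: w i].

Definition transverse (j : nat) (w : 'I_j -> V) (eta : R) (x : V) := forall t : 'I_j -> R,
  eta * ip_norm x <= ip_norm (x - \sum_i t i *: w i).

Definition transverse_segment (xi : T) (j : nat) (w : 'I_j -> V) (u : T) (r e eta : R) :=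
  let c := chart Phi xi in exists b, [/\ K b /\ b <> xi, r / 2 <= ip_norm (c b - c u) <= r,
    approx_segment c (K `\ xi) u b (e * r) & transverse w eta (c b - c u)].

Definition tangent_points (xi : T) (j : nat) (w : 'I_j -> V) (e eta : R) :=
  [set u | [/\ K u, u <> xi & exists2 r0 : R, 0 < r0 & forall r : R, 0 < r -> r < r0 ->
    transverse_segment xi w u r e eta]].

Context (k : nat) (k0 : (0 < k)%N) (xo : T).
Hypothesis Kfin : forall e : R, 0 < e -> hausdorff_finite d k (K `&` [set x | e <= d x xo]).
Hypothesis Kncol : ~ colourable U d k.-1 K.
Context (xi : T) (Kxi : K xi).
Notation c := (chart Phi xi).
Let dist u v := ip_norm (c u - c v).

Lemma dense_chart_separating (D : nat -> T) j (w : 'I_j -> V) :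
  (forall x (e : R), K x -> 0 < e -> exists n, d x (D n) < e) ->
  forall u v, K u -> K v -> u <> xi -> v <> xi ->
  (forall n, ip (c u - c v) (moment_vector w (fun m => c (D m)) n) = 0) -> u = v.
Proof.
move=> dense u v Ku Kv uxi vxi /moment_vector_separating orthD.
have orthK y : K y -> y <> xi -> ip (c u - c v) (c y) = 0.
  move=> Ky yxi; have [e e0|x [Dx xy]] := @ultra_cvg_exists _ _ _ _ _ pd (range D) y.
    by have [n yn] := dense y e Ky e0; exists (D n); split=> //; exists n.
  have [_ cxy] := chart_cvg d_sep dPhi (ultra_cvg_cst pd xi) xy yxi.
  by apply: (ip_cvg_ip_cst (ip_cvg_cst (c u - c v)) cxy) => n; have [m _ <-] := Dx n.
apply: (chart_inj d_sep dPhi uxi vxi); apply: ip_dist_eq0.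
by rewrite /ip_norm ipDr ipNr !orthK // subrr sqrtr0.
Qed.

Section Slices.
Variable f : nat -> V.
Hypothesis f_sep : forall u v, K u -> K v -> u <> xi -> v <> xi ->
  (forall n, ip (c u - c v) (f n) = 0) -> u = v.

Lemma not_slice_dim_le : ~ slice_dim_le d lebesgue_null (slice Phi xi f) k.-1 K.
Proof.
move=> dimK; apply: Kncol; apply: (slice_dim_le_colourable pd d_sep (K := K)) dimK => //.
- by move=> A B AB; exact: negligibleS.
- exact: negligible_set0.
- by move=> A B; exact: negligibleU.
- by move=> i t A; exact: (ultra_compact_slice d_sep dPhi).
by move=> N N_null x e; exact: (slice_nbhd d_sep dPhi cK f_sep).
Qed.

(* Slicing [k.-1] times by generic values of the coordinates leaves continua of
   finite length; away from [xi] and [xo] the chart metric is comparable to [d]. *)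
Lemma exists_rectifiable_slice (E : set T) : ~ E xi -> hausdorff_null d k E ->
  exists ga p0 p1, exists2 l : seq nat,
    uniq l /\ size l = k.-1 &
  [/\ ga `<=` K `\ xi, ultra_compact U dist ga /\ chain_connected dist ga,
      ga p0 /\ ga p1 /\ 0 < dist p0 p1, hausdorff_finite dist 1 ga /\ hausdorff_null dist 1 (E `&` ga)
    & forall i u v, i \in l -> ga u -> ga v -> ip (c u - c v) (f i) = 0].
Proof.
move=> Exi nulE; have [d0 _ _] := pd.
have kE : k.-1.+1 = k by rewrite prednK.
have finK : finite_away d xi xo k.-1.+1 K.
  by move=> e e0; rewrite kE; apply: hausdorff_finiteS (Kfin e0) => u [Ku []].
have nulK : hausdorff_null d k.-1.+1 (E `&` K) by rewrite kE; apply: hausdorff_nullS nulE => u [].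
have [//|//|A [l [t [AK [cA nzA] At [ul sl] [finA nulA]]]]] :=
  slice_descent d_sep dPhi Exi (l := [::]) (t := fun=> 0)
    (fun u (Ku : K u) => Ku) cK _ _ finK nulK not_slice_dim_le.
have [rho rho0 [ga [p0 [p1 [gA [cg cog] [g0 g1] p01 far]]]]] :=
  exists_continuum_away pd d_sep xi xo cA nzA.
have gxi u : ga u -> u <> xi by move=> /far[h _] E'; move: h; rewrite E' d0; lra.
have L0 : 0 < (rho ^+ 2)^-1 by positivity.
have dist_le u v : ga u -> ga v -> dist u v <= (rho ^+ 2)^-1 * d u v.
  by move=> /far[ur _] /far[vr _]; exact: (chart_lip d_sep dPhi).
exists ga, p0, p1, l => //; split.
- by move=> u gu; split; [exact/AK/gA|exact: gxi].
- by split; [exact: ultra_compact_metric_le L0 dist_le _|exact: chain_connected_metric_le L0 dist_le _].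
- split=> //; split=> //; rewrite /dist (chart_dist d_sep dPhi) //; [|exact: gxi..].
  by rewrite divr_gt0 // mulr_gt0 // (Phi_gt0 d_sep dPhi) //; exact: gxi.
- split; first by apply: hausdorff_finite_metric_le L0 dist_le _ _;
  apply: hausdorff_finiteS (finA _ rho0) => u gu; split; [exact: gA|exact/and_comm/far].
  by apply: hausdorff_null_metric_le L0 dist_le _ _ _; apply: hausdorff_nullS nulA => u [? /gA].
move=> i u v il gu gv; rewrite ipDl ipNl -/(coord Phi xi f i u) -/(coord Phi xi f i v).
by rewrite !(At i) ?subrr //; [exact: gA|exact: gxi|exact: gA|exact: gxi].
Qed.

End Slices.

Lemma tangent_points_nonnull j (w : 'I_j -> V) : (j < k)%N -> invariant_frame xi w ->
  exists2 eta : R, 0 < eta & forall e : R, 0 < e ->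
    ~ hausdorff_null d k (tangent_points xi w e eta).
Proof.
move=> jk [w_orth _]; apply: contrapT => none.
have /choice[e he] q : exists e : R, 0 < e /\ hausdorff_null d k (tangent_points xi w e q.+1%:R^-1).
  apply: contrapT => no_e; apply: none; exists q.+1%:R^-1; first by rewrite invr_gt0.
  by move=> e e0 nul; apply: no_e; exists e.
pose E := \bigcup_q tangent_points xi w (e q) q.+1%:R^-1.
have nulE : hausdorff_null d k E by apply: (hausdorff_null_bigcup k0) => q; case: (he q).
have Exi : ~ E xi by move=> [q _ []].
have [D [_ denseD]] := dense_seq pd cK Kxi.
pose f := moment_vector w (fun m => c (D m)).
have f_sep := dense_chart_separating (w := w) denseD.
have [ga [p0 [p1 [l [ul sl] [gK [cg cog] [g0 [g1 p01]] [fing nulg] const_l]]]]] :=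
  exists_rectifiable_slice f_sep Exi nulE.
have il (i : 'I_j) : (i < size l)%N.
  by apply: leq_trans (ltn_ord i) _; rewrite sl -ltnS prednK.
have nth_inj : injective (fun i : 'I_j => nth 0%N l i).
  by move=> i i' /eqP; rewrite nth_uniq // => /eqP/ord_inj.
have [eta eta0 angle] := moment_vector_angle w_orth (fun m => c (D m)) nth_inj.
have [q hq] := exists_invS_lt eta0; have [eq0 _] := he q.
pose q0 := e q / 4; have q00 : 0 < q0 by rewrite divr_gt0.
have e10 : 0 < q0 ^+ 2 / 2 by rewrite divr_gt0 ?exprn_gt0.
have [p [gp Np [r0 r00 hr0]]] :=
  near_straight_exists (pseudometric_map c) cg cog fing g0 g1 p01 nulg e10.
have [Kp pxi] := gK _ gp.
apply: Np; split=> //; exists q => //; split=> //; exists r0 => // r rp rr.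
have [W [a [b [Wg st rD Wr]]]] := hr0 r rp rr.
have [|b' [Wb' b'r seg]] := near_straight_segment st (ltW e10) (ltW q00) _ rp rD Wr.
  by rewrite mulrC divfK.
exists b'; split=> //; first exact/gK/Wg.
  move=> s /seg[z Wz hz]; exists z; first exact/gK/Wg.
  by apply: le_trans hz _; rewrite /q0; lra.
move=> t; apply: le_trans (angle _ _ t); last first.
  by move=> i; apply: const_l => //; [exact: mem_nth|exact: Wg].
by apply: ler_wpM2r; [exact: ip_norm_ge0|exact: ltW].
Qed.

Lemma not_colourable_nonnull : ~ hausdorff_null d k K.
Proof.
have fr0 : invariant_frame xi (fun _ : 'I_0 => 0).
  by split=> [[]//|u t Ku uxi]; exists u; rewrite big_ord0 addr0.
have [eta _ /(_ 1 ltr01) tan] := tangent_points_nonnull k0 fr0.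
by apply: contra_not tan; apply: hausdorff_nullS => u [].
Qed.

End Tangent.

(** * Flatness by zooming *)

Section ChartSimilarities.
Context {R : realType} (V : ipspace R) (T : Type) (Phi : T -> V) (K : set T).
Notation chart := (chart Phi).

Lemma sum_scale_if j (w : 'I_j -> V) i (s : R) :
  \sum_i' (if i' == i then s else 0) *: w i' = s *: w i.
Proof.
rewrite (bigD1 i) //= eqxx big1 ?addr0 // => i' /negbTE ->.
by rewrite scale0r.
Qed.

Definition chart_span xi i0 := diff_span (fun u => K u /\ u <> xi) (chart xi) i0.

Lemma chart_span_diff xi i0 u v : K u -> u <> xi -> K v -> v <> xi ->
  chart_span xi i0 (chart xi u - chart xi v).
Proof. by move=> *; exact: diff_span_diff. Qed.

(* [h] maps [K] onto itself and acts on the charts as a similarity of ratio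
   [lam] with linear part [A]. *)
Record chart_similarity xi i0 (h : T -> T) (lam : R) (A : V -> V) : Prop := ChartSimilarity {
  chart_sim_isometry : linear_isometry (chart_span xi i0) A;
  chart_sim_stable : forall u, K u -> K (h u);
  chart_sim_neq : forall u, K u -> u <> xi -> h u <> h xi;
  chart_sim_onto : forall u, K u -> u <> h xi -> exists v, [/\ K v, v <> xi & h v = u];
  chart_simE : forall u v, K u -> u <> xi -> K v -> v <> xi ->
    chart (h xi) (h u) - chart (h xi) (h v) = lam *: A (chart xi u - chart xi v) }.

Lemma invariant_frame_span xi i0 j (w : 'I_j -> V) i : K i0 -> i0 <> xi ->
  invariant_frame Phi K xi w -> chart_span xi i0 (w i).
Proof.
move=> K0 i0xi [_ inv].
have [v [Kv vxi]] := inv i0 (fun i' => if i' == i then 1 else 0) K0 i0xi.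
rewrite sum_scale_if scale1r => E.
have -> : w i = chart xi v - chart xi i0 by rewrite E addrAC subrr add0r.
exact: chart_span_diff.
Qed.

Lemma transverseZ j (w : 'I_j -> V) (eta a : R) x : 0 < a ->
  transverse w eta x -> transverse w eta (a *: x).
Proof.
move=> a0 trx t; have -> : \sum_i t i *: w i = a *: \sum_i (t i / a) *: w i.
  by rewrite scaler_sumr; apply: eq_bigr => i _; rewrite scalerA mulrCA divff ?gt_eqF // mulr1.
by rewrite -scalerBr !ip_normZ gtr0_norm // mulrCA ler_pM2l.
Qed.

Lemma transverse_isometry D (A : V -> V) j (w : 'I_j -> V) (eta : R) x : linear_isometry D A ->
  (forall i, D (w i)) -> D x -> transverse w eta x -> transverse (fun i => A (w i)) eta (A x).
Proof.
move=> isoA Dw Dx trx t; rewrite -(isometry_sum isoA) // -(isometryB isoA) //; last first.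
  exact: (isometry_dom_sum isoA).
rewrite !(isometry_norm isoA) //.
by apply: (isometry_domB isoA) => //; exact: (isometry_dom_sum isoA).
Qed.

Section Similarity.
Context (xi i0 : T) (h : T -> T) (lam : R) (A : V -> V).
Hypotheses (K0 : K i0) (i0xi : i0 <> xi) (lam0 : 0 < lam).
Hypothesis sim : chart_similarity xi i0 h lam A.
Let isoA : linear_isometry (chart_span xi i0) A. Proof. by case: sim. Qed.

Lemma chart_sim_translate u v (x : V) (s : R) : K u -> u <> xi -> K v -> v <> xi ->
  chart_span xi i0 x -> chart xi v = chart xi u + (s / lam) *: x ->
  chart (h xi) (h v) = chart (h xi) (h u) + s *: A x.
Proof.
move=> Ku uxi Kv vxi Dx E; rewrite -[LHS](subrK (chart (h xi) (h u))) (chart_simE sim) //.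
rewrite E addrAC subrr add0r addrC (isometryZ isoA) // scalerA.
by rewrite mulrCA divff ?gt_eqF // mulr1.
Qed.

Lemma chart_sim_frame j (w : 'I_j -> V) : invariant_frame Phi K xi w ->
  invariant_frame Phi K (h xi) (fun i => A (w i)).
Proof.
move=> fr; have Dw i : chart_span xi i0 (w i) by exact: invariant_frame_span.
have [w_orth inv] := fr; split=> [i i'|u t Ku uxi].
  by rewrite (isometry_ip isoA).
have [u0 [Ku0 u0xi <-]] := chart_sim_onto sim Ku uxi.
have [v0 [Kv0 v0xi Ev]] := inv u0 (fun i => t i / lam) Ku0 u0xi.
exists (h v0); split; [exact: (chart_sim_stable sim)|exact: (chart_sim_neq sim)|].
rewrite -(isometry_sum isoA) // -[X in _ + X]scale1r; apply: chart_sim_translate => //.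
  exact: (isometry_dom_sum isoA).
rewrite Ev scaler_sumr; congr (_ + _); apply: eq_bigr => i _.
by rewrite scalerA mulrC div1r.
Qed.

Lemma chart_sim_segment j (w : 'I_j -> V) u (r e eta : R) : invariant_frame Phi K xi w ->
  K u -> u <> xi -> transverse_segment Phi K xi w u r e eta ->
  transverse_segment Phi K (h xi) (fun i => A (w i)) (h u) (lam * r) e eta.
Proof.
move=> fr Ku uxi [b [[Kb bxi] br seg trans]].
have Dw i : chart_span xi i0 (w i) by exact: invariant_frame_span.
have Db : chart_span xi i0 (chart xi b - chart xi u) by exact: chart_span_diff.
exists (h b); rewrite !(chart_simE sim) //; split.
- by split; [exact: (chart_sim_stable sim)|exact: (chart_sim_neq sim)].
- by rewrite ip_normZ (isometry_norm isoA) // gtr0_norm // -mulrA !ler_pM2l.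
- move=> s /seg[z [Kz zxi] hz]; exists (h z).
    by split; [exact: (chart_sim_stable sim)|exact: (chart_sim_neq sim)].
  have Dz : chart_span xi i0 (chart xi z - chart xi u) by exact: chart_span_diff.
  have Dsb : chart_span xi i0 (s *: (chart xi b - chart xi u)) by exact: (isometry_domZ isoA).
  rewrite !(chart_simE sim) // scalerA mulrC -scalerA -scalerBr ip_normZ gtr0_norm //.
  rewrite -(isometryZ isoA) // -(isometryB isoA) // (isometry_norm isoA).
    by rewrite mulrCA ler_pM2l.
  exact: (isometry_domB isoA).
by apply: transverseZ => //; exact: transverse_isometry isoA Dw Db trans.
Qed.

End Similarity.

End ChartSimilarities.

Section ChartLimits.
Context {R : realType} (U : set_system nat) {uU : FreeUltraFilter U} (V : ipspace R).
Context (T : Type) (d : T -> T -> R) (Phi : T -> V).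
Hypothesis d_sep : forall x y, d x y = 0 -> x = y.
Hypothesis dPhi : forall x y, d x y = ip_norm (Phi x - Phi y).
Context (K : set T) (cK : ultra_compact U d K).
Let pd : pseudometric d := Phi_pseudometric dPhi.
Notation chart := (chart Phi).

Lemma ultra_choice (P : nat -> T -> Prop) (x0 : T) : U [set n | exists z, P n z] ->
  exists z : nat -> T, U [set n | P n (z n)].
Proof.
move=> exP; have /choice[z hz] n : exists z, (exists z, P n z) -> P n z.
  by have [[z Pz]|no] := pselect (exists z, P n z); [exists z|exists x0].
by exists z; apply: filterS exP => n; exact: hz.
Qed.

Lemma chart_cvg_cst xs xi u : ultra_cvg U d xs xi -> u <> xi ->
  U [set n | u <> xs n] /\ ip_cvg U (fun n => chart (xs n) u) (chart xi u).
Proof. by move=> xs_xi; exact: (chart_cvg d_sep dPhi xs_xi (ultra_cvg_cst pd u)). Qed.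

Lemma ip_cvg_frame_sum j (w : nat -> 'I_j -> V) w' (t : 'I_j -> R) :
  (forall i, ip_cvg U (w^~ i) (w' i)) ->
  ip_cvg U (fun n => \sum_i t i *: w n i) (\sum_i t i *: w' i).
Proof.
by move=> ww'; apply: (ip_cvg_sum (x := fun i n => t i *: w n i)) => i; exact: ip_cvgZ.
Qed.

Lemma transverse_limit j (w : nat -> 'I_j -> V) w' (x : nat -> V) x' (eta : R) : 0 < eta ->
  (forall i, ip_cvg U (w^~ i) (w' i)) -> ip_cvg U x x' ->
  U [set n | transverse (w n) eta (x n)] -> transverse w' eta x'.
Proof.
move=> eta0 ww' xx' tr t.
apply: (ip_cvg_norm_ge (ip_cvgB xx' (ip_cvg_frame_sum t ww'))) => q q0.
apply: filterS (filterI tr (xx' _ (divr_gt0 q0 eta0))) => n /= [/(_ t) trn xn].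
apply: le_trans trn; rewrite lerBlDr -lerBlDl -mulrBr.
apply: (@le_trans _ _ (eta * (q / eta))); last by rewrite mulrC divfK ?gt_eqF.
by rewrite ler_pM2l //; have := ip_norm_dist (x n) x'; rewrite ler_norml; lra.
Qed.

Section Limit.
Context (xs : nat -> T) (xi : T).
Hypotheses (xs_xi : ultra_cvg U d xs xi) (Kxi : K xi).

(* Points [y n] of [K] whose charts stay at bounded distance [sg n] from a
   convergent sequence [P n] converge, hence so does [sg]. *)
Lemma chart_offset_cvg (P : nat -> V) p (y : nat -> T) (sg : nat -> V) (B : R) :
  ip_cvg U P p -> U [set n | K (y n) /\ y n <> xs n] -> U [set n | ip_norm (sg n) <= B] ->
  ip_cvg U (fun n => chart (xs n) (y n) - (P n + sg n)) 0 ->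
  exists v, [/\ K v, v <> xi & ip_cvg U sg (chart xi v - p)].
Proof.
move=> Pp Ky sgB y0.
have yB : U [set n | ip_norm (chart (xs n) (y n)) <= ip_norm p + 1 + B + 1].
  apply: filterS (filterI (filterI (ip_cvg_bounded Pp) sgB) (ip_cvg_bounded y0)) => n /= [[Pn sgn]].
  rewrite ip_norm0 add0r => yn.
  have := ip_normD (chart (xs n) (y n) - (P n + sg n)) (P n + sg n); rewrite subrK.
  by have := ip_normD (P n) (sg n); lra.
have [v [Kv vxi _ yv]] := chart_bounded_cvg d_sep dPhi cK xs_xi Kxi Ky yB.
exists v; split=> //; rewrite -[_ - p]subr0.
by apply: (ip_cvg_near_eq _ (ip_cvgB (ip_cvgB yv Pp) y0)); apply: filterE => n /=; vector_ring.
Qed.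

Section Frames.
Context (j : nat) (w : nat -> 'I_j -> V).
Hypothesis fr : forall n, invariant_frame Phi K (xs n) (w n).

Lemma frame_sum_cvg u (t : 'I_j -> R) : K u -> u <> xi -> exists v,
  [/\ K v, v <> xi & ip_cvg U (fun n => \sum_i t i *: w n i) (chart xi v - chart xi u)].
Proof.
move=> Ku uxi; have [uxs cu] := chart_cvg_cst xs_xi uxi.
have [|y hy] := @ultra_choice (fun n z => [/\ K z, z <> xs n
     & chart (xs n) z = chart (xs n) u + \sum_i t i *: w n i]) u.
  by apply: filterS uxs => n /= un; exact: (fr n).2.
apply: (chart_offset_cvg (B := \sum_i `|t i|) (y := y) cu).
- by apply: filterS hy => n [].
- apply: filterE => n /=; apply: le_trans (ip_norm_sum _ _) _; apply: ler_sum => i _.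
  by rewrite ip_normZ (ip_norm_w (fr n).1) mulr1.
apply: (ip_cvg_near_eq _ (ip_cvg_cst 0)); apply: filterS hy => n /= [_ _ ->].
by rewrite subrr.
Qed.

Lemma invariant_frame_limit v0 : K v0 -> v0 <> xi ->
  exists w', (forall i, ip_cvg U (w^~ i) (w' i)) /\ invariant_frame Phi K xi w'.
Proof.
move=> K0 v0xi; have /choice[w' ww'] i : exists wi, ip_cvg U (w^~ i) wi.
  have [v [_ _ cv]] := frame_sum_cvg (fun i' => if i' == i then 1 else 0) K0 v0xi.
  exists (chart xi v - chart xi v0); apply: (ip_cvg_near_eq _ cv); apply: filterE => n /=.
  by rewrite sum_scale_if scale1r.
exists w'; split=> //; split=> [i i'|u t Ku uxi].
  by apply: (ip_cvg_ip_cst (ww' i) (ww' i')) => n; exact: (fr n).1.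
have [v [Kv vxi cv]] := frame_sum_cvg t Ku uxi; exists v; split=> //.
by rewrite -(ip_cvg_unique cv (ip_cvg_frame_sum t ww')) addrC subrK.
Qed.

End Frames.

Section Segments.
Context (x : nat -> T) (v : T) (en : nat -> R) (e : R).
Hypothesis xv : ip_cvg U (fun n => chart (xs n) (x n)) (chart xi v).
Hypothesis en_le : forall q : R, 0 < q -> U [set n | en n <= e + q].

Lemma approx_segment_limit (b : nat -> T) b' :
  ip_cvg U (fun n => chart (xs n) (b n) - chart (xs n) (x n)) (chart xi b' - chart xi v) ->
  U [set n | approx_segment (chart (xs n)) (K `\ xs n) (x n) (b n) (en n)] ->
  approx_segment (chart xi) (K `\ xi) v b' e.
Proof.
move=> bb' seg s s01; pose y n := s *: (chart (xs n) (b n) - chart (xs n) (x n)).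
have [|z hz] := @ultra_choice (fun n z => (K `\ xs n) z /\
    ip_norm (chart (xs n) z - chart (xs n) (x n) - y n) <= en n) v.
  by apply: filterS seg => n /= /(_ s s01)[z Kz hz]; exists z.
have yv : ip_cvg U y (s *: (chart xi b' - chart xi v)) by exact: ip_cvgZ.
have zB : U [set n | ip_norm (chart (xs n) (z n)) <=
    e + 1 + (ip_norm (chart xi v + s *: (chart xi b' - chart xi v)) + 1)].
  apply: filterS (filterI (filterI hz (en_le ltr01)) (ip_cvg_bounded (ip_cvgD xv yv))).
  move=> n /= [[[_ zn] en1] xyn].
  have := ip_normD (chart (xs n) (z n) - chart (xs n) (x n) - y n) (chart (xs n) (x n) + y n).
  rewrite [X in ip_norm X <= _](_ : _ = chart (xs n) (z n)); [lra|vector_ring].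
have Kz : U [set n | K (z n) /\ z n <> xs n] by apply: filterS hz => n [].
have [z' [Kz' z'xi _ zz']] := chart_bounded_cvg d_sep dPhi cK xs_xi Kxi Kz zB.
exists z' => //; apply: (ip_cvg_norm_le (ip_cvgB (ip_cvgB zz' xv) yv)) => q q0.
by apply: filterS (filterI hz (en_le q0)) => n /= [[_ zn] enq]; lra.
Qed.

Lemma transverse_segment_limit j (w : nat -> 'I_j -> V) w' (eta : R) : 0 < eta ->
  (forall i, ip_cvg U (w^~ i) (w' i)) ->
  U [set n | transverse_segment Phi K (xs n) (w n) (x n) 1 (en n) eta] ->
  transverse_segment Phi K xi w' v 1 e eta.
Proof.
move=> eta0 ww' /(ultra_choice v)[b hb].
pose sg n := chart (xs n) (b n) - chart (xs n) (x n).
have [|||b' [Kb' b'xi bb']] := chart_offset_cvg (y := b) (sg := sg) (B := 1) xv.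
- by apply: filterS hb => n [].
- by apply: filterS hb => n [_ /andP[]].
- apply: (ip_cvg_near_eq _ (ip_cvg_cst 0)); apply: filterE => n /=.
  by rewrite /sg addrCA subrr addr0 subrr.
exists b'; split=> //.
- apply/andP; split.
    by apply: (ip_cvg_norm_ge bb') => q q0; apply: filterS hb => n [_ /andP[h1 _] _ _] /=;
      rewrite /sg; lra.
  by apply: (ip_cvg_norm_le bb') => q q0; apply: filterS hb => n [_ /andP[_ h1] _ _] /=;
    rewrite /sg; lra.
- by rewrite mulr1; apply: (approx_segment_limit bb'); apply: filterS hb => n [_ _]; rewrite mulr1.
by apply: (transverse_limit eta0 ww' bb'); apply: filterS hb => n [].
Qed.

End Segments.

End Limit.

Definition translations xi (S : set R) (sg : V) := forall u (s : R), S s -> K u -> u <> xi ->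
  exists v, [/\ K v, v <> xi & chart xi v = chart xi u + s *: sg].

(* The charts at [xi], blown up by [h n], tend to the chart at [xi']. *)
Record zoom_limit xi p xi' (h : nat -> T -> T) (lam : nat -> R) (A : nat -> V -> V) : Prop :=
  ZoomLimit {
  zoom_limit_base : K p;
  zoom_limit_base_neq : p <> xi;
  zoom_limit_pole : K xi';
  zoom_limit_cvg : ultra_cvg U d (fun n => h n xi) xi';
  zoom_limit_ratio_gt0 : forall n, 0 < lam n;
  zoom_limit_infinite : forall M : R, U [set n | M < lam n];
  zoom_limit_similarity : forall n, chart_similarity Phi K xi p (h n) (lam n) (A n) }.

Definition fills xi xi' (h : nat -> T -> T) (Q : set T) := forall v, K v -> v <> xi' ->
  exists x : nat -> T, U [set n | Q (x n) /\ x n <> xi] /\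
    ip_cvg U (fun n => chart (h n xi) (h n (x n))) (chart xi' v).

Section ZoomLimitTheory.
Context (xi p xi' : T) (h : nat -> T -> T) (lam : nat -> R) (A : nat -> V -> V).
Hypothesis ZL : zoom_limit xi p xi' h lam A.
Context (v0 : T) (K0 : K v0) (v0xi' : v0 <> xi').
Let Kp : K p. Proof. by case: ZL. Qed.
Let pxi : p <> xi. Proof. by case: ZL. Qed.
Let Kxi' : K xi'. Proof. by case: ZL. Qed.
Let lam0 n : 0 < lam n. Proof. by case: ZL. Qed.
Let sim n : chart_similarity Phi K xi p (h n) (lam n) (A n). Proof. by case: ZL. Qed.
Let isoA n : linear_isometry (chart_span Phi K xi p) (A n). Proof. by case: (sim n). Qed.
Let h_xi : ultra_cvg U d (fun n => h n xi) xi'. Proof. by case: ZL. Qed.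

Lemma zoom_limit_frame j (w : 'I_j -> V) : invariant_frame Phi K xi w -> exists w',
  (forall i, ip_cvg U (fun n => A n (w i)) (w' i)) /\ invariant_frame Phi K xi' w'.
Proof.
move=> fr; apply: (invariant_frame_limit h_xi Kxi' _ K0 v0xi') => n.
exact: (chart_sim_frame Kp pxi (lam0 n) (sim n)).
Qed.

Lemma zoom_limit_direction (S : set R) sg : S 1 ->
  (forall v s, S s -> K v -> v <> xi' -> exists v', [/\ K v', v' <> xi'
     & ip_cvg U (fun n => s *: A n sg) (chart xi' v' - chart xi' v)]) ->
  exists2 sg', ip_cvg U (fun n => A n sg) sg' & translations xi' S sg'.
Proof.
move=> S1 step; have [v1 [_ _ cv1]] := step v0 1 S1 K0 v0xi'.
have sg_cvg : ip_cvg U (fun n => A n sg) (chart xi' v1 - chart xi' v0).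
  by apply: (ip_cvg_near_eq _ cv1); apply: filterE => n /=; rewrite scale1r.
exists (chart xi' v1 - chart xi' v0) => // u s Ss Ku uxi'.
have [v [Kv vxi' cv]] := step u s Ss Ku uxi'; exists v; split=> //.
by rewrite -(ip_cvg_unique cv (ip_cvgZ s sg_cvg)) addrC subrK.
Qed.

Lemma zoom_limit_norm sg sg' : chart_span Phi K xi p sg -> ip_cvg U (fun n => A n sg) sg' ->
  ip_norm sg' = ip_norm sg.
Proof.
move=> Dsg sg_cvg; rewrite /ip_norm.
by rewrite (ip_cvg_ip_cst (c := ip sg sg) sg_cvg sg_cvg) // => n; rewrite (isometry_ip (isoA n)).
Qed.

Lemma zoom_limit_transverse j (w w' : 'I_j -> V) sg sg' (eta : R) : 0 < eta ->
  invariant_frame Phi K xi w -> (forall i, ip_cvg U (fun n => A n (w i)) (w' i)) ->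
  chart_span Phi K xi p sg -> ip_cvg U (fun n => A n sg) sg' ->
  transverse w eta sg -> transverse w' eta sg'.
Proof.
move=> eta0 fr ww' Dsg sg_cvg tr.
apply: (transverse_limit (w := fun n i => A n (w i)) eta0 ww' sg_cvg).
apply: filterE => n /=; apply: (transverse_isometry (isoA n)) => // i.
exact: invariant_frame_span.
Qed.

End ZoomLimitTheory.

End ChartLimits.

Lemma ord_max_or_widen j (i : 'I_j.+1) : i = ord_max \/ exists i0, i = widen_ord (leqnSn j) i0.
Proof.
have [lt_ij|le_ji] := ltnP i j; first by right; exists (Ordinal lt_ij); exact: val_inj.
by left; apply: val_inj => /=; apply/eqP; rewrite eqn_leq le_ji -ltnS ltn_ord.
Qed.

Definition ord_rcons (A : Type) j (f : 'I_j -> A) (a : A) (i : 'I_j.+1) : A :=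
  if insub (val i) is Some i0 then f i0 else a.

Lemma ord_rcons_widen A j (f : 'I_j -> A) a i : ord_rcons f a (widen_ord (leqnSn j) i) = f i.
Proof. by rewrite /ord_rcons /= valK. Qed.

Lemma ord_rcons_max A j (f : 'I_j -> A) a : ord_rcons f a ord_max = a.
Proof. by rewrite /ord_rcons /= insubF // ltnn. Qed.

Lemma widen_neq_max j (i : 'I_j) : (widen_ord (leqnSn j) i == ord_max) = false.
Proof. by apply/eqP => /(congr1 val) /= E; have := ltn_ord i; rewrite E ltnn. Qed.

Section ZoomSteps.
Context {R : realType} (U : set_system nat) {uU : FreeUltraFilter U} (V : ipspace R).
Context (T : Type) (d : T -> T -> R) (Phi : T -> V).
Hypothesis d_sep : forall x y, d x y = 0 -> x = y.
Hypothesis dPhi : forall x y, d x y = ip_norm (Phi x - Phi y).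
Hypothesis d_le2 : forall x y, d x y <= 2.
Context (K : set T) (cK : ultra_compact U d K).
Context (c0 : R) (c00 : 0 < c0).
Context (Z : (T -> T) -> (T -> T) -> R -> (T -> R) -> Prop).
Hypothesis ZS : zoom_system d K c0 Z.
Context (k : nat) (k0 : (0 < k)%N) (xo : T) (Kxo : K xo).
Hypothesis Kfin : forall e : R, 0 < e -> hausdorff_finite d k (K `&` [set x | e <= d x xo]).
Hypothesis Lnull : hausdorff_null d k (K `\` radial_points K Z).
Hypothesis Kncol : ~ colourable U d k.-1 K.
Notation chart := (chart Phi).
Notation zoom_limit := (zoom_limit U d Phi K).
Notation fills := (fills U Phi K).
Notation invariant_frame := (invariant_frame Phi K).
Notation transverse_segment := (transverse_segment Phi K).
Notation translations := (translations Phi K).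
Notation chart_span := (chart_span Phi K).
Let pd : pseudometric d := Phi_pseudometric dPhi.
Let d0 x : d x x = 0. Proof. by case: pd. Qed.
Let dgt0 x y : x <> y -> 0 < d x y. Proof. exact: Phi_gt0. Qed.
Let nK : ~ hausdorff_null d k K.
Proof. exact: (not_colourable_nonnull d_sep dPhi cK k0 Kfin Kncol Kxo). Qed.

Lemma nonnull_neq xi : ~ hausdorff_null d k (K `\ xi).
Proof. exact: (hausdorff_nonnullD k0 nK (hausdorff_null1 k0 (d0 xi))). Qed.

Lemma exists_neq xi : exists v, K v /\ v <> xi.
Proof. by have [v [Kv vxi]] := hausdorff_nonnull_nonempty k0 (@nonnull_neq xi); exists v. Qed.

Lemma zoom_chart_similarity g h kap m xi i0 : zoom_map d K c0 g h kap m ->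
  K xi -> K i0 -> i0 <> xi -> exists A, chart_similarity Phi K xi i0 h (m xi ^+ 2 / kap) A.
Proof.
move=> z Kxi K0 i0xi; have lam0 : 0 < m xi ^+ 2 / kap.
  by rewrite divr_gt0 ?(zoom_scale_gt0 z) // exprn_gt0 // (zoom_pole_gt0 c00 z).
have [A isoA AE] := @similarity_linear_ext R V V T (fun u => K u /\ u <> xi) (chart xi)
  (fun u => chart (h xi) (h u)) _ i0 lam0 (conj K0 i0xi)
  (fun i j Pi Pj => zoom_chart_dist d_sep dPhi c00 z Kxi Pi.1 Pj.1 Pi.2 Pj.2).
exists A; split=> //; [exact: (zoom_bwd z)|by move=> u; exact: (zoom_chart_neq z)| |].
  move=> u Ku uxi; exists (g u); split; [exact: (zoom_fwd z)| |exact: (zoom_fwdK z)].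
  by move=> E; apply: uxi; rewrite -E (zoom_fwdK z).
by move=> u v Ku uxi Kv vxi; exact: AE.
Qed.

Lemma exists_zoom_limit xi (X : set T) (Q : nat -> set T) : K xi -> X `<=` K ->
  ~ hausdorff_null d k X -> (forall i, Q i `<=` K) ->
  exists p xi' h lam A, [/\ X p, zoom_limit xi p xi' h lam A
    & forall i, Q i p -> fills xi xi' h (Q i)].
Proof.
move=> Kxi XK nX QK.
have [p [g [h [kap [m [xi' [[Xp pxi] hZ [Kxi' h_xi] ratio fill]]]]]]] :=
  exists_filling_zooms d_sep dPhi d_le2 cK c00 ZS k0 Kfin Lnull Kxi XK nX QK.
have z n := zoom_system_map ZS (hZ n); have Kp := XK _ Xp.
have /choice[A sim] n := zoom_chart_similarity (z n) Kxi Kp pxi.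
exists p, xi', h, (fun n => m n xi ^+ 2 / kap n), A; split=> //.
  split=> // n.
  by rewrite divr_gt0 ?(zoom_scale_gt0 (z n)) // exprn_gt0 // (zoom_pole_gt0 c00 (z n)).
move=> i Qp v Kv vxi'; have [x [Qx xv]] := fill i Qp v Kv vxi'; exists x.
have [hx_neq cx] := chart_cvg d_sep dPhi h_xi xv vxi'; split=> //.
by apply: filterS (filterI Qx hx_neq) => n /= [Qn xn]; split=> // E; apply: xn; rewrite E.
Qed.

Lemma segment_everywhere xi j (w : 'I_j -> V) (e eta : R) : K xi -> invariant_frame xi w ->
  0 < e -> 0 < eta -> ~ hausdorff_null d k (tangent_points Phi K xi w e eta) ->
  exists xi' (w' : 'I_j -> V), [/\ K xi', invariant_frame xi' w'
    & forall v, K v -> v <> xi' -> transverse_segment xi' w' v 1 e eta].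
Proof.
move=> Kxi fr e0 eta0 tan; pose X N := [set u | [/\ K u, u <> xi & forall r : R, 0 < r ->
  r < N.+1%:R^-1 -> transverse_segment xi w u r e eta]].
have [N nX] : exists N, ~ hausdorff_null d k (X N).
  apply: contrapT => none; apply: tan.
  apply: (@hausdorff_nullS _ _ _ _ _ (\bigcup_N X N)).
    move=> u [Ku uxi [r0 /exists_invS_lt[N hN] seg]]; exists N => //; split=> // r r_gt0 rN.
    by apply: seg => //; exact: lt_trans hN.
  by apply: (hausdorff_null_bigcup k0) => N; apply: contrapT => nX; apply: none; exists N.
have XK : X N `<=` K by move=> u [].
have [p [xi' [h [lam [A [Xp ZL fill]]]]]] := exists_zoom_limit (Q := fun=> X N) Kxi XK nX (fun=> XK).
have [v0 [K0 v0xi']] := exists_neq xi'; have [Kp pxi Kxi' h_xi lam0 lam_inf sim] := ZL.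
have [w' [ww' fr']] := zoom_limit_frame d_sep dPhi cK ZL K0 v0xi' fr.
exists xi', w'; split=> // v Kv vxi'; have [x [Xx xv]] := fill 0%N Xp v Kv vxi'.
apply: (transverse_segment_limit d_sep dPhi cK h_xi Kxi' xv (en := fun=> e) _ eta0 ww').
  by move=> q q0; apply: filterE => n /=; lra.
apply: filterS (filterI Xx (lam_inf N.+1%:R)) => n /= [[[Kx xxi seg] _] lamN].
have lamV : 0 < (lam n)^-1 by rewrite invr_gt0.
have := chart_sim_segment Kp pxi (lam0 n) (sim n) fr Kx xxi (seg _ lamV _).
by rewrite divff ?gt_eqF //; apply; rewrite ltf_pV2 ?posrE // ltr0Sn.
Qed.

Lemma exact_segment_everywhere xi j (w : 'I_j -> V) : K xi -> (j < k)%N ->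
  invariant_frame xi w -> exists xi' (w' : 'I_j -> V), exists2 eta : R, 0 < eta &
  [/\ K xi', invariant_frame xi' w'
    & forall v, K v -> v <> xi' -> transverse_segment xi' w' v 1 0 eta].
Proof.
move=> Kxi jk fr.
have [eta eta0 tan] := tangent_points_nonnull d_sep dPhi cK k0 Kfin Kncol Kxi jk fr.
have n0 n : 0 < n.+1%:R^-1 :> R by rewrite invr_gt0.
have /choice[q hq] n : exists q : T * ('I_j -> V), [/\ K q.1, invariant_frame q.1 q.2
    & forall v, K v -> v <> q.1 -> transverse_segment q.1 q.2 v 1 n.+1%:R^-1 eta].
  by have [x [wx hx]] := segment_everywhere Kxi fr (n0 n) eta0 (tan _ (n0 n)); exists (x, wx).
have Kq n : K (q n).1 by case: (hq n).
have [xi' Kxi' q_xi'] := cK Kq.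
have frq n : invariant_frame (q n).1 (q n).2 by case: (hq n).
have [v0 [K0 v0xi']] := exists_neq xi'.
have [w' [ww' fr']] := invariant_frame_limit d_sep dPhi cK q_xi' Kxi' frq K0 v0xi'.
exists xi', w', eta => //; split=> // v Kv vxi'.
have [vq cv] := chart_cvg_cst d_sep dPhi q_xi' vxi'.
apply: (transverse_segment_limit (x := fun=> v) d_sep dPhi cK q_xi' Kxi' cv _ eta0 ww').
  by move=> e /free_ultra_invS_lt; apply: filterS => n /=; rewrite add0r; exact: ltW.
by apply: filterS vq => n /= vn; have [_ _] := hq n; exact.
Qed.

Definition exact_segment xi u (x : V) := forall s : R, 0 <= s <= 1 ->
  exists z, [/\ K z, z <> xi & chart xi z = chart xi u + s *: x].

Lemma exact_segment_span xi i0 u x : K u -> u <> xi -> exact_segment xi u x ->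
  chart_span xi i0 x.
Proof.
move=> Ku uxi /(_ 1)[|z [Kz zxi]]; first by rewrite ler01 lexx.
rewrite scale1r => E; have -> : x = chart xi z - chart xi u by rewrite E addrAC subrr add0r.
exact: chart_span_diff.
Qed.

Lemma approx_segment0 xi u b : approx_segment (chart xi) (K `\ xi) u b 0 ->
  exact_segment xi u (chart xi b - chart xi u).
Proof.
move=> seg s /seg[z [Kz zxi] hz]; exists z; split=> //.
have z0 : ip_norm (chart xi z - chart xi u - s *: (chart xi b - chart xi u)) = 0.
  by apply/eqP; rewrite eq_le ip_norm_ge0 andbT.
by rewrite -(ip_dist_eq0 z0) addrC subrK.
Qed.

(* Cells of points with a segment in nearly prescribed direction, the
   prescribed directions ranging over a countable dense set. *)
Definition direction_cell (D : nat -> T) xi (i : nat) : set T :=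
  [set u | [/\ K u, u <> xi & exists a b N x,
   [/\ unpickle i = Some (a, b, N) :> option (nat * nat * nat), exact_segment xi u x
     & ip_norm (x - (chart xi (D a) - chart xi (D b))) <= N.+1%:R^-1]]].

Lemma exists_direction_cell D xi p b (e : R) :
  (forall x (e : R), K x -> 0 < e -> exists n, d x (D n) < e) -> K p -> p <> xi -> K b -> b <> xi ->
  exact_segment xi p (chart xi b - chart xi p) -> 0 < e ->
  exists i, direction_cell D xi i p /\ forall u, direction_cell D xi i u ->
    exists2 x, exact_segment xi u x & ip_norm (x - (chart xi b - chart xi p)) <= e.
Proof.
move=> denseD Kp pxi Kb bxi seg e0; set x0 := chart xi b - chart xi p.
have dense_chart u (q : R) : K u -> u <> xi -> 0 < q ->
  exists n, ip_norm (chart xi (D n) - chart xi u) < q.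
  move=> Ku uxi q0; have [r r0|x [Dx xu]] := @ultra_cvg_exists _ _ _ _ _ pd (range D) u.
    by have [n un] := denseD u r Ku r0; exists (D n); split=> //; exists n.
  have [_ /(_ q q0)/filter_ex[n /= xn]] := chart_cvg d_sep dPhi (ultra_cvg_cst pd xi) xu uxi.
  by have [m _ Dm] := Dx n; exists m; rewrite Dm.
have e2 : 0 < e / 2 by lra.
have [N hN] := exists_invS_lt e2; pose q : R := N.+1%:R^-1.
have q0 : 0 < q / 2 by rewrite divr_gt0 // invr_gt0.
have [a ba] := dense_chart b _ Kb bxi q0; have [c pc] := dense_chart p _ Kp pxi q0.
have near : ip_norm (x0 - (chart xi (D a) - chart xi (D c))) <= q.
  have -> : x0 - (chart xi (D a) - chart xi (D c)) =
      (chart xi b - chart xi (D a)) + (chart xi (D c) - chart xi p) by rewrite /x0; vector_ring.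
  apply: le_trans (ip_normD _ _) _; rewrite (ip_distC (chart xi b)).
  by move: ba pc; move: q q0 => q q0; lra.
exists (pickle (a, c, N)); split.
  by split=> //; exists a, c, N, x0; rewrite pickleK.
move=> u [Ku uxi [a' [c' [N' [x [E segx]]]]]].
move: E; rewrite pickleK => -[<- <- <-] x_near; exists x => //.
have -> : x - x0 = (x - (chart xi (D a) - chart xi (D c))) - (x0 - (chart xi (D a) - chart xi (D c))).
  by vector_ring.
apply: le_trans (ip_normD _ _) _; rewrite ip_normN.
by move: near x_near hN; rewrite /q; move: (N.+1%:R^-1 : R) => r; lra.
Qed.

Section Rays.
Context (xi p xi' : T) (h : nat -> T -> T) (lam : nat -> R) (A : nat -> V -> V).
Hypothesis ZL : zoom_limit xi p xi' h lam A.
Context (x0 : V) (Dx0 : chart_span xi p x0).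
Hypothesis fill : forall e : R, 0 < e -> exists2 Q : set T, fills xi xi' h Q &
  forall u, Q u -> [/\ K u, u <> xi
    & exists2 x, exact_segment xi u x & ip_norm (x - x0) <= e].

Lemma zoom_ray_near v (s e : R) : K v -> v <> xi' -> 0 <= s -> 0 < e ->
  U [set n | exists z, (K z /\ z <> h n xi) /\
     ip_norm (chart (h n xi) z - (chart xi' v + s *: A n x0)) <= e].
Proof.
move=> Kv vxi' s0 e0; have q0 : 0 < e / (2 * (s + 1)) by rewrite divr_gt0 //; lra.
have [Q fillQ segQ] := fill q0; have [x [Qx xv]] := fillQ v Kv vxi'.
have e2 : 0 < e / 2 by lra.
have [Kp pxi _ _ lam0 lam_inf sim] := ZL.
apply: filterS (filterI (filterI Qx (xv _ e2)) (lam_inf s)) => n /= [[[Qn xxi] xn] s_lam].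
have [Kx _ [y segy yx0]] := segQ _ Qn; have isoA := chart_sim_isometry (sim n).
have [|z [Kz zxi Ez]] := segy (s / lam n).
  by rewrite divr_ge0 ?(ltW (lam0 n)) //= ler_pdivrMr // mul1r ltW.
have Dy : chart_span xi p y := exact_segment_span p Kx xxi segy.
exists (h n z); split.
  by split; [exact: (chart_sim_stable (sim n))|exact: (chart_sim_neq (sim n))].
rewrite (chart_sim_translate (lam0 n) (sim n) Kx xxi Kz zxi Dy Ez).
have -> : chart (h n xi) (h n (x n)) + s *: A n y - (chart xi' v + s *: A n x0) =
  (chart (h n xi) (h n (x n)) - chart xi' v) + s *: (A n y - A n x0) by vector_ring.
apply: le_trans (ip_normD _ _) _; rewrite ip_normZ ger0_norm //.
rewrite -(isometryB isoA) // (isometry_norm isoA); last exact: (isometry_domB isoA).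
have : s * ip_norm (y - x0) <= (s + 1) * (e / (2 * (s + 1))).
  by apply: ler_pM => //; [exact: ip_norm_ge0|lra].
have -> : (s + 1) * (e / (2 * (s + 1))) = e / 2 by field; rewrite gt_eqF //; lra.
lra.
Qed.

Lemma zoom_ray_cvg v (s : R) : K v -> v <> xi' -> 0 <= s -> exists v', [/\ K v', v' <> xi'
  & ip_cvg U (fun n => s *: A n x0) (chart xi' v' - chart xi' v)].
Proof.
move=> Kv vxi' s0; have [_ _ Kxi' h_xi _ _ sim] := ZL.
have [z hz] := ultra_diagonal v (P := fun n z => K z /\ z <> h n xi)
  (f := fun n z => ip_norm (chart (h n xi) z - (chart xi' v + s *: A n x0)))
  (fun n x => ip_norm_ge0 _) (fun e => zoom_ray_near (e := e) Kv vxi' s0).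
apply: (chart_offset_cvg d_sep dPhi cK h_xi Kxi' (y := z) (B := s * ip_norm x0)
  (ip_cvg_cst (chart xi' v))).
- by apply: filterS (hz 1 ltr01) => n [].
- by apply: filterE => n /=; rewrite ip_normZ ger0_norm // (isometry_norm (chart_sim_isometry (sim n))).
move=> e e0; have e2 : 0 < e / 2 by lra.
by apply: filterS (hz _ e2) => n /= [_]; rewrite subr0; lra.
Qed.

End Rays.

Lemma exists_ray xi j (w : 'I_j -> V) (eta : R) : K xi -> invariant_frame xi w -> 0 < eta ->
  (forall v, K v -> v <> xi -> transverse_segment xi w v 1 0 eta) ->
  exists xi' (w' : 'I_j -> V) sg, [/\ K xi', invariant_frame xi' w', 0 < ip_norm sg,
    translations xi' [set s | 0 <= s] sg & transverse w' eta sg].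
Proof.
move=> Kxi fr eta0 segs; have [D [_ denseD]] := dense_seq pd cK Kxi.
have XK : K `\ xi `<=` K by move=> u [].
have [p [xi' [h [lam [A [_ ZL fill]]]]]] := exists_zoom_limit (Q := direction_cell D xi) Kxi XK
  (@nonnull_neq xi) (fun i u hu => let: And3 Ku _ _ := hu in Ku).
have [Kp pxi Kxi' _ _ _ _] := ZL; have [v0 [K0 v0xi']] := exists_neq xi'.
have [b [[Kb bxi] br]] := segs p Kp pxi; rewrite mulr1 => /approx_segment0 seg tr.
set x0 := chart xi b - chart xi p in br seg tr.
have Dx0 : chart_span xi p x0 by exact: exact_segment_span seg.
have fill_x0 (e : R) : 0 < e -> exists2 Q : set T, fills xi xi' h Q &
    forall u, Q u -> [/\ K u, u <> xi & exists2 x, exact_segment xi u x & ip_norm (x - x0) <= e].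
  move=> /(exists_direction_cell denseD Kp pxi Kb bxi seg)[i [cell_p cell_dir]].
  exists (direction_cell D xi i) => [|u cell_u]; first exact: fill.
  by have [Ku uxi _] := cell_u; split=> //; exact: cell_dir.
have [w' [ww' fr']] := zoom_limit_frame d_sep dPhi cK ZL K0 v0xi' fr.
have [sg sg_cvg ray] : exists2 sg, ip_cvg U (fun n => A n x0) sg & translations xi' [set s | 0 <= s] sg.
  apply: (zoom_limit_direction K0 v0xi'); first exact: ler01.
  by move=> v s s0 Kv vxi'; exact: (zoom_ray_cvg ZL Dx0 fill_x0 Kv vxi').
exists xi', w', sg; split=> //; last exact: (zoom_limit_transverse ZL eta0 fr ww' Dx0 sg_cvg).
by rewrite (zoom_limit_norm ZL Dx0 sg_cvg); have /andP[+ _] := br; lra.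
Qed.

Definition translated xi (sg : V) : set T := [set v | [/\ K v, v <> xi
  & exists u, [/\ K u, u <> xi & chart xi v = chart xi u + sg]]].

Lemma dist_le_chart xi u v : u <> xi -> v <> xi ->
  d u v <= 4 * ip_norm (chart xi u - chart xi v).
Proof.
move=> uxi vxi; rewrite (chart_dist d_sep dPhi uxi vxi) mulrA.
have pos : 0 < d u xi * d v xi by rewrite mulr_gt0 ?dgt0.
rewrite ler_pdivlMr // mulrC ler_wpM2r ?(pseudometric_ge0 pd) //.
have -> : 4 = 2 * 2 :> R by lra.
by apply: ler_pM; rewrite ?(ltW (dgt0 _)).
Qed.

Lemma chart_norm_le xi u (r : R) : 0 < r -> r <= d u xi -> ip_norm (chart xi u) <= r^-1.
Proof. by move=> r0 ru; rewrite (chart_norm dPhi) lef_pV2 ?posrE //; exact: lt_le_trans ru. Qed.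

Lemma le_dist_pole xi u (B : R) : 0 < B -> u <> xi -> ip_norm (chart xi u) <= B ->
  B^-1 <= d u xi.
Proof.
move=> B0 uxi; rewrite (chart_norm dPhi) => uB; have du := dgt0 uxi.
by rewrite -[leRHS]invrK lef_pV2 ?posrE ?invr_gt0.
Qed.

(* Away from [xi] the inverse translation is Lipschitz. *)
Lemma translated_nonnull xi sg : K xi -> translations xi [set s | 0 <= s] sg ->
  ~ hausdorff_null d k (translated xi sg).
Proof.
move=> Kxi ray nul; apply: nK; pose r n : R := n.+1%:R^-1; have r0 n : 0 < r n by rewrite invr_gt0.
pose Y n := [set u | K u /\ r n <= d u xi].
have Yxi n u : Y n u -> u <> xi by move=> [_ ru] E; move: ru; rewrite E d0 leNgt r0.
apply: (@hausdorff_nullS _ _ _ _ _ ([set xi] `|` \bigcup_n Y n)).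
  move=> u Ku; have [->|/dgt0/exists_invS_lt[n hn]] := pselect (u = xi); [by left|right].
  by exists n => //; split=> //; exact: ltW.
apply: (hausdorff_nullU k0); first exact: (hausdorff_null1 k0).
apply: (hausdorff_null_bigcup k0) => n; pose B := (r n)^-1 + ip_norm sg.
have B0 : 0 < B by rewrite ltr_pwDl ?invr_gt0 ?ip_norm_ge0.
pose image_of v u := Y n u /\ chart xi v = chart xi u + sg.
pose X := [set v | [/\ K v, v <> xi & exists u, image_of v u]].
have /choice[f hf] v : exists u, X v -> image_of v u.
  by have [[_ _ [u hu]]|no] := pselect (X v); [exists u|exists v].
have X_far v : X v -> B^-1 <= d v xi.
  move=> [Kv vxi [u [[Ku ru] E]]]; apply: le_dist_pole => //; rewrite E.
  by apply: le_trans (ip_normD _ _) _; rewrite lerD2r chart_norm_le.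
have f_lip v v' : X v -> X v' -> d (f v) (f v') <= 4 * B ^+ 2 * d v v'.
  move=> Xv Xv'; have [Yf E] := hf v Xv; have [Yf' E'] := hf v' Xv'.
  apply: le_trans (dist_le_chart (Yxi _ _ Yf) (Yxi _ _ Yf')) _.
  have -> : chart xi (f v) - chart xi (f v') = chart xi v - chart xi v' by rewrite E E'; vector_ring.
  rewrite -mulrA ler_pM2l // -[B ^+ 2]invrK -exprVn.
  by apply: (chart_lip d_sep dPhi); rewrite ?invr_gt0 //; exact: X_far.
have nulX : hausdorff_null d k X.
  apply: hausdorff_nullS nul => v [Kv vxi [u [Yu E]]]; split=> //.
  by exists u; split=> //; [case: Yu|exact: Yxi Yu].
have L0 : 0 < 4 * B ^+ 2 by positivity.
have := hausdorff_null_image (d' := d) (f := f) L0 f_lip nulX.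
apply: hausdorff_nullS => u Yu; have uxi := Yxi _ _ Yu; have [Ku _] := Yu.
have [v [Kv vxi]] := ray u 1 ler01 Ku uxi; rewrite scale1r => E.
have Xv : X v by split=> //; exists u.
exists v => //; have [Yf Ef] := hf v Xv.
by apply: (chart_inj d_sep dPhi (Yxi _ _ Yf) uxi); apply: (addIr sg); rewrite -Ef -E.
Qed.

(* Deep inside the image of a translation one can also translate backwards. *)
Lemma zoom_line_cvg xi p xi' h lam A sg v (s : R) : zoom_limit xi p xi' h lam A ->
  chart_span xi p sg -> translations xi [set s | 0 <= s] sg -> fills xi xi' h (translated xi sg) ->
  K v -> v <> xi' -> exists v', [/\ K v', v' <> xi'
  & ip_cvg U (fun n => s *: A n sg) (chart xi' v' - chart xi' v)].
Proof.
move=> ZL Dsg ray fill Kv vxi'; have [Kp pxi Kxi' h_xi lam0 lam_inf sim] := ZL.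
have [x [Xx xv]] := fill v Kv vxi'.
have [|y hy] := ultra_choice (U := U) (P := fun n z => [/\ K z, z <> h n xi
    & chart (h n xi) z = chart (h n xi) (h n (x n)) + s *: A n sg]) v _.
  apply: filterS (filterI Xx (lam_inf `|s|)) => n /= [[[Kx xxi [u [Ku uxi Ex]]] _] s_lam].
  have s1 : 0 <= 1 + s / lam n.
    have : `|s / lam n| <= 1.
      by rewrite normrM normfV (gtr0_norm (lam0 n)) ler_pdivrMr // mul1r ltW.
    by rewrite ler_norml; lra.
  have [z [Kz zxi Ez]] := ray u _ s1 Ku uxi.
  exists (h n z); split; [exact: (chart_sim_stable (sim n))|exact: (chart_sim_neq (sim n))|].
  apply: (chart_sim_translate (lam0 n) (sim n)) => //.
  by rewrite Ez Ex -addrA -[X in _ = _ + (X + _)]scale1r -scalerDl.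
apply: (chart_offset_cvg d_sep dPhi cK h_xi Kxi' (y := y) (B := `|s| * ip_norm sg) xv).
- by apply: filterS hy => n [].
- by apply: filterE => n /=; rewrite ip_normZ (isometry_norm (chart_sim_isometry (sim n))).
by apply: (ip_cvg_near_eq _ (ip_cvg_cst 0)); apply: filterS hy => n /= [_ _ ->]; rewrite subrr.
Qed.

Lemma exists_line xi j (w : 'I_j -> V) sg (eta : R) : K xi -> invariant_frame xi w ->
  0 < ip_norm sg -> translations xi [set s | 0 <= s] sg -> 0 < eta -> transverse w eta sg ->
  exists xi' (w' : 'I_j -> V) sg', [/\ K xi', invariant_frame xi' w', 0 < ip_norm sg',
    translations xi' setT sg' & transverse w' eta sg'].
Proof.
move=> Kxi fr sg0 ray eta0 tr; have XK : translated xi sg `<=` K by move=> u [].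
have [p [xi' [h [lam [A [Xp ZL fill]]]]]] := exists_zoom_limit (Q := fun=> translated xi sg) Kxi XK
  (translated_nonnull Kxi ray) (fun=> XK).
have [Kp pxi Kxi' _ _ _ _] := ZL; have [v0 [K0 v0xi']] := exists_neq xi'.
have [w' [ww' fr']] := zoom_limit_frame d_sep dPhi cK ZL K0 v0xi' fr.
have Dsg : chart_span xi p sg.
  have [v [Kv vxi]] := ray p 1 ler01 Kp pxi; rewrite scale1r => E.
  have -> : sg = chart xi v - chart xi p by rewrite E addrAC subrr add0r.
  exact: chart_span_diff.
have [sg' sg_cvg line] : exists2 sg', ip_cvg U (fun n => A n sg) sg' & translations xi' setT sg'.
  apply: (zoom_limit_direction K0 v0xi') => // v s _.
  exact: (zoom_line_cvg s ZL Dsg ray (fill 0%N Xp)).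
exists xi', w', sg'; split=> //; last exact: (zoom_limit_transverse ZL eta0 fr ww' Dsg sg_cvg).
by rewrite (zoom_limit_norm ZL Dsg sg_cvg).
Qed.

(* Gram-Schmidt. *)
Lemma invariant_frame_extend xi j (w : 'I_j -> V) sg (eta : R) : invariant_frame xi w ->
  translations xi setT sg -> 0 < ip_norm sg -> 0 < eta -> transverse w eta sg ->
  exists w' : 'I_j.+1 -> V, invariant_frame xi w'.
Proof.
move=> [w_orth inv] line sg0 eta0 tr.
pose ta := sg - \sum_i ip sg (w i) *: w i.
have ta0 : 0 < ip_norm ta by apply: lt_le_trans (tr _); rewrite mulr_gt0.
pose wn := (ip_norm ta)^-1 *: ta.
have wn_w i : ip wn (w i) = 0.
  by rewrite /wn ipZl /ta ipDl ipNl (ip_orth_sum w_orth) subrr mulr0.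
have wn_wn : ip wn wn = 1 by rewrite /wn ipZl ipZr -ip_norm_sq; field; rewrite gt_eqF.
exists (ord_rcons w wn); split=> [i i'|u t Ku uxi].
  have [->|[i0 ->]] := ord_max_or_widen i; have [->|[i0' ->]] := ord_max_or_widen i';
    rewrite ?ord_rcons_widen ?ord_rcons_max.
  - by rewrite wn_wn eqxx.
  - by rewrite wn_w eq_sym widen_neq_max.
  - by rewrite ipC wn_w widen_neq_max.
  by rewrite w_orth.
pose s := t ord_max / ip_norm ta.
have [v1 [Kv1 v1xi Ev1]] := line u s I Ku uxi.
have [v2 [Kv2 v2xi Ev2]] := inv v1 (fun i => t (widen_ord (leqnSn j) i) - s * ip sg (w i)) Kv1 v1xi.
exists v2; split=> //; rewrite Ev2 Ev1 big_ord_recr /= ord_rcons_max.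
under [in RHS]eq_bigr do rewrite ord_rcons_widen.
rewrite /wn scalerA -/s /ta -addrA; congr (_ + _).
rewrite scalerBr scaler_sumr addrCA; congr (_ + _); rewrite -sumrB; apply: eq_bigr => i _.
by rewrite scalerBl scalerA.
Qed.

Lemma exists_invariant_frame j : (j <= k)%N ->
  exists xi (w : 'I_j -> V), K xi /\ invariant_frame xi w.
Proof.
elim: j => [|j IH] jk.
  exists xo, (fun=> 0); split=> //; split=> [[]//|u t Ku uxo]; exists u; split=> //.
  by rewrite big_ord0 addr0.
have [xi [w [Kxi fr]]] := IH (ltnW jk).
have [x1 [w1 [eta eta0 [K1 fr1 segs]]]] := exact_segment_everywhere Kxi jk fr.
have [x2 [w2 [sg2 [K2 fr2 sg2_gt0 ray tr2]]]] := exists_ray K1 fr1 eta0 segs.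
have [x3 [w3 [sg3 [K3 fr3 sg3_gt0 line tr3]]]] := exists_line K2 fr2 sg2_gt0 ray eta0 tr2.
by have [w4 fr4] := invariant_frame_extend fr3 line sg3_gt0 eta0 tr3; exists x3, w4.
Qed.

Section Cubes.
Context (xi : T) (w : 'I_k -> V) (fr : invariant_frame xi w).

Definition cube (n : nat) (b : T) : set T := [set u | [/\ K u, u <> xi & exists2 t : 'I_k -> R,
  chart xi u = chart xi b + \sum_i t i *: w i & forall i : 'I_k, 0 <= t i <= (i < n)%:R]].

Lemma cube_chart_norm n b u : cube n b u -> ip_norm (chart xi u) <= ip_norm (chart xi b) + k%:R.
Proof.
move=> [_ _ [t -> t01]]; apply: le_trans (ip_normD _ _) _; rewrite lerD2l.
apply: le_trans (ip_norm_sum _ _) _.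
apply: (@le_trans _ _ (\sum_(i < k) 1)); last by rewrite sumr_const card_ord.
apply: ler_sum => i _; rewrite ip_normZ (ip_norm_w fr.1) mulr1.
by have /andP[t0 t1] := t01 i; rewrite ger0_norm // (le_trans t1) // lern1; case: (i < n)%N.
Qed.

Lemma cube_slice n (nk : (n < k)%N) b (t : R) : K b -> b <> xi ->
  let f u := ip (chart xi u) (w (Ordinal nk)) in f b <= t <= f b + 1 ->
  exists b', [/\ K b', b' <> xi, f b' = t & cube n b' `<=` cube n.+1 b `&` [set u | f u = t]].
Proof.
move=> Kb bxi f tb; have [w_orth inv] := fr; set i0 := Ordinal nk in f tb *.
have [b' [Kb' b'xi]] := inv b (fun i => if i == i0 then t - f b else 0) Kb bxi.
rewrite sum_scale_if => Eb'.
have fb' : f b' = t by rewrite {1}/f Eb' ipDl (ipZl (t - f b)) w_orth eqxx mulr1 -/(f b) addrC subrK.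
exists b'; split=> // u [Ku uxi [s Eu s01]].
have s_i0 : s i0 = 0 by apply/eqP; rewrite eq_le andbC; have := s01 i0; rewrite ltnn.
split; last by rewrite /= /f Eu ipDl (ip_orth_sum w_orth) s_i0 addr0.
split=> //; exists (fun i => if i == i0 then t - f b else s i).
  rewrite Eu Eb' -addrA; congr (_ + _); rewrite [in LHS](bigD1 i0) // [in RHS](bigD1 i0) //= eqxx.
  by rewrite s_i0 scale0r add0r; congr (_ + _); apply: eq_bigr => i /negbTE ->.
move=> i; case: eqP => [->|ne]; first by rewrite ltnSn /=; lra.
rewrite ltnS leq_eqVlt; case: eqP => [E|_]; last exact: s01.
by case: ne; exact: val_inj.
Qed.

Lemma cube_coord_lip n i b : exists2 L : R, 0 < L & forall u v, cube n b u -> cube n b v ->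
  `|ip (chart xi u) (w i) - ip (chart xi v) (w i)| <= L * d u v.
Proof.
pose B := ip_norm (chart xi b) + k%:R + 1.
have B0 : 0 < B by rewrite ltr_wpDl // addr_ge0 ?ip_norm_ge0.
have iB0 : 0 < B^-1 by rewrite invr_gt0.
have far u : cube n b u -> B^-1 <= d u xi.
  move=> cu; have [_ uxi _] := cu; apply: le_dist_pole => //.
  by apply: le_trans (cube_chart_norm cu) _; rewrite lerDl.
exists ((ip_norm (w i) + 1) / B^-1 ^+ 2).
  by rewrite divr_gt0 ?exprn_gt0 // ltr_wpDl ?ip_norm_ge0.
by move=> u v /far ur /far vr; exact: (coord_lip d_sep dPhi (fun=> w i) 0 iB0 ur vr).
Qed.

Lemma cube_nonnull n b : (0 < n)%N -> (n <= k)%N -> K b -> b <> xi ->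
  ~ hausdorff_null d n (cube n b).
Proof.
case: n => // n _; elim: n b => [|n IH] b nk Kb bxi nul.
  have [L L0 f_lip] := cube_coord_lip 1 (Ordinal nk) b.
  apply: (@unit_interval_nonnull R (ip (chart xi b) (w (Ordinal nk)))).
  apply: hausdorff_nullS (hausdorff_null_image L0 f_lip nul) => t /=.
  move=> /(cube_slice (nk := nk) Kb bxi)[b' [Kb' b'xi fb' sub]].
  have [|cube_b' _] := sub b'; last by exists b'.
  split=> //; exists (fun=> 0) => [|i]; last by rewrite ltn0 lexx.
  by rewrite big1 ?addr0 // => i _; rewrite scale0r.
have [L L0 f_lip] := cube_coord_lip n.+2 (Ordinal nk) b.
pose f u := ip (chart xi u) (w (Ordinal nk)); have fb1 : f b < f b + 1 by rewrite ltrDl.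
have [t /andP[tb tb1] /contrapT nul_t] :=
  lebesgue_null_itv fb1 (eilenberg_null (ltn0Sn n) L0 f_lip nul).
have [|b' [Kb' b'xi _ sub]] := cube_slice (t := t) (nk := nk) Kb bxi; first by rewrite !ltW.
by apply: (IH b' (ltnW nk) Kb' b'xi); exact: hausdorff_nullS nul_t.
Qed.

End Cubes.

Lemma orth_expansion (w : 'I_k -> V) x : (forall i i', ip (w i) (w i') = (i == i')%:R) ->
  (exists t : 'I_k -> R, x = \sum_i t i *: w i) -> x = \sum_i ip x (w i) *: w i.
Proof.
by move=> w_orth [t Ex]; rewrite {1}Ex; apply: eq_bigr => i _; rewrite Ex (ip_orth_sum w_orth).
Qed.

Lemma exists_flat_chart : exists xi (w : 'I_k -> V), [/\ K xi, invariant_frame xi w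
  & forall u v, K u -> u <> xi -> K v -> v <> xi -> exists t : 'I_k -> R,
    chart xi u = chart xi v + \sum_i t i *: w i].
Proof.
have [xi [w [Kxi fr]]] := exists_invariant_frame (leqnn k); have [b [Kb bxi]] := exists_neq xi.
pose X := [set u | [/\ K u, u <> xi &
  exists t : 'I_k -> R, chart xi u = chart xi b + \sum_i t i *: w i]].
have XK : X `<=` K by move=> u [].
have nX : ~ hausdorff_null d k X.
  apply: contra_not (cube_nonnull fr k0 (leqnn k) Kb bxi); apply: hausdorff_nullS.
  by move=> u [Ku uxi [t Et _]]; split=> //; exists t.
have [p [xi' [h [lam [A [Xp ZL fill]]]]]] := exists_zoom_limit (Q := fun=> X) Kxi XK nX (fun=> XK).
have [v0 [K0 v0xi']] := exists_neq xi'; have [Kp pxi Kxi' _ lam0 _ sim] := ZL.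
have [w' [ww' fr']] := zoom_limit_frame d_sep dPhi cK ZL K0 v0xi' fr.
exists xi', w'; split=> // u v Ku uxi' Kv vxi'.
have [x [Xx xu]] := fill 0%N Xp u Ku uxi'; have [y [Xy yv]] := fill 0%N Xp v Kv vxi'.
pose L n := chart (h n xi) (h n (x n)) - chart (h n xi) (h n (y n)).
have Luv : ip_cvg U L (chart xi' u - chart xi' v) by exact: ip_cvgB.
exists (fun i => ip (chart xi' u - chart xi' v) (w' i)).
apply: (addIr (- chart xi' v)); rewrite [RHS]addrAC subrr add0r.
suff Lsum : ip_cvg U L (\sum_i ip (chart xi' u - chart xi' v) (w' i) *: w' i).
  exact: ip_cvg_unique Luv Lsum.
apply: (ip_cvg_near_eq _ (ip_cvg_sum (fun i => ip_cvg_coef Luv (ww' i)))).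
apply: filterS (filterI Xx Xy) => n /= [[[Kx xxi [tx Ex]] _] [[Ky yxi [ty Ey]] _]].
have isoA := chart_sim_isometry (sim n); have Dw i := invariant_frame_span i Kp pxi fr.
apply/esym/orth_expansion; first by move=> i i'; rewrite (isometry_ip isoA) // fr.1.
exists (fun i => lam n * (tx i - ty i)); rewrite /L (chart_simE (sim n)) // Ex Ey.
have -> : chart xi b + \sum_i tx i *: w i - (chart xi b + \sum_i ty i *: w i) =
    \sum_i (tx i - ty i) *: w i.
  by rewrite opprD addrACA subrr add0r -sumrB; apply: eq_bigr => i _; rewrite scalerBl.
by rewrite (isometry_sum isoA) // scaler_sumr; apply: eq_bigr => i _; rewrite scalerA.
Qed.

End ZoomSteps.

(** * Square-summable sequences *)

Section L2.
Context {R : realType}.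
Implicit Types x y : nat -> R.

Lemma sqn_ge x n : ((\sum_(i < n) x i ^+ 2)%:E <= sqn x)%E.
Proof.
apply: le_trans (nneseries_lim_ge n _); last by move=> i _ _; rewrite lee_fin sqr_ge0.
by rewrite big_mkord sumEFin.
Qed.

Lemma sqn_le x (M : R) : (forall n, \sum_(i < n) x i ^+ 2 <= M) -> (sqn x <= M%:E)%E.
Proof.
move=> h; apply: lime_le; first by apply: is_cvg_nneseries => i _ _; rewrite lee_fin sqr_ge0.
by apply: nearW => n; rewrite big_mkord sumEFin lee_fin.
Qed.

Lemma sqn_ge0 x : (0 <= sqn x)%E.
Proof. by apply: nneseries_ge0 => i _ _; rewrite lee_fin sqr_ge0. Qed.

Lemma sqn_finP x : (sqn x < +oo)%E <-> exists M : R, forall n, \sum_(i < n) x i ^+ 2 <= M.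
Proof.
split=> [h|[M h]]; last by apply: le_lt_trans (sqn_le h) (ltry _).
exists (fine (sqn x)) => n; rewrite -lee_fin fineK; first exact: sqn_ge.
by rewrite ge0_fin_numE // sqn_ge0.
Qed.

Definition l2pred : {pred nat -> R} := [pred x | `[< (sqn x < +oo)%E >]].

Lemma l2_submod : submod_closed l2pred.
Proof.
split=> [|a x y]; rewrite !inE.
  by apply/sqn_finP; exists 0 => n; rewrite big1 // => i _; rewrite expr0n.
move=> /sqn_finP [M hM] /sqn_finP [N hN]; apply/sqn_finP.
exists (2 * a ^+ 2 * M + 2 * N) => n.
apply: (@le_trans _ _ (\sum_(i < n) (2 * a ^+ 2 * x i ^+ 2 + 2 * y i ^+ 2))).
  apply: ler_sum => i _; rewrite -[(a *: x + y) i]/(a * x i + y i).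
  have := sqr_ge0 (a * x i - y i); move: (x i : R) (y i : R) => p q; nra.
rewrite big_split /= -!mulr_sumr; apply: lerD.
  by apply: ler_wpM2l; [rewrite mulr_ge0 // sqr_ge0 | exact: hM].
by apply: ler_wpM2l => //; exact: hN.
Qed.

HB.instance Definition _ := GRing.isSubmodClosed.Build R (nat -> R) l2pred l2_submod.

Record l2 := L2 { l2v :> nat -> R; l2P : l2v \in l2pred }.
HB.instance Definition _ := [isSub for l2v].
HB.instance Definition _ := [Choice of l2 by <:].
HB.instance Definition _ := [SubChoice_isSubLmodule of l2 by <:].

Lemma l2DE (x y : l2) i : (x + y) i = x i + y i. Proof. by []. Qed.
Lemma l2ZE a (x : l2) i : (a *: x) i = a * x i. Proof. by []. Qed.
Lemma l2NE (x : l2) i : (- x) i = - x i. Proof. by []. Qed.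
Lemma l2_bound (x : l2) : exists M : R, forall n, \sum_(i < n) x i ^+ 2 <= M.
Proof. by apply/sqn_finP; have := l2P x; rewrite inE. Qed.

Definition psum (x y : l2) (n : nat) : R := \sum_(i < n) x i * y i.

Lemma psum_cvg (x y : l2) : cvgn (psum x y).
Proof.
have sq (z : l2) : cvgn (psum z z).
{ apply: nondecreasing_is_cvgn.
    apply/nondecreasing_seqP => n; rewrite /psum big_ord_recr /= lerDl -expr2; exact: sqr_ge0.
  have [M hM] := l2_bound z; exists M => _ [n _ <-].
  by apply: le_trans (hM n); apply: ler_sum => i _; rewrite expr2.
}
have -> : psum x y = (fun n => 4^-1 * (psum (x + y) (x + y) n - psum (x - y) (x - y) n)).
{ apply/funext => n; rewrite /psum -sumrB mulr_sumr; apply: eq_bigr => i _.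
  rewrite !l2DE l2NE; by field.
}
by apply: is_cvgM; [exact: is_cvg_cst | apply: is_cvgB].
Qed.

Definition l2ip (x y : l2) : R := limn (psum x y).

Lemma l2ipC (x y : l2) : l2ip x y = l2ip y x.
Proof.
by congr (limn _); apply/funext => n; apply: eq_bigr => i _; rewrite mulrC.
Qed.

Lemma l2ipDl (x y z : l2) : l2ip (x + y) z = l2ip x z + l2ip y z.
Proof.
have -> : l2ip (x + y) z = limn (fun n => psum x z n + psum y z n).
{ congr (limn _); apply/funext => n; rewrite /psum -big_split /=.
  by apply: eq_bigr => i _; rewrite mulrDl.
}
by apply: cvg_lim => //; apply: cvgD; exact: psum_cvg.
Qed.

Lemma l2ipZl a (x y : l2) : l2ip (a *: x) y = a * l2ip x y.
Proof.
have -> : l2ip (a *: x) y = limn (fun n => a * psum x y n).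
{ congr (limn _); apply/funext => n; rewrite /psum mulr_sumr.
  by apply: eq_bigr => i _; rewrite mulrA.
}
by apply: cvg_lim => //; apply: cvgM; [exact: cvg_cst | exact: psum_cvg].
Qed.

Lemma l2ip_ge (x : l2) n : \sum_(i < n) x i ^+ 2 <= l2ip x x.
Proof.
have -> : \sum_(i < n) x i ^+ 2 = psum x x n by apply: eq_bigr => i _; rewrite expr2.
apply: nondecreasing_cvgn_le; last exact: psum_cvg.
by apply/nondecreasing_seqP => m; rewrite /psum big_ord_recr /= lerDl -expr2; exact: sqr_ge0.
Qed.

Lemma l2ip_ge0 (x : l2) : 0 <= l2ip x x.
Proof. by have := l2ip_ge x 0; rewrite big_ord0. Qed.

Lemma l2ip_coord (x : l2) i : x i ^+ 2 <= l2ip x x.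
Proof.
apply: le_trans (l2ip_ge x i.+1); rewrite big_ord_recr /= lerDr.
by apply: sumr_ge0 => m _; exact: sqr_ge0.
Qed.

Lemma l2_ext (x y : l2) : (forall i, x i = y i) -> x = y.
Proof. by move=> h; apply: val_inj; apply/funext. Qed.

Lemma l2ip_eq0 (x : l2) : l2ip x x = 0 -> x = 0.
Proof.
move=> h; apply: l2_ext => i; apply/eqP; rewrite -sqrf_eq0 eq_le sqr_ge0 andbT -h.
exact: l2ip_coord.
Qed.

Definition l2space : ipspace R := IPSpace l2ipC l2ipDl l2ipZl l2ip_ge0 l2ip_eq0.

Lemma l2_sqn (x : l2) : sqn x = (l2ip x x)%:E.
Proof.
apply/eqP; rewrite eq_le; apply/andP; split; first by apply: sqn_le => n; exact: l2ip_ge.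
have fx : sqn x \is a fin_num.
  by rewrite ge0_fin_numE ?sqn_ge0 //; have := l2P x; rewrite inE.
rewrite -(fineK fx) lee_fin; apply: limr_le; first exact: psum_cvg.
apply: nearW => n; rewrite -lee_fin (fineK fx); apply: le_trans (sqn_ge x n).
by rewrite lee_fin; apply: ler_sum => i _; rewrite expr2.
Qed.

Lemma nrm_l2 (x : l2space) : nrm (x : l2) = ip_norm x.
Proof. by rewrite /nrm l2_sqn. Qed.

End L2.

Definition scons (R : Type) (a : R) (x : nat -> R) : nat -> R := fun i => if i is j.+1 then x j else a.

Lemma ip_dist_height (R : realType) (V : ipspace R) (t : R) (a b : V) :
  t ^+ 2 * ip_norm (a - b) ^+ 2 <= (t ^+ 2 + ip_norm a ^+ 2) * (t ^+ 2 + ip_norm b ^+ 2).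
Proof.
have := ip_cauchy_schwarz a b; rewrite -(ler_pXn2r (n := 2)) ?nnegrE ?mulr_ge0 ?ip_norm_ge0 //.
rewrite exprMn !ip_norm_sq real_normK ?num_real // ipDl !ipDr !ipNr !ipNl (ipC b a).
have := sqr_ge0 (t ^+ 2 + ip a b).
move: (ip a b) (ip a a) (ip b b) (t ^+ 2) => m n l s; nra.
Qed.

Section Cons.
Context {R : realType}.
Notation V := (l2space (R := R)).

Lemma scons_fin a (x : nat -> R) : (sqn x < +oo)%E -> (sqn (scons a x) < +oo)%E.
Proof.
move=> /sqn_finP [M hM]; apply/sqn_finP; exists (a ^+ 2 + M) => -[|n].
  by rewrite big_ord0 addr_ge0 ?sqr_ge0 //; have := hM 0%N; rewrite big_ord0.
rewrite big_ord_recl /= lerD2l; exact: hM.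
Qed.

Lemma tail_fin (x : nat -> R) : (sqn x < +oo)%E -> (sqn (fun i => x i.+1) < +oo)%E.
Proof.
move=> /sqn_finP [M hM]; apply/sqn_finP; exists M => n.
by apply: le_trans (hM n.+1); rewrite big_ord_recl /= lerDr sqr_ge0.
Qed.

Lemma l2ip_behead (x y : l2 (R := R)) (x' y' : l2 (R := R)) :
  (forall i, x' i = x i.+1) -> (forall i, y' i = y i.+1) ->
  l2ip x y = x 0%N * y 0%N + l2ip x' y'.
Proof.
move=> hx hy; rewrite /l2ip.
have <- : limn (fun n => psum x y n.+1) = limn (psum x y).
{ apply: cvg_lim => //; have := @psum_cvg R x y; by rewrite -(cvg_shiftS (psum x y)).
}
apply: cvg_lim => //.
have -> : (fun n => psum x y n.+1) = (fun n => x 0%N * y 0%N + psum x' y' n).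
{ apply/funext => n; rewrite /psum big_ord_recl /=; congr (_ + _).
  by apply: eq_bigr => i _; rewrite hx hy.
}
by apply: cvgD; [exact: cvg_cst | exact: psum_cvg].
Qed.

End Cons.

(** * The chordal model *)

Section Model.
Context {R : realType} (d : option nat).
Notation V := (l2space (R := R)).
Implicit Types (p q : @hat R d) (x y : @Hpt R d).

Lemma hvec_proof x : sval x \in @l2pred R.
Proof. by rewrite inE; have [h _] := proj2_sig x. Qed.

Definition hvec x : V := L2 (hvec_proof x).

Lemma hvec_inj x y : hvec x = hvec y -> x = y.
Proof.
case: x y => x px [y py] /(congr1 (@l2v R)) /= E; move: px py; rewrite /= in E.
by case: _ / E => px py; congr exist; exact: Prop_irrelevance.
Qed.

Lemma nrm_vsub x y : nrm (vsub (sval x) (sval y)) = ip_norm (hvec x - hvec y).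
Proof. by rewrite -nrm_l2. Qed.

Lemma nrm_hvec x : nrm (sval x) = ip_norm (hvec x).
Proof. by rewrite -nrm_l2. Qed.

(* The chordal metric is [2 hdist p q / (hweight p * hweight q)], where
   distances to infinity count as 1. *)
Definition hweight p : R := if p is Some x then Num.sqrt (1 + ip_norm (hvec x) ^+ 2) else 1.
Definition hdist p q : R := match p, q with
  | Some x, Some y => ip_norm (hvec x - hvec y)
  | None, None => 0
  | _, _ => 1 end.

Lemma hweight_gt0 p : 0 < hweight p.
Proof.
case: p => [x|] //=; rewrite sqrtr_gt0; have := sqr_ge0 (ip_norm (hvec x)); lra.
Qed.

Lemma hweight_ge1 p : 1 <= hweight p.
Proof.
case: p => [x|] //=; rewrite -[X in X <= _]sqrtr1 ler_sqrt; have := sqr_ge0 (ip_norm (hvec x)); lra.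
Qed.

Lemma hweight_sq x : hweight (Some x) ^+ 2 = 1 + ip_norm (hvec x) ^+ 2.
Proof. by rewrite /= sqr_sqrtr //; have := sqr_ge0 (ip_norm (hvec x)); lra. Qed.

Lemma hdist_ge0 p q : 0 <= hdist p q.
Proof. by case: p q => [x|] [y|] //=; exact: ip_norm_ge0. Qed.

Lemma hdistC p q : hdist p q = hdist q p.
Proof. by case: p q => [x|] [y|] //=; exact: ip_distC. Qed.

Lemma hdist_eq0 p q : hdist p q = 0 -> p = q.
Proof.
case: p q => [x|] [y|] //=; first by move/ip_dist_eq0/hvec_inj => ->.
  by move/eqP; rewrite oner_eq0.
by move/eqP; rewrite oner_eq0.
Qed.

Lemma chordalE p q : chordal p q = 2 * hdist p q / (hweight p * hweight q).
Proof.
case: p q => [x|] [y|] /=; rewrite ?nrm_vsub ?nrm_hvec ?mulr1 ?mul1r //.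
by rewrite mulr0 mul0r.
Qed.

Lemma hdist_le p q : hdist p q <= hweight p * hweight q.
Proof.
case: p q => [x|] [y|]; last by rewrite /= mulr1.
- rewrite -(ler_pXn2r (n := 2)) ?nnegrE ?hdist_ge0 ?mulr_ge0 ?(ltW (hweight_gt0 _)) // exprMn
  !hweight_sq.
  by have := ip_dist_height 1 (hvec x) (hvec y); rewrite expr1n mul1r.
- by have := hweight_ge1 (Some x); rewrite /= mulr1.
- by have := hweight_ge1 (Some y); rewrite /= mul1r.
Qed.

Lemma chordal_le2 p q : chordal p q <= 2.
Proof.
rewrite chordalE ler_pdivrMr ?mulr_gt0 ?hweight_gt0 // ler_pM2l //; exact: hdist_le.
Qed.

Lemma chordal_sep p q : chordal p q = 0 -> p = q.
Proof.
rewrite chordalE => /eqP; rewrite mulf_eq0 invr_eq0 mulf_eq0 mulf_eq0 !(gt_eqF (hweight_gt0 _))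
  orbF orbF.
by rewrite (@pnatr_eq0 R 2) /= => /eqP; exact: hdist_eq0.
Qed.

Lemma hcons_proof (x : @Hpt R d) (a : R) : in_H (dsucc d) (scons a (sval x)).
Proof.
case: x => x [h1 h2]; split; first exact: scons_fin.
by case: d h2 => [n|] //= h2 _ [<-] [|i] //= ni; apply: (h2 n).
Qed.

Definition hcons (a : R) (x : @Hpt R d) : @Hpt R (dsucc d) := exist _ _ (hcons_proof x a).

Lemma htail_proof (y : @Hpt R (dsucc d)) : in_H d (fun i => sval y i.+1).
Proof.
case: y => y [h1 h2]; split; first exact: tail_fin.
by move=> n E i ni; apply: (h2 n.+1) => //; rewrite E.
Qed.

Definition htail (y : @Hpt R (dsucc d)) : @Hpt R d := exist _ _ (htail_proof y).

End Model.

Section Model2.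
Context {R : realType} (d : option nat).
Notation V := (l2space (R := R)).
Implicit Types (p q : @hat R d) (x y : @Hpt R d).

Lemma hcons_htail (y : @Hpt R (dsucc d)) : hcons (sval y 0%N) (htail y) = y.
Proof. by apply: hvec_inj; apply: l2_ext => -[|i]. Qed.

Lemma hcons_dist_sq (a b : R) x y :
  ip_norm (hvec (hcons a x) - hvec (hcons b y)) ^+ 2 = (a - b) ^+ 2 + ip_norm (hvec x - hvec y) ^+ 2.
Proof. by rewrite !ip_norm_sq /ip /= (@l2ip_behead _ _ _ (hvec x - hvec y) (hvec x - hvec y)) //
  expr2. Qed.

Lemma hcons_norm_sq (a : R) x : ip_norm (hvec (hcons a x)) ^+ 2 = a ^+ 2 + ip_norm (hvec x) ^+ 2.
Proof. by rewrite !ip_norm_sq /ip /= (@l2ip_behead _ _ _ (hvec x) (hvec x)) // expr2. Qed.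

Lemma hcons_distB (a : R) x y : ip_norm (hvec (hcons a x) - hvec (hcons a y)) =
  ip_norm (hvec x - hvec y).
Proof.
apply: (@pexpIrn _ 2) => //; rewrite ?nnegrE ?ip_norm_ge0 //.
by rewrite (hcons_dist_sq a a x y) subrr expr0n add0r.
Qed.

Definition hembed p : @hat R (dsucc d) := omap (hcons 0) p.

Lemma embedsP p (q : @hat R (dsucc d)) : embeds p q <-> q = hembed p.
Proof.
case: p q => [x|] [y|] //=; split=> //.
  by move=> [h1 h2]; congr Some; apply: hvec_inj; apply: l2_ext => -[|i] /=.
by case=> ->.
Qed.

Lemma hdist_embed p q : hdist (hembed p) (hembed q) = hdist p q.
Proof.
by case: p q => [x|] [y|] //=; exact: hcons_distB.
Qed.

Lemma hweight_embed p : hweight (hembed p) = hweight p.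
Proof. by case: p => [x|] //=; rewrite hcons_norm_sq expr0n add0r. Qed.

Lemma chordal_embed p q : chordal (hembed p) (hembed q) = chordal p q.
Proof. by rewrite !chordalE hdist_embed !hweight_embed. Qed.

Lemma in_H0 : in_H d (fun=> 0 : R).
Proof.
split=> //; apply/sqn_finP; exists 0 => n; by rewrite big1 // => i _; rewrite expr0n.
Qed.

Definition hzero : @Hpt R d := exist _ _ in_H0.

Lemma hvec0 : hvec hzero = 0.
Proof. exact: l2_ext. Qed.

Definition horigin : @hat R (dsucc d) := Some (hcons 1 hzero).

Lemma originP (q : @hat R (dsucc d)) : origin q <-> q = horigin.
Proof.
split=> [[y [-> [h1 h2]]]|->]; last by exists (hcons 1 hzero).
by congr Some; apply: hvec_inj; apply: l2_ext => -[|i] /=.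
Qed.

Lemma hweight_origin : hweight horigin = Num.sqrt 2.
Proof. by rewrite /= hcons_norm_sq hvec0 ip_norm0 expr0n addr0 expr1n. Qed.

Lemma hdist_origin p : hdist horigin (hembed p) = hweight p.
Proof.
case: p => [x|] //=; apply: (@pexpIrn _ 2) => //; rewrite ?nnegrE ?ip_norm_ge0 ?sqrtr_ge0 //.
by rewrite -[Num.sqrt _]/(hweight (Some x)) hweight_sq hcons_dist_sq hvec0 sub0r ip_normN subr0 expr1n.
Qed.

Lemma chordal_origin p : chordal horigin (hembed p) = Num.sqrt 2.
Proof.
rewrite chordalE hdist_origin hweight_origin hweight_embed.
have h2 : 0 < Num.sqrt 2 :> R by rewrite sqrtr_gt0.
have := hweight_gt0 p => hp; have E : Num.sqrt 2 ^+ 2 = 2 :> R by rewrite sqr_sqrtr.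
rewrite -{1}E; field; by rewrite !gt_eqF.
Qed.

Lemma hdist_height (y : @Hpt R (dsucc d)) p q :
  0 <= sval y 0%N -> sval y 0%N * hdist p q <= hdist (Some y) (hembed p) * hdist (Some y) (hembed q).
Proof.
set t := sval y 0%N; move=> t0; pose z := htail y.
have Ny x : hdist (Some y) (hembed (Some x)) ^+ 2 = t ^+ 2 + ip_norm (hvec z - hvec x) ^+ 2.
  by rewrite /= -[y in LHS]hcons_htail hcons_dist_sq subr0.
have Nt x : t <= hdist (Some y) (hembed (Some x)).
  rewrite -(ler_pXn2r (n := 2)) ?nnegrE ?hdist_ge0 // Ny lerDl; exact: sqr_ge0.
case: p q => [u|] [v|] /=; rewrite ?mulr1 ?mul1r ?mulr0 //; [|exact: Nt..].
have n0 := ip_norm_ge0 (hvec u - hvec v).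
have N1 := hdist_ge0 (Some y) (hembed (Some u)); have N2 := hdist_ge0 (Some y) (hembed (Some v)).
have := ip_dist_height t (hvec z - hvec v) (hvec z - hvec u).
have -> : hvec z - hvec v - (hvec z - hvec u) = hvec u - hvec v by vector_ring.
rewrite -!Ny -!exprMn; move: n0 N1 N2; rewrite /=.
move: (ip_norm (hvec u - hvec v)) (ip_norm (hvec y - hvec (hcons 0 u)))
  (ip_norm (hvec y - hvec (hcons 0 v))) => a b c a0 b0 c0.
by rewrite ler_pXn2r ?nnegrE ?mulr_ge0 // (mulrC c).
Qed.

Lemma hdist_foot (y : @Hpt R (dsucc d)) : 0 <= sval y 0%N ->
  hdist (Some y) (hembed (Some (htail y))) = sval y 0%N.
Proof.
move=> t0; apply: (@pexpIrn _ 2) => //; rewrite ?nnegrE ?hdist_ge0 //.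
by rewrite /= -{1}[y]hcons_htail hcons_dist_sq subr0 subrr ip_norm0 expr0n addr0.
Qed.

End Model2.

Lemma ip_invZ (R : realType) (W : ipspace R) (a : R) (v : W) : ip_inv (a *: v) = a^-1 *: ip_inv v.
Proof.
have [->|a0] := eqVneq a 0; first by rewrite scale0r invr0 scale0r /ip_inv scaler0.
have [v0|v0] := eqVneq (ip v v) 0; first by rewrite (ip_eq0 v0) scaler0 /ip_inv scaler0 scaler0.
rewrite /ip_inv ipZl ipZr !scalerA; congr (_ *: _); field; by rewrite a0 v0.
Qed.

Lemma ip_invK (R : realType) (W : ipspace R) (v : W) : ip_inv (ip_inv v) = v.
Proof.
have [v0|v0] := eqVneq (ip v v) 0; first by rewrite (ip_eq0 v0) /ip_inv !scaler0.
have {1}-> : ip_inv v = (ip v v)^-1 *: v by [].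
by rewrite ip_invZ invrK /ip_inv scalerA mulfV // scale1r.
Qed.

Section Stereographic.
Context {R : realType} (d : option nat).
Notation V := (l2space (R := R)).
Notation T := (@hat R d).

Definition lift1 (x : @Hpt R d) : V := hvec (hcons 1 x).

Lemma lift1_neq0 x : lift1 x <> 0.
Proof.
move=> E; have : (lift1 x : l2) 0%N = 0 by rewrite E.
by move/eqP; rewrite /= oner_eq0.
Qed.

Lemma lift1_norm x : ip_norm (lift1 x) = hweight (Some x).
Proof.
apply: (@pexpIrn _ 2) => //; rewrite ?nnegrE ?ip_norm_ge0 ?(ltW (hweight_gt0 _)) //.
by rewrite hcons_norm_sq hweight_sq expr1n.
Qed.

(* Stereographic projection onto a sphere of diameter 2, based at [0]. *)
Definition Phi (p : @hat R d) : V := if p is Some x then 2 *: ip_inv (lift1 x) else 0.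

Lemma chordal_Phi p q : chordal p q = ip_norm (Phi p - Phi q).
Proof.
have n2 : `|2| = 2 :> R by rewrite ger0_norm.
rewrite chordalE; case: p q => [x|] [y|] /=.
- rewrite -scalerBr ip_normZ n2 ip_inv_dist; [|exact: lift1_neq0..].
  by rewrite !lift1_norm mulrA (hcons_distB 1 x y).
- by rewrite subr0 ip_normZ n2 ip_inv_norm lift1_norm !mulr1.
- by rewrite sub0r ip_normN ip_normZ n2 ip_inv_norm lift1_norm mulr1 mul1r.
- by rewrite subrr ip_norm0 mulr0 mul0r.
Qed.

Lemma chordal_pseudometric : pseudometric (@chordal R d).
Proof. exact: (Phi_pseudometric chordal_Phi). Qed.

Lemma ext_sim_hdist (f : T -> T) : is_ext_sim f -> exists nu : T -> R,
  (forall p, 0 < nu p) /\ forall p q, hdist (f p) (f q) = nu p * nu q * hdist p q.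
Proof.
move=> [f0 [/choice[F fF] [_ [lam [lam0 f_sim]]]]].
have s0 : 0 < Num.sqrt lam by rewrite sqrtr_gt0.
have ss : Num.sqrt lam * Num.sqrt lam = lam by rewrite -expr2 sqr_sqrtr // ltW.
exists (fun p => if p is Some _ then Num.sqrt lam else (Num.sqrt lam)^-1); split.
  by case=> [x|] //; rewrite invr_gt0.
case=> [x|] [y|]; rewrite ?f0 ?fF /=.
- by rewrite ss -!nrm_vsub; exact: f_sim.
- by rewrite mulfV ?gt_eqF // mul1r.
- by rewrite mulVf ?gt_eqF // mul1r.
by rewrite mulr0.
Qed.

(* Inversion in the unit sphere around [a], seen from [a]; [None] goes to [0]. *)
Definition inversion_at (a : @Hpt R d) (p : T) : V :=
  if p is Some x then ip_inv (hvec x - hvec a) else 0.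

Lemma hvec_sub_neq0 (x y : @Hpt R d) : x <> y -> hvec x - hvec y <> 0.
Proof. by move=> xy /eqP; rewrite subr_eq0 => /eqP/hvec_inj. Qed.

Lemma inversion_at_dist a (p q : T) : p <> Some a -> q <> Some a ->
  ip_norm (inversion_at a p - inversion_at a q) =
  hdist p q / (hdist p (Some a) * hdist q (Some a)).
Proof.
have sub_neq0 x : Some x <> Some a :> T -> hvec x - hvec a <> 0.
  by move=> xa; apply: hvec_sub_neq0 => E; apply: xa; rewrite E.
case: p q => [x|] [y|] /= pa qa.
- rewrite ip_inv_dist; [|exact: sub_neq0..].
  by rewrite opprB addrA subrK.
- by rewrite subr0 ip_inv_norm mulr1 mul1r.
- by rewrite sub0r ip_normN ip_inv_norm !mul1r.
by rewrite subrr ip_norm0 mul0r.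
Qed.

Lemma inversionP (f : T -> T) : is_inversion f -> exists a, exists2 r : R, 0 < r &
  f (Some a) = None /\ forall p, p <> Some a -> exists y,
    f p = Some y /\ hvec y - hvec a = r ^+ 2 *: inversion_at a p.
Proof.
move=> [a [r [r0 [f0 [fa f_inv]]]]]; exists a, r => //; split=> // -[x|] xa; last first.
  by exists a; rewrite subrr scaler0.
have [|y [fx Ey]] := f_inv x.
  by move=> E; apply: xa; congr Some; apply: hvec_inj; apply: l2_ext => i; rewrite /= E.
exists y; split=> //; apply: l2_ext => i; have := Ey i; rewrite nrm_vsub ip_norm_sq => E.
by rewrite l2ZE /inversion_at /ip_inv l2ZE !l2DE !l2NE /= E /ip /=; ring.
Qed.

Lemma inversion_hdist (f : T -> T) : is_inversion f -> exists nu : T -> R,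
  (forall p, 0 < nu p) /\ forall p q, hdist (f p) (f q) = nu p * nu q * hdist p q.
Proof.
move=> /inversionP[a [r r0 [fa f_inv]]].
have da p : p <> Some a -> 0 < hdist p (Some a).
  by move=> pa; rewrite lt_neqAle hdist_ge0 andbT eq_sym; apply/eqP => /hdist_eq0.
pose nu p := if pselect (p = Some a) then r^-1 else r / hdist p (Some a).
have nu_a : nu (Some a) = r^-1 by rewrite /nu; case: pselect.
have nuE p : p <> Some a -> nu p = r / hdist p (Some a) by rewrite /nu; case: pselect.
have nu_pole q : q <> Some a -> hdist (f (Some a)) (f q) = nu (Some a) * nu q * hdist (Some a) q.
  move=> qa; have [y [fq _]] := f_inv q qa.
  rewrite fa fq nu_a (nuE q) // (hdistC (Some a)) -[hdist None _]/(1 : R).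
  by field; rewrite !gt_eqF ?da.
exists nu; split=> [p|p q].
  by have [->|pa] := pselect (p = Some a); rewrite ?nu_a ?invr_gt0 // nuE // divr_gt0 ?da.
have [->|pa] := pselect (p = Some a); have [->|qa] := pselect (q = Some a).
- by rewrite fa /= subrr ip_norm0 mulr0.
- exact: nu_pole.
- by rewrite hdistC nu_pole // hdistC (mulrC (nu _)).
have [x [-> Ex]] := f_inv p pa; have [y [-> Ey]] := f_inv q qa.
have -> : hdist (Some x) (Some y) = ip_norm (r ^+ 2 *: (inversion_at a p - inversion_at a q)).
  by rewrite scalerBr -Ex -Ey /=; congr ip_norm; vector_ring.
rewrite ip_normZ ger0_norm ?exprn_ge0 ?ltW // inversion_at_dist // !nuE //.
by field; rewrite !gt_eqF ?da.
Qed.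

Lemma mobius_hdist (f : T -> T) : mobius f -> exists nu : T -> R,
  (forall p, 0 < nu p) /\ forall p q, hdist (f p) (f q) = nu p * nu q * hdist p q.
Proof.
elim=> {f} [f /ext_sim_hdist //|f /inversion_hdist //|f g _ [nf [nf0 fE]] _ [ng [ng0 gE]]].
exists (fun p => nf (g p) * ng p); split=> [p|p q]; first exact: mulr_gt0.
by rewrite /= fE gE; ring.
Qed.

Lemma chordal_mobius (f : @hat R d -> @hat R d) : mobius f ->
  exists mu : @hat R d -> R, (forall p, 0 < mu p) /\
    forall p q, chordal (f p) (f q) = mu p * mu q * chordal p q.
Proof.
move=> /mobius_hdist [nu [nu0 h]]; exists (fun p => nu p * hweight p / hweight (f p)); split.
  by move=> p; rewrite !mulr_gt0 ?invr_gt0 ?hweight_gt0.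
move=> p q; rewrite !chordalE h; have := hweight_gt0 p; have := hweight_gt0 q.
have := hweight_gt0 (f p); have := hweight_gt0 (f q) => *; field; by rewrite !gt_eqF.
Qed.

Lemma ext_sim_inv (f : T -> T) : is_ext_sim f ->
  exists f', [/\ mobius f', forall p, f (f' p) = p & forall p, f' (f p) = p].
Proof.
move=> [f0 [/choice[F fF] [/choice[F' fF'] [lam [lam0 f_sim]]]]].
have F_inj x x' : F x = F x' -> x = x'.
  move=> E; have := f_sim _ _ _ _ (fF x) (fF x').
  rewrite E !nrm_vsub subrr ip_norm0 => /esym/eqP.
  by rewrite mulf_eq0 gt_eqF //= => /eqP/ip_dist_eq0/hvec_inj.
have FF' x : F (F' x) = x by have := fF' x; rewrite fF => -[].
have F'F x : F' (F x) = x by apply: F_inj; rewrite FF'.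
exists (fun p => if p is Some y then Some (F' y) else None); split.
- apply: mob_sim; split=> //; split=> [x|]; first by exists (F' x).
  split=> [y|]; first by exists (F y); rewrite F'F.
  exists lam^-1; split=> [|x y _ _ [<-] [<-]]; first by rewrite invr_gt0.
  by rewrite -{2}(FF' x) -{2}(FF' y) (f_sim _ _ _ _ (fF _) (fF _)) mulKf // gt_eqF.
- by case=> [y|] //=; rewrite fF'.
by case=> [x|]; rewrite ?f0 ?fF //= F'F.
Qed.

Lemma inversionK (f : T -> T) : is_inversion f -> forall p, f (f p) = p.
Proof.
move=> f_is_inv; have [a [_ [_ [f0 _]]]] := f_is_inv.
have [b [r r0 [fb f_inv]]] := inversionP f_is_inv.
have fNone : f None = Some b by have [//|y [->]] := f_inv None; rewrite scaler0 => /eqP;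
  rewrite subr_eq0 => /eqP/hvec_inj ->.
have r2 : r ^+ 2 != 0 by rewrite expf_neq0 // gt_eqF.
move=> p; have [->|pb] := pselect (p = Some b); first by rewrite fb.
case: p pb => [x|] pb; last by rewrite fNone.
have [y [-> Ey]] := f_inv _ pb.
have yb : Some y <> Some b :> T.
  move=> [E]; move: Ey; rewrite E subrr => /esym/eqP; rewrite scaler_eq0 (negbTE r2) /= => /eqP inv0.
  case: (@hvec_sub_neq0 x b) => [xb|]; first by apply: pb; rewrite xb.
  by rewrite -[LHS]ip_invK inv0 /ip_inv scaler0.
have [z [-> Ez]] := f_inv _ yb; congr Some; apply: hvec_inj; apply: (addIr (- hvec b)).
by rewrite Ez /= Ey ip_invZ /= ip_invK scalerA mulfV // scale1r.
Qed.

Lemma mobius_inv (f : T -> T) : mobius f ->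
  exists f', [/\ mobius f', forall p, f (f' p) = p & forall p, f' (f p) = p].
Proof.
elim=> {f} [f /ext_sim_inv //|f f_inv|f g _ [f' [mf ff' f'f]] _ [g' [mg gg' g'g]]].
  by exists f; split; [exact: mob_inv|exact: inversionK|exact: inversionK].
exists (g' \o f'); split; first exact: mob_comp.
  by move=> p /=; rewrite gg' ff'.
by move=> p /=; rewrite f'f g'g.
Qed.

(* [f] expands by the factor [mu], which stays bounded along [u] since the
   images keep distance at most 2 from the image of a point [a <> p]. *)
Lemma mobius_hconv (f : T -> T) u p : mobius f -> hconv u p -> hconv (f \o u) (f p).
Proof.
move=> /chordal_mobius[mu [mu0 fE]] u_p e e0; have [d0 dC dT] := chordal_pseudometric.
have [a pa] : exists a, p <> a.
  by case: p {u_p} => [x|]; [exists None|exists (Some (hzero d))].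
have D0 : 0 < chordal p a by exact: (Phi_gt0 (@chordal_sep R d) chordal_Phi).
set D := chordal p a in D0; pose B := 4 / (mu a * D).
have B0 : 0 < B by rewrite divr_gt0 // mulr_gt0.
have C0 : 0 < B * mu p by rewrite mulr_gt0.
have [|N hN] := u_p (Num.min (D / 2) (e / (B * mu p))).
  by rewrite lt_min !divr_gt0.
exists N => n /hN; rewrite lt_min (ltr_pdivlMr _ _ C0) => /andP[near_p near_e] /=.
have far_a : D / 2 <= chordal (u n) a by have := dT p (u n) a; rewrite (dC p (u n)) -/D; lra.
have mu_le : mu (u n) <= B.
  rewrite /B ler_pdivlMr ?mulr_gt0 //; have := chordal_le2 (f (u n)) (f a); rewrite fE => le2.
  have : mu (u n) * mu a * (D / 2) <= 2 by apply: le_trans le2; rewrite ler_pM2l // mulr_gt0.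
  by move: (mu (u n)) (mu a) => x y; lra.
rewrite fE -mulrA; apply: (@le_lt_trans _ _ (B * (mu p * chordal (u n) p))).
  by rewrite ler_wpM2r // mulr_ge0 ?(pseudometric_ge0 chordal_pseudometric) // ltW.
by rewrite mulrA mulrC.
Qed.

End Stereographic.

(** * Moebius groups as systems of zooms *)

Section ConformalHeight.
Context {R : realType} (d : option nat).
Notation T := (@hat R d).

(* The squared chordal scale at [q] of its height above the boundary. *)
Definition conformal_height (q : @hat R (dsucc d)) : R :=
  if q is Some y then 4 * sval y 0%N / hweight q ^+ 2 else 0.

Context (y : @Hpt R (dsucc d)) (y0 : 0 < sval y 0%N).
Let q := Some y.
Let wq : 0 < hweight q := hweight_gt0 q.

Let conformal_heightE : conformal_height q = 4 * sval y 0%N / hweight q ^+ 2. Proof. by []. Qed.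

Lemma conformal_height_gt0 : 0 < conformal_height q.
Proof. by rewrite conformal_heightE divr_gt0 ?exprn_gt0 // mulr_gt0. Qed.

Lemma conformal_height_le (u v : T) : conformal_height q * chordal u v <=
  2 * (chordal q (hembed u) * chordal q (hembed v)).
Proof.
rewrite !chordalE !hweight_embed conformal_heightE.
have := hdist_height u v (ltW y0); have := hweight_gt0 u; have := hweight_gt0 v; move: wq.
move: (hdist q _) (hdist q _) (hdist u v) (hweight q) (hweight u) (hweight v) (sval y 0%N).
move=> b a c w p r t w0 r0 p0 h.
have -> : 4 * t / w ^+ 2 * (2 * c / (p * r)) = 8 / (w ^+ 2 * (p * r)) * (t * c).
  by field; rewrite !gt_eqF.
have -> : 2 * (2 * a / (w * p) * (2 * b / (w * r))) = 8 / (w ^+ 2 * (p * r)) * (a * b).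
  by field; rewrite !gt_eqF.
rewrite ler_pM2l; first lra.
by rewrite divr_gt0 // mulr_gt0 ?exprn_gt0 // mulr_gt0.
Qed.

(* Equality holds for the foot point of [y] and infinity. *)
Lemma conformal_height_attained : exists u v : T, u <> v /\
  conformal_height q * chordal u v = 2 * (chordal q (hembed u) * chordal q (hembed v)).
Proof.
exists (Some (htail y)), None; split=> //; rewrite !chordalE !hweight_embed conformal_heightE.
rewrite (hdist_foot (ltW y0)) -[hdist q (hembed None)]/(1 : R) -[hdist _ None]/(1 : R).
have := hweight_gt0 (Some (htail y) : T); move: wq; rewrite -[hweight None]/(1 : R).
move: (hweight q) (hweight _) (sval y 0%N) => w p t w0 p0.
by field; rewrite !gt_eqF.
Qed.

Lemma chordal_le_height (p : T) (C : R) : 0 <= C -> hweight q <= 2 * hweight p ->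
  hdist q (hembed p) <= C * sval y 0%N -> chordal q (hembed p) <= C * conformal_height q.
Proof.
rewrite chordalE hweight_embed conformal_heightE; have := hweight_gt0 p; move: wq y0.
move: (hweight q) (hweight p) (hdist _ _) (sval y 0%N) => w v n t w0 t0 v0 C0 wv nt.
rewrite ler_pdivrMr ?mulr_gt0 //.
have -> : C * (4 * t / w ^+ 2) * (w * v) = 2 * (C * t) * (2 * v / w) by field; rewrite gt_eqF.
apply: (@le_trans _ _ (2 * (C * t))); first by rewrite ler_pM2l.
by rewrite ler_peMr ?mulr_ge0 ?(ltW t0) // ler_pdivlMr // mul1r.
Qed.

Lemma hdist_le_height (p : T) (C : R) : 0 <= C ->
  chordal q (hembed p) <= C * conformal_height q ->
  hdist q (hembed p) <= 2 * C * hweight p * sval y 0%N.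
Proof.
rewrite chordalE hweight_embed conformal_heightE; have := hweight_gt0 p.
have := hweight_ge1 q; move: wq y0.
move: (hweight q) (hweight p) (hdist _ _) (sval y 0%N) => w v n t w0 t0 w1 v0 C0.
rewrite ler_pdivrMr ?mulr_gt0 //.
have -> : C * (4 * t / w ^+ 2) * (w * v) = 4 * C * t * v / w by field; rewrite gt_eqF.
have : 4 * C * t * v / w <= 4 * C * t * v.
  by rewrite ler_pdivrMr // ler_peMr // !mulr_ge0 // ltW.
lra.
Qed.

End ConformalHeight.

Section Group.
Context {R : realType} (d : option nat) (G : set (@hat R d -> @hat R d)).
Hypothesis hG : mobius_group G.
Notation K := (limit_set G).
Notation T := (@hat R d).
Notation horigin := (@horigin R d).

Definition mobius_zoom (g h : T -> T) (kap : R) (m : T -> R) := [/\ G g /\ G h,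
  (forall u, h (g u) = u) /\ (forall u, g (h u) = u)
  & exists gh, [/\ poincare_ext g gh, m = (fun u => chordal (gh horigin) (hembed u))
    & kap = conformal_height (gh horigin)]].

Lemma poincare_ext_embed g gh u : @poincare_ext R d g gh -> gh (hembed u) = hembed (g u).
Proof. by move=> [_ [_ ext]]; apply/embedsP; apply: ext; exact/embedsP. Qed.

Lemma poincare_ext_origin g gh : @poincare_ext R d g gh ->
  exists2 y, gh horigin = Some y & 0 < sval y 0%N.
Proof.
move=> [_ [up _]]; have : upper (gh horigin) by apply: (up horigin).1; exact: ltr01.
by case: (gh horigin) => // y y0; exists y.
Qed.

Lemma poincare_ext_comp g gh g' gh' : @poincare_ext R d g gh -> @poincare_ext R d g' gh' ->
  poincare_ext (g \o g') (gh \o gh').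
Proof.
move=> [mob [up ext]] [mob' [up' ext']]; split; first exact: mob_comp.
by split=> [q|p q /ext'/ext //]; exact: iff_trans (up' q) (up _).
Qed.

Lemma poincare_ext_inv g gh h : @poincare_ext R d g gh -> (forall u, g (h u) = u) ->
  exists hh, poincare_ext h hh.
Proof.
move=> pe gK; have [mob [up _]] := pe; have [hh [mobh ghK hhK]] := mobius_inv mob.
exists hh; split=> //; split=> [q|p q /embedsP ->]; first by rewrite (up (hh q)) ghK.
by apply/embedsP; rewrite -{1}(gK p) -(poincare_ext_embed _ pe) hhK.
Qed.

(* The constant in the conformal identity is [2 mu(o)^2]; it is identified by
   the extremal property of the conformal height. *)
Lemma mobius_conformal g gh h : @poincare_ext R d g gh -> (forall u, h (g u) = u) ->
  (forall u, g (h u) = u) ->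
  (forall u, 0 < chordal (gh horigin) (hembed u)) /\ forall u v,
  chordal (h u) (h v) * (chordal (gh horigin) (hembed u) * chordal (gh horigin) (hembed v)) =
  conformal_height (gh horigin) * chordal u v.
Proof.
move=> pe hK gK; have [mob _] := pe; have [mu [mu0 muE]] := chordal_mobius mob.
have [y Ey y0] := poincare_ext_origin pe.
have s2 : 0 < Num.sqrt 2 :> R by rewrite sqrtr_gt0.
pose m u := chordal (gh horigin) (hembed u); rewrite -/m.
have mE u : m u = mu horigin * mu (hembed (h u)) * Num.sqrt 2.
  by rewrite /m -{1}(gK u) -(poincare_ext_embed _ pe) muE chordal_origin.
have m0 u : 0 < m u by rewrite mE !mulr_gt0.
pose k0 := 2 * mu horigin ^+ 2; have k00 : 0 < k0 by rewrite mulr_gt0 ?exprn_gt0.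
have conf u v : chordal (h u) (h v) * (m u * m v) = k0 * chordal u v.
  have -> : chordal u v = mu (hembed (h u)) * mu (hembed (h v)) * chordal (h u) (h v).
    by rewrite -(chordal_embed (h u) (h v)) -muE !(poincare_ext_embed _ pe) !gK chordal_embed.
  rewrite !mE /k0 -[X in X * mu _ ^+ 2](sqr_sqrtr (ler0n R 2)).
  by ring.
suff -> : conformal_height (gh horigin) = k0 by [].
have dist_gt0 (u v : T) : u <> v -> 0 < chordal u v.
  exact: (Phi_gt0 (@chordal_sep R d) (@chordal_Phi R d)).
apply/eqP; rewrite eq_le; apply/andP; split.
  have far : chordal (Some (hzero d)) None = 2 :> R.
    by rewrite chordalE /= hvec0 ip_norm0 expr0n addr0 sqrtr1 !mulr1 divr1.
  have := conf (g (Some (hzero d))) (g None); rewrite !hK far => E.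
  have := conformal_height_le y0 (g (Some (hzero d))) (g None).
  rewrite -Ey -!/(m _) E ler_pM2r //; apply: dist_gt0 => /(congr1 h).
  by rewrite !hK.
have [u [v [uv]]] := conformal_height_attained y0; rewrite -Ey -!/(m _) => E.
rewrite -(ler_pM2r (dist_gt0 _ _ uv)) E -conf ler_pM2r ?mulr_gt0 //.
exact: chordal_le2.
Qed.

Lemma mobius_group_inv g : G g ->
  exists h, [/\ G h, forall u, h (g u) = u & forall u, g (h u) = u].
Proof.
have [_ [_ [_ inv]]] := hG; move=> /inv[h [Gh [hg gh]]]; exists h; split=> // u.
  exact: (congr1 (@^~ u) hg).
exact: (congr1 (@^~ u) gh).
Qed.

Lemma limit_setP p : K p <-> exists gs ghs, (forall n, G (gs n) /\ poincare_ext (gs n) (ghs n)) /\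
  hconv (fun n => ghs n horigin) (hembed p).
Proof.
split=> [[gs [ghs [base [q [/originP -> [/embedsP -> [Ggs gs_p]]]]]]]|[gs [ghs [Ggs gs_p]]]].
  by exists gs, ghs.
by exists gs, ghs, horigin, (hembed p); split; [exact/originP|split; [exact/embedsP|]].
Qed.

Lemma limit_set_stable g gh p : G g -> poincare_ext g gh -> K p -> K (g p).
Proof.
move=> Gg pe /limit_setP[gs [ghs [Ggs gs_p]]]; apply/limit_setP.
have [_ [_ [comp _]]] := hG.
exists (fun n => g \o gs n), (fun n => gh \o ghs n); split=> [n|].
  by have [Gn pn] := Ggs n; split; [exact: comp|exact: poincare_ext_comp].
by rewrite -(poincare_ext_embed _ pe); have [mob _] := pe; exact: (mobius_hconv mob gs_p).
Qed.

Lemma mobius_zoom_comp g h kap m g' h' kap' m' : mobius_zoom g h kap m ->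
  mobius_zoom g' h' kap' m' -> exists kap'' m'', mobius_zoom (g \o g') (h' \o h) kap'' m''.
Proof.
move=> [[Gg Gh] [hg gh_] [gh [pe _ _]]] [[Gg' Gh'] [hg' gh'_] [gh' [pe' _ _]]].
have [_ [_ [comp _]]] := hG.
exists (conformal_height ((gh \o gh') horigin)), (fun u => chordal ((gh \o gh') horigin) (hembed u)).
split; first by split; exact: comp.
  by split=> u /=; rewrite ?hg ?hg' ?gh'_ ?gh_.
by exists (gh \o gh'); split=> //; exact: poincare_ext_comp.
Qed.

Lemma mobius_zoom_of_ext g gh : G g -> poincare_ext g gh -> exists h,
  mobius_zoom g h (conformal_height (gh horigin)) (fun u => chordal (gh horigin) (hembed u)).
Proof.
by move=> Gg pe; have [h [Gh hg gh_]] := mobius_group_inv Gg; exists h; split=> //; exists gh.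
Qed.

Section Spread.
Context (D : R) (D0 : 0 < D).
Hypothesis spread : forall u, K u -> exists2 v, K v & D <= chordal u v.

Lemma mobius_zoom_map g h kap m : mobius_zoom g h kap m ->
  zoom_map (@chordal R d) K (4 / D) g h kap m.
Proof.
move=> [[Gg Gh] [hg gh_] [gh [pe -> ->]]]; have [m0 conf] := mobius_conformal pe hg gh_.
have [hh peh] := poincare_ext_inv pe gh_; have [_ dC dT] := @chordal_pseudometric R (dsucc d).
have k0 : 0 < conformal_height (gh horigin).
  by have [y -> y0] := poincare_ext_origin pe; exact: conformal_height_gt0.
split=> //.
- by move=> u; exact: limit_set_stable pe.
- by move=> u; exact: limit_set_stable peh.
- by move=> u _; exact: chordal_le2.
- move=> u Ku; have [v Kv Dv] := spread Ku.
  rewrite mulrAC ler_pdivlMr //; apply: (@le_trans _ _ (conformal_height (gh horigin) * chordal u v)).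
    by rewrite ler_pM2l.
  rewrite -conf; have -> : 4 * chordal (gh horigin) (hembed u) =
    2 * (chordal (gh horigin) (hembed u) * 2) by ring.
  apply: ler_pM; [|by rewrite mulr_ge0 // ltW|exact: chordal_le2|].
    exact: (pseudometric_ge0 (@chordal_pseudometric R d)).
  by rewrite ler_pM2l // chordal_le2.
- move=> u v _ _; rewrite -(chordal_embed u v).
  by have := dT (hembed u) (gh horigin) (hembed v); rewrite (dC (hembed u) (gh horigin)).
- move=> u v _ _; rewrite -(chordal_embed u v).
  by have := dT (gh horigin) (hembed v) (hembed u); rewrite (dC (hembed v) (hembed u)).
Qed.

Lemma mobius_zoom_near g gh p (e : R) : G g -> poincare_ext g gh -> K p ->
  chordal (gh horigin) (hembed p) < e / (4 / D) -> conformal_height (gh horigin) < e.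
Proof.
move=> Gg pe Kp; have [h hz] := mobius_zoom_of_ext Gg pe; rewrite ltr_pdivlMr ?divr_gt0 // mulrC.
exact/le_lt_trans/(zoom_scale_le_pole (mobius_zoom_map hz) Kp).
Qed.

Lemma mobius_zoom_system : zoom_system (@chordal R d) K (4 / D) mobius_zoom.
Proof.
split; [exact: mobius_zoom_map|exact: mobius_zoom_comp|move=> x e Kx e0].
have /limit_setP[gs [ghs [Ggs gs_x]]] := Kx.
have [|N /(_ N (leqnn N))] := gs_x (Num.min e (e / (4 / D))); first by rewrite lt_min e0 !divr_gt0.
rewrite lt_min => /andP[lt_e /(mobius_zoom_near (Ggs N).1 (Ggs N).2 Kx) kap_lt].
have [h hz] := mobius_zoom_of_ext (Ggs N).1 (Ggs N).2.
by do 4!eexists; split; [exact: hz|exact: kap_lt|exact: lt_e].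
Qed.

Lemma radial_set_sub : radial_set G `<=` radial_points K mobius_zoom.
Proof.
move=> p [Kp [x [Ep [gs [ghs [base [q [C [/originP -> [/embedsP -> [Ggs [gs_p radial]]]]]]]]]]]].
have [_ dC dT] := @chordal_pseudometric R (dsucc d); have wp := hweight_gt0 p.
exists (`|C| + 1); split=> // e e0.
have [|N /(_ N (leqnn N))] := gs_p (Num.min (e / (4 / D)) (hweight p)^-1).
  by rewrite lt_min !divr_gt0 // invr_gt0.
have [Gn pn] := Ggs N; rewrite lt_min => /andP[/(mobius_zoom_near Gn pn Kp) kap_lt near_p].
have [h hz] := mobius_zoom_of_ext Gn pn; do 4!eexists; split; [exact: hz|exact: kap_lt|].
have [y Ey y0] := poincare_ext_origin pn; have [y' [z [Ey' [Ez hC]]]] := radial N.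
rewrite Ey in Ey' hC near_p *; case: Ey' hC => <- /=; rewrite nrm_vsub => hC.
have wy : hweight (Some y) <= 2 * hweight p.
  have to_infty (s : option nat) (u : @hat R s) : hdist u None = 1 -> chordal u None = 2 / hweight u.
    by rewrite chordalE => ->; rewrite -[hweight None]/(1 : R) !mulr1.
  have := dT (hembed p) (Some y) None; rewrite (dC (hembed p) (Some y)) !to_infty //; last by rewrite Ep.
  rewrite hweight_embed => tri.
  have : (hweight p)^-1 <= 2 / hweight (Some y) by move: near_p tri; move: (chordal _ _) => t; lra.
  by rewrite ler_pdivlMr ?hweight_gt0 // mulrC ler_pdivrMr.
have y_p : hdist (Some y) (hembed p) <= `|C| * sval y 0%N.
  have -> : hdist (Some y) (hembed p) = ip_norm (hvec y - hvec z) by rewrite Ez.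
  by apply: le_trans hC _; rewrite ler_pM2r // ler_norm.
apply: le_lt_trans (chordal_le_height y0 (normr_ge0 C) wy y_p) _.
by rewrite ltr_pM2r ?conformal_height_gt0 // ltrDl.
Qed.

End Spread.

Lemma radial_points_sub p : radial_points K mobius_zoom p -> p = None \/ radial_set G p.
Proof.
move=> [C [Kp near]]; case Ep : p => [x|]; [right|by left]; rewrite -Ep; split=> //.
have n0 n : 0 < n.+1%:R^-1 :> R by rewrite invr_gt0.
have /choice[q hq] n : exists q : (T -> T) * (@hat R (dsucc d) -> @hat R (dsucc d)),
   [/\ G q.1, poincare_ext q.1 q.2, conformal_height (q.2 horigin) < n.+1%:R^-1
     & 0 < chordal (q.2 horigin) (hembed p) < C * conformal_height (q.2 horigin)].
  have [g [h [kap [m [hz kap_lt m_lt]]]]] := near _ (n0 n).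
  have [[Gg Gh] [hg gh_] [gh [pe Em Ek]]] := hz; subst kap m.
  by have [m0 _] := mobius_conformal pe hg gh_; exists (g, gh); rewrite m0.
have pe n : poincare_ext (q n).1 (q n).2 by case: (hq n).
have k0 n : 0 < conformal_height ((q n).2 horigin).
  by have [y -> y0] := poincare_ext_origin (pe n); exact: conformal_height_gt0.
have C0 : 0 < C.
  by have [_ _ _ /andP[m0 m_lt]] := hq 0%N; rewrite -(pmulr_lgt0 C (k0 0%N)) (lt_trans m0).
exists x; split=> //.
exists (fun n => (q n).1), (fun n => (q n).2), horigin, (hembed p), (2 * C * hweight p).
split; first exact/originP.
split; first exact/embedsP.
split; first by move=> n; case: (hq n).
split=> [e e0|n].
  have [N hN] := exists_invS_lt (divr_gt0 e0 C0); exists N => n Nn.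
  have [_ _ kap_lt /andP[_ m_lt]] := hq n; apply: lt_trans m_lt _.
  rewrite mulrC -ltr_pdivlMr //; apply: lt_trans kap_lt _; apply: le_lt_trans hN.
  by rewrite lef_pV2 ?posrE // ler_nat.
have [y Ey y0] := poincare_ext_origin (pe n); exists y, (hcons 0 x); split=> //.
split; first by rewrite Ep.
have [_ _ _ /andP[_ /ltW]] := hq n; rewrite Ey nrm_vsub.
by move=> /(hdist_le_height y0 (ltW C0)); rewrite Ep.
Qed.

Context (U : set_system nat) {uU : FreeUltraFilter U}.

Lemma limit_set_closed u p : (forall n, K (u n)) -> ultra_cvg U (@chordal R d) u p -> K p.
Proof.
move=> Ku u_p; apply/limit_setP; have [_ _ dT] := @chordal_pseudometric R (dsucc d).
have n0 n : 0 < n.+1%:R^-1 :> R by rewrite invr_gt0.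
have /choice[q hq] n : exists q : (T -> T) * (@hat R (dsucc d) -> @hat R (dsucc d)),
   (G q.1 /\ poincare_ext q.1 q.2) /\ chordal (q.2 horigin) (hembed p) < 2 * n.+1%:R^-1.
  have [m /= um] := filter_ex (u_p _ (n0 n)).
  have /limit_setP[gs [ghs [Ggs gs_um]]] := Ku m; have [N /(_ N (leqnn N)) gsN] := gs_um _ (n0 n).
  exists (gs N, ghs N); split=> //=.
  have := dT (ghs N horigin) (hembed (u m)) (hembed p); rewrite (chordal_embed (u m) p).
  by move: um gsN; move: (n.+1%:R^-1 : R) => t; lra.
exists (fun n => (q n).1), (fun n => (q n).2); split=> [n|e e0]; first by case: (hq n).
have e2 : 0 < e / 2 by lra.
have [N hN] := exists_invS_lt e2; exists N => n Nn; have [_ qn] := hq n; apply: lt_trans qn _.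
have : n.+1%:R^-1 <= N.+1%:R^-1 :> R by rewrite lef_pV2 ?posrE // ler_nat.
by move: hN; move: (n.+1%:R^-1 : R) (N.+1%:R^-1 : R) => r t; lra.
Qed.

End Group.

Section Compactness.
Context {R : realType} (U : set_system nat) {uU : FreeUltraFilter U}.

Lemma hcompact_ultra_compact d (A : set (@hat R d)) : hcompact A ->
  ultra_compact U (@chordal R d) A.
Proof.
move=> compactA u Au; apply: contrapT => no_limit; have [d0 dC dT] := @chordal_pseudometric R d.
have /choice2[e e0 he] x : exists2 e : R, 0 < e & A x -> ~ U [set n | chordal (u n) x < e].
  have [Ax|] := pselect (A x); last by exists 1.
  apply: contrapT => none; apply: no_limit; exists x => // e e0; apply: contrapT => nU.
  by apply: none; exists e.
pose W (a : {x | A x}) : set (@hat R d) := [set y | chordal y (sval a) < e (sval a)].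
have [a y Wy|x Ax|m [f hf]] := compactA _ W.
- exists (e (sval a) - chordal y (sval a)); rewrite subr_gt0; split=> // z yz; rewrite /W /=.
  by have := dT z y (sval a); rewrite (dC z y); lra.
- by exists (exist _ x Ax) => //; rewrite /W /= d0.
have /ultra_exists[j hj] : U [set n | exists j, W (f j) (u n)].
  by apply: filterE => n; exact: hf.
exact: he (proj2_sig (f j)) hj.
Qed.

Lemma ultra_cvg_bounded (x : nat -> R) (B : R) : U [set n | `|x n| <= B] -> exists a : R,
  forall e : R, 0 < e -> U [set n | `|x n - a| < e].
Proof.
move=> xB; pose S : set R := [set a | U [set n | a <= x n]].
have SB : S (- B) by apply: filterS xB => n /=; rewrite ler_norml => /andP[].
have ubS : ubound S B.
  move=> a Sa; have [n [/= an]] := filter_ex (filterI Sa xB).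
  by rewrite ler_norml => /andP[_]; exact: le_trans.
have supS : has_sup S by split; [exists (- B)|exists B].
exists (sup S) => e e0.
have above : U [set n | sup S - e < x n].
  have : sup S - e < sup S by lra.
  by move=> /(sup_gt supS.1)[a Sa ha]; apply: filterS Sa => n /=; exact: lt_le_trans.
have below : U [set n | x n < sup S + e / 2].
  have nS : ~ U [set n | sup S + e / 2 <= x n] by move=> /(sup_upper_bound supS); lra.
  by apply: filterS (ultra_setC nS) => n /= /negP; rewrite -ltNge.
by apply: filterS (filterI above below) => n /= [? ?]; rewrite ltr_norml; lra.
Qed.

Context (n : nat).
Notation T := (@hat R (Some n)).

Lemma finite_support_sum (z : nat -> R) : (forall i, (n <= i)%N -> z i = 0) ->
  forall N, \sum_(i < N) z i ^+ 2 <= \sum_(i < n) z i ^+ 2.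
Proof.
move=> z_supp N; have [Nn|nN] := leqP N n.
  rewrite (big_ord_widen n (fun i => z i ^+ 2) Nn) [leRHS](bigID (fun i : 'I_n => (i < N)%N)) /=.
  by rewrite lerDl; apply: sumr_ge0 => i _; exact: sqr_ge0.
rewrite [leRHS](big_ord_widen N (fun i => z i ^+ 2) (ltnW nN)).
rewrite [leLHS](bigID (fun i : 'I_N => (i < n)%N)) /= [X in _ + X]big1 ?addr0 //.
by move=> i; rewrite -leqNgt => ni; rewrite z_supp // expr0n.
Qed.

Lemma hvec_dist_le (x y : @Hpt R (Some n)) (q : R) : 0 <= q ->
  (forall i : 'I_n, `|sval x i - sval y i| <= q) -> ip_norm (hvec x - hvec y) <= q * n.+1%:R.
Proof.
move=> q0 near; rewrite -(ler_pXn2r (n := 2)) ?nnegrE ?ip_norm_ge0 ?mulr_ge0 //.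
rewrite ip_norm_sq -lee_fin -(l2_sqn (hvec x - hvec y)); apply: sqn_le => N.
apply: le_trans (finite_support_sum (z := fun i => sval x i - sval y i) _ N) _ => [i ni|].
  by have [_ supp_x] := proj2_sig x; have [_ supp_y] := proj2_sig y;
    rewrite (supp_x n) // (supp_y n) // subrr.
apply: (@le_trans _ _ (\sum_(i < n) q ^+ 2)).
  by apply: ler_sum => i _; rewrite -real_normK ?num_real // ler_pXn2r ?nnegrE.
rewrite sumr_const card_ord -[_ *+ n]mulr_natr exprMn ler_wpM2l ?exprn_ge0 // -natrX ler_nat.
by rewrite (leq_trans (leqnSn n)) // -{1}(expn1 n.+1) leq_pexp2l.
Qed.

Lemma hvec_bounded_cvg (x : nat -> @Hpt R (Some n)) (B : R) :
  U [set m | ip_norm (hvec (x m)) <= B] -> exists z : @Hpt R (Some n),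
  forall q : R, 0 < q -> U [set m | ip_norm (hvec (x m) - hvec z) < q].
Proof.
move=> xB; have /choice[a0 ha0] i : exists a : R, forall q : R, 0 < q ->
  U [set m | `|sval (x m) i - a| < q].
  apply: (@ultra_cvg_bounded _ B); apply: filterS xB => m /=; apply: le_trans.
  rewrite -(ler_pXn2r (n := 2)) ?nnegrE ?normr_ge0 ?ip_norm_ge0 // real_normK ?num_real //.
  by rewrite ip_norm_sq; exact: (l2ip_coord (hvec (x m))).
pose a i := if (i < n)%N then a0 i else 0.
have a_supp i : (n <= i)%N -> a i = 0 by rewrite /a ltnNge => ->.
have Ha : in_H (Some n) a.
  split; last by move=> _ [<-].
  by apply/sqn_finP; exists (\sum_(i < n) a i ^+ 2); exact: finite_support_sum.
exists (exist _ a Ha) => q q0; pose r := q / 2 / n.+1%:R.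
have r0 : 0 < r by rewrite !divr_gt0.
have near : U [set m | forall i : 'I_n, `|sval (x m) i - a0 i| < r].
  by apply: filter_forall => i; exact: ha0.
apply: filterS near => m /= near_m.
apply: (@le_lt_trans _ _ (r * n.+1%:R)); last by rewrite divfK ?pnatr_eq0 //; lra.
by apply: hvec_dist_le (ltW r0) _ => i /=; rewrite /a ltn_ord ltW.
Qed.

Lemma ultra_compact_hat : ultra_compact U (@chordal R (Some n)) setT.
Proof.
move=> u _.
have [to_infty|] := pselect (forall e : R, 0 < e -> U [set m | chordal (u m) None < e]).
  by exists None.
move=> /existsNP[e /not_implyP[e0 /ultra_setC away]].
pose x m : @Hpt R (Some n) := if u m is Some z then z else hzero (Some n).
have ux : U [set m | u m = Some (x m) /\ ip_norm (hvec (x m)) <= 2 / e].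
  apply: filterS away => m /= /negP; rewrite -leNgt /x chordalE.
  case: (u m) => [z|] /=; last by rewrite mulr0 mul0r leNgt e0.
  rewrite !mulr1 -[Num.sqrt _]/(hweight (Some z : T)) => e_le; split=> //.
  have wz := hweight_gt0 (Some z : T).
  apply: (@le_trans _ _ (hweight (Some z : T))).
    by rewrite -(ler_pXn2r (n := 2)) ?nnegrE ?ip_norm_ge0 ?(ltW wz) // hweight_sq lerDr.
  by rewrite ler_pdivlMr // mulrC -ler_pdivlMr.
have [z xz] := hvec_bounded_cvg (filterS (fun m => @proj2 _ _) ux).
exists (Some z) => // q q0; have q2 : 0 < q / 2 by lra.
apply: filterS (filterI ux (xz _ q2)) => m /= [[-> _]]; rewrite chordalE /hdist.
have := hweight_ge1 (Some (x m) : T); have := hweight_ge1 (Some z : T).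
move: (ip_norm _) (hweight _) (hweight _) => t w v w1 v1 t_lt.
have wv : 1 <= w * v by rewrite -[1]mulr1; apply: ler_pM.
rewrite ltr_pdivrMr; last lra.
by apply: (@lt_le_trans _ _ q); [lra|rewrite ler_peMr ?(ltW q0) // mulrC].
Qed.

End Compactness.

(** * Proof of the theorem *)

Section HausdorffLinks.
Context {R : realType} (d : option nat).
Notation T := (@hat R d).

Lemma powR_le_exp (r s t : R) : 0 <= r <= 1 -> s <= t -> 0 < t -> r `^ t <= r `^ s.
Proof.
move=> /andP[r0 r1] st t0; have [->|rn] := eqVneq r 0.
  by rewrite powR0 ?gt_eqF //; exact: powR_ge0.
have -> : t = s + (t - s) by ring.
rewrite powRD; last by rewrite rn implybT.
have : r `^ (t - s) <= 1 `^ (t - s) by apply: ge0_ler_powR; rewrite ?nnegrE ?subr_ge0.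
by rewrite powR1 => h; rewrite -[leRHS]mulr1; apply: ler_wpM2l => //; exact: powR_ge0.
Qed.

Lemma diam_bounds (A : set T) : A !=set0 -> (diam A <= 1)%E ->
  0 <= fine (diam A) <= 1 /\ forall x y, A x -> A y -> chordal x y <= fine (diam A).
Proof.
move=> [x0 Ax0] diam1; have [d0 _ _] := @chordal_pseudometric R d.
have le_diam x y : A x -> A y -> ((chordal x y)%:E <= diam A)%E.
  by move=> Ax Ay; apply: ereal_sup_ubound; exists x, y.
have diam0 : (0 <= diam A)%E by have := le_diam _ _ Ax0 Ax0; rewrite d0.
have fin : diam A \is a fin_num.
  by rewrite ge0_fin_numE //; apply: le_lt_trans diam1 (ltry _).
split=> [|x y Ax Ay]; first by rewrite -!lee_fin (fineK fin) diam0 diam1.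
by rewrite -lee_fin (fineK fin); exact: le_diam.
Qed.

Lemma hmeasure0_cover (s t : R) (A : set T) : hmeasure s A = 0%E -> s <= t -> 0 < t ->
  forall e : R, 0 < e -> exists (V : nat -> set T) (r : nat -> R), [/\ A `<=` \bigcup_i V i,
    forall i, 0 <= r i <= 1, forall i x y, V i x -> V i y -> chordal x y <= r i
    & forall n, \sum_(i < n) r i `^ t <= e].
Proof.
move=> As0 st t0 e e0; have : (hcontent s 1 A < e%:E)%E.
  apply: (@le_lt_trans _ _ 0%E); last by rewrite lte_fin.
  by rewrite -As0; apply: ereal_sup_ubound; exists 1 => //=; exact: ltr01.
move=> /ereal_inf_lt[_ [V [cov [diamV ->]]] sum_lt].
pose r i : R := if pselect (V i = set0) then 0 else fine (diam (V i)).
have bounds i : V i <> set0 -> 0 <= fine (diam (V i)) <= 1 /\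
    forall x y, V i x -> V i y -> chordal x y <= fine (diam (V i)).
  by move=> /eqP/set0P/diam_bounds; apply; exact: diamV.
have r01 i : 0 <= r i <= 1.
  rewrite /r; case: pselect => [?|Vi]; first by rewrite lexx ler01.
  by have [] := bounds i Vi.
have term i : ((r i `^ t)%:E <= hterm s (V i))%E.
  rewrite /hterm /r; case: pselect => Vi; case: asboolP => Vi' //.
    by rewrite powR0 ?gt_eqF.
  by rewrite lee_fin; apply: powR_le_exp => //; case: (bounds i Vi).
exists V, r; split=> // [i x y Vx Vy|n].
  rewrite /r; case: pselect => [V0|Vi]; first by rewrite V0 in Vx.
  by have [_] := bounds i Vi; exact.
rewrite -lee_fin -sumEFin; apply: ltW; apply: le_lt_trans sum_lt.
have pos i : (0 <= hterm s (V i))%E by apply: le_trans (term i); rewrite lee_fin powR_ge0.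
apply: le_trans (nneseries_lim_ge n (fun i _ _ => pos i)).
by rewrite big_mkord; exact: lee_sum.
Qed.

Lemma hmeasure0_hausdorff_null (s : R) (k : nat) (A : set T) : (0 < k)%N -> s <= k%:R ->
  hmeasure s A = 0%E -> hausdorff_null (@chordal R d) k A.
Proof.
move=> k0 sk As0; apply/(hausdorff_nullP _ k0) => e e0.
have kp : 0 < k%:R :> R by rewrite ltr0n.
have [V [r [cov r01 rV sum_r]]] := hmeasure0_cover As0 sk kp e0.
exists 1, V, r; split=> // n; apply: le_trans (sum_r n).
by apply: ler_sum => i _; rewrite powR_mulrn //; case/andP: (r01 i).
Qed.

Lemma HD_fin_num (k : R) (A : set T) : (HD A <= k%:E)%E -> exists2 s : R, HD A = s%:E & s <= k.
Proof.
move=> le_k; have HD0 : (0 <= HD A)%E.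
  by rewrite leNgt; apply/negP => /ereal_inf_lt[_ [s [s0 _] <-]]; rewrite lte_fin ltNge s0.
have fin : HD A \is a fin_num by rewrite ge0_fin_numE //; exact: le_lt_trans le_k (ltry _).
by exists (fine (HD A)); rewrite ?fineK // -lee_fin fineK.
Qed.

Lemma HD_hausdorff_dim_le (G : set (T -> T)) (k : nat) :
  (HD (radial_set G) <= k%:R%:E)%E ->
  hausdorff_dim_le (@chordal R d) (radial_points (limit_set G) (mobius_zoom G)) k.
Proof.
move=> HD_le s ks e e0; have [d0 _ _] := @chordal_pseudometric R d.
have : (HD (radial_set G) < s%:E)%E by apply: le_lt_trans HD_le _; rewrite lte_fin.
move=> /ereal_inf_lt[_ [s' [_ radial0] <-]]; rewrite lte_fin => /ltW s's.
have s0 : 0 < s by apply: le_lt_trans ks; rewrite ler0n.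
have [V [r [cov r01 rV sum_r]]] := hmeasure0_cover radial0 s's s0 e0.
exists (fun i => if i is j.+1 then V j else [set None]), (fun i => if i is j.+1 then r j else 0).
split.
- by move=> p /radial_points_sub[->|/cov[i _ Vi]]; [exists 0%N|exists i.+1].
- by case=> // i; case/andP: (r01 i).
- by case=> [x y -> ->|i]; [rewrite d0|exact: rV].
case=> [|n]; first by rewrite big_ord0 ltW.
by rewrite big_ord_recl /= powR0 ?gt_eqF // add0r; exact: sum_r.
Qed.

End HausdorffLinks.

Local Arguments ip {R V} _ _ : simpl never.

Section SphereThroughOrigin.
Context {R : realType} (V : ipspace R) (k : nat) (w : 'I_k -> V).
Hypothesis w_orth : forall i i', ip (w i) (w i') = (i == i')%:R.

Definition in_flat (y0 y : V) := exists t : 'I_k -> R, y = y0 + \sum_i t i *: w i.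

Lemma in_flat_trans y0 y1 y : in_flat y0 y1 -> in_flat y0 y <-> in_flat y1 y.
Proof.
move=> [s ->]; split=> -[t ->].
  exists (fun i => t i - s i); rewrite -addrA -big_split; congr (_ + _); apply: eq_bigr => i _.
  by rewrite /= -scalerDl addrCA subrr addr0.
exists (fun i => s i + t i); rewrite -addrA -big_split; congr (_ + _); apply: eq_bigr => i _.
by rewrite /= scalerDl.
Qed.

Lemma in_flatZ a y : in_flat 0 y -> in_flat 0 (a *: y).
Proof.
move=> [t ->]; exists (fun i => a * t i); rewrite !add0r scaler_sumr.
by apply: eq_bigr => i _; rewrite scalerA.
Qed.

Lemma in_flat_ip_inv y : in_flat 0 (ip_inv y) <-> in_flat 0 y.
Proof. by split=> [/(in_flatZ (ip (ip_inv y) (ip_inv y))^-1)|];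
  [rewrite -/(ip_inv _) ip_invK|exact: in_flatZ]. Qed.

Lemma in_flatB b y : in_flat b y <-> in_flat 0 (y - b).
Proof.
split=> -[t E]; exists t; first by rewrite E add0r addrAC subrr add0r.
by rewrite -[LHS](subrK b) E add0r addrC.
Qed.

Lemma in_flat00 : in_flat 0 0.
Proof. by exists (fun=> 0); rewrite add0r big1 // => i _; rewrite scale0r. Qed.

Definition flat_foot (y0 : V) := y0 - \sum_i ip y0 (w i) *: w i.

Lemma flat_foot_orth y0 i : ip (flat_foot y0) (w i) = 0.
Proof. by rewrite /flat_foot ipDl ipNl (ip_orth_sum w_orth) subrr. Qed.

Lemma in_flat_foot y0 : in_flat (flat_foot y0) y0.
Proof. by exists (fun i => ip y0 (w i)); rewrite subrK. Qed.

Section Sphere.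
Context (z0 : V) (z0_orth : forall i, ip z0 (w i) = 0) (z0_neq0 : z0 <> 0).
Let rho := ip z0 z0.

Let rho0 : 0 < rho.
Proof. by rewrite /rho -ip_norm_sq exprn_gt0 // ip_norm_gt0. Qed.

Lemma ip_sum_orth (t : 'I_k -> R) : ip (\sum_i t i *: w i) z0 = 0.
Proof. by rewrite ip_suml big1 // => i _; rewrite (ipZl (t i)) ipC z0_orth mulr0. Qed.

Lemma on_sphere_ip y : ip_norm (y - (2 * rho)^-1 *: z0) = (2 * ip_norm z0)^-1 <->
  rho * ip y y = ip y z0.
Proof.
have n0 : 0 < ip_norm z0 by exact: ip_norm_gt0.
have dist2 : ip_norm (y - (2 * rho)^-1 *: z0) ^+ 2 = ip y y - ip y z0 / rho + (4 * rho)^-1.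
  rewrite ip_norm_sq ipDl !ipDr !ipNl !ipNr !(ipZl (2 * rho)^-1) !(ipZr (2 * rho)^-1) (ipC z0 y) -/rho.
  by field; rewrite gt_eqF.
have radius2 : (2 * ip_norm z0)^-1 ^+ 2 = (4 * rho)^-1.
  by rewrite /rho -ip_norm_sq; field; rewrite gt_eqF.
split=> [/(congr1 (fun a => a ^+ 2))|E].
  rewrite dist2 radius2 => h; have -> : ip y y = ip y z0 / rho by lra.
  by rewrite mulrC divfK ?gt_eqF.
apply: (@pexpIrn _ 2) => //; rewrite ?nnegrE ?ip_norm_ge0 ?invr_ge0 ?mulr_ge0 ?ip_norm_ge0 //.
by rewrite dist2 radius2 -E mulrAC divff ?gt_eqF // mul1r subrr add0r.
Qed.

(* Inversion turns a flat at distance [ip_norm z0] from [0] into a sphere through [0]. *)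
Lemma in_flat_ip_inv_sphere y : y = 0 \/ in_flat z0 (ip_inv y) <->
  (exists s : R, in_flat (s *: z0) y) /\ ip_norm (y - (2 * rho)^-1 *: z0) = (2 * ip_norm z0)^-1.
Proof.
split=> [|[[s [t Ey]] /on_sphere_ip Eip]].
  case=> [->|[t Ey]]; first split.
  - by exists 0; rewrite scale0r; exact: in_flat00.
  - by apply/on_sphere_ip; rewrite !ip0l mulr0.
  pose z := z0 + \sum_i t i *: w i; have -> : y = ip_inv z by rewrite -[y]ip_invK Ey.
  have zz0 : ip z z0 = rho by rewrite /z ipDl ip_sum_orth addr0.
  have zz : ip z z != 0 by apply/eqP => /ip_eq0 E; move: rho0; rewrite -zz0 E ip0l ltxx.
  split; first exists (ip z z)^-1, (fun i => (ip z z)^-1 * t i).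
    by rewrite /ip_inv /z scalerDr scaler_sumr; congr (_ + _); apply: eq_bigr => i _; rewrite scalerA.
  apply/on_sphere_ip; rewrite /ip_inv !(ipZl (ip z z)^-1) (ipZr (ip z z)^-1) zz0.
  by field.
have [->|y0] := pselect (y = 0); [by left|right].
have yz0 : ip y z0 = s * rho by rewrite Ey ipDl (ipZl s) ip_sum_orth addr0.
have yy : ip y y = s by apply: (mulfI (lt0r_neq0 rho0)); rewrite Eip yz0 mulrC.
have s0 : s != 0 by rewrite -yy; apply/eqP => /ip_eq0.
exists (fun i => s^-1 * t i); rewrite /ip_inv yy Ey scalerDr scalerA mulVf // scale1r.
by rewrite scaler_sumr; congr (_ + _); apply: eq_bigr => i _; rewrite scalerA.
Qed.

End Sphere.

End SphereThroughOrigin.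

Lemma in_flat_rcons (R : realType) (V : ipspace R) k (w : 'I_k -> V) z b (c : R) y :
  in_flat (ord_rcons w z) (b + c *: z) y <-> exists s : R, in_flat w (s *: z) (y - b).
Proof.
have sumE (t : 'I_k.+1 -> R) : \sum_i t i *: ord_rcons w z i =
    \sum_i t (widen_ord (leqnSn k) i) *: w i + t ord_max *: z.
  rewrite big_ord_recr /= ord_rcons_max; congr (_ + _).
  by apply: eq_bigr => i _; rewrite ord_rcons_widen.
split=> [[t ->]|[s [t E]]].
  exists (c + t ord_max), (fun i => t (widen_ord (leqnSn k) i)); rewrite sumE.
  by move: (\sum_(i < k) _) => S; vector_ring.
exists (ord_rcons t (s - c)); rewrite sumE ord_rcons_max.
under eq_bigr do rewrite ord_rcons_widen.
by rewrite -[LHS](subrK b) E; move: (\sum_i _) => S; vector_ring.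
Qed.


Section GeneralizedSpheres.
Context {R : realType} (d : option nat).
Notation T := (@hat R d).
Notation V := (l2space (R := R)).
Notation chart := (chart (@Phi R d)).

Lemma l2_sum (n : nat) (t : 'I_n -> R) (v : 'I_n -> V) i :
  (\sum_j t j *: v j : l2) i = \sum_j t j * (v j : l2) i.
Proof.
elim: (index_enum _) => [|j l IH]; first by rewrite !big_nil.
by rewrite !big_cons l2DE IH.
Qed.

Definition supported (z : V) := forall n, d = Some n -> forall i, (n <= i)%N -> (z : l2) i = 0.

Lemma supported_hvec (x : @Hpt R d) : supported (hvec x).
Proof. by move=> n E i ni; have [_ supp] := proj2_sig x; exact: (supp n). Qed.

Lemma supported_lin a y z : supported y -> supported z -> supported (a *: y + z).
Proof.
by move=> sy sz n E i ni; rewrite l2DE l2ZE (sy n) // (sz n) // mulr0 addr0.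
Qed.

Lemma supported0 : supported 0. Proof. by []. Qed.

Lemma supportedZ a y : supported y -> supported (a *: y).
Proof. by move=> sy; rewrite -[_ *: _]addr0; exact: supported_lin. Qed.

Lemma supportedB y z : supported y -> supported z -> supported (y - z).
Proof. by move=> sy sz; rewrite -[- z]scaleN1r addrC; exact: supported_lin. Qed.

Lemma supported_sum n (t : 'I_n -> R) (v : 'I_n -> V) : (forall i, supported (v i)) ->
  supported (\sum_i t i *: v i).
Proof.
move=> sv; elim: (index_enum _) => [|i l IH]; first by rewrite big_nil.
by rewrite big_cons; exact: supported_lin.
Qed.

Lemma supported_Hpt z : supported z -> exists x : @Hpt R d, hvec x = z.
Proof.
move=> sz; have Hz : in_H d (z : l2) by split=> //; have := l2P (z : l2); rewrite inE.
by exists (exist _ _ Hz); exact: l2_ext.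
Qed.

Lemma in_affineP n (b : @Hpt R d) (v : 'I_n -> Hpt d) (w : 'I_n -> V) x :
  (forall i, hvec (v i) = w i) -> in_affine b v x <-> in_flat w (hvec b) (hvec x).
Proof.
move=> vw; split=> -[t E]; exists t.
  apply: l2_ext => i; rewrite l2DE l2_sum; apply: etrans (E i) _; congr (_ + _).
  by apply: eq_bigr => j _; rewrite -vw.
move=> i; have := congr1 (fun z : l2 => z i) E; rewrite l2DE l2_sum => Ei; apply: etrans Ei _.
by congr (_ + _); apply: eq_bigr => j _; rewrite -vw.
Qed.

Lemma lin_indep_orth n (v : 'I_n -> @Hpt R d) (w : 'I_n -> V) : (forall i, hvec (v i) = w i) ->
  (forall i j, i != j -> ip (w i) (w j) = 0) -> (forall i, w i <> 0) -> lin_indep v.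
Proof.
move=> vw orth w_neq0 t tv0 j.
have sum0 : \sum_i t i *: w i = 0.
  apply: l2_ext => i; rewrite l2_sum; apply: etrans (tv0 i).
  by apply: eq_bigr => l _; rewrite -vw.
have := ip_suml (index_enum _) xpredT (fun i => t i *: w i) (w j).
rewrite sum0 ip0l (bigD1 j) //= big1 => [|i ij]; last by rewrite (ipZl (t i)) orth // mulr0.
rewrite addr0 (ipZl (t j)) => /esym/eqP; rewrite mulf_eq0 => /orP[/eqP//|/eqP wj0].
by case: (w_neq0 j); exact: ip_eq0.
Qed.

Lemma orthonormal_neq0 n (w : 'I_n -> V) : (forall i i', ip (w i) (w i') = (i == i')%:R) ->
  forall i, w i <> 0.
Proof. by move=> w_orth i /(congr1 (fun z => ip z (w i)))/eqP; rewrite w_orth eqxx ip0l oner_eq0. Qed.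

Lemma chart_hdist xi u v : u <> xi -> v <> xi -> ip_norm (chart xi u - chart xi v) =
  hweight xi ^+ 2 / 2 * (hdist u v / (hdist u xi * hdist v xi)).
Proof.
move=> uxi vxi; rewrite (chart_dist (@chordal_sep R d) (@chordal_Phi R d) uxi vxi) !chordalE.
have hdist_gt0 p : p <> xi -> 0 < hdist p xi.
  by move=> pxi; rewrite lt_neqAle hdist_ge0 andbT eq_sym; apply/eqP => /hdist_eq0.
move: (hdist_gt0 u uxi) (hdist_gt0 v vxi) (hweight_gt0 u) (hweight_gt0 v) (hweight_gt0 xi).
move: (hdist u xi) (hdist v xi) (hdist u v) (hweight u) (hweight v) (hweight xi).
by move=> a b c p q r a0 b0 p0 q0 r0; field; rewrite !gt_eqF.
Qed.

Context (K : set T) (k : nat) (xi : T) (w : 'I_k -> V) (v0 : T).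
Hypotheses (Kxi : K xi) (fr : invariant_frame (@Phi R d) K xi w).
Hypothesis flat : forall u v, K u -> u <> xi -> K v -> v <> xi -> exists t : 'I_k -> R,
  chart xi u = chart xi v + \sum_i t i *: w i.
Hypotheses (K0 : K v0) (v0xi : v0 <> xi).

Lemma similar_chart_flat (Y : T -> V) (lam : R) : 0 < lam ->
  (forall u v, u <> xi -> v <> xi ->
     ip_norm (Y u - Y v) = lam * ip_norm (chart xi u - chart xi v)) ->
  (forall u, u <> xi -> supported (Y u)) ->
  exists wh : 'I_k -> V, [/\ forall i i', ip (wh i) (wh i') = (i == i')%:R,
    forall i, supported (wh i) & forall u, u <> xi -> K u <-> in_flat wh (Y v0) (Y u)].
Proof.
move=> lam0 Ysim Ysupp; have Yinj u v : u <> xi -> v <> xi -> Y u = Y v -> u = v.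
  move=> uxi vxi E; have := Ysim u v uxi vxi; rewrite E subrr ip_norm0 => /esym/eqP.
  rewrite mulf_eq0 gt_eqF //= => /eqP/ip_dist_eq0.
  exact: (chart_inj (@chordal_sep R d) (@chordal_Phi R d) uxi vxi).
have [A isoA YA] := @similarity_linear_ext R V V T (fun u => K u /\ u <> xi) (chart xi) Y lam v0
  lam0 (conj K0 v0xi) (fun i j Pi Pj => Ysim i j Pi.2 Pj.2).
rewrite -/(chart_span (@Phi R d) K xi v0) in isoA.
have Dw i := invariant_frame_span i K0 v0xi fr; have [w_orth inv] := fr.
have YE u (t : 'I_k -> R) : K u -> u <> xi -> chart xi u = chart xi v0 + \sum_i t i *: w i ->
    Y u = Y v0 + \sum_i (lam * t i) *: A (w i).
  move=> Ku uxi E; rewrite -[LHS](subrK (Y v0)) YA // E addrAC subrr add0r addrC.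
  rewrite (isometry_sum isoA) // scaler_sumr; congr (_ + _); apply: eq_bigr => i _.
  by rewrite scalerA.
exists (fun i => A (w i)); split=> [i i'|i|u uxi].
- by rewrite (isometry_ip isoA) // w_orth.
- have [v [Kv vxi E]] := inv v0 (fun i' => if i' == i then 1 else 0) K0 v0xi.
  have := YA _ _ (conj Kv vxi) (conj K0 v0xi); rewrite E sum_scale_if scale1r addrAC subrr add0r => YE1.
  have -> : A (w i) = lam^-1 *: (Y v - Y v0) by rewrite YE1 scalerA mulVf ?gt_eqF // scale1r.
  by apply: supportedZ; apply: supportedB; exact: Ysupp.
split=> [Ku|[t Eu]].
  by have [t /(YE u t Ku uxi) ->] := flat Ku uxi K0 v0xi; exists (fun i => lam * t i).
have [v [Kv vxi /(YE v _ Kv vxi) Ev]] := inv v0 (fun i => t i / lam) K0 v0xi.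
have -> // : u = v; apply: Yinj => //; rewrite Ev Eu; congr (_ + _); apply: eq_bigr => i _.
by rewrite mulrCA divff ?gt_eqF // mulr1.
Qed.

Lemma gen_sphere_pole_infty : xi = None -> gen_sphere K k.
Proof.
move=> xiE; left; pose Y (u : T) : V := if u is Some x then hvec x else 0.
have neq x : Some x <> xi :> T by rewrite xiE.
have [|u v uxi vxi|[x|] _|wh [wh_orth wh_supp KE]] := @similar_chart_flat Y 2.
- by [].
- rewrite chart_hdist //; case: u v uxi vxi => [x|] [y|]; rewrite xiE // => _ _ /=.
  by field.
- exact: supported_hvec.
- exact: supported0.
have /choice[v vE] i := supported_Hpt (wh_supp i).
have [x0 v0E] : exists x0, v0 = Some x0.
  by case: v0 v0xi => [x0|]; [exists x0|rewrite xiE].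
exists x0, v; split.
  apply: (lin_indep_orth vE); last exact: orthonormal_neq0.
  by move=> i j /negbTE ij; rewrite wh_orth ij.
have KP x : K (Some x) <-> in_affine x0 v x.
  by rewrite (in_affineP _ _ vE) (KE _ (neq x)) v0E.
apply/seteqP; split=> [[x|] Kp /=|_ [->|[x [-> /KP //]]]].
- by right; exists x; split=> //; exact/KP.
- by left.
by rewrite -xiE.
Qed.

Section FinitePole.
Context (a : @Hpt R d) (xiE : xi = Some a).

Lemma inverted_flat : exists (z0 : V) (wh : 'I_k -> V),
  [/\ forall i i', ip (wh i) (wh i') = (i == i')%:R, forall i, ip z0 (wh i) = 0,
      supported z0 /\ forall i, supported (wh i),
      K None <-> in_flat wh z0 0
    & forall x, K (Some x) <-> hvec x - hvec a = 0 \/ in_flat wh z0 (ip_inv (hvec x - hvec a))].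
Proof.
have w0 := hweight_gt0 xi; have l0 : 0 < 2 / hweight xi ^+ 2 by rewrite divr_gt0 // exprn_gt0.
have inv_supp u : supported (inversion_at a u).
  case: u => [x|]; last exact: supported0.
  by apply: supportedZ; apply: supportedB; exact: supported_hvec.
have [u v uxi vxi|//|wh [wh_orth wh_supp KE]] := @similar_chart_flat (inversion_at a) _ l0.
  have := @inversion_at_dist R d a u v; rewrite -xiE => -> //; rewrite chart_hdist // mulrA -[LHS]mul1r.
  by congr (_ * _); field; rewrite gt_eqF.
pose z0 := flat_foot wh (inversion_at a v0).
have KE0 u : u <> xi -> K u <-> in_flat wh z0 (inversion_at a u).
  move=> uxi; rewrite (KE u uxi); apply: iff_sym.
  exact: in_flat_trans (in_flat_foot wh (inversion_at a v0)).
exists z0, wh; split=> // [i| | |x].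
- exact: flat_foot_orth.
- by split=> //; apply: supportedB => //; exact: supported_sum.
- by apply: (KE0 None); rewrite xiE.
have [->|xa] := pselect (x = a); first by rewrite subrr -xiE; split=> // _; left.
rewrite KE0; last by rewrite xiE => -[].
split; first by right.
by move=> [xa0|//]; case: (hvec_sub_neq0 xa).
Qed.

Lemma gen_sphere_pole_finite : gen_sphere K k.
Proof.
have [z0 [wh [wh_orth z0_orth [z0_supp wh_supp] KNone KSome]]] := inverted_flat.
have /choice[v vE] i := supported_Hpt (wh_supp i).
have wh_neq0 := orthonormal_neq0 wh_orth.
have wh_ij i j : i != j -> ip (wh i) (wh j) = 0 by move=> /negbTE ij; rewrite wh_orth ij.
have [z00|z0_neq0] := pselect (z0 = 0).
  left; exists a, v; split; first exact: (lin_indep_orth vE).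
  have KP x : K (Some x) <-> in_affine a v x.
    rewrite KSome z00 in_flat_ip_inv (in_affineP _ _ vE) (in_flatB _ (hvec a));
      split=> [[->|]|]; last by right.
    + exact: in_flat00.
    + by [].
  have KN : K None by apply/KNone; rewrite z00; exact: in_flat00.
  by apply/seteqP; split=> [[x /KP Kx|_] /=|_ [->|[x [-> /KP]]] //]; [right; exists x|left].
have [zz zzE] := supported_Hpt z0_supp; pose rho := ip z0 z0.
have [c cE] : exists c : @Hpt R d, hvec c = hvec a + (2 * rho)^-1 *: z0.
  by apply: supported_Hpt; rewrite addrC; apply: supported_lin => //; exact: supported_hvec.
have v'E i : hvec (ord_rcons v zz i) = ord_rcons wh z0 i.
  by have [->|[i0 ->]] := ord_max_or_widen i; rewrite ?ord_rcons_max ?ord_rcons_widen.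
right; exists c, (ord_rcons v zz), (2 * ip_norm z0)^-1; split.
  apply: (lin_indep_orth v'E) => [i j|i].
    have [->|[i0 ->]] := ord_max_or_widen i; have [->|[j0 ->]] := ord_max_or_widen j;
      rewrite ?ord_rcons_max ?ord_rcons_widen ?eqxx // => ij.
    - by rewrite ipC z0_orth.
    by apply: wh_ij; apply: contra ij => /eqP ->.
  by have [->|[i0 ->]] := ord_max_or_widen i; rewrite ?ord_rcons_max ?ord_rcons_widen.
split; first by rewrite invr_gt0 mulr_gt0 // ip_norm_gt0.
have KP x : K (Some x) <-> in_affine c (ord_rcons v zz) x /\
    nrm (vsub (sval x) (sval c)) = (2 * ip_norm z0)^-1.
  rewrite KSome in_flat_ip_inv_sphere // nrm_vsub cE opprD addrA (in_affineP _ _ v'E).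
  by rewrite cE in_flat_rcons.
have KN : ~ K None.
  move=> /KNone[t /(congr1 (fun y => ip y z0))]; rewrite ip0l ipDl ip_sum_orth // addr0.
  by move=> /esym/ip_eq0.
by apply/seteqP; split=> [[x /KP Kx|/KN //] /=|_ [x [-> /KP]] //]; exists x.
Qed.

End FinitePole.

End GeneralizedSpheres.

Lemma exists_two_points (R : realType) (U : set_system nat) (T : Type) (d : T -> T -> R)
    (K : set T) n : (forall x, d x x = 0) -> ultra_compact U d K -> ~ colourable U d n K ->
  exists x1 x2, [/\ K x1, K x2 & x1 <> x2].
Proof.
move=> d0 cK; apply: contra_notP => single e e0.
exists unit, (fun=> K), (fun=> 0%N); split=> [_|_ x y Kx Ky|x Kx|].
- by split.
- have -> : x = y; last by rewrite d0 ltW.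
  by apply: contrapT => xy; apply: single; exists x, y.
- by exists tt.
by split=> // -[] [].
Qed.

Lemma exists_far_point (R : realType) (T : Type) (d : T -> T -> R) (K : set T) x1 x2 u :
  pseudometric d -> K x1 -> K x2 -> exists2 v, K v & d x1 x2 / 2 <= d u v.
Proof.
move=> [_ dC dT] K1 K2; have [far|near] := leP (d x1 x2 / 2) (d u x1); first by exists x1.
by exists x2 => //; have := dT x1 u x2; rewrite (dC x1 u); lra.
Qed.

Lemma ultra_compact_limit_set (R : realType) (d : option nat) (G : set (@hat R d -> @hat R d))
    (U : set_system nat) (uU : FreeUltraFilter U) : (d = None -> hcompact (limit_set G)) ->
  ultra_compact U (@chordal R d) (limit_set G).
Proof.
case: d G => [n|] G compactK; last by apply: hcompact_ultra_compact; exact: compactK.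
move=> u Ku; have [x _ ux] := @ultra_compact_hat R U uU n u (fun=> I).
by exists x => //; exact: limit_set_closed Ku ux.
Qed.

Lemma radial_points_conull (R : realType) (d : option nat) (G : set (@hat R d -> @hat R d))
    (k : nat) (D : R) : mobius_group G -> (0 < k)%N -> 0 < D ->
  (forall u, limit_set G u -> exists2 v, limit_set G v & D <= chordal u v) ->
  (HD (radial_set G) <= k%:R%:E)%E ->
  (forall s : R, HD (radial_set G) = s%:E ->
     hmeasure s (limit_set G `\` radial_set G) = 0%E) ->
  hausdorff_null (@chordal R d) k (limit_set G `\` radial_points (limit_set G) (mobius_zoom G)).
Proof.
move=> hG k0 D0 spread /HD_fin_num[s HDs sk] hmeas.
apply: hausdorff_nullS (hmeasure0_hausdorff_null k0 sk (hmeas s HDs)) => p [Kp not_radial].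
by split=> // /(radial_set_sub hG D0 spread).
Qed.

Theorem theorem1 (R : realType) (d : option nat) (G : set (@hat R d -> @hat R d)) :
  mobius_group G ->
  (d = None -> hcompact (limit_set G)) ->
  forall k : nat, (1 <= k)%N -> top_dim_eq (limit_set G) k ->
  (forall s : R, HD (radial_set G) = s%:E ->
     hmeasure s (limit_set G `\` radial_set G) = 0%E) ->
  ((k%:R)%:E < HD (radial_set G))%E \/ gen_sphere (limit_set G) k.
Proof.
move=> hG compactK k k0 [_ dim_ge] hmeas.
have [|HD_le] := ltP (k%:R)%:E (HD (radial_set G)); [by left|right].
have pd := @chordal_pseudometric R d; have sep := @chordal_sep R d.
have dPhi := @chordal_Phi R d; have le2 := @chordal_le2 R d.
have [U uU] := free_ultra_exists; have cK := ultra_compact_limit_set uU compactK.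
have Kncol : ~ colourable U (@chordal R d) k.-1 (limit_set G).
  move=> /(colourable_covering_dim_le pd sep cK); apply: dim_ge.
  by rewrite prednK.
have [d0 _ _] := pd; have [x1 [x2 [K1 K2 x12]]] := exists_two_points d0 cK Kncol.
have D0 : 0 < chordal x1 x2 / 2 by rewrite divr_gt0 // (dist_gt0 pd sep).
have spread u (_ : limit_set G u) := exists_far_point u pd K1 K2.
have c00 := divr_gt0 (ltr0n R 4) D0; have ZS := mobius_zoom_system hG D0 spread.
have Lnull := radial_points_conull hG k0 D0 spread HD_le hmeas.
have [xo Kxo Kfin] := limit_finite_away pd sep le2 cK c00 ZS k0 (HD_hausdorff_dim_le HD_le) Lnull
  (ex_intro _ x1 K1).
have [xi [w [Kxi fr flat]]] := exists_flat_chart sep dPhi le2 cK c00 ZS k0 Kxo Kfin Lnull Kncol.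
have [v0 [K0 v0xi]] : exists v0, limit_set G v0 /\ v0 <> xi.
  by have [<-|] := pselect (x1 = xi); [exists x2; split=> // /esym|exists x1].
case xiE : xi => [a|]; first exact: gen_sphere_pole_finite Kxi fr flat K0 v0xi a xiE.
exact: gen_sphere_pole_infty Kxi fr flat K0 v0xi xiE.
Qed.
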